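(* Let $M\subset\mathbb{C}^2$ be a real-analytic Levi nonflat hypersurface with $0\in M$ which is nonminimal at the origin. Then the infinitesimal automorphism algebra of $M$ at $0$ satisfies $$\dim\,\mathfrak{hol}(M,0)\le 5 .$$
   Context: All hypersurfaces are smooth (nonsingular), real-analytic and connected. $M$ is nonminimal at $0$ if it contains (the germ of) a complex hypersurface $X\ni 0$. $M$ is Levi nonflat if its Levi form does not vanish identically. $\mathfrak{hol}(M,0)$ is the real Lie algebra of germs at $0$ of holomorphic vector fields $L=f_1\frac{\partial}{\partial z_1}+f_2\frac{\partial}{\partial z_2}$ ($f_j$ holomorphic near $0$ in $\mathbb{C}^2$) such that $\mathrm{Re}\,L$ is tangent to $M$ at every point of $M$ where it is defined; $\dim$ is the real dimension. *)

(* Defs.v *)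
From HB Require Import structures.
From mathcomp Require Import all_boot all_order all_algebra.
From mathcomp Require Import finmap.
From mathcomp Require Import complex.
From mathcomp Require Import boolp classical_sets functions reals topology.
From mathcomp Require Import normedtype derive.
From mathcomp Require Import showcase.summability.

Set Implicit Arguments.
Unset Strict Implicit.
Unset Printing Implicit Defensive.

Import Order.TTheory GRing.Theory Num.Theory.
Import numFieldNormedType.Exports.

Local Open Scope classical_set_scope.
Local Open Scope ring_scope.
Local Open Scope complex_scope.

(* R[i] inherits the topology and normed module structure over itself that
   every numFieldType carries (the library only provides them, on the carrier,
   for abstract fields). *)
#[non_forgetful_inheritance]
HB.instance Definition _ (R : rcfType) := GRing.ComAlgebra.copy R[i] R[i]^o.
#[non_forgetful_inheritance]
HB.instance Definition _ (R : rcfType) := Vector.copy R[i] R[i]^o.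
#[non_forgetful_inheritance]
HB.instance Definition _ (R : rcfType) := NormedModule.copy R[i] R[i]^o.

(* Analyticity over K at p: near p, f is the sum of a power series in n.+1
   variables.  The sum over multi-indices is unconditional (limit along the
   filter [totally] of finite sets of multi-indices), that is, absolutely
   convergent.  For K = R this is real-analyticity, for K = R[i] it is
   holomorphy in a neighborhood of p. *)
Definition monomial (K : numFieldType) (n : nat) (h : 'rV[K]_n.+1)
    (a : {ffun 'I_n.+1 -> nat}) : K :=
  \prod_(i < n.+1) h ord0 i ^+ a i.

Definition analytic_at (K : numFieldType) (n : nat)
    (f : 'rV[K]_n.+1 -> K) (p : 'rV[K]_n.+1) : Prop :=
  exists c : {ffun 'I_n.+1 -> nat} -> K,
    \forall h \near (0 : 'rV[K]_n.+1),
      (fun A : {fset {ffun 'I_n.+1 -> nat}} =>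
         \sum_(a <- A) c a * monomial h a) @ totally --> f (p + h).

Section CR.
Variable R : realType.

Local Notation C := R[i].
Local Notation C2 := 'rV[C]_2.
Local Notation R4 := 'rV[R]_4.
Local Notation Re := (@complex.Re R).
Local Notation Im := (@complex.Im R).

(* The identification of C^2 with R^4, (x1 + i y1, x2 + i y2) being sent to
   (x1, x2, y1, y2). *)
Definition realify (z : C2) : R4 :=
  (row_mx (map_mx Re z) (map_mx Im z) : 'rV[R]_(2 + 2)).

Definition Rderive (v : R4) (f : R4 -> C) (x : R4) : C :=
  'D_v (fun y => Re (f y)) x +i* 'D_v (fun y => Im (f y)) x.

Definition ddx (j : 'I_2) : (R4 -> C) -> R4 -> C :=
  Rderive (realify (delta_mx ord0 j)).
Definition ddy (j : 'I_2) : (R4 -> C) -> R4 -> C :=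
  Rderive (realify ('i *: delta_mx ord0 j)).

(* Wirtinger derivatives d/dz_j and d/dzbar_j. *)
Definition ddz (j : 'I_2) (f : R4 -> C) (x : R4) : C :=
  (ddx j f x - 'i * ddy j f x) / 2.
Definition ddzbar (j : 'I_2) (f : R4 -> C) (x : R4) : C :=
  (ddx j f x + 'i * ddy j f x) / 2.

Definition local_equation (M : set C2) (p : C2) (rho : R4 -> R) : Prop :=
  [/\ \forall x \near realify p, analytic_at rho x,
      exists v : R4, 'D_v rho (realify p) != 0
    & \forall z \near p, M z <-> rho (realify z) = 0].

Definition hypersurface (M : set C2) : Prop :=
  connected M /\ forall p, M p -> exists rho, local_equation M p rho.

Definition local_holo_equation (X : set C2) (p : C2) (g : C2 -> C) : Prop :=
  [/\ \forall z \near p, analytic_at g z,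
      exists v : C2, 'D_v g p != 0
    & \forall z \near p, X z <-> g z = 0].

Definition complex_hypersurface (X : set C2) : Prop :=
  connected X /\ forall p, X p -> exists g, local_holo_equation X p g.

Definition nonminimal_at0 (M : set C2) : Prop :=
  exists X : set C2, [/\ complex_hypersurface X, X 0
    & \forall z \near (0 : C2), X z -> M z].

(* The (1,0)-vector v is tangent to M = {rho = 0} at p. *)
Definition complex_tangent (rho : R4 -> R) (p v : C2) : Prop :=
  \sum_(j < 2) ddz j (fun x => (rho x)%:C) (realify p) * v ord0 j = 0.

Definition levi_form (rho : R4 -> R) (p v : C2) : C :=
  \sum_(j < 2) \sum_(k < 2)
    ddz j (ddzbar k (fun x => (rho x)%:C)) (realify p)
      * v ord0 j * conjc (v ord0 k).

(* Changing rho multiplies the Levi form at p by a nonzero real factor. *)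
Definition levi_flat (M : set C2) : Prop :=
  forall p rho v, M p -> local_equation M p rho ->
    complex_tangent rho p v -> levi_form rho p v = 0.

(* A vector field L = f_1 d/dz_1 + f_2 d/dz_2 is given by (f_1, f_2).  The
   derivative of a real function rho along Re L is Re (L rho). *)
Definition Re_tangent (M : set C2) (L : C2 -> C2) (p : C2) : Prop :=
  forall rho, local_equation M p rho ->
    Re (\sum_(j < 2) L p ord0 j * ddz j (fun x => (rho x)%:C) (realify p)) = 0.

(* Representatives of the elements of hol(M,0). *)
Definition hol0 (M : set C2) (L : C2 -> C2) : Prop :=
  (forall j, \forall z \near (0 : C2), analytic_at (fun w => L w ord0 j) z) /\
  (\forall z \near (0 : C2), M z -> Re_tangent M L z).

Definition germ_eq0 (L L' : C2 -> C2) : Prop :=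
  \forall z \near (0 : C2), L z = L' z.

Definition real_comb n (a : 'I_n -> R) (b : 'I_n -> C2 -> C2) : C2 -> C2 :=
  fun z => \sum_(i < n) (a i)%:C *: b i z.

(* The germs of b_0, ..., b_(n-1) form a basis of the real vector space
   hol(M,0). *)
Definition hol0_basis (M : set C2) n (b : 'I_n -> C2 -> C2) : Prop :=
  [/\ forall i, hol0 M (b i),
      forall a, germ_eq0 (real_comb a b) (fun=> 0) -> forall i, a i = 0
    & forall L, hol0 M L -> exists a, germ_eq0 L (real_comb a b)].

Definition dim_hol0 (M : set C2) (n : nat) : Prop :=
  exists b : 'I_n -> C2 -> C2, hol0_basis M b.

End CR.

(* Main.v *)
(* By contradiction: six independent fields near 0 span, after adding brackets, a Lie algebra of
   dimension at most 8, since at a Levi nondegenerate point of M a field is determined by its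
   weighted jet of order 4 (as for the sphere), and this graded model has no subalgebra of
   dimension 6 or 7; so the dimension is 8 and the algebra is perfect.  At 0 the Levi determinant
   vanishes, by nonminimality, and it is a relative invariant of the fields; if their values at 0
   had real rank 3 it would vanish identically on M, that is, M would be Levi flat.  Hence the
   isotropy subalgebra at 0 has dimension at least 6, so it is everything.  The linear parts at 0
   preserve the conormal line, and perfectness forces them to vanish; then brackets strictly raise
   the order of vanishing at 0, so all the fields are zero by perfectness again. *)
Require Import Defs.
From HB Require Import structures.
From mathcomp Require Import all_boot all_order all_algebra.
From mathcomp Require Import finmap complex boolp classical_sets functions.
From mathcomp Require Import reals topology normedtype landau sequences derive.
From mathcomp Require Import ring lra zify.
Set Implicit Arguments.
Unset Strict Implicit.
Unset Printing Implicit Defensive.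
Import Order.TTheory GRing.Theory Num.Theory.
Local Open Scope ring_scope.
Local Open Scope complex_scope.

(** A field f is encoded by the single function [hf], its (1,0) derivative of a defining function
    [P]. Let Z and its conjugate Zbar be the tangential fields annihilating P. Holomorphic
    coefficients are constants for Zbar, so [hf] and its Zbar derivative recover both coefficients
    of f after division by the Levi determinant; the bracket of fields becomes a Lagrange bracket of
    functions. The functions derived from [hf] by Z and Zbar satisfy, modulo functions vanishing on
    M, a system closed at order four, with 1 + 2 + 2 + 2 + 1 = 8 real parameters: this is the origin
    of the bound 8 and of the grading of su(2,1). The obstacle is that two base points are in play:
    the graded model needs an invertible Levi determinant and lives at a nondegenerate point near 0,
    whereas isotropy is studied at 0. The identity theorem on one ball lets the same finite family
    serve at both. Analyticity enters through Cauchy estimates for iterated directional derivatives,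
    and functions on M are followed along real arcs inside M. *)

(** * Formal calculus of tangential fields, Levi determinant and contact Hamiltonians *)

Section Derivations.
Variable A : comNzRingType.
Implicit Types (x y z : A) (D : A -> A).

Definition derivation D :=
  (forall x y, D (x + y) = D x + D y) /\ (forall x y, D (x * y) = D x * y + x * D y).

Lemma derD D x y : derivation D -> D (x + y) = D x + D y. Proof. by case. Qed.
Lemma derM D x y : derivation D -> D (x * y) = D x * y + x * D y. Proof. by case. Qed.
Lemma der0 D : derivation D -> D 0 = 0.
Proof. by move=> dD; apply: (addrI (D 0)); rewrite -(derD _ _ dD) !addr0. Qed.
Lemma derN D x : derivation D -> D (- x) = - D x.
Proof. by move=> dD; apply/eqP; rewrite -addr_eq0 -(derD _ _ dD) addNr (der0 dD). Qed.
Lemma derB D x y : derivation D -> D (x - y) = D x - D y.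
Proof. by move=> dD; rewrite (derD _ _ dD) (derN _ dD). Qed.

Lemma der4 D x1 y1 x2 y2 x3 y3 x4 y4 : derivation D ->
  D (x1 * y1 + x2 * y2 + (x3 * y3 + x4 * y4)) =
  D x1 * y1 + D x2 * y2 + (D x3 * y3 + D x4 * y4) +
  (x1 * D y1 + x2 * D y2 + (x3 * D y3 + x4 * D y4)).
Proof. by move=> dD; rewrite !(derD _ _ dD) !(derM _ _ dD); ring. Qed.

Lemma der_comb D D' x y : derivation D -> derivation D' ->
  derivation (fun z => x * D z - y * D' z).
Proof.
by move=> dD dD'; split => z t; rewrite ?(derD _ _ dD) ?(derD _ _ dD') ?(derM _ _ dD) ?(derM _ _ dD'); ring.
Qed.

Lemma der_com D D' : derivation D -> derivation D' ->
  derivation (fun z => D (D' z) - D' (D z)).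
Proof.
move=> dD dD'; split => z t.
  by rewrite (derD z t dD') (derD z t dD) (derD _ _ dD) (derD _ _ dD'); ring.
rewrite (derM z t dD') (derM z t dD) (derD _ _ dD) (derD _ _ dD').
by rewrite !(derM _ _ dD) !(derM _ _ dD'); ring.
Qed.

(* pd false j and pd true j play the roles of d/dz_j and d/dzbar_j. *)
Variable pd : bool -> bool -> A -> A.
Hypothesis pdD : forall s j, derivation (pd s j).
Hypothesis pdC : forall s j s' j' x, pd s j (pd s' j' x) = pd s' j' (pd s j x).
Variable P : A.

(* Zf false = Z = P_1 d_0 - P_0 d_1 and Zf true is its conjugate; both annihilate P. *)
Definition Zf s x := pd s true P * pd s false x - pd s false P * pd s true x.
Definition Tf x := Zf false (Zf true x) - Zf true (Zf false x).
(** The Levi form of [P] evaluated on [Zf false], a bordered complex Hessian determinant. Up to sign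
    it is also the determinant of the linear system that gives the two coefficients of a field from
    [hf] and [Zf true hf]. *)
Definition Jf := pd false true P * Zf true (pd false false P)
  - pd false false P * Zf true (pd false true P).

Lemma Zf_der s : derivation (Zf s). Proof. exact: der_comb. Qed.
Lemma Tf_der : derivation Tf. Proof. by apply: der_com; exact: Zf_der. Qed.

Lemma ZfP s : Zf s P = 0. Proof. by rewrite /Zf; ring. Qed.
Lemma TfP : Tf P = 0.
Proof. by rewrite /Tf !ZfP !(der0 (Zf_der _)) subr0. Qed.

Lemma ZfZf s s' x : Zf s (Zf s' x) = Zf s (pd s' true P) * pd s' false x
  - Zf s (pd s' false P) * pd s' true x
  + (pd s' true P * Zf s (pd s' false x) - pd s' false P * Zf s (pd s' true x)).
Proof.
have dZ := Zf_der s.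
by rewrite {2}/Zf (derB _ _ dZ) !(derM _ _ dZ); ring.
Qed.

(** Coefficients of the vector field [Tf]: [sf] along the d/dz_j, [tf] along their conjugates. *)
Definition sf j := if j then Zf true (pd false false P) else - Zf true (pd false true P).
Definition tf j := if j then - Zf false (pd true false P) else Zf false (pd true true P).

Lemma TfE x : Tf x = sf false * pd false false x + sf true * pd false true x
  + (tf false * pd true false x + tf true * pd true true x).
Proof.
rewrite /Tf !ZfZf /sf /tf.
rewrite /(Zf false (pd true false x)) /(Zf false (pd true true x)).
rewrite /(Zf true (pd false false x)) /(Zf true (pd false true x)).
rewrite (pdC true false false false x) (pdC true true false false x).
rewrite (pdC true false false true x) (pdC true true false true x).
move: (Zf _ _) (Zf _ _) (Zf _ _) (Zf _ _) => ? ? ? ?; ring.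
Qed.

Lemma JfE : Jf = pd true true P * Zf false (pd true false P)
  - pd true false P * Zf false (pd true true P).
Proof.
rewrite /Jf /Zf (pdC true false false false P) (pdC true true false false P).
by rewrite (pdC true false false true P) (pdC true true false true P); ring.
Qed.

(** Coefficients of the commutator of [Tf] with [Zf false]: [cw] along the d/dz_j, [cy] along their
    conjugates. *)
Definition cw j := (if j then - Tf (pd false false P) else Tf (pd false true P)) - Zf false (sf j).
Definition cy j := - Zf false (tf j).

Lemma TZ_coord x : Tf (Zf false x) - Zf false (Tf x) =
  cw false * pd false false x + cw true * pd false true x
  + (cy false * pd true false x + cy true * pd true true x).
Proof.
have E : Zf false (Tf x) = Zf false (sf false) * pd false false x + Zf false (sf true) * pd false true x
  + (Zf false (tf false) * pd true false x + Zf false (tf true) * pd true true x)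
  + (sf false * Zf false (pd false false x) + sf true * Zf false (pd false true x)
  + (tf false * Zf false (pd true false x) + tf true * Zf false (pd true true x))).
  by rewrite TfE (der4 _ _ _ _ _ _ _ _ (Zf_der _)).
have dT := Tf_der.
have E' : Tf (Zf false x) = Tf (pd false true P) * pd false false x - Tf (pd false false P) * pd false true x
  + (pd false true P * Tf (pd false false x) - pd false false P * Tf (pd false true x)).
  by rewrite {1}/Zf (derB _ _ dT) !(derM _ _ dT); ring.
rewrite E E' (TfE (pd false false x)) (TfE (pd false true x)) /cw /cy.
rewrite /(Zf false (pd false false x)) /(Zf false (pd false true x)).
rewrite /(Zf false (pd true false x)) /(Zf false (pd true true x)).
rewrite (pdC false true false false x).
rewrite (pdC true false false false x) (pdC true true false false x).
rewrite (pdC true false false true x) (pdC true true false true x).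
move: (sf _) (sf _) (tf _) (tf _) (Zf _ _) (Zf _ _) (Zf _ _) (Zf _ _) (Tf _) (Tf _) => ? ? ? ? ? ? ? ? ? ?.
by ring.
Qed.

(** By Cramer's rule with determinant [Jf], the (1,0) part of the commutator is a combination of
    [Zf false] and the (1,0) part of [Tf], and similarly for its (0,1) part with [Zf true]. The
    commutator annihilates [P], so the two coefficients of the parts of [Tf] agree (E0) and the
    parts recombine into [Tf]. *)
Lemma Jf_TZ x : Jf * (Tf (Zf false x) - Zf false (Tf x)) =
  (cw false * Zf true (pd false false P) + cw true * Zf true (pd false true P)) * Zf false x
  + (cy false * Zf false (pd true false P) + cy true * Zf false (pd true true P)) * Zf true x
  + (cw false * pd false false P + cw true * pd false true P) * Tf x.
Proof.
have E0 : cy false * pd true false P + cy true * pd true true P =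
    - (cw false * pd false false P + cw true * pd false true P).
  by apply/eqP; rewrite -addr_eq0 addrC -TZ_coord ZfP TfP (der0 Tf_der) (der0 (Zf_der _)) subr0.
have E1 : Jf * (cw false * pd false false x + cw true * pd false true x) =
  (cw false * Zf true (pd false false P) + cw true * Zf true (pd false true P)) * Zf false x
  + (cw false * pd false false P + cw true * pd false true P) *
    (sf false * pd false false x + sf true * pd false true x).
  rewrite /Jf /sf /(Zf false x); move: (cw _) (cw _) (Zf _ _) (Zf _ _) => ? ? ? ?; ring.
have E2 : Jf * (cy false * pd true false x + cy true * pd true true x) =
  (cy false * Zf false (pd true false P) + cy true * Zf false (pd true true P)) * Zf true x
  - (cy false * pd true false P + cy true * pd true true P) *
    (tf false * pd true false x + tf true * pd true true x).
  rewrite JfE /tf /(Zf true x); move: (cy _) (cy _) (Zf _ _) (Zf _ _) => ? ? ? ?; ring.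
rewrite TZ_coord mulrDr E1 E2 E0 (TfE x); ring.
Qed.

Section Field.
Variables (f : bool -> A).
Hypothesis f_hol : forall k j, pd true k (f j) = 0.

(** The contact Hamiltonian of the field: with its derivative by [Zf true] it determines both
    coefficients of [f]. *)
Definition hf := f false * pd false false P + f true * pd false true P.

Lemma Zb_hol j : Zf true (f j) = 0. Proof. by rewrite /Zf !f_hol; ring. Qed.

Lemma Zb_hf : Zf true hf =
  f false * Zf true (pd false false P) + f true * Zf true (pd false true P).
Proof.
by rewrite /hf (derD _ _ (Zf_der _)) !(derM _ _ (Zf_der _)) !Zb_hol; ring.
Qed.

(** Cramer's rule for the two linear equations in [f] given by the definition of [hf] and by
    [Zb_hf]. *)
Lemma Jf_f0 : Jf * f false = pd false true P * Zf true hf - Zf true (pd false true P) * hf.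
Proof. by rewrite Zb_hf /hf /Jf; move: (Zf _ _) (Zf _ _) => ? ?; ring. Qed.

Lemma Jf_f1 : Jf * f true = Zf true (pd false false P) * hf - pd false false P * Zf true hf.
Proof. by rewrite Zb_hf /hf /Jf; move: (Zf _ _) (Zf _ _) => ? ?; ring. Qed.

Lemma ZbZb_hf : Zf true (Zf true hf) = f false * Zf true (Zf true (pd false false P))
  + f true * Zf true (Zf true (pd false true P)).
Proof.
by rewrite Zb_hf (derD _ _ (Zf_der _)) !(derM _ _ (Zf_der _)) !Zb_hol; ring.
Qed.

Definition Lf x := f false * pd false false x + f true * pd false true x.

(** The (0,1) part of [Tf] applied to the derivative of [P] along d/dz_j: the correction needed to
    complete the (1,0) part of [Tf] to [Tf] when it acts on some [hf]. *)
Definition sg j := tf false * pd true false (pd false j P) + tf true * pd true true (pd false j P).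

(** In the basis made of [Zf false] and the (1,0) part of [Tf], the field has coordinates
    [Zf true hf] and [hf], up to the factor [Jf]. *)
Lemma Jf_Lf x : Jf * Lf x = Zf true hf * Zf false x
  + hf * (sf false * pd false false x + sf true * pd false true x).
Proof.
rewrite Zb_hf /hf /Lf /sf /Jf /(Zf false x); move: (Zf _ _) (Zf _ _) => ? ?; ring.
Qed.

End Field.

Lemma tf_hf f : (forall k j, pd true k (f j) = 0) ->
  tf false * pd true false (hf f) + tf true * pd true true (hf f) =
  f false * sg false + f true * sg true.
Proof.
move=> fh; rewrite /hf /sg !(derD _ _ (pdD _ _)) !(derM _ _ (pdD _ _)) !fh.
by ring.
Qed.

Definition br f g j := Lf f (g j) - Lf g (f j).

Lemma pd_Lf f x k : (forall k j, pd true k (f j) = 0) -> pd true k x = 0 ->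
  pd true k (Lf f x) = 0.
Proof.
move=> fh xh; rewrite /Lf (derD _ _ (pdD _ _)) !(derM _ _ (pdD _ _)) !fh.
rewrite (pdC true k false false) (pdC true k false true) xh !(der0 (pdD _ _)); ring.
Qed.

Lemma br_hol f g : (forall k j, pd true k (f j) = 0) -> (forall k j, pd true k (g j) = 0) ->
  forall k j, pd true k (br f g j) = 0.
Proof.
move=> fh gh k j; rewrite /br (derB _ _ (pdD _ _)).
by rewrite (pd_Lf fh (gh k j)) (pd_Lf gh (fh k j)) subr0.
Qed.

Lemma hf_br f g : hf (br f g) = Lf f (hf g) - Lf g (hf f).
Proof.
rewrite /hf /br /Lf !(derD _ _ (pdD _ _)) !(derM _ _ (pdD _ _)).
by rewrite (pdC false true false false P); ring.
Qed.

Definition Qf := pd false true P * sg false - pd false false P * sg true.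

(** A Lagrange bracket. The fields in [hf_br] are expanded by [Jf_Lf]; completing the (1,0) part of
    [Tf] to [Tf] costs terms in [sg] (E), which are again linear in the Hamiltonian and its
    [Zf true] derivative (F). Their antisymmetrisation leaves only the term in [Qf], which contains
    fewer derivatives. *)
Lemma Jf2_hf_br f g : (forall k j, pd true k (f j) = 0) -> (forall k j, pd true k (g j) = 0) ->
  let h1 := hf f in let h2 := hf g in
  Jf * (Jf * hf (br f g)) = Jf * (Zf true h1 * Zf false h2 - Zf true h2 * Zf false h1
    + h1 * Tf h2 - h2 * Tf h1) - Qf * (h1 * Zf true h2 - h2 * Zf true h1).
Proof.
move=> fh gh h1 h2; rewrite hf_br mulrBr -/h1 -/h2.
have E f' (fh' : forall k j, pd true k (f' j) = 0) : sf false * pd false false (hf f') + sf true * pd false true (hf f')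
    = Tf (hf f') - (f' false * sg false + f' true * sg true).
  by rewrite TfE tf_hf // addrK.
rewrite (Jf_Lf fh) (Jf_Lf gh) -/h1 -/h2 (E g gh) (E f fh) -/h1 -/h2.
have F f' (fh' : forall k j, pd true k (f' j) = 0) : Jf * (f' false * sg false + f' true * sg true) =
   Qf * Zf true (hf f') + (Zf true (pd false false P) * sg true - Zf true (pd false true P) * sg false) * hf f'.
  rewrite mulrDr !mulrA (Jf_f0 fh') (Jf_f1 fh') /Qf; ring.
transitivity (Jf * (Zf true h1 * Zf false h2 - Zf true h2 * Zf false h1
    + h1 * Tf h2 - h2 * Tf h1) - h1 * (Jf * (g false * sg false + g true * sg true))
    + h2 * (Jf * (f false * sg false + f true * sg true))); first by ring.
rewrite (F g gh) (F f fh) -/h1 -/h2; ring.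
Qed.

End Derivations.

Lemma In_cat (I : Type) (s1 s2 : seq I) y : List.In y (s1 ++ s2) -> List.In y s1 \/ List.In y s2.
Proof. by elim: s1 => [|x s1 IH] /=; [right|case=> [->|/IH[]]; tauto]. Qed.

(** * Weighted order of vanishing at a point and leading terms of brackets *)

Section Filtration.
Variables (R : rcfType) (A : comNzRingType).
Local Notation C := R[i].
Variables (Z : bool -> A -> A) (T : A -> A) (ev : A -> C) (N : A -> Prop).
Hypothesis Zd : forall s, derivation (Z s).
Hypothesis TE : forall x, T x = Z false (Z true x) - Z true (Z false x).
Hypothesis evD : forall x y, ev (x + y) = ev x + ev y.
Hypothesis evM : forall x y, ev (x * y) = ev x * ev y.
Implicit Types (x y a : A) (s : bool) (l : seq A) (w : seq (option bool)).

Lemma Td : derivation T.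
Proof. have := der_com (Zd false) (Zd true); case=> h1 h2; split=> x y; rewrite !TE; [exact: h1|exact: h2]. Qed.

Lemma ev0 : ev 0 = 0.
Proof. by apply: (addrI (ev 0)); rewrite -evD !addr0. Qed.
Lemma evN x : ev (- x) = - ev x.
Proof. by apply/eqP; rewrite -addr_eq0 -evD addNr ev0. Qed.
Lemma evB x y : ev (x - y) = ev x - ev y. Proof. by rewrite evD evN. Qed.

(** Weighted order of vanishing at the base point: all words of length less than [k] in the two
    derivations evaluate to zero. A derivation by [T], being a commutator, counts for two. *)
Fixpoint ord k x := if k is k'.+1 then [/\ ev x = 0, ord k' (Z false x) & ord k' (Z true x)] else True.

Lemma ord_ev k x : ord k.+1 x -> ev x = 0. Proof. by case. Qed.
Lemma ord_Z k s x : ord k.+1 x -> ord k (Z s x). Proof. by case: s => -[]. Qed.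
Lemma ordS k x : ord k.+1 x -> ord k x.
Proof. by elim: k x => [//|k IH] x [h0 h1 h2]; split; [|exact: IH|exact: IH]. Qed.
Lemma ord_le k k' x : (k <= k')%N -> ord k' x -> ord k x.
Proof. by move/subnK <-; elim: (k' - k)%N => [//|n IH]; rewrite addSn => /ordS/IH. Qed.
Lemma ord_D k x y : ord k x -> ord k y -> ord k (x + y).
Proof.
elim: k x y => [//|k IH] x y [x0 x1 x2] [y0 y1 y2] /=.
by rewrite evD x0 y0 addr0 !(derD _ _ (Zd _)); split => //; exact: IH.
Qed.
(** Induction on the total order with the Leibniz rule; a factor of order zero cannot lose any
    order, so in that case the other factor carries the whole bound. *)
Lemma ord_M k k2 x y : ord k x -> ord k2 y -> ord (k + k2) (x * y).
Proof.
move E : (k + k2)%N => n; elim: n k k2 x y E => [//|n IH] k k2 x y E ox oy /=.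
have D s : ord n (Z s (x * y)).
  rewrite (derM _ _ (Zd _)); apply: ord_D.
    case: k E ox => [|k] E ox; last by apply: (IH k k2); [lia|exact: ord_Z|].
    by apply: (IH 0%N n) => //; apply: ord_le oy; lia.
  case: k2 E oy => [|k2] E oy; last by apply: (IH k k2); [lia| |exact: ord_Z].
  by apply: (IH n 0%N) => //; [lia|apply: ord_le ox; lia].
split; [|exact: D|exact: D]; rewrite evM.
case: k E ox => [|k] E ox; last by rewrite (ord_ev ox) mul0r.
by case: k2 E oy => [|k2] E oy; [lia|rewrite (ord_ev oy) mulr0].
Qed.
Lemma ord_Ml k x y : ord k y -> ord k (x * y).
Proof. by move=> oy; apply: (@ord_M 0). Qed.
Lemma ord_N k x : ord k x -> ord k (- x).
Proof. by move=> ox; rewrite -mulN1r; exact: ord_Ml. Qed.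
Lemma ord_B k x y : ord k x -> ord k y -> ord k (x - y).
Proof. by move=> ox oy; apply: ord_D => //; exact: ord_N. Qed.
Lemma ord_T k x : ord k.+2 x -> ord k (T x).
Proof. by move=> ox; rewrite TE; apply: ord_B; do 2! apply: ord_Z. Qed.
Lemma ord_Z1 k s x : ord k x -> ord k.-1 (Z s x).
Proof. by case: k => [//|k]; exact: ord_Z. Qed.
Lemma ord_T2 k x : ord k x -> ord k.-2 (T x).
Proof. by case: k => [//|[//|k]]; exact: ord_T. Qed.

(* None stands for T, which has weight 2; the head of the word acts first. *)
Definition op o := if o is Some s then Z s else T.
Definition wt1 (o : option bool) := if o is Some _ then 1%N else 2%N.
Fixpoint W w x := if w is o :: w' then W w' (op o x) else x.
Fixpoint wt' w := if w is o :: w' then (wt1 o + wt' w')%N else 0%N.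

Lemma op_der o : derivation (op o). Proof. by case: o => [s|]; [exact: Zd|exact: Td]. Qed.

Lemma W_add w x y : W w (x + y) = W w x + W w y.
Proof. by elim: w x y => [//|o w IH] x y /=; rewrite (derD _ _ (op_der o)) IH. Qed.

Lemma W_opp w x : W w (- x) = - W w x.
Proof. by elim: w x => [//|o w IH] x /=; rewrite (derN _ (op_der o)) IH. Qed.

Lemma ord_op k o x : ord (wt1 o + k) x -> ord k (op o x).
Proof. by case: o => [s|]; [exact: ord_Z|exact: ord_T]. Qed.

Lemma W_ev0 w x : ord (wt' w).+1 x -> ev (W w x) = 0.
Proof.
elim: w x => [|o w IH] x; first exact: (@ord_ev 0).
by rewrite [W _ _]/= [wt' _]/= -addnS => h; exact/IH/ord_op.
Qed.

(** Each derivation that falls on [a] leaves a word on [x] shorter than its order, and such a term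
    vanishes at the base point. *)
Lemma W_lead w a x : ord (wt' w) x -> ev (W w (a * x)) = ev a * ev (W w x).
Proof.
elim: w a x => [|o w IH] a x; first by move=> _; exact: evM.
rewrite ![W _ _]/= [wt' _]/= => ox.
rewrite (derM _ _ (op_der o)) W_add evD (IH a); last exact: ord_op.
rewrite W_ev0 ?add0r //; apply: ord_Ml; apply: ord_le ox.
by case: (o) => [s|] /=; lia.
Qed.

Section Bracket.
Variables (h1 h2 h12 i q : A).
(** Principal part of the Lagrange bracket. The term with [q] in [h12E] has one more order of
    vanishing, so it never reaches the leading coefficients. *)
Let M := Z true h1 * Z false h2 - Z true h2 * Z false h1 + (h1 * T h2 - h2 * T h1).
Hypothesis h12E : h12 = i * M - q * (h1 * Z true h2 - h2 * Z true h1).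

Lemma ord_br k k2 : ord k h1 -> ord k2 h2 -> ord (k + k2 - 2) h12.
Proof.
move=> o1 o2; rewrite h12E; apply: ord_B; apply: ord_Ml.
  apply: ord_D; apply: ord_B.
  - by apply: ord_le (ord_M (ord_Z1 true o1) (ord_Z1 false o2)); lia.
  - by apply: ord_le (ord_M (ord_Z1 true o2) (ord_Z1 false o1)); lia.
  - by apply: ord_le (ord_M o1 (ord_T2 o2)); lia.
  - by apply: ord_le (ord_M o2 (ord_T2 o1)); lia.
apply: ord_B.
- by apply: ord_le (ord_M o1 (ord_Z1 true o2)); lia.
- by apply: ord_le (ord_M o2 (ord_Z1 true o1)); lia.
Qed.

Lemma lead_br k k2 w : ord k h1 -> ord k2 h2 -> (wt' w + 2 = k + k2)%N ->
  ev (W w h12) = ev i * ev (W w M).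
Proof.
move=> o1 o2 E; rewrite h12E W_add W_opp evB W_lead; last first.
  apply: ord_D; apply: ord_B.
  - by apply: ord_le (ord_M (ord_Z1 true o1) (ord_Z1 false o2)); lia.
  - by apply: ord_le (ord_M (ord_Z1 true o2) (ord_Z1 false o1)); lia.
  - by apply: ord_le (ord_M o1 (ord_T2 o2)); lia.
  - by apply: ord_le (ord_M o2 (ord_T2 o1)); lia.
rewrite [X in _ - X]W_ev0 ?subr0 //; apply: ord_Ml; apply: ord_B.
- by apply: ord_le (ord_M o1 (ord_Z1 true o2)); lia.
- by apply: ord_le (ord_M o2 (ord_Z1 true o1)); lia.
Qed.

Ltac expand :=
  rewrite ?(derB _ _ (Zd _), derD _ _ (Zd _), derM _ _ (Zd _), derB _ _ Td, derD _ _ Td, derM _ _ Td).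
Let evE := (evB, evD, evM, evN).
Local Notation Zf := (Z false).
Local Notation Zt := (Z true).

(** In the names of this table the two digits are the orders of the arguments; order [k] is weight
    [k - 2] in the grading of su(2,1). These are the structure constants through which a subalgebra
    is later forced to fill a graded piece. *)
Lemma br11 : ord 1 h1 -> ord 1 h2 ->
  ev h12 = ev i * (ev (Zt h1) * ev (Zf h2) - ev (Zt h2) * ev (Zf h1)).
Proof.
move=> o1 o2; rewrite (lead_br (w := [::]) o1 o2 erefl) /M !evE.
by rewrite (ord_ev o1) (ord_ev o2) !mul0r subr0 addr0.
Qed.

Lemma br12 : ord 1 h1 -> ord 2 h2 -> ev (Zf (Zf h2)) = 0 ->
  ev (Zf h12) = - ev i * ev (Zf h1) * ev (Zt (Zf h2)).
Proof.
move=> o1 o2 z; rewrite (lead_br (w := [:: Some false]) o1 o2 erefl) /M /=; expand; rewrite !evE.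
rewrite z (ord_ev o1) (ord_ev o2) !(ord_ev (ord_Z _ o2)) TE !evE; ring.
Qed.

Lemma br03 : ord 3 h2 -> ev (Zf h12) = ev i * ev h1 * ev (Zf (T h2)).
Proof.
move=> o2; rewrite (@lead_br 0 3 [:: Some false] I o2 erefl) /M /=; expand; rewrite !evE.
rewrite (ord_ev o2) !(ord_ev (ord_Z _ o2)) !(ord_ev (ord_Z _ (ord_Z _ o2))) (ord_ev (ord_T o2)); ring.
Qed.

Lemma br13 : ord 1 h1 -> ord 3 h2 -> ev (Zf (Zt (Zt h2))) = 0 ->
  ev (Zf (Zt h12)) = ev i * (ev (Zt h1) * (ev (Zf (Zt (Zf h2))) + ev (Zf (T h2)))
    + ev (Zf h1) * ev (Zt (T h2))).
Proof.
move=> o1 o2 z; rewrite (lead_br (w := [:: Some true; Some false]) o1 o2 erefl) /M /=; expand; rewrite !evE.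
rewrite z (ord_ev o1) (ord_ev o2) !(ord_ev (ord_Z _ o2)) !(ord_ev (ord_Z _ (ord_Z _ o2))).
rewrite (ord_ev (ord_T o2)); ring.
Qed.

Lemma br23 : ord 2 h1 -> ord 3 h2 -> ev (Zf (Zf h1)) = 0 ->
  ev (T (Zf h12)) = ev i * (ev (Zf (Zt h1)) * ev (T (Zf h2)) +
    ev (T h1) * (ev (Zf (T h2)) - ev (T (Zf h2)))).
Proof.
move=> o1 o2 z; rewrite (lead_br (w := [:: Some false; None]) o1 o2 erefl) /M /=; expand; rewrite !evE.
rewrite z (ord_ev o1) !(ord_ev (ord_Z _ o1)).
rewrite (ord_ev o2) !(ord_ev (ord_Z _ o2)) !(ord_ev (ord_Z _ (ord_Z _ o2))).
rewrite (ord_ev (ord_T o2)); ring.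
Qed.

Lemma br33 : ord 3 h1 -> ord 3 h2 ->
  ev (T (T h12)) = ev i * (ev (T (Zt h1)) * ev (T (Zf h2))
    - ev (T (Zt h2)) * ev (T (Zf h1))) *+ 2.
Proof.
move=> o1 o2; rewrite (lead_br (w := [:: None; None]) o1 o2 erefl) /M /=; expand; rewrite !evE.
rewrite (ord_ev o1) !(ord_ev (ord_Z _ o1)) (ord_ev (ord_T o1)).
rewrite (ord_ev o2) !(ord_ev (ord_Z _ o2)) (ord_ev (ord_T o2)); ring.
Qed.

Lemma br14 : ord 1 h1 -> ord 4 h2 -> ev (T (Zf (Zf h2))) = 0 ->
  ev (T (Zf h12)) = ev i * ev (Zf h1) * (ev (T (T h2)) - ev (T (Zf (Zt h2)))).
Proof.
move=> o1 o2 z; rewrite (lead_br (w := [:: Some false; None]) o1 o2 erefl) /M /=; expand; rewrite !evE.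
have o3 := ord_T o2.
rewrite z (ord_ev o1) (ord_ev o2) !(ord_ev (ord_Z _ o2)) !(ord_ev (ord_Z _ (ord_Z _ o2))).
rewrite !(ord_ev (ord_Z _ o3)) (ord_ev o3) !(ord_ev (ord_T (ord_Z _ o2))); ring.
Qed.

Definition bracket_table :=
  (forall k k2, ord k h1 -> ord k2 h2 -> ord (k + k2 - 2) h12) /\
  (ord 1 h1 -> ord 1 h2 -> ev h12 = ev i * (ev (Zt h1) * ev (Zf h2) - ev (Zt h2) * ev (Zf h1))) /\
  (ord 1 h1 -> ord 2 h2 -> ev (Zf (Zf h2)) = 0 ->
    ev (Zf h12) = - ev i * ev (Zf h1) * ev (Zt (Zf h2))) /\
  (ord 3 h2 -> ev (Zf h12) = ev i * ev h1 * ev (Zf (T h2))) /\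
  (ord 1 h1 -> ord 3 h2 -> ev (Zf (Zt (Zt h2))) = 0 ->
    ev (Zf (Zt h12)) = ev i * (ev (Zt h1) * (ev (Zf (Zt (Zf h2))) + ev (Zf (T h2)))
      + ev (Zf h1) * ev (Zt (T h2)))) /\
  (ord 2 h1 -> ord 3 h2 -> ev (Zf (Zf h1)) = 0 ->
    ev (T (Zf h12)) = ev i * (ev (Zf (Zt h1)) * ev (T (Zf h2)) +
      ev (T h1) * (ev (Zf (T h2)) - ev (T (Zf h2))))) /\
  (ord 3 h1 -> ord 3 h2 -> ev (T (T h12)) = ev i * (ev (T (Zt h1)) * ev (T (Zf h2))
    - ev (T (Zt h2)) * ev (T (Zf h1))) *+ 2) /\
  (ord 1 h1 -> ord 4 h2 -> ev (T (Zf (Zf h2))) = 0 ->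
    ev (T (Zf h12)) = ev i * ev (Zf h1) * (ev (T (T h2)) - ev (T (Zf (Zt h2))))).

Lemma bracket_tableP : bracket_table.
Proof.
split; first exact: ord_br.
do ![split]; [exact: br11|exact: br12|exact: br03|exact: br13|exact: br23|exact: br33|exact: br14].
Qed.

End Bracket.

(** * Closure at length four of the system satisfied by a contact Hamiltonian *)

Section Span.
Hypotheses (N_D : forall x y, N x -> N y -> N (x + y)) (N_M : forall a x, N x -> N (a * x))
  (N_Z : forall s x, N x -> N (Z s x)) (N_ev : forall x, N x -> ev x = 0).
Variables (half third : A) (h : A).
Hypotheses (halfE : half *+ 2 = 1) (thirdE : third *+ 3 = 1).

(** Congruence modulo [N] to a combination of [l] with coefficients in [A]; the inductive form makes
    stability under derivations an induction and keeps the coefficients implicit. *)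
Inductive sp l : A -> Prop :=
| sp_mem x : List.In x l -> sp l x
| sp_N x : N x -> sp l x
| sp_D x y : sp l x -> sp l y -> sp l (x + y)
| sp_M a x : sp l x -> sp l (a * x).

Lemma sp_opp l x : sp l x -> sp l (- x).
Proof. by move=> h0; rewrite -mulN1r; exact: sp_M. Qed.
Lemma sp_B l x y : sp l x -> sp l y -> sp l (x - y).
Proof. by move=> h1 h2; apply: sp_D => //; exact: sp_opp. Qed.
Lemma sp_trans l l' x : sp l x -> (forall y, List.In y l -> sp l' y) -> sp l' x.
Proof.
move=> h0 ll; elim: h0 => [y /ll //|y Ny|y z _ h1 _ h2|a y _ h1].
- exact: sp_N.
- exact: sp_D.
- exact: sp_M.
Qed.
Lemma sp_der l l' s x : sp l x -> (forall y, List.In y l -> sp l' y /\ sp l' (Z s y)) ->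
  sp l' (Z s x).
Proof.
move=> h0 ll; suff [] : sp l' x /\ sp l' (Z s x) by [].
elim: h0 => [y /ll //|y Ny|y z _ [h1 h1'] _ [h2 h2']|a y _ [h1 h1']].
- by split; apply: sp_N; last exact: N_Z.
- by rewrite (derD _ _ (Zd _)); split; exact: sp_D.
- rewrite (derM _ _ (Zd _)); split; first exact: sp_M.
  by apply: sp_D; exact: sp_M.
Qed.
Lemma sp_ev l x : sp l x -> (forall y, List.In y l -> ev y = 0) -> ev x = 0.
Proof.
move=> h0 ll; elim: h0 => [y /ll //|y /N_ev //|y z _ h1 _ h2|a y _ h1].
  by rewrite evD h1 h2 addr0.
by rewrite evM h1 mulr0.
Qed.

Hypothesis ZZh : forall s, sp [:: h; Z false h; Z true h] (Z s (Z s h)).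
Hypothesis TZ : forall s x, sp [:: Z false x; Z true x; T x] (T (Z s x) - Z s (T x)).

Let l1 := [:: h; Z false h; Z true h].
Let l2 := [:: h; Z false h; Z true h; Z false (Z true h); Z true (Z false h)].
Let l3 := l2 ++ [:: Z false (Z true (Z false h)); Z true (Z false (Z true h))].
Let l4 := l3 ++ [:: Z true (Z false (Z true (Z false h)))].
(** Words generating, with coefficients, all derivatives of [h] of length at most [n]. The
    successive levels add 1, 2, 2, 2 and 1 words. The list stops growing at 4 because the system
    closes there. *)
Definition L n := match n with 0 => [:: h] | 1 => l1 | 2 => l2 | 3 => l3 | _ => l4 end.

Lemma L_S n x : List.In x (L n) -> List.In x (L n.+1).
Proof. by case: n => [|[|[|[|n]]]] //=; tauto. Qed.

Lemma L_sp m n x : (m <= n)%N -> sp (L m) x -> sp (L n) x.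
Proof.
move/subnK <-; elim: (n - m)%N => [//|k IH] /IH h0; rewrite addSn.
by apply: sp_trans h0 _ => y /L_S; exact: sp_mem.
Qed.

Lemma L_TZ n s x : sp (L n) (Z false x) -> sp (L n) (Z true x) -> sp (L n) (T x) ->
  sp (L n) (T (Z s x) - Z s (T x)).
Proof. by move=> h1 h2 h3; apply: (sp_trans (TZ s x)) => y [<-|[<-|[<-|[]]]]. Qed.

(** The commutator of [T] with [Z s] is, up to sign, a double commutator of the two derivations;
    this is its expansion solved for one word. The sign depends on which of the two derivations
    comes first in [T]. *)
Lemma ZZZ s x : exists b : bool, Z s (Z s (Z (~~ s) x)) =
  Z s (Z (~~ s) (Z s x)) *+ 2 - Z (~~ s) (Z s (Z s x)) - (-1) ^+ b * (T (Z s x) - Z s (T x)).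
Proof.
exists s; case: s; rewrite !TE !(derB _ _ (Zd _)) /=; ring.
Qed.

Lemma sp_nat l n x : sp l x -> sp l (x *+ n).
Proof. by move=> h0; rewrite -mulr_natl; exact: sp_M. Qed.

Lemma sp_eqm l x y : sp l (x - y) -> sp l y -> sp l x.
Proof. by move=> h1 h2; rewrite -(subrK y x); exact: sp_D. Qed.

Lemma L_Z0 s x : sp (L 0) x -> sp (L 1) (Z s x).
Proof.
move=> h0; apply: (sp_der h0) => y [<-|[]]; split; apply: sp_mem; case: s => /=; tauto.
Qed.

Lemma L_Z1 s x : sp (L 1) x -> sp (L 2) (Z s x).
Proof.
move=> h0; apply: (sp_der h0) => y yL; split; first by apply: sp_mem; exact: L_S.
case: yL => [<-|[<-|[<-|[]]]].
- by apply: sp_mem; case: s => /=; tauto.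
- by case: s; [apply: sp_mem; rewrite /=; tauto|apply: (@L_sp 1 2) => //; exact: (ZZh false)].
- by case: s; [apply: (@L_sp 1 2) => //; exact: (ZZh true)|apply: sp_mem; rewrite /=; tauto].
Qed.

Lemma L_h s : sp (L 1) (Z s h).
Proof. by apply: sp_mem; case: s => /=; tauto. Qed.
Lemma L_Zh s s' : sp (L 2) (Z s (Z s' h)). Proof. exact/L_Z1/L_h. Qed.
Lemma L_Th : sp (L 2) (T h). Proof. by rewrite TE; apply: sp_B; exact: L_Zh. Qed.

(** In [ZZZ] the word beginning its action with [Z s] twice is shortened by [ZZh], and the
    commutator with [T] is shortened by [TZ]. *)
Lemma L_ZZZh s : sp (L 2) (Z s (Z s (Z (~~ s) h)) - Z s (Z (~~ s) (Z s h)) *+ 2).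
Proof.
have [b ->] := ZZZ s h; rewrite addrAC [_ *+ 2 - _]addrC addrK.
apply: sp_B; first by apply/sp_opp/L_Z1/ZZh.
apply/sp_M/L_TZ; [exact/(@L_sp 1 2)/L_h|exact/(@L_sp 1 2)/L_h|exact: L_Th].
Qed.

Lemma L_Z2 s x : sp (L 2) x -> sp (L 3) (Z s x).
Proof.
move=> h0; apply: (sp_der h0) => y yL; split; first by apply: sp_mem; exact: L_S.
have a s' : sp (L 3) (Z s' (Z (~~ s') (Z s' h))) by apply: sp_mem; case: s' => /=; tauto.
have b s' : sp (L 3) (Z s' (Z s' (Z (~~ s') h))).
  apply: sp_eqm (sp_nat 2 (a s')); apply: (@L_sp 2 3) => //; exact: L_ZZZh.
case: yL => [<-|[<-|[<-|[<-|[<-|[]]]]]].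
- exact/(@L_sp 1 3)/L_h.
- exact/(@L_sp 2 3)/L_Zh.
- exact/(@L_sp 2 3)/L_Zh.
- case: s; [exact: (a true)|exact: (b false)].
- case: s; [exact: (b true)|exact: (a false)].
Qed.

Lemma L_ZZh s s' s'' : sp (L 3) (Z s (Z s' (Z s'' h))). Proof. exact/L_Z2/L_Zh. Qed.
Lemma L_TZh s : sp (L 3) (T (Z s h)). Proof. by rewrite TE; apply: sp_B; exact: L_ZZh. Qed.

Lemma L_ZZZZ s : sp (L 3) (Z s (Z s (Z (~~ s) (Z s h)))).
Proof.
have [b ->] := ZZZ s (Z s h).
have t : sp (L 1) (Z s (Z s h)) by exact: ZZh.
apply: sp_B; first apply: sp_B.
- by apply/sp_nat/L_Z2/L_Z1.
- by apply/L_Z2/L_Z1.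
- apply/sp_M/L_TZ; [exact/(@L_sp 2 3)/L_Zh|exact/(@L_sp 2 3)/L_Zh|exact: L_TZh].
Qed.

Let e s := Z s (Z (~~ s) (Z s (Z (~~ s) h))).

Lemma L_half l x : sp l (x *+ 2) -> sp l x.
Proof. by move=> h0; rewrite -(mul1r x) -halfE mulrnAl -mulrnAr; exact: sp_M. Qed.
Lemma L_third l x : sp l (x *+ 3) -> sp l x.
Proof. by move=> h0; rewrite -(mul1r x) -thirdE mulrnAl -mulrnAr; exact: sp_M. Qed.

Lemma L_e1 : sp (L 3) (Z false (Z true (Z true (Z false h))) - e false *+ 2).
Proof.
have := L_Z2 false (L_ZZZh true); rewrite (derB _ _ (Zd _)) mulr2n (derD _ _ (Zd _)) -mulr2n.
by [].
Qed.

Lemma L_e2 : sp (L 3) (Z true (Z false (Z false (Z true h))) - e true *+ 2).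
Proof.
have := L_Z2 true (L_ZZZh false); rewrite (derB _ _ (Zd _)) mulr2n (derD _ _ (Zd _)) -mulr2n.
by [].
Qed.

(** The commutator of [T] with [Z true], applied to [Z false h], yields a second expression for the
    word of [L_e1]. The comparison identifies the two alternating words [e false] and [e true]
    modulo shorter ones, so that length four contributes a single new generator. *)
Lemma L_e3 : sp (L 3) (Z false (Z true (Z true (Z false h))) - e true *+ 2).
Proof.
have h1 : sp (L 3) (T (Z true (Z false h)) - Z true (T (Z false h))).
  by apply: L_TZ; [exact/(@L_sp 2 3)/L_Zh|exact/(@L_sp 2 3)/L_Zh|exact: L_TZh].
have h2 : sp (L 3) (Z true (Z true (Z false (Z false h)))) by exact/L_Z2/L_Z1/ZZh.
have := sp_B h1 h2; rewrite !TE (derB _ _ (Zd _)) /e /=.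
move: (Z true (Z true (Z false (Z false h)))) => u.
move: (Z true (Z false (Z true (Z false h)))) (Z false (Z true (Z true (Z false h)))) => v t.
by rewrite (_ : t - v - (v - u) - u = t - v *+ 2) //; ring.
Qed.

Lemma L_e : sp (L 3) (e false - e true).
Proof.
apply: L_half; have := sp_B L_e3 L_e1.
by rewrite opprB addrC addrA subrK mulrnBl.
Qed.

(** The four words of [T (T h)] are all multiples of the same alternating word modulo [L 3], with
    total coefficient -2; the last symbol can therefore be read from [T (T h)]. *)
Lemma L_TT : sp (L 3) (T (T h) + e true *+ 2).
Proof.
have h1 := sp_B L_e L_e2; have := sp_B h1 L_e3; rewrite !TE !(derB _ _ (Zd _)) /e /=.
set u := Z false (Z true (Z true _)); set v := Z true (Z false (Z false _)).
move: (Z false (Z true (Z false (Z true h)))) (Z true (Z false (Z true (Z false h)))) => b a h2.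
by rewrite (_ : _ + _ = b - a - (v - a *+ 2) - (u - a *+ 2)) //; ring.
Qed.

Lemma L_Z3 s x : sp (L 3) x -> sp (L 4) (Z s x).
Proof.
move=> h0; apply: (sp_der h0) => y yL; split; first by apply: sp_mem; exact: L_S.
have et : sp (L 4) (e true) by apply: sp_mem; rewrite /=; tauto.
have ef : sp (L 4) (e false) by apply: sp_eqm et; apply: (@L_sp 3 4) => //; exact: L_e.
case: (In_cat yL) => [|[<-|[<-|[]]]].
- by move=> yl; apply/(@L_sp 3 4) => //; apply/L_Z2; exact: sp_mem.
- case: s; [exact: et|exact/(@L_sp 3 4)/(L_ZZZZ false)].
- case: s; [exact/(@L_sp 3 4)/(L_ZZZZ true)|exact: ef].
Qed.

(** Closure at length five. Call X the word in question. [ZZZ] writes X as twice a word Y modulo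
    [L 4], while [L_ZZZh] and [L_e] give that Y is congruent to twice X. Hence three times X lies in
    the span, and division by three concludes. *)
Lemma L_Ze s : sp (L 4) (Z s (e s)).
Proof.
have d2 s' x y : Z s' (x - y *+ 2) = Z s' x - Z s' y *+ 2.
  by rewrite (derB _ _ (Zd _)) !mulr2n (derD _ _ (Zd _)).
have ee : e (~~ s) = Z (~~ s) (Z s (Z (~~ s) (Z s h))) by rewrite /e negbK.
have a : sp (L 4) (Z s (Z (~~ s) (Z s (Z s (Z (~~ s) h)))) - Z s (e (~~ s)) *+ 2).
  by have := L_Z3 s (L_Z2 (~~ s) (L_ZZZh s)); rewrite !d2 ee.
have b : sp (L 4) (Z (~~ s) (Z s (Z s (Z s (Z (~~ s) h))))).
  have := L_Z3 (~~ s) (L_Z2 s (L_ZZZh s)); rewrite !d2 => h0.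
  by apply: sp_eqm h0 _; exact/sp_nat/L_Z3/L_ZZZZ.
have c : sp (L 4) (Z s (e (~~ s)) - Z s (e s)).
  rewrite -(derB _ _ (Zd _)); apply: L_Z3; case: s {ee a b}; first exact: L_e.
  by rewrite -opprB; exact/sp_opp/L_e.
have [t E] := ZZZ s (Z s (Z (~~ s) h)).
have d : sp (L 4) (T (Z s (Z s (Z (~~ s) h))) - Z s (T (Z s (Z (~~ s) h)))).
  by apply: L_TZ; [exact/(@L_sp 3 4)/L_ZZh|exact/(@L_sp 3 4)/L_ZZh|rewrite TE; apply: sp_B; exact/L_Z3/L_Z2/L_Zh].
apply: L_third; move: E; rewrite -/(e s) => E.
have h1 := sp_D (sp_opp (sp_nat 2 (sp_D a (sp_nat 2 c)))) (sp_D b (sp_M ((-1) ^+ t) d)).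
move: E h1; rewrite {1 2 3}/e.
set V := Z (~~ s) (Z s (Z s (Z s (Z (~~ s) h)))).
set Y := Z s (Z (~~ s) (Z s (Z s _))); set X := Z s (Z s _).
set D := T _ - _; move: (Z s (e (~~ s))) ((-1) ^+ t) => Q r E.
have -> : X *+ 3 = X *+ 4 - (Y *+ 2 - V - r * D) by rewrite -E; ring.
rewrite (_ : X *+ 4 - (Y *+ 2 - V - r * D) =
  - ((Y - Q *+ 2 + (Q - X) *+ 2) *+ 2) + (V + r * D)) //; ring.
Qed.

Lemma L_Z4 s x : sp (L 4) x -> sp (L 4) (Z s x).
Proof.
move=> h0; apply: (sp_der h0) => y yL; split; first by apply: sp_mem.
case: (In_cat yL) => [|[<-|[]]].
  by move=> yl; apply/L_Z3; exact: sp_mem.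
case: s; first exact: (L_Ze true).
apply: (sp_eqm _ (L_Ze false)); rewrite -opprB -(derB _ _ (Zd _)).
exact/sp_opp/L_Z3/L_e.
Qed.

Lemma L_Z n s x : sp (L n) x -> sp (L n.+1) (Z s x).
Proof.
by case: n => [|[|[|[|n]]]]; [exact: L_Z0|exact: L_Z1|exact: L_Z2|exact: L_Z3|exact: L_Z4].
Qed.

(** Each derivation moves from [L i] to [L i.+1], so an element of level [i] can be differentiated
    [m - i] times and still be a combination of generators that vanish at the point. *)
Lemma ord_L m : (forall y, List.In y (L m) -> ev y = 0) ->
  forall j i x, (i + j <= m.+1)%N -> sp (L i) x -> ord j x.
Proof.
move=> Lm; elim=> [//|j IH] i x ij xi.
have D s : ord j (Z s x) by apply: (IH i.+1); [lia|exact: L_Z].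
split; [|exact: D|exact: D]; apply: (sp_ev _ Lm); apply: L_sp xi; lia.
Qed.

Lemma ord_h m : (forall y, List.In y (L m) -> ev y = 0) -> ord m.+1 h.
Proof. by move=> Lm; apply: (ord_L Lm (i := 0)) => //; apply: sp_mem; left. Qed.

(** The span of [L 4] is stable under both derivations: once its generators vanish at the point,
    every word does. This is the determination of a field by its weighted jet of order four. *)
Lemma ord5_all : ord 5 h -> forall k, ord k h.
Proof.
move=> o k; apply: (@ord_le _ (k + 4).+1); first lia.
apply: ord_h; rewrite addnC => y yL.
have o1 s := ord_Z s o; have o2 s s' := ord_Z s (o1 s').
have o3 s s' s'' := ord_Z s (o2 s' s''); have o4 s s' s'' t := ord_Z s (o3 s' s'' t).
move: yL => /=; case=> [<-|]; first exact: (ord_ev o).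
do 2! (case=> [<-|]; first exact: (ord_ev (o1 _))).
do 2! (case=> [<-|]; first exact: (ord_ev (o2 _ _))).
do 2! (case=> [<-|]; first exact: (ord_ev (o3 _ _ _))).
by case=> [<-|//]; exact: (ord_ev (o4 _ _ _ _)).
Qed.

Lemma ev_sp m x : ord m.+1 h -> (m <= 3)%N -> sp (L m) x -> ev x = 0.
Proof.
move=> o m4 xs; have o1 (m1 : (0 < m)%N) s : ord m (Z s h) := ord_Z s o.
case: m m4 o xs o1 => [|m] m4 o xs o1.
  by apply: (sp_ev xs) => y [<-|[]]; exact: (ord_ev o).
have {}o1 s : ord m.+1 (Z s h) by exact: o1.
case: m m4 o xs o1 => [|m] m4 o xs o1.
  by apply: (sp_ev xs) => y [<-|[<-|[<-|[]]]]; [exact: (ord_ev o)|exact: (ord_ev (o1 _))..].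
have o2 s s' := ord_Z s (o1 s').
case: m m4 o xs o1 o2 => [|m] m4 o xs o1 o2.
  by apply: (sp_ev xs) => y [<-|[<-|[<-|[<-|[<-|[]]]]]];
    [exact: (ord_ev o)|exact: (ord_ev (o1 _))|exact: (ord_ev (o1 _))|exact: (ord_ev (o2 _ _))..].
have o3 s s' s'' := ord_Z s (o2 s' s'').
case: m m4 o xs o1 o2 o3 => [|//] m4 o xs o1 o2 o3.
by apply: (sp_ev xs) => y [<-|[<-|[<-|[<-|[<-|[<-|[<-|[]]]]]]]];
    [exact: (ord_ev o)|exact: (ord_ev (o1 _))|exact: (ord_ev (o1 _))|exact: (ord_ev (o2 _ _))
    |exact: (ord_ev (o2 _ _))|exact: (ord_ev (o3 _ _ _))..].
Qed.

Variable cj : A -> A.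
Hypotheses (cjB : forall x y, cj (x - y) = cj x - cj y) (cjZ : forall s x, cj (Z s x) = Z (~~ s) (cj x))
  (ev_cj : forall x, ev (cj x) = (ev x)^*) (h_cj : N (h + cj h)).

Lemma cjT x : cj (T x) = - T (cj x).
Proof. by rewrite !TE cjB !cjZ /= opprB. Qed.

Lemma evNcj x : N (x + cj x) -> ev x = - (ev x)^*.
Proof. by move=> /N_ev; rewrite evD ev_cj => /eqP; rewrite addr_eq0 => /eqP. Qed.

(** Tangency makes [h] imaginary modulo [N], and conjugation exchanges the two derivations; each
    coefficient is thus tied to that of the mirror word. This halves the number of real
    parameters. *)
Lemma ev_h : ev h = - (ev h)^*. Proof. exact: evNcj. Qed.

Lemma ev_Zh s : ev (Z s h) = - (ev (Z (~~ s) h))^*.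
Proof.
have /N_ev := N_Z s h_cj; rewrite (derD _ _ (Zd _)) evD -{2}(negbK s) -cjZ ev_cj => /eqP.
by rewrite addr_eq0 => /eqP.
Qed.

Lemma ev_ZZh s s' : ev (Z s (Z s' h)) = - (ev (Z (~~ s) (Z (~~ s') h)))^*.
Proof.
have /N_ev := N_Z s (N_Z s' h_cj).
rewrite !(derD _ _ (Zd _)) evD -{2}(negbK s) -{2}(negbK s') -!cjZ ev_cj => /eqP.
by rewrite addr_eq0 => /eqP.
Qed.

Lemma N_B x y : N x -> N y -> N (x - y).
Proof. by move=> Nx Ny; rewrite -[- y]mulN1r; apply: N_D => //; exact: N_M. Qed.
Lemma N_T x : N x -> N (T x).
Proof. by move=> Nx; rewrite TE; apply: N_B; do 2! apply: N_Z. Qed.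

Lemma ev_TZh s : ev (T (Z s h)) = (ev (T (Z (~~ s) h)))^*.
Proof.
have /N_ev := N_T (N_Z s h_cj); rewrite (derD _ _ (Zd _)) (derD _ _ Td) evD.
rewrite -{2}(negbK s) -cjZ -[T (cj _)]opprK -cjT evN ev_cj => /eqP.
by rewrite subr_eq0 => /eqP.
Qed.

Lemma ev_TTh : ev (T (T h)) = - (ev (T (T h)))^*.
Proof.
apply: evNcj; rewrite cjT cjT (derN _ Td) opprK -!(derD _ _ Td).
exact/N_T/N_T.
Qed.

Lemma ord1_sym : ev h = 0 -> ord 1 h. Proof. by []. Qed.
(** From here to [ord5_sym]: at each level a single coefficient decides the next order, the other
    words of that length being mirror images of it or reducible to shorter words. *)
Lemma ord2_sym : ord 1 h -> ev (Z false h) = 0 -> ord 2 h.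
Proof.
move=> o a0; apply: ord_h => y [<-|[<-|[<-|[]]]]; [exact: (ord_ev o)|exact: a0|].
by rewrite ev_Zh /= a0 rmorph0 oppr0.
Qed.
Lemma ord3_sym : ord 2 h -> ev (Z false (Z true h)) = 0 -> ord 3 h.
Proof.
move=> o a0; apply: ord_h => y [<-|[<-|[<-|[<-|[<-|[]]]]]].
- exact: (ord_ev o).
- exact: (ord_ev (ord_Z false o)).
- exact: (ord_ev (ord_Z true o)).
- exact: a0.
- by rewrite ev_ZZh /= a0 rmorph0 oppr0.
Qed.

Lemma ev_ZZZ0 s s' : ord 3 h -> ev (Z s (Z s' (Z s' h))) = 0.
Proof. by move=> o; apply: (ev_sp o) => //; apply/L_Z1/ZZh. Qed.
Lemma ev_ZZZ2 s : ord 3 h -> ev (Z s (Z s (Z (~~ s) h))) = ev (Z s (Z (~~ s) (Z s h))) *+ 2.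
Proof.
move=> o; have := ev_sp o isT (L_ZZZh s); rewrite evB => /eqP; rewrite subr_eq0 => /eqP ->.
by rewrite !mulr2n evD.
Qed.
Lemma ev_ZZbZ : ord 3 h -> ev (Z false (Z true (Z false h))) = ev (T (Z false h)).
Proof. by move=> o; rewrite TE evB ev_ZZZ0 // subr0. Qed.
Lemma ev_ZbZZb : ord 3 h -> ev (Z true (Z false (Z true h))) = - ev (T (Z true h)).
Proof. by move=> o; rewrite TE evB ev_ZZZ0 // sub0r opprK. Qed.

Lemma ord4_sym : ord 3 h -> ev (T (Z false h)) = 0 -> ord 4 h.
Proof.
move=> o a0; apply: ord_h => y yL.
case: (In_cat yL) => [yl|[<-|[<-|[]]]].
- by apply: (ev_sp (m := 2) o) => //; exact: sp_mem.
- by rewrite ev_ZZbZ.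
- by rewrite ev_ZbZZb // ev_TZh /= a0 rmorph0 oppr0.
Qed.

Lemma ord5_sym : ord 4 h -> ev (T (T h)) = 0 -> ord 5 h.
Proof.
move=> o a0; apply: ord_h => y yL.
case: (In_cat yL) => [yl|[<-|[]]].
  by apply: (ev_sp (m := 3) o) => //; exact: sp_mem.
have := ev_sp (m := 3) o isT L_TT; rewrite evD a0 add0r mulr2n evD -mulr2n => /eqP.
by rewrite mulrn_eq0 /= => /eqP.
Qed.

Lemma ev_ZT s : ord 3 h -> ev (Z s (T h)) = ev (T (Z s h)).
Proof.
move=> o; apply/esym/eqP; rewrite -subr_eq0 -evB; apply/eqP/(ev_sp o) => //.
by apply: L_TZ; [exact/(@L_sp 1 2)/L_h|exact/(@L_sp 1 2)/L_h|exact: L_Th].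
Qed.

(** Modulo shorter words, [T (Z false (Z true h))] is [e false] minus twice [e true], that is minus
    [e true], and this is half of [T (T h)] by [L_TT]. *)
Lemma ev_TZZb : ord 4 h -> ev (T (Z false (Z true h))) = ev (T (T h)) / 2.
Proof.
move=> o; have E x : sp (L 3) x -> ev x = 0 by exact: (ev_sp (m := 3) o).
have := E _ L_TT; have := E _ L_e; have := E _ L_e2.
rewrite (TE (Z false _)) !(evB, evD) ?mulr2n ?evD /e /=.
move: (ev (Z false (Z true (Z false (Z true h))))) (ev (Z true (Z false (Z true (Z false h))))) => b a.
move: (ev (Z true (Z false (Z false _)))) (ev (T _)) => c d.
move=> /eqP; rewrite subr_eq0 => /eqP ->.
move=> /eqP; rewrite subr_eq0 => /eqP ->.
move=> /eqP; rewrite addr_eq0 => /eqP ->.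
by field.
Qed.
Lemma ev_TZZ : ord 4 h -> ev (T (Z false (Z false h))) = 0.
Proof.
move=> o; apply: (ev_sp (m := 3) o) => //; rewrite TE.
by apply: sp_B; apply/L_Z2/L_Z1/ZZh.
Qed.

Definition symbol_facts :=
  (ev h = - (ev h)^* /\ (forall s, ev (Z s h) = - (ev (Z (~~ s) h))^*)) /\
  ((forall s s', ev (Z s (Z s' h)) = - (ev (Z (~~ s) (Z (~~ s') h)))^*) /\
   (forall s, ev (T (Z s h)) = (ev (T (Z (~~ s) h)))^*)) /\
  (ev (T (T h)) = - (ev (T (T h)))^* /\ (forall s, ord 2 h -> ev (Z s (Z s h)) = 0)) /\
  ((ev h = 0 -> ord 1 h) /\ (ord 1 h -> ev (Z false h) = 0 -> ord 2 h)) /\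
  ((ord 2 h -> ev (Z false (Z true h)) = 0 -> ord 3 h) /\
   (ord 3 h -> ev (T (Z false h)) = 0 -> ord 4 h)) /\
  ((ord 4 h -> ev (T (T h)) = 0 -> ord 5 h) /\ (ord 5 h -> forall k, ord k h)) /\
  ((forall s s', ord 3 h -> ev (Z s (Z s' (Z s' h))) = 0) /\
   (ord 3 h -> ev (Z false (Z true (Z false h))) = ev (T (Z false h)))) /\
  ((forall s, ord 3 h -> ev (Z s (T h)) = ev (T (Z s h))) /\
   (ord 4 h -> ev (T (Z false (Z true h))) = ev (T (T h)) / 2) /\
   (ord 4 h -> ev (T (Z false (Z false h))) = 0)).

Lemma symbol_factsP : symbol_facts.
Proof.
split; first by split; [exact: ev_h|exact: ev_Zh].
split; first by split; [exact: ev_ZZh|exact: ev_TZh].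
split; first by split; [exact: ev_TTh|move=> s o; exact: (ev_sp (m := 1) o isT (ZZh s))].
split; first by split; [exact: ord1_sym|exact: ord2_sym].
split; first by split; [exact: ord3_sym|exact: ord4_sym].
split; first by split; [exact: ord5_sym|exact: ord5_all].
split; first by split; [exact: ev_ZZZ0|exact: ev_ZZbZ].
by split; [exact: ev_ZT|split; [exact: ev_TZZb|exact: ev_TZZ]].
Qed.

End Span.
End Filtration.

(** * Linear algebra of the graded model: large subalgebras and perfectness *)

Section Graded.
Variables (R : rcfType) (V : vectType R).
Local Notation C := R[i].
Implicit Types (x y : V) (W S : {vspace V}).

Lemma hom_ex (W : vectType R) (f : V -> W) : linear f -> exists S : 'Hom(V, W), forall x, S x = f x.
Proof.
move=> lf.
pose mf := GRing.isLinear.Build R V W _ f lf.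
pose g : {linear V -> W} := HB.pack f mf.
by exists (linfun g) => x; rewrite lfunE.
Qed.

Lemma real_hom (f : V -> R) : (forall k x y, f (k *: x + y) = k * f x + f y) ->
  exists S : 'Hom(V, 'rV[R]_1), forall x, S x = const_mx (f x).
Proof. by move=> lf; apply: hom_ex => k x y; apply/rowP => j; rewrite !mxE lf. Qed.

Definition crow (z : C) : 'rV[R]_2 := \row_j (if j == 0 then complex.Re z else complex.Im z).

Lemma crow_inj : injective crow.
Proof.
move=> [z1 z2] [t1 t2] /rowP h; move: (h 0) (h 1); rewrite !mxE /= => -> h2.
by congr (_ +i* _).
Qed.

Lemma crow_surj v : exists z, crow z = v.
Proof.
exists (v 0 0 +i* v 0 1); apply/rowP => j; rewrite !mxE /=.
have [->//|h] := eqVneq j 0; congr (v _ _).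
by case: j h => [[|[|//]] //= i h]; apply: val_inj.
Qed.

Lemma complex_hom (f : V -> C) : (forall k x y, f (k *: x + y) = k%:C * f x + f y) ->
  exists S : 'Hom(V, 'rV[R]_2), forall x, S x = crow (f x).
Proof.
move=> lf; apply: hom_ex => k x y; apply/rowP => j; rewrite !mxE lf.
by case: (f x) (f y) => [? ?] [? ?] /=; case: ifP => _ /=; ring.
Qed.

Variables (bk : V -> V -> V) (h0 k4 : V -> R) (a c b : V -> C) (j : C).
Hypotheses (h0L : forall k x y, h0 (k *: x + y) = k * h0 x + h0 y)
  (k4L : forall k x y, k4 (k *: x + y) = k * k4 x + k4 y)
  (aL : forall k x y, a (k *: x + y) = k%:C * a x + a y)
  (cL : forall k x y, c (k *: x + y) = k%:C * c x + c y)
  (bL : forall k x y, b (k *: x + y) = k%:C * b x + b y).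

(** The filtration by order, written with symbols: [h0], [a], [c], [b], [k4] are the coordinates of
    the pieces of weight -2, -1, 0, 1, 2, of real dimension at most 1, 2, 2, 2, 1. *)
Definition Fk k x := [/\ (0 < k)%N -> h0 x = 0, (1 < k)%N -> a x = 0, (2 < k)%N -> c x = 0,
  (3 < k)%N -> b x = 0 & (4 < k)%N -> k4 x = 0].

Hypothesis F5 : forall x, Fk 5 x -> x = 0.

(** The rank formula along the successive kernels of the symbols inside [W], the last of which is
    zero by [F5]. The number [d k] is the dimension of the space of symbols of order [k], and a
    complex symbol takes all values exactly when this number is 2. *)
Lemma graded_dim W : exists d : nat -> nat,
  [/\ \dim W = (d 0 + d 1 + d 2 + d 3 + d 4)%N,
   [/\ (d 0 <= 1), (d 1 <= 2), (d 2 <= 2), (d 3 <= 2) & (d 4 <= 1)]%N,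
   [/\ (0 < d 0)%N <-> (exists x, [/\ x \in W, Fk 0 x & h0 x != 0]),
       (0 < d 1)%N <-> (exists x, [/\ x \in W, Fk 1 x & a x != 0]),
       (0 < d 3)%N <-> (exists x, [/\ x \in W, Fk 3 x & b x != 0]) &
       (0 < d 4)%N <-> (exists x, [/\ x \in W, Fk 4 x & k4 x != 0])] &
   [/\ (2 <= d 1)%N <-> (forall z, exists x, [/\ x \in W, Fk 1 x & a x = z]),
       (2 <= d 2)%N <-> (forall z, exists x, [/\ x \in W, Fk 2 x & c x = z]) &
       (2 <= d 3)%N <-> (forall z, exists x, [/\ x \in W, Fk 3 x & b x = z])]].
Proof.
have [S0 E0] := real_hom h0L; have [S1 E1] := complex_hom aL.
have [S2 E2] := complex_hom cL; have [S3 E3] := complex_hom bL.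
have [S4 E4] := real_hom k4L.
pose W1 := (W :&: lker S0)%VS; pose W2 := (W1 :&: lker S1)%VS.
pose W3 := (W2 :&: lker S2)%VS; pose W4 := (W3 :&: lker S3)%VS.
have c0 : crow 0 = 0 by apply/rowP => k; rewrite !mxE if_same.
have rk (f : V -> R) (S : 'Hom(V, 'rV[R]_1)) (E : forall x, S x = const_mx (f x)) x :
    (x \in lker S) <-> f x = 0.
  rewrite memv_ker E; split => [/eqP/rowP/(_ 0)|->]; first by rewrite !mxE.
  by apply/eqP/rowP => k; rewrite !mxE.
have ck (f : V -> C) (S : 'Hom(V, 'rV[R]_2)) (E : forall x, S x = crow (f x)) x :
    (x \in lker S) <-> f x = 0.
  by rewrite memv_ker E; split => [/eqP|->]; [rewrite -c0 => /crow_inj|rewrite c0].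
have m1 x : (x \in W1) <-> (x \in W /\ Fk 1 x).
  rewrite memv_cap; split => [/andP[xW /(rk _ _ E0) h]|[xW [h _ _ _ _]]].
    by split; [exact: xW|split].
  by apply/andP; split => //; apply/(rk _ _ E0); exact: h.
have m2 x : (x \in W2) <-> (x \in W /\ Fk 2 x).
  rewrite memv_cap; split => [/andP[/m1[xW [h' _ _ _ _]] /(ck _ _ E1) h]|[xW [h' h _ _ _]]].
    by split; [exact: xW|split=> // _; auto].
  apply/andP; split; last by apply/(ck _ _ E1); exact: h.
  by apply/m1; split => //; split => // _; auto.
have m3 x : (x \in W3) <-> (x \in W /\ Fk 3 x).
  rewrite memv_cap; split => [/andP[/m2[xW [h' h'' _ _ _]] /(ck _ _ E2) h]|[xW [h' h'' h _ _]]].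
    by split; [exact: xW|split=> // _; auto].
  apply/andP; split; last by apply/(ck _ _ E2); exact: h.
  by apply/m2; split => //; split => // _; auto.
have m4 x : (x \in W4) <-> (x \in W /\ Fk 4 x).
  rewrite memv_cap; split => [/andP[/m3[xW [h' h'' h3 _ _]] /(ck _ _ E3) h]|[xW [h' h'' h3 h _]]].
    by split; [exact: xW|split=> // _; auto].
  apply/andP; split; last by apply/(ck _ _ E3); exact: h.
  by apply/m3; split => //; split => // _; auto.
have m5 : (W4 :&: lker S4)%VS = 0%VS.
  apply/eqP; rewrite -subv0; apply/subvP => x; rewrite memv_cap memv0.
  case/andP => /m4[xW [h1 h2 h3 h5 _]] /(rk _ _ E4) h; apply/eqP/F5.
  by split => // _; auto.
pose d n := match n with 0 => \dim (S0 @: W) | 1 => \dim (S1 @: W1) | 2 => \dim (S2 @: W2)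
  | 3 => \dim (S3 @: W3) | _ => \dim (S4 @: W4) end.
have df n (U : {vspace 'rV[R]_n}) : (\dim U <= n)%N.
  by rewrite (leq_trans (dimvS (subvf U))) // dimvf /dim /= mul1n.
exists d; split.
- rewrite -(limg_ker_dim S0 W) -/W1 -(limg_ker_dim S1 W1) -/W2 -(limg_ker_dim S2 W2) -/W3.
  rewrite -(limg_ker_dim S3 W3) -/W4 -(limg_ker_dim S4 W4) m5 dimv0 /d; lia.
- by split; exact: df.
- have pos n (U : {vspace V}) (S : 'Hom(V, 'rV[R]_n)) : (0 < \dim (S @: U))%N <->
      exists2 x, x \in U & S x != 0.
    rewrite lt0n dimv_eq0; split => [h|[x xU Sx]].
      have := vpick0 (S @: U)%VS; rewrite (negPf h) => /negbT.
      by have /memv_imgP[x xU ->] := memv_pick (S @: U)%VS => Sx; exists x.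
    apply: contra Sx => /eqP h; have : S x \in (S @: U)%VS by exact: memv_img.
    by rewrite h memv0.
  have rk' (f : V -> R) (S : 'Hom(V, 'rV[R]_1)) (E : forall x, S x = const_mx (f x)) x :
    (S x != 0) <-> (f x != 0).
    by have := rk f S E x; rewrite memv_ker => -[h1 h2]; split; apply: contra => /eqP ?; apply/eqP; [apply/eqP/h2|exact/h1/eqP].
  have ck' (f : V -> C) (S : 'Hom(V, 'rV[R]_2)) (E : forall x, S x = crow (f x)) x :
    (S x != 0) <-> (f x != 0).
    by have := ck f S E x; rewrite memv_ker => -[h1 h2]; split; apply: contra => /eqP ?; apply/eqP; [apply/eqP/h2|exact/h1/eqP].
  split; rewrite /d; split => [/pos[x]|[x [xW Fx fx]]].
  + by move=> xW /(rk' _ _ E0) fx; exists x.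
  + by apply/pos; exists x => //; apply/(rk' _ _ E0).
  + by move=> /m1[xW Fx] /(ck' _ _ E1) fx; exists x.
  + by apply/pos; exists x; [apply/m1|apply/(ck' _ _ E1)].
  + by move=> /m3[xW Fx] /(ck' _ _ E3) fx; exists x.
  + by apply/pos; exists x; [apply/m3|apply/(ck' _ _ E3)].
  + by move=> /m4[xW Fx] /(rk' _ _ E4) fx; exists x.
  + by apply/pos; exists x; [apply/m4|apply/(rk' _ _ E4)].
- have full (U : {vspace V}) (S : 'Hom(V, 'rV[R]_2)) (f : V -> C) (E : forall x, S x = crow (f x)) :
      (2 <= \dim (S @: U))%N <-> forall z, exists2 x, x \in U & f x = z.
    split => [h z|h].
      have e : (S @: U)%VS = fullv.
        by apply/eqP; rewrite eqEdim subvf dimvf /dim /= mul1n.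
      have : crow z \in (S @: U)%VS by rewrite e memvf.
      by case/memv_imgP => x xU; rewrite E => /crow_inj ->; exists x.
    suff -> : (S @: U)%VS = fullv by rewrite dimvf /dim /= mul1n.
    apply/eqP; rewrite eqEsubv subvf; apply/subvP => v _; have [z <-] := crow_surj v.
    by have [x xU <-] := h z; rewrite -E memv_img.
  split; rewrite /d; split.
  + by move=> /(full _ _ _ E1) h z; have [x /m1[xW Fx] fx] := h z; exists x.
  + by move=> h; apply/(full _ _ _ E1) => z; have [x [xW Fx fx]] := h z; exists x => //; apply/m1.
  + by move=> /(full _ _ _ E2) h z; have [x /m2[xW Fx] fx] := h z; exists x.
  + by move=> h; apply/(full _ _ _ E2) => z; have [x [xW Fx fx]] := h z; exists x => //; apply/m2.
  + by move=> /(full _ _ _ E3) h z; have [x /m3[xW Fx] fx] := h z; exists x.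
  + by move=> h; apply/(full _ _ _ E3) => z; have [x [xW Fx fx]] := h z; exists x => //; apply/m3.
Qed.

Lemma dim_le8 : (\dim (fullv : {vspace V}) <= 8)%N.
Proof. have [d [-> [? ? ? ? ?] _ _]] := graded_dim fullv; lia. Qed.

Hypothesis j0 : j != 0.
Hypothesis bkF : forall k k' x y, Fk k x -> Fk k' y -> Fk (k + k' - 2) (bk x y).
Hypotheses
  (b11 : forall x y, Fk 1 x -> Fk 1 y ->
    'i * (h0 (bk x y))%:C = j * (a x * (a y)^* - (a x)^* * a y))
  (b12 : forall x y, Fk 1 x -> Fk 2 y -> a (bk x y) = j * (a x * (c y)^*))
  (b03 : forall x y, Fk 3 y -> a (bk x y) = j * ('i * (h0 x)%:C * b y))
  (b13 : forall x y, Fk 1 x -> Fk 3 y -> c (bk x y) = j * (a x * (b y)^* - (a x)^* * b y *+ 2))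
  (b23 : forall x y, Fk 2 x -> Fk 3 y -> b (bk x y) = j * (c x * b y))
  (b33 : forall x y, Fk 3 x -> Fk 3 y ->
    'i * (k4 (bk x y))%:C = j * ((b x)^* * b y - b x * (b y)^*) *+ 2)
  (b14 : forall x y, Fk 1 x -> Fk 4 y -> b (bk x y) = j * (a x * ('i * (k4 y)%:C / 2))).

Let i0 : 'i != 0 :> C. Proof. exact: neq0Ci. Qed.

Section Closure.
Variables W S : {vspace V}.
Hypothesis WS : forall x y, x \in W -> y \in W -> bk x y \in S.

Lemma bkFS k k' k2 x y : x \in W -> y \in W -> Fk k x -> Fk k' y -> (k + k' - 2)%N = k2 ->
  bk x y \in S /\ Fk k2 (bk x y).
Proof. by move=> xW yW Fx Fy <-; split; [exact: WS|exact: bkF]. Qed.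

(** The bracket of two elements of weight -1 is a nondegenerate alternating form of their symbols,
    nonzero on 1 and ['i]. Source [W] and target [S] are kept distinct so that these closure lemmas
    serve both for subalgebras and for spaces containing all brackets. *)
Lemma cl0 : (forall z, exists x, [/\ x \in W, Fk 1 x & a x = z]) ->
  exists x, [/\ x \in S, Fk 0 x & h0 x != 0].
Proof.
move=> h; have [x [xW Fx ax]] := h 1; have [y [yW Fy ay]] := h 'i.
exists (bk x y); have [? ?] := bkFS xW yW Fx Fy erefl; split => //.
have := b11 Fx Fy; rewrite ax ay => E; apply/eqP => z; move: E; rewrite z mulr0.
have -> : 1 * 'i^* - 1^* * 'i = 'i * - 2%:R :> C.
  rewrite rmorph1 conjCi; by ring.
by move/esym/eqP; rewrite !mulf_eq0 (negPf j0) (negPf i0) oppr_eq0 pnatr_eq0.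
Qed.

Lemma cl2 : (forall z, exists x, [/\ x \in W, Fk 1 x & a x = z]) ->
  (exists x, [/\ x \in W, Fk 3 x & b x != 0]) ->
  (forall z, exists x, [/\ x \in S, Fk 2 x & c x = z]).
Proof.
move=> h [y [yW Fy by0]] z; pose w := z / j.
have cb : Num.conj (b y) != 0 by rewrite fmorph_eq0.
(* The equation for the symbol is only real-linear: with X the product of u and the conjugate of
   [b y], it reads X minus twice its conjugate equals w. Combining it with its conjugate gives X as
   minus one third of w plus twice the conjugate of w. *)
pose u := - (w + w^* *+ 2) / ((b y)^* *+ 3).
have cu : Num.conj u = - (w^* + w *+ 2) / (b y *+ 3).
  by rewrite /u rmorphM fmorphV rmorphN rmorphD !rmorphMn /= !conjCK.
have [x [xW Fx ax]] := h u.
exists (bk x y); have [? ?] := bkFS xW yW Fx Fy erefl; split => //.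
rewrite (b13 Fx Fy) ax cu (_ : _ - _ = w); first by rewrite /w mulrC divfK.
rewrite /u; clear cu ax; move: by0 cb; move: (w) (Num.conj w) (b y) (Num.conj (b y)) => w'' w' v v' v0 v0'; field.
by rewrite v0 v0'.
Qed.

Lemma cl3 : (forall z, exists x, [/\ x \in W, Fk 2 x & c x = z]) ->
  (exists x, [/\ x \in W, Fk 3 x & b x != 0]) ->
  (forall z, exists x, [/\ x \in S, Fk 3 x & b x = z]).
Proof.
move=> h [y [yW Fy by0]] z; have [x [xW Fx cx]] := h (z / (j * b y)).
exists (bk x y); have [? ?] := bkFS xW yW Fx Fy erefl; split => //.
by rewrite (b23 Fx Fy) cx; move: by0; move: (b y) => u u0; field; rewrite j0 u0.
Qed.

Lemma cl4 : (forall z, exists x, [/\ x \in W, Fk 3 x & b x = z]) ->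
  exists x, [/\ x \in S, Fk 4 x & k4 x != 0].
Proof.
move=> h; have [x [xW Fx ax]] := h 1; have [y [yW Fy ay]] := h 'i.
exists (bk x y); have [? ?] := bkFS xW yW Fx Fy erefl; split => //.
have := b33 Fx Fy; rewrite ax ay => E; apply/eqP => z; move: E; rewrite z mulr0.
have -> : 1^* * 'i - 1 * 'i^* = 'i * 2%:R :> C.
  rewrite rmorph1 conjCi; by ring.
by move/esym/eqP; rewrite mulrn_eq0 !mulf_eq0 (negPf j0) (negPf i0) pnatr_eq0.
Qed.

Lemma cl3' : (forall z, exists x, [/\ x \in W, Fk 1 x & a x = z]) ->
  (exists x, [/\ x \in W, Fk 4 x & k4 x != 0]) ->
  (forall z, exists x, [/\ x \in S, Fk 3 x & b x = z]).
Proof.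
move=> h [y [yW Fy ky0]] z; have k0 : 'i * (k4 y)%:C != 0 :> C by rewrite mulf_neq0 // fmorph_eq0.
have [x [xW Fx ax]] := h (z / (j * ('i * (k4 y)%:C / 2))).
exists (bk x y); have [? ?] := bkFS xW yW Fx Fy erefl; split => //.
rewrite (b14 Fx Fy) ax; move: k0; move: ('i * _) => u u0; field.
by rewrite j0 u0.
Qed.

Lemma cl1 : (forall z, exists x, [/\ x \in W, Fk 2 x & c x = z]) ->
  (exists x, [/\ x \in W, Fk 1 x & a x != 0]) ->
  (forall z, exists x, [/\ x \in S, Fk 1 x & a x = z]).
Proof.
move=> h [x [xW Fx ax0]] z; have [y [yW Fy cy]] := h (Num.conj (z / (j * a x))).
exists (bk x y); have [? ?] := bkFS xW yW Fx Fy erefl; split => //.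
rewrite (b12 Fx Fy) cy conjCK; move: ax0; move: (a x) => u u0; field; by rewrite j0 u0.
Qed.

Lemma cl1' : (forall z, exists x, [/\ x \in W, Fk 3 x & b x = z]) ->
  (exists x, [/\ x \in W, Fk 0 x & h0 x != 0]) ->
  (forall z, exists x, [/\ x \in S, Fk 1 x & a x = z]).
Proof.
move=> h [x [xW Fx hx0]] z; have k0 : 'i * (h0 x)%:C != 0 :> C by rewrite mulf_neq0 // fmorph_eq0.
have [y [yW Fy cy]] := h (z / (j * ('i * (h0 x)%:C))).
exists (bk x y); have [? ?] := bkFS xW yW Fx Fy erefl; split => //.
rewrite (b03 _ Fy) cy; move: k0; move: ('i * _) => u u0; field; by rewrite j0 u0.
Qed.

End Closure.

(** A total of 6 or 7 means that one or two of the eight dimensions are missing. The implications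
    [i1] to [i7] refill each deficient piece from the pieces that remain, so no such dimension
    vector is closed under brackets. *)
Lemma subalg_dim W : (forall x y, x \in W -> y \in W -> bk x y \in W) ->
  (6 <= \dim W)%N -> \dim W = 8.
Proof.
move=> cl; have [d [E [l0 l1 l2 l3 l4] [p0 p1 p3 p4] [f1 f2 f3]]] := graded_dim W; rewrite E.
have i1 : (2 <= d 1 -> 0 < d 0)%N by move=> /f1 h; exact/p0/(cl0 cl).
have i2 : (2 <= d 1 -> 0 < d 3 -> 2 <= d 2)%N by move=> /f1 h /p3 h'; exact/f2/(cl2 cl).
have i3 : (2 <= d 2 -> 0 < d 3 -> 2 <= d 3)%N by move=> /f2 h /p3 h'; exact/f3/(cl3 cl).
have i4 : (2 <= d 3 -> 0 < d 4)%N by move=> /f3 h; exact/p4/(cl4 cl).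
have i5 : (2 <= d 1 -> 0 < d 4 -> 2 <= d 3)%N by move=> /f1 h /p4 h'; exact/f3/(cl3' cl).
have i6 : (2 <= d 2 -> 0 < d 1 -> 2 <= d 1)%N by move=> /f2 h /p1 h'; exact/f1/(cl1 cl).
have i7 : (2 <= d 3 -> 0 < d 0 -> 2 <= d 1)%N by move=> /f3 h /p0 h'; exact/f1/(cl1' cl).
lia.
Qed.

(** When all pieces are full, each of them is generated by brackets of suitable elements; a space
    containing all brackets then has full symbols in every weight. *)
Lemma full_perfect (S : {vspace V}) : \dim (fullv : {vspace V}) = 8 ->
  (forall x y, bk x y \in S) -> S = fullv.
Proof.
move=> d8 cl; have cl' : forall x y, x \in fullv -> y \in fullv -> bk x y \in S by [].
have [d [E [l0 l1 l2 l3 l4] [p0 p1 p3 p4] [f1 f2 f3]]] := graded_dim fullv.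
have [/f1 F1 /f2 F2 /f3 F3] : [/\ 2 <= d 1, 2 <= d 2 & 2 <= d 3]%N by split; lia.
have P0 : (0 < d 0)%N by lia. have P3 : (0 < d 3)%N by lia. have P4 : (0 < d 4)%N by lia.
have [d' [E' [l0' l1' l2' l3' l4'] [p0' p1' p3' p4'] [f1' f2' f3']]] := graded_dim S.
have i0' : (0 < d' 0)%N by exact/p0'/(cl0 cl').
have i1' : (2 <= d' 1)%N by apply/f1'/(cl1' cl' F3)/p0.
have i2' : (2 <= d' 2)%N by apply/f2'/(cl2 cl' F1)/p3.
have i3' : (2 <= d' 3)%N by apply/f3'/(cl3 cl' F2)/p3.
have i4' : (0 < d' 4)%N by exact/p4'/(cl4 cl').
by apply/eqP; rewrite eqEdim subvf d8; lia.
Qed.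

End Graded.

(** * The closed system for actual tangent fields, modulo functions vanishing on M *)

Section Assemble.
Variables (A : comNzRingType) (pd : bool -> bool -> A -> A).
Hypothesis pdD : forall s j, derivation (pd s j).
Hypothesis pdC : forall s j s' j' x, pd s j (pd s' j' x) = pd s' j' (pd s j x).
Variables (P Ji : A).
Hypothesis JiE : Jf pd P * Ji = 1.
Variable N : A -> Prop.
Hypotheses (N_D : forall x y, N x -> N y -> N (x + y)) (N_M : forall a x, N x -> N (a * x))
  (N_Z : forall s x, N x -> N (Zf pd P s x)).
Variable cj : A -> A.
Hypotheses (cjD : forall x y, cj (x + y) = cj x + cj y) (cjM : forall x y, cj (x * y) = cj x * cj y)
  (cjpd : forall s j x, cj (pd s j x) = pd (~~ s) j (cj x)) (cjP : cj P = P).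
Local Notation Z := (Zf pd P).
Local Notation T := (Tf pd P).
Local Notation J := (Jf pd P).
Implicit Types (x y : A) (f g : bool -> A).

Lemma cjB x y : cj (x - y) = cj x - cj y.
Proof. by apply/(addIr (cj y)); rewrite -cjD !subrK. Qed.

Lemma cjZ s x : cj (Z s x) = Z (~~ s) (cj x).
Proof. by rewrite /Zf cjB !cjM !cjpd cjP. Qed.

Lemma mulJi x y : J * x = y -> x = Ji * y.
Proof. by move=> <-; rewrite mulrA [Ji * _]mulrC JiE mul1r. Qed.

(** For [Z true], exchanging holomorphic and antiholomorphic derivatives fixes [J] by [JfE] and
    changes the sign of [T], which transports [Jf_TZ] to the conjugate derivation. *)
Lemma sp_TZ s x : sp N [:: Z false x; Z true x; T x] (T (Z s x) - Z s (T x)).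
Proof.
have m y : List.In y [:: Z false x; Z true x; T x] -> forall a, sp N [:: Z false x; Z true x; T x] (a * y).
  by move=> yl a; exact/sp_M/sp_mem.
have mF := m (Z false x) (or_introl erefl); have mT := m (Z true x) (or_intror (or_introl erefl)).
have mTT := m (T x) (or_intror (or_intror (or_introl erefl))).
case: s; last first.
  rewrite (mulJi (Jf_TZ pdD pdC P x)); apply: sp_M; apply: sp_D; first apply: sp_D; [exact: mF|exact: mT|exact: mTT].
have JE : Jf (fun s => pd (~~ s)) P = J by rewrite (JfE pdC).
have TE' y : Tf (fun s => pd (~~ s)) P y = - T y by exact: (esym (opprB _ _)).
have [k1 [k2 [k3]]] : exists k1 k2 k3, J * (- T (Z true x) - Z true (- T x)) =
    k1 * Z true x + k2 * Z false x + k3 * - T x.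
  do 3 eexists; rewrite -JE -!TE'.
  exact: (Jf_TZ (pd := fun s => pd (~~ s)) (fun s j => pdD (~~ s) j)
    (fun s j s' j' => pdC (~~ s) j (~~ s') j') P x).
rewrite (derN _ (Zf_der pdD P true)) => /mulJi E.
rewrite (_ : _ - _ = - (- T (Z true x) - - Z true (T x))); last by ring.
rewrite E; apply: sp_opp; apply: sp_M; apply: sp_D; last by rewrite mulrN; exact/sp_opp/mTT.
by apply: sp_D; [exact: mT|exact: mF].
Qed.

Section Field.
Variable f : bool -> A.
Hypotheses (f_hol : forall k j, pd true k (f j) = 0).
Let h := hf pd P f.

Lemma f0E : f false = Ji * (pd false true P * Z true h - Z true (pd false true P) * h).
Proof. exact/mulJi/(Jf_f0 pdD). Qed.
Lemma f1E : f true = Ji * (Z true (pd false false P) * h - pd false false P * Z true h).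
Proof. exact/mulJi/(Jf_f1 pdD). Qed.

(** Since the coefficients of the field are constants for [Z true], the second derivative is again
    linear in them; they are then replaced by their expressions in [h] and [Z true h]. *)
Lemma ZbZb_comb : exists a b, Z true (Z true h) = a * Z true h + b * h.
Proof.
rewrite /h (ZbZb_hf pdD _ f_hol) -/h f0E f1E.
move: (Z true (Z true (pd false false P))) (Z true (Z true (pd false true P))) => u v.
exists (Ji * (pd false true P * u - pd false false P * v)).
exists (Ji * (Z true (pd false false P) * v - Z true (pd false true P) * u)).
by move: (Z true _) (Z true _) (Z true _) => ? ? ?; ring.
Qed.

Hypothesis f_tan : N (h + cj h).

(** The exact relation for [Z true] comes from holomorphy. The one for [Z false] is its conjugate,
    valid only modulo [N] because [cj h] is replaced by [- h]. *)
Lemma sp_ZZ s : sp N [:: h; Z false h; Z true h] (Z s (Z s h)).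
Proof.
have [a [b E]] := ZbZb_comb.
case: s; first by rewrite E; apply: sp_D; apply/sp_M/sp_mem; rewrite /=; tauto.
have Zd := Zf_der pdD P.
have := congr1 cj E; rewrite (cjD (a * _)) (cjM a) (cjM b) !cjZ /=.
have -> : cj h = (h + cj h) - h by ring.
move: f_tan; move: (h + cj h) => n Nn; rewrite !(derB n h (Zd false)) (derB (Z false n) (Z false h) (Zd false)) => E'.
have -> : Z false (Z false h) = (cj a * Z false h + cj b * h) +
    (Z false (Z false n) + (- cj a) * Z false n + (- cj b) * n).
  move: E'; move: (Z false n) (Z false h) (Z false (Z false n)) (Z false (Z false h)) (cj a) (cj b).
  by move=> w t u v ca cb E'; rewrite -[LHS](subKr u) E'; ring.
apply: sp_D; first by apply: sp_D; apply/sp_M/sp_mem; rewrite /=; tauto.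
apply: sp_N; apply: N_D; first apply: N_D.
- exact/N_Z/N_Z.
- exact/N_M/N_Z.
- exact: N_M.
Qed.

End Field.

Lemma hf_brE f g : (forall k j, pd true k (f j) = 0) -> (forall k j, pd true k (g j) = 0) ->
  let h1 := hf pd P f in let h2 := hf pd P g in
  hf pd P (br pd f g) = Ji * (Z true h1 * Z false h2 - Z true h2 * Z false h1
    + (h1 * T h2 - h2 * T h1)) - Ji * Ji * Qf pd P * (h1 * Z true h2 - h2 * Z true h1).
Proof.
move=> fh gh h1 h2; rewrite (mulJi (mulJi (Jf2_hf_br pdD pdC P fh gh))) -/h1 -/h2.
have J1 : Ji * J = 1 by rewrite mulrC.
rewrite mulrBr mulrA J1 mul1r; move: (Z _ _) (Z _ _) (Z _ _) (Z _ _) (T _) (T _) => ? ? ? ? ? ?; ring.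
Qed.

End Assemble.

(** * Relative invariance of the Levi determinant *)

Section SemiInvariance.
Variables (A : comNzRingType) (pd : bool -> bool -> A -> A).
Hypothesis pdD : forall s j, derivation (pd s j).
Hypothesis pdC : forall s j s' j' x, pd s j (pd s' j' x) = pd s' j' (pd s j x).
Variable P : A.
Variable N : A -> Prop.
Hypotheses (N_D : forall x y, N x -> N y -> N (x + y)) (N_M : forall a x, N x -> N (a * x))
  (N_pd : forall x, N x -> exists c, forall s j, N (pd s j x - c * pd s j P)).
Variables f cf : bool -> A.
Hypotheses (f_hol : forall k j, pd true k (f j) = 0) (cf_hol : forall k j, pd false k (cf j) = 0).
Hypothesis f_tan : N (hf pd P f + (cf false * pd true false P + cf true * pd true true P)).

(** The field plus its conjugate, that is, twice its real part when [cf] is the conjugate of [f]. *)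
Definition Xf x := f false * pd false false x + f true * pd false true x
  + (cf false * pd true false x + cf true * pd true true x).

Lemma Xf_der : derivation Xf.
Proof.
split=> x y; rewrite /Xf; first by rewrite !(derD _ _ (pdD _ _)); ring.
by rewrite !(derM _ _ (pdD _ _)); ring.
Qed.

Local Notation a j := (pd false j P).
Local Notation b k := (pd true k P).
Local Notation hh j k := (pd true k (pd false j P)).

Lemma N_opp x : N x -> N (- x).
Proof. by move=> Nx; rewrite -mulN1r; exact: N_M. Qed.

Lemma N_sub x y : N x -> N y -> N (x - y).
Proof. by move=> Nx Ny; apply: N_D => //; exact: N_opp. Qed.

Lemma N_Mr x y : N x -> N (x * y).
Proof. by rewrite mulrC; exact: N_M. Qed.

(** Infinitesimal form of the change of the Levi determinant under biholomorphisms. The derivative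
    of [P] along the field lies in [N]; differentiating this fact twice with [N_pd] gives the action
    of [Xf] on the first and mixed second derivatives of [P], and the determinant follows. *)
Lemma Xf_J : exists k, N (Xf (Jf pd P) - k * Jf pd P).
Proof.
have [c Nc] := N_pd f_tan.
pose na j := Xf (a j) + pd false j (f false) * a false + pd false j (f true) * a true - c * a j.
pose nb j := Xf (b j) + pd true j (cf false) * b false + pd true j (cf true) * b true - c * b j.
have Na j : N (na j).
  have := Nc false j; rewrite /hf !(derD _ _ (pdD _ _)) !(derM _ _ (pdD _ _)) !cf_hol.
  rewrite (pdC false j false false P) (pdC false j false true P) (pdC false j true false P) (pdC false j true true P).
  by congr N; rewrite /na /Xf; ring.
have Nb j : N (nb j).
  have := Nc true j; rewrite /hf !(derD _ _ (pdD _ _)) !(derM _ _ (pdD _ _)) !f_hol.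
  rewrite (pdC true j false false P) (pdC true j false true P) (pdC true j true false P) (pdC true j true true P).
  by congr N; rewrite /nb /Xf; ring.
(* Second differentiation: [na j] lies in [N], so its differential is again a multiple of that of
   [P] modulo [N]. *)
have [e Ne] : exists e : bool -> A, forall j s k, N (pd s k (na j) - e j * pd s k P).
  have [e0 h0] := N_pd (Na false); have [e1 h1] := N_pd (Na true).
  by exists (fun j => if j then e1 else e0) => -[] s k; [exact: h1|exact: h0].
(* The terms with the derivative of [c] and with [e] add to the Hessian multiples of the border;
   they cancel in the bordered determinant [Jf]. *)
pose nh j k := Xf (hh j k) - (c * hh j k + pd true k c * a j + e j * b k
  - pd false j (f false) * hh false k - pd false j (f true) * hh true k
  - pd true k (cf false) * hh j false - pd true k (cf true) * hh j true).
have Nh j k : N (nh j k).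
  have := Ne j true k; rewrite /na (derB _ _ (pdD _ _)).
  have -> : pd true k (Xf (a j) + pd false j (f false) * a false + pd false j (f true) * a true) =
     pd true k (cf false) * hh j false + pd true k (cf true) * hh j true + Xf (hh j k) +
     (pd false j (f false) * hh false k + pd false j (f true) * hh true k).
    rewrite /Xf !(derD _ _ (pdD _ _)) !(derM _ _ (pdD _ _)) !f_hol.
    rewrite !(pdC true k false j (f _)) !f_hol !(der0 (pdD _ _)).
    rewrite (pdC true k false false (a j)) (pdC true k false true (a j)).
    by rewrite (pdC true k true false (a j)) (pdC true k true true (a j)); ring.
  rewrite (derM _ _ (pdD _ _)); congr N; rewrite /nh; move: (Xf _) => z.
  by move: (hh _ _) => z'; ring.
have JE : Jf pd P = a true * (b true * hh false false - b false * hh false true)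
    - a false * (b true * hh true false - b false * hh true true) by [].
(* Every term of [Jf] contains two first derivatives and one second derivative of [P], hence three
   times [c]; the rest is minus the divergences of the field and of its conjugate part. *)
exists (c *+ 3 - pd false false (f false) - pd false true (f true)
  - pd true false (cf false) - pd true true (cf true)).
have Ea j : Xf (a j) = c * a j - pd false j (f false) * a false - pd false j (f true) * a true + na j.
  by rewrite /na; ring.
have Eb j : Xf (b j) = c * b j - pd true j (cf false) * b false - pd true j (cf true) * b true + nb j.
  by rewrite /nb; ring.
have Eh j k : Xf (hh j k) = c * hh j k + pd true k c * a j + e j * b k
  - pd false j (f false) * hh false k - pd false j (f true) * hh true k
  - pd true k (cf false) * hh j false - pd true k (cf true) * hh j true + nh j k.
  by rewrite /nh; ring.
have dX := Xf_der.
have -> : Xf (Jf pd P) = Xf (a true) * (b true * hh false false - b false * hh false true)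
  + a true * (Xf (b true) * hh false false + b true * Xf (hh false false)
     - (Xf (b false) * hh false true + b false * Xf (hh false true)))
  - (Xf (a false) * (b true * hh true false - b false * hh true true)
  + a false * (Xf (b true) * hh true false + b true * Xf (hh true false)
     - (Xf (b false) * hh true true + b false * Xf (hh true true)))).
  have m5 u v w x y : Xf (u * (v * w - x * y)) = Xf u * (v * w - x * y)
      + u * (Xf v * w + v * Xf w - (Xf x * y + x * Xf y)).
    by rewrite (derM u _ dX) (derB (v * w) _ dX) (derM v w dX) (derM x y dX).
  by rewrite JE (derB (a true * _) _ dX) !m5.
rewrite !Ea !Eb !Eh JE.
set W := (X in N X).
have -> : W = na true * (b true * hh false false - b false * hh false true)
  + (nb true * (a true * hh false false) + nh false false * (a true * b true)
     - (nb false * (a true * hh false true) + nh false true * (a true * b false)))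
  - (na false * (b true * hh true false - b false * hh true true)
  + (nb true * (a false * hh true false) + nh true false * (a false * b true)
     - (nb false * (a false * hh true true) + nh true true * (a false * b false)))).
  rewrite /W; move: (na _) (na _) (nb _) (nb _) (nh _ _) (nh _ _) (nh _ _) (nh _ _) => ? ? ? ? ? ? ? ?.
  by move: (hh _ _) (hh _ _) (hh _ _) (hh _ _) => ? ? ? ?; ring.
by do ![apply: N_sub|apply: N_D]; exact: N_Mr.
Qed.

End SemiInvariance.

Import numFieldNormedType.Exports.
Local Open Scope classical_set_scope.
Local Open Scope ring_scope.

(** * Differentiability through first order estimates *)

Section Differentiability.
Variables (R : realType) (V : normedModType R).
Implicit Types (f g : V -> R) (x v : V) (U : set V).

Lemma differentiable_eps f x (A : {linear V -> R}) : continuous A ->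
  (forall eps, 0 < eps -> \forall h \near (0 : V),
    `|f (x + h) - f x - A h| <= eps * `|h|) ->
  is_diff x f A.
Proof.
move=> Ac fA.
have E : f \o shift x = cst (f x) + A +o_ (0 : V) id.
  apply/eqaddoP => eps eps0; apply: filterS (fA _ eps0) => h.
  by rewrite !fctE /= [h + x]addrC opprD addrA.
have dE := diff_unique Ac E.
by apply: DiffDef => //; apply/diff_locallyP; rewrite dE; split.
Qed.

Lemma diff_eps f x : differentiable f x -> forall eps, 0 < eps ->
  \forall h \near (0 : V), `|f (x + h) - f x - 'D_h f x| <= eps * `|h|.
Proof.
move=> df eps eps0; have /diff_locally/eqaddoP/(_ _ eps0) := df.
apply: filterS => h /=; rewrite !fctE /= deriveE // opprD addrA.
by rewrite [h + x]addrC.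
Qed.

Lemma differentiable_near f g x : (\near x, f x = g x) ->
  differentiable f x -> differentiable g x.
Proof.
move=> fg df; have fgx := nbhs_singleton fg.
suff: is_diff x g ('d f x) by [].
apply: differentiable_eps; first exact: diff_continuous.
move=> eps eps0; have := diff_eps df eps0.
have : \forall h \near (0 : V), f (x + h) = g (x + h).
  by move: fg; rewrite (near_shift 0) /=; apply: filterS => h; rewrite subr0 addrC.
by apply: filterS2 => h e; rewrite -e -fgx deriveE.
Qed.

Lemma differentiable_open U f g x : open U -> U x -> (forall y, U y -> f y = g y) ->
  differentiable f x -> differentiable g x.
Proof.
move=> oU Ux fg; apply: differentiable_near.
by near=> y; apply: fg; near: y; apply: open_nbhs_nbhs.
Unshelve. all: by end_near. Qed.

Lemma derive_open U f g x v : open U -> U x -> (forall y, U y -> f y = g y) ->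
  'D_v f x = 'D_v g x.
Proof.
move=> oU Ux fg; apply: near_eq_derive.
by near=> y; apply: fg; near: y; apply: open_nbhs_nbhs.
Unshelve. all: by end_near. Qed.

Lemma deriveDv f x u v : differentiable f x ->
  'D_(u + v) f x = 'D_u f x + 'D_v f x.
Proof. by move=> df; rewrite !deriveE // linearD. Qed.

Lemma deriveZv f x k v : differentiable f x -> 'D_(k *: v) f x = k * 'D_v f x.
Proof. by move=> df; rewrite !deriveE // linearZ. Qed.

Lemma deriveNv f x v : differentiable f x -> 'D_(- v) f x = - 'D_v f x.
Proof. by move=> df; rewrite !deriveE // linearN. Qed.

Lemma is_derive_line f x u (s : R) : differentiable f (x + s *: u) ->
  is_derive s 1 (fun t : R => f (x + t *: u)) ('D_u f (x + s *: u)).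
Proof.
move=> df; set g := fun t : R => _.
have E : (fun h : R => h^-1 *: ((g \o shift s) (h *: 1) - g s)) =
    (fun h : R => h^-1 *: ((f \o shift (x + s *: u)) (h *: u) - f (x + s *: u))).
  apply: funext => h; congr (_ *: (f _ - _)).
  by rewrite /= [h *: 1]mulr1 scalerDl addrCA.
have -> : 'D_u f (x + s *: u) = 'D_1 g s by rewrite /derive E.
by apply: derivableP; rewrite /derivable E; apply: diff_derivable.
Qed.

End Differentiability.

#[local] Opaque derive.

(** * Smooth functions and iterated directional derivatives *)

Section Smooth.
Variables (R : realType) (V : normedModType R).
Implicit Types (F G : V -> R) (U : set V) (w : seq V) (x v : V).

Fixpoint dws w F : V -> R := if w is v :: w' then dws w' ('D_v F) else F.

Lemma dws_cat w1 w2 F : dws (w1 ++ w2) F = dws w2 (dws w1 F).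
Proof. by elim: w1 F => //= v w1 IH F. Qed.

Lemma dws_rcons w v F : dws (rcons w v) F = 'D_v (dws w F).
Proof. by rewrite -cats1 dws_cat. Qed.

(** Symmetry of mixed derivatives is part of the notion, at every order. It is checked on constants
    and linear forms, is preserved by ring operations, and passes to limits under uniform
    estimates. *)
Record sm U F : Prop := Sm { smP : forall x, U x -> forall w,
  differentiable (dws w F) x /\
  forall u v, 'D_u ('D_v (dws w F)) x = 'D_v ('D_u (dws w F)) x }.

Lemma sm_diff U F x : sm U F -> U x -> differentiable F x.
Proof. by move=> [sF] Ux; have [] := sF x Ux [::]. Qed.

Lemma sm_derivable U F x v : sm U F -> U x -> derivable F x v.
Proof. by move=> sF Ux; apply/diff_derivable/sm_diff/Ux. Qed.
#[local] Arguments sm_derivable {U F x} v.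

Lemma sm_com U F x u v : sm U F -> U x -> 'D_u ('D_v F) x = 'D_v ('D_u F) x.
Proof. by move=> [sF] Ux; have [_] := sF x Ux [::]. Qed.

Lemma sm_D U F v : sm U F -> sm U ('D_v F).
Proof. by move=> [sF]; split=> x Ux w; apply: (sF x Ux (v :: w)). Qed.

Lemma sm_dws U F w : sm U F -> sm U (dws w F).
Proof.
by elim: w F => [|v w IH] F sF; [exact: sF|exact: (IH _ (sm_D v sF))].
Qed.

Lemma sm_sub U U' F : U' `<=` U -> sm U F -> sm U' F.
Proof. by move=> UU [sF]; split=> x /UU; apply: sF. Qed.

Lemma dws_open U F G w : open U -> (forall x, U x -> F x = G x) ->
  forall x, U x -> dws w F x = dws w G x.
Proof.
move=> oU; elim: w F G => //= v w IH F G FG x Ux.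
by apply: IH => // y Uy; apply: derive_open FG.
Qed.

Lemma sm_ext U F G : open U -> (forall x, U x -> F x = G x) -> sm U F -> sm U G.
Proof.
move=> oU FG [sF]; split=> x Ux w.
have [dF cF] := sF x Ux w; have e := dws_open w oU FG.
split; first exact: differentiable_open e dF.
move=> u v; have eD z : forall y, U y -> 'D_z (dws w F) y = 'D_z (dws w G) y.
  by move=> y Uy; apply: derive_open e.
by rewrite -(derive_open u oU Ux (eD v)) -(derive_open v oU Ux (eD u)).
Qed.

Lemma sm_coind U (S : (V -> R) -> Prop) :
  (forall F, S F -> (forall x, U x -> differentiable F x) /\
    (forall x, U x -> forall u v, 'D_u ('D_v F) x = 'D_v ('D_u F) x)) ->
  (forall F v, S F -> S ('D_v F)) -> forall F, S F -> sm U F.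
Proof.
move=> SP SD F SF; split=> x Ux w; elim: w F SF => [|v w IH] F SF /=.
  by have [dF cF] := SP _ SF; split; [apply: dF|apply: cF].
by apply: IH; apply: SD.
Qed.

(* Coinduction up to this inductive closure yields the stability of [sm]
   under the ring operations. *)
Inductive smalg U : (V -> R) -> Prop :=
| smalg_base F : sm U F -> smalg U F
| smalg_cst c : smalg U (cst c)
| smalg_add F G : smalg U F -> smalg U G -> smalg U (F + G)
| smalg_mul F G : smalg U F -> smalg U G -> smalg U (F * G)
| smalg_inv F : smalg U F -> (forall x, U x -> F x != 0) ->
    smalg U (fun x => (F x)^-1)
| smalg_ext F G : smalg U F -> (forall x, U x -> F x = G x) -> smalg U G.

Lemma smalg_diff U F : open U -> smalg U F ->
  (forall x, U x -> differentiable F x) /\ (forall v, smalg U ('D_v F)).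
Proof.
move=> oU; elim => {F}.
- move=> F sF; split=> [x|v]; first exact: sm_diff.
  by apply: smalg_base; apply: sm_D.
- move=> c; split=> [x _|v]; first exact: differentiable_cst.
  by apply: (smalg_ext (smalg_cst U 0)) => x _; rewrite derive_cst.
- move=> F G sF [dF aF] sG [dG aG]; split=> [x Ux|v].
    by apply: differentiableD; [apply: dF|apply: dG].
  apply: (smalg_ext (smalg_add (aF v) (aG v))) => x Ux /=.
  by rewrite deriveD //; apply: diff_derivable; [apply: dF|apply: dG].
- move=> F G sF [dF aF] sG [dG aG]; split=> [x Ux|v].
    by apply: differentiableM; [apply: dF|apply: dG].
  apply: (smalg_ext (smalg_add (smalg_mul sF (aG v)) (smalg_mul sG (aF v)))) => x Ux /=.
  by rewrite deriveM //; apply: diff_derivable; [apply: dF|apply: dG].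
- move=> F sF [dF aF] F0; split=> [x Ux|v].
    by apply: differentiableV; [apply: dF|apply: F0].
  apply: (smalg_ext (smalg_mul (smalg_mul (smalg_cst U (-1)) (smalg_inv (smalg_mul sF sF) _)) (aF v))) => [x Ux|x Ux].
    by rewrite mulf_neq0 // F0.
  have dFv : derivable F x v by apply: diff_derivable; apply: dF.
  by rewrite deriveV ?F0 //= !fctE /= expr2 /GRing.scale /= mulN1r.
- move=> F G sF [dF aF] FG; split=> [x Ux|v].
    by apply: differentiable_open FG _ => //; apply: dF.
  by apply: (smalg_ext (aF v)) => x Ux; apply: derive_open FG.
Qed.

Lemma smalg_com U F : open U -> smalg U F -> forall x, U x ->
  forall u v, 'D_u ('D_v F) x = 'D_v ('D_u F) x.
Proof.
move=> oU; have dv G v x : smalg U G -> U x -> derivable G x v.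
  by move=> aG Ux; apply: diff_derivable; have [+ _] := smalg_diff oU aG; apply.
have dd G u v x : smalg U G -> U x -> derivable ('D_u G) x v.
  by move=> aG Ux; apply: dv => //; have [_] := smalg_diff oU aG.
elim => {F}.
- by move=> F sF x Ux u v; apply: sm_com sF Ux.
- move=> c x Ux u v.
  have e z : 'D_z (cst c : V -> R) = cst 0 by apply: funext => y; rewrite derive_cst.
  by rewrite !e !derive_cst.
- move=> F G sF cF sG cG x Ux u v.
  have e z y : U y -> 'D_z (F + G) y = ('D_z F + 'D_z G) y.
    by move=> Uy; rewrite deriveD //; apply: dv.
  rewrite (derive_open u oU Ux (e v)) (derive_open v oU Ux (e u)).
  rewrite !deriveD; try exact: dd.
  by rewrite (cF _ Ux u v) (cG _ Ux u v).
- move=> F G sF cF sG cG x Ux u v.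
  have e z y : U y -> 'D_z (F * G) y = (F * 'D_z G + G * 'D_z F) y.
    by move=> Uy; rewrite deriveM //; apply: dv.
  rewrite (derive_open u oU Ux (e v)) (derive_open v oU Ux (e u)).
  have dF z : derivable F x z by apply: dv.
  have dG z : derivable G x z by apply: dv.
  have ddF z z' : derivable ('D_z F) x z' by apply: dd.
  have ddG z z' : derivable ('D_z G) x z' by apply: dd.
  rewrite !deriveD; try exact: derivableM.
  rewrite (deriveM (dF u) (ddG v u)) (deriveM (dG u) (ddF v u)).
  rewrite (deriveM (dF v) (ddG u v)) (deriveM (dG v) (ddF u v)).
  rewrite (cF _ Ux u v) (cG _ Ux u v) /GRing.scale /=.
  move: (F x) (G x) ('D_v F x) ('D_u F x) ('D_v G x) ('D_u G x).
  move: ('D_v ('D_u F) x) ('D_v ('D_u G) x) => a b c d e1 e2 e3 e4; ring.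
- move=> F sF cF F0 x Ux u v.
  pose G y := (F y)^-1.
  have aG : smalg U G by apply: smalg_inv.
  have e z y : U y -> 'D_z G y = (cst (-1) * (G * G) * 'D_z F) y.
    move=> Uy; have dFv : derivable F y z by apply: dv.
    by rewrite deriveV ?F0 //= !fctE /= expr2 invfM /GRing.scale /= mulN1r.
  rewrite (derive_open u oU Ux (e v)) (derive_open v oU Ux (e u)).
  have dG z : derivable G x z by apply: dv.
  have ddF z z' : derivable ('D_z F) x z' by apply: dd.
  have dGG z : derivable (G * G) x z by apply: derivableM.
  have dcGG z : derivable (cst (-1) * (G * G)) x z by apply: derivableM => //; apply: derivable_cst.
  have dc z : derivable (cst (-1) : V -> R) x z by apply: derivable_cst.
  rewrite (deriveM (dcGG u) (ddF v u)) (deriveM (dcGG v) (ddF u v)).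
  rewrite (deriveM (dc u) (dGG u)) (deriveM (dc v) (dGG v)).
  rewrite (deriveM (dG u) (dG u)) (deriveM (dG v) (dG v)).
  rewrite !derive_cst (e u x Ux) (e v x Ux) (cF _ Ux u v).
  rewrite /GRing.scale /= !fctE.
  move: (G x) ('D_v F x) ('D_u F x) ('D_v ('D_u F) x) => a b c d; ring.
- move=> F G sF cF FG x Ux u v.
  have e z y : U y -> 'D_z F y = 'D_z G y by move=> Uy; apply: derive_open FG.
  by rewrite -(derive_open u oU Ux (e v)) -(derive_open v oU Ux (e u)); apply: cF.
Qed.

Lemma smalg_sm U F : open U -> smalg U F -> sm U F.
Proof.
move=> oU; apply: (@sm_coind U (smalg U)) => [G aG|G v aG].
  have [dG _] := smalg_diff oU aG; split; first exact: dG.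
  by move=> x Ux u v; exact: (smalg_com oU aG Ux).
by have [_] := smalg_diff oU aG; apply.
Qed.

Lemma sm_cst U c : open U -> sm U (cst c).
Proof. by move=> oU; exact: (smalg_sm oU (smalg_cst U c)). Qed.

Lemma sm_add U F G : open U -> sm U F -> sm U G -> sm U (fun x => F x + G x).
Proof.
by move=> oU sF sG; exact: (smalg_sm oU (smalg_add (smalg_base sF) (smalg_base sG))).
Qed.

Lemma sm_mul U F G : open U -> sm U F -> sm U G -> sm U (fun x => F x * G x).
Proof.
by move=> oU sF sG; exact: (smalg_sm oU (smalg_mul (smalg_base sF) (smalg_base sG))).
Qed.

Lemma sm_opp U F : open U -> sm U F -> sm U (fun x => - F x).
Proof.
move=> oU sF; apply: (sm_ext oU _ (sm_mul oU (sm_cst (-1) oU) sF)) => x _ /=.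
by rewrite mulN1r.
Qed.

Lemma sm_sub2 U F G : open U -> sm U F -> sm U G -> sm U (fun x => F x - G x).
Proof. by move=> oU sF sG; exact: (sm_add oU sF (sm_opp oU sG)). Qed.

Lemma sm_inv U F : open U -> sm U F -> (forall x, U x -> F x != 0) ->
  sm U (fun x => (F x)^-1).
Proof.
by move=> oU sF F0; exact: (smalg_sm oU (smalg_inv (smalg_base sF) F0)).
Qed.

Lemma sm_div U F G : open U -> sm U F -> sm U G -> (forall x, U x -> G x != 0) ->
  sm U (fun x => F x / G x).
Proof. by move=> oU sF sG G0; exact: (sm_mul oU sF (sm_inv oU sG G0)). Qed.

Lemma sm_sum U (I : Type) (s : seq I) (P : pred I) (F : I -> V -> R) : open U ->
  (forall i, sm U (F i)) -> sm U (fun x => \sum_(i <- s | P i) F i x).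
Proof.
move=> oU sF; elim: s => [|i s IH].
  by apply: (sm_ext oU _ (sm_cst 0 oU)) => x _; rewrite big_nil.
case Pi: (P i).
  by apply: (sm_ext oU _ (sm_add oU (sF i) IH)) => x _; rewrite big_cons Pi.
by apply: (sm_ext oU _ IH) => x _; rewrite big_cons Pi.
Qed.

Lemma sm_prod U (I : Type) (s : seq I) (F : I -> V -> R) : open U ->
  (forall i, sm U (F i)) -> sm U (fun x => \prod_(i <- s) F i x).
Proof.
move=> oU sF; elim: s => [|i s IH].
  by apply: (sm_ext oU _ (sm_cst 1 oU)) => x _; rewrite big_nil.
by apply: (sm_ext oU _ (sm_mul oU (sF i) IH)) => x _; rewrite big_cons.
Qed.

Lemma derive_sumE U (I : Type) (s : seq I) (P : pred I) (F : I -> V -> R) v x :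
  open U -> (forall i, sm U (F i)) -> U x ->
  'D_v (fun x => \sum_(i <- s | P i) F i x) x = \sum_(i <- s | P i) 'D_v (F i) x.
Proof.
move=> oU sF Ux; elim: s => [|i s IH].
  rewrite big_nil (_ : (fun x => _) = cst 0) ?derive_cst //.
  by apply: funext => y; rewrite big_nil.
rewrite big_cons; case Pi: (P i); last first.
  rewrite -IH; apply: (derive_open v oU Ux) => y _.
  by rewrite big_cons Pi.
have dS := sm_derivable v (sm_sum s P oU sF) Ux.
rewrite -IH -(deriveD (sm_derivable v (sF i) Ux) dS).
by apply: (derive_open v oU Ux) => y _; rewrite big_cons Pi.
Qed.

Lemma dws_sub U F G w x : open U -> sm U F -> sm U G -> U x ->
  dws w (fun y => F y - G y) x = dws w F x - dws w G x.
Proof.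
move=> oU; elim: w F G x => [//|v w IH] F G x sF sG Ux /=.
rewrite -(IH _ _ _ (sm_D v sF) (sm_D v sG) Ux).
apply: (dws_open w oU _ Ux) => y Uy.
by rewrite deriveB //; apply: sm_derivable Uy.
Qed.

Lemma dws_add U F G w x : open U -> sm U F -> sm U G -> U x ->
  dws w (fun y => F y + G y) x = dws w F x + dws w G x.
Proof.
move=> oU; elim: w F G x => [//|v w IH] F G x sF sG Ux /=.
rewrite -(IH _ _ _ (sm_D v sF) (sm_D v sG) Ux).
apply: (dws_open w oU _ Ux) => y Uy.
by rewrite deriveD //; apply: sm_derivable Uy.
Qed.

End Smooth.
Arguments sm_derivable {R V U F x} v.

(** * Cauchy estimates with rising factorials *)

Section Bounds.
Variables (R : realType) (V : normedModType R).
Implicit Types (F G H : V -> R) (U : set V) (w : seq V) (x v : V) (m C K : R).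

(** The rising factorial m (m + 1) ... (m + k - 1), the k-th derivative at 0 of (1 - s)^(-m). *)
Fixpoint rise m k : R := if k is k'.+1 then m * rise (m + 1) k' else 1.

Lemma rise_ge0 m k : 0 <= m -> 0 <= rise m k.
Proof. by elim: k m => //= k IH m m0; rewrite mulr_ge0 // IH // addr_ge0. Qed.

Lemma rise_le m m' k : 0 <= m -> m <= m' -> rise m k <= rise m' k.
Proof.
elim: k m m' => //= k IH m m' m0 mm'; apply: ler_pM => //.
  by apply: rise_ge0; apply: addr_ge0.
by apply: IH; rewrite ?addr_ge0 // lerD2r.
Qed.

Lemma rise_scale m m' A k : 0 <= m -> 0 <= m' -> 1 <= A -> m <= A * m' ->
  rise m k <= A ^+ k * rise m' k.
Proof.
elim: k m m' => [|k IH] m m' m0 m'0 A1 mm'; first by rewrite /= mulr1.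
rewrite /= exprS mulrACA; apply: ler_pM => //.
  by apply: rise_ge0; apply: addr_ge0.
by apply: IH => //; rewrite ?addr_ge0 // mulrDr mulr1 lerD.
Qed.

(* The weighted Cauchy estimates satisfied by a function majorised by
   C (1 - K s)^(-m). *)
Definition bndn n U F m C K := forall w y, (size w <= n)%N -> U y ->
  `|dws w F y| <= C * rise m (size w) * K ^+ size w * \prod_(v <- w) `|v|.
Definition bnd U F m C K := forall n, bndn n U F m C K.

Lemma prod_norm_ge0 w : 0 <= \prod_(v <- w) `|v| :> R.
Proof. by apply: prodr_ge0 => v _. Qed.

Lemma bndn_D n U F m C K v :
  bndn n.+1 U F m C K -> bndn n U ('D_v F) (m + 1) (C * m * K * `|v|) K.
Proof.
move=> bF w y sw Uy; have := bF (v :: w) y sw Uy.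
rewrite /= big_cons exprS; move: (\prod_(_ <- _) _) => p h; apply: le_trans h _.
by rewrite le_eqVlt; apply/orP; left; apply/eqP; ring.
Qed.

Lemma bnd_D U F m C K v :
  bnd U F m C K -> bnd U ('D_v F) (m + 1) (C * m * K * `|v|) K.
Proof. by move=> bF n; apply: bndn_D; apply: bF. Qed.

Lemma bndn_le n U F m m' C C' K K' : 0 <= m -> m <= m' -> 0 <= C -> C <= C' ->
  0 <= K -> K <= K' -> bndn n U F m C K -> bndn n U F m' C' K'.
Proof.
move=> m0 mm C0 CC K0 KK bF w y sw Uy; apply: le_trans (bF w y sw Uy) _.
apply: ler_wpM2r; first exact: prod_norm_ge0.
have r0 := rise_ge0 (size w) m0; have k0 := exprn_ge0 (size w) K0.
apply: ler_pM => //; first exact: mulr_ge0.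
  by apply: ler_pM => //; apply: rise_le.
by apply: lerXn2r => //; rewrite nnegrE (le_trans K0).
Qed.

Lemma bnd_le U F m m' C C' K K' : 0 <= m -> m <= m' -> 0 <= C -> C <= C' ->
  0 <= K -> K <= K' -> bnd U F m C K -> bnd U F m' C' K'.
Proof. by move=> m0 mm C0 CC K0 KK bF n; apply: bndn_le (bF n). Qed.

Lemma bnd_set U U' F m C K : U' `<=` U -> bnd U F m C K -> bnd U' F m C K.
Proof. by move=> UU bF n w y sw /UU; apply: bF sw. Qed.

Lemma bndn_ext n U F G m C K : open U -> (forall x, U x -> F x = G x) ->
  bndn n U F m C K -> bndn n U G m C K.
Proof.
by move=> oU FG bF w y sw Uy; rewrite -(dws_open w oU FG Uy); apply: bF.
Qed.

Lemma bndn_sub n U F G m C C' K : open U -> sm U F -> sm U G ->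
  bndn n U F m C K -> bndn n U G m C' K ->
  bndn n U (fun x => F x - G x) m (C + C') K.
Proof.
move=> oU sF sG bF bG w y sw Uy; rewrite (dws_sub w oU sF sG Uy).
apply: le_trans (ler_normB _ _) _; rewrite !mulrDl; apply: lerD.
  exact: bF.
exact: bG.
Qed.

Lemma bnd_sub U F G m C C' K : open U -> sm U F -> sm U G ->
  bnd U F m C K -> bnd U G m C' K -> bnd U (fun x => F x - G x) m (C + C') K.
Proof. by move=> oU sF sG bF bG n; apply: bndn_sub. Qed.

Lemma bndn_add n U F G m C C' K : open U -> sm U F -> sm U G ->
  bndn n U F m C K -> bndn n U G m C' K ->
  bndn n U (fun x => F x + G x) m (C + C') K.
Proof.
move=> oU sF sG bF bG w y sw Uy; rewrite (dws_add w oU sF sG Uy).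
apply: le_trans (ler_normD _ _) _; rewrite !mulrDl; apply: lerD.
  exact: bF.
exact: bG.
Qed.

Lemma bnd_add U F G m C C' K : open U -> sm U F -> sm U G ->
  bnd U F m C K -> bnd U G m C' K -> bnd U (fun x => F x + G x) m (C + C') K.
Proof. by move=> oU sF sG bF bG n; apply: bndn_add. Qed.

(** Majorants multiply and their exponents add. In the induction the two Leibniz terms carry the
    factors [m] and [m'] in front of the same rising factorial, and [m + m'] is exactly the factor
    missing from the next one. *)
Lemma bndn_mul n U F G m m' C C' K : open U -> sm U F -> sm U G ->
  bndn n U F m C K -> bndn n U G m' C' K ->
  bndn n U (fun x => F x * G x) (m + m') (C * C') K.
Proof.
move=> oU sF sG bF bG w y sw Uy.
elim: w n F G m m' C C' sF sG bF bG sw => [|v w IH] n F G m m' C C' sF sG bF bG sw.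
  have := bF [::] y isT Uy; have := bG [::] y isT Uy.
  rewrite /= !big_nil !mulr1 normrM => h1 h2.
  by apply: ler_pM.
case: n bF bG sw => // n bF bG sw /=.
have E : dws w ('D_v (fun x => F x * G x)) y =
    dws w (fun x => 'D_v F x * G x) y + dws w (fun x => F x * 'D_v G x) y.
  rewrite -(dws_add w oU (sm_mul oU (sm_D v sF) sG) (sm_mul oU sF (sm_D v sG)) Uy).
  apply: (dws_open w oU _ Uy) => z Uz.
  rewrite (deriveM (sm_derivable v sF Uz) (sm_derivable v sG Uz)).
  by rewrite /GRing.scale /= addrC [G z * _]mulrC.
rewrite E; apply: le_trans (ler_normD _ _) _.
have bF' : bndn n U F m C K by move=> z x sz; apply: bF; apply: leqW.
have bG' : bndn n U G m' C' K by move=> z x sz; apply: bG; apply: leqW.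
have h1 := IH n _ _ _ _ _ _ (sm_D v sF) sG (bndn_D v bF) bG' sw.
have h2 := IH n _ _ _ _ _ _ sF (sm_D v sG) bF' (bndn_D v bG) sw.
apply: le_trans (lerD h1 h2) _.
rewrite (addrAC m 1 m') (addrA m m' 1) big_cons exprS.
move: (\prod_(_ <- _) _) => p.
by rewrite le_eqVlt; apply/orP; left; apply/eqP; ring.
Qed.

Lemma bnd_mul U F G m m' C C' K : open U -> sm U F -> sm U G ->
  bnd U F m C K -> bnd U G m' C' K ->
  bnd U (fun x => F x * G x) (m + m') (C * C') K.
Proof. by move=> oU sF sG bF bG n; apply: bndn_mul. Qed.

(** The exponent is normalised at the expense of the radius, since each factor m + i is at most 2m +
    1 times 1/2 + i. *)
Lemma bnd_half U F m C K : 0 <= m -> 0 <= C -> 0 <= K -> bnd U F m C K ->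
  bnd U F (2^-1) C (K * (2 * m + 1)).
Proof.
move=> m0 C0 K0 bF n w y sw Uy; apply: le_trans (bF n w y sw Uy) _.
apply: ler_wpM2r; first exact: prod_norm_ge0.
rewrite exprMn (mulrC (K ^+ _)) mulrA; apply: ler_wpM2r; first exact: exprn_ge0.
rewrite -mulrA; apply: ler_wpM2l => //; rewrite mulrC.
by apply: rise_scale; lra.
Qed.

(* If E = 1/H then D_v E = - E^2 D_v H; the exponent 1/2 is chosen so that the
   estimate of E reproduces itself. *)
Lemma bnd_inv U H m C K d : open U -> sm U H -> 0 <= m -> 0 <= C -> 0 <= K ->
  bnd U H m C K -> 0 < d -> (forall y, U y -> d <= `|H y|) ->
  exists2 K', K <= K' & bnd U (fun y => (H y)^-1) (2^-1) (d^-1) K'.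
Proof.
move=> oU sH m0 C0 K0 bH d0 Hd.
have H0 y : U y -> H y != 0 by move/Hd; rewrite -normr_gt0; apply: lt_le_trans.
have sE := sm_inv oU sH H0.
(* The first summand brings the derivative of H, of exponent m + 1, to exponent 1/2; the second lets
   the constant produced by the recursion be absorbed by the factor 1/2 of the rising factorial. *)
pose K' := K * (2 * (m + 1) + 1) + 2 * (C * m * K * d^-1).
have P0 : 0 <= C * m * K by rewrite !mulr_ge0.
have Q0 : 0 <= C * m * K * d^-1 by rewrite mulr_ge0 // invr_ge0 ltW.
have K1 : K * (2 * (m + 1) + 1) <= K' by rewrite lerDl mulr_ge0.
have K1p : 0 <= K * (2 * (m + 1) + 1) by rewrite mulr_ge0 //; lra.
have KK' : K <= K'.
  by apply: le_trans K1; rewrite ler_peMr //; lra.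
have K'0 : 0 <= K' by apply: le_trans K0 KK'.
exists K' => // n; elim: n => [|n IH].
  move=> [|//] y _ Uy; rewrite /= big_nil !mulr1 normfV lef_pV2 ?posrE //; first exact: Hd.
  by rewrite normr_gt0 H0.
move=> [|v w] y sw Uy.
  rewrite /= big_nil !mulr1 normfV lef_pV2 ?posrE //; first exact: Hd.
  by rewrite normr_gt0 H0.
have sDH := sm_D v sH.
have bDH : bndn n U ('D_v H) (2^-1) (C * m * K * `|v|) K'.
  have h20 : 0 <= 2^-1 :> R by lra.
  apply: (@bndn_le n U _ (2^-1) (2^-1) (C * m * K * `|v|) _ (K * (2 * (m + 1) + 1))) => //.
  - by rewrite mulr_ge0.
  have m10 : 0 <= m + 1 by rewrite addr_ge0.
  have C10 : 0 <= C * m * K * `|v| by rewrite mulr_ge0.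
  exact: (bnd_half m10 C10 K0 (bnd_D v bH)).
have bP := bndn_mul oU (sm_mul oU sE sE) sDH (bndn_mul oU sE sE IH IH) bDH.
have sP := sm_mul oU (sm_mul oU sE sE) sDH.
have E : `|dws w ('D_v (fun y => (H y)^-1)) y| =
    `|dws w (fun x => (H x)^-1 * (H x)^-1 * 'D_v H x) y|.
  have -> : dws w ('D_v (fun y => (H y)^-1)) y =
      dws w (fun x => cst 0 x - (H x)^-1 * (H x)^-1 * 'D_v H x) y.
    apply: (dws_open w oU _ Uy) => z Uz.
    rewrite (deriveV (H0 z Uz) (sm_derivable v sH Uz)) /GRing.scale /= sub0r.
    by rewrite -exprVn expr2 mulNr.
  rewrite (dws_sub w oU (sm_cst 0 oU) sP Uy).
  have -> : dws w (cst 0) y = 0.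
    elim: w {bP sP sw Uy sDH bDH} y => //= u w IHw y.
    have -> : 'D_u (cst 0 : V -> R) = cst 0 by apply: funext => z; rewrite derive_cst.
    exact: IHw.
  by rewrite sub0r normrN.
rewrite /= E; apply: le_trans (bP w y sw Uy) _.
have -> : 2^-1 + 2^-1 + 2^-1 = 2^-1 + 1 :> R by lra.
rewrite big_cons exprS; have := prod_norm_ge0 w; move: (\prod_(_ <- _) _) => p p0.
have r0 : 0 <= rise (2^-1 + 1) (size w) by apply: rise_ge0; lra.
have k0 := exprn_ge0 (size w) K'0.
set r := rise _ _ in r0 *; set k := K' ^+ _ in k0 *.
have -> : d^-1 * (2^-1 * r) * (K' * k) * (`|v| * p) =
    (d^-1 * 2^-1 * K') * (r * k * `|v| * p) by ring.
have -> : d^-1 * d^-1 * (C * m * K * `|v|) * r * k * p =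
    (d^-1 * (C * m * K * d^-1)) * (r * k * `|v| * p) by ring.
apply: ler_wpM2r; first by rewrite !mulr_ge0.
rewrite -[leRHS]mulrA; apply: ler_wpM2l; first by rewrite invr_ge0 ltW.
rewrite /K'; move: K1p Q0; move: (K * _) (C * m * K / d) => a b; lra.
Qed.

End Bounds.

(** * Mean value and Taylor estimates, first on an interval, then along segments *)

Section OneVariable.
Variable R : realType.
Implicit Types (f g : R -> R) (s a b c K : R).

Lemma is_derive_within f df a b :
  (forall s, a <= s <= b -> is_derive s 1 f (df s)) ->
  {within `[a, b], continuous f}.
Proof.
move=> fd; apply: derivable_within_continuous => s.
by rewrite in_itv /= => /fd [].
Qed.

Lemma mean_value f df a b : a <= b ->
  (forall s, a <= s <= b -> is_derive s 1 f (df s)) ->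
  exists2 c, a <= c <= b & f b - f a = df c * (b - a).
Proof.
move=> ab fd.
have fd' s : s \in `]a, b[ -> is_derive s 1 f (df s).
  by rewrite in_itv /= => /andP[sa sb]; apply: fd; rewrite !ltW.
have [c] := MVT_segment ab fd' (is_derive_within fd).
by rewrite in_itv /= => cab e; exists c.
Qed.

Lemma derive_bound f df g dg s : 0 <= s ->
  (forall t, 0 <= t <= s -> is_derive t 1 f (df t)) ->
  (forall t, 0 <= t <= s -> is_derive t 1 g (dg t)) ->
  f 0 = 0 -> g 0 = 0 -> (forall t, 0 <= t <= s -> `|df t| <= dg t) ->
  `|f s| <= g s.
Proof.
move=> s0 fd gd f0 g0 fg; rewrite ler_norml; apply/andP; split.
  have [|c c0 e] := @mean_value (fun t => g t + f t) (fun t => dg t + df t) 0 s s0.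
    by move=> t ts; exact: (is_deriveD (gd t ts) (fd t ts)).
  rewrite -subr_ge0 opprK addrC.
  have : 0 <= g s + f s - (g 0 + f 0).
    rewrite e subr0 mulr_ge0 //; have := fg c c0.
    by rewrite ler_norml => /andP[+ _]; rewrite -subr_ge0 opprK addrC.
  by rewrite f0 g0 addr0 subr0.
have [|c c0 e] := @mean_value (fun t => g t - f t) (fun t => dg t - df t) 0 s s0.
  by move=> t ts; exact: (is_deriveB (gd t ts) (fd t ts)).
rewrite -subr_ge0.
have : 0 <= g s - f s - (g 0 - f 0).
  rewrite e subr0 mulr_ge0 // subr_ge0; have := fg c c0.
  by rewrite ler_norml => /andP[_].
by rewrite f0 g0 !subr0.
Qed.

Lemma is_derive_pow K n s : is_derive s 1 (fun t => K * t ^+ n.+1 / n.+1`!%:R)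
  (K * s ^+ n / n`!%:R).
Proof.
have -> : (fun t => K * t ^+ n.+1 / n.+1`!%:R) =
    horner ((K / n.+1`!%:R) *: 'X^(n.+1) : {poly R}).
  by apply: funext => t; rewrite hornerZ hornerXn mulrAC.
have := is_derive_poly ((K / n.+1`!%:R) *: 'X^(n.+1) : {poly R}) s.
rewrite derivZ derivXn /= hornerZ hornerMn hornerXn => h.
apply: is_derive_eq h _; rewrite factS natrM -[s ^+ n *+ _]mulr_natr.
have h1 : n.+1%:R != 0 :> R by rewrite pnatr_eq0.
have h2 : n`!%:R != 0 :> R by rewrite pnatr_eq0 -lt0n fact_gt0.
move: h1 h2; move: (n.+1%:R) (n`!%:R) (s ^+ n) => a b c a0 b0.
by field; rewrite a0 b0.
Qed.

(** The sequence [phi] lists the successive derivatives of [phi 0]. The bound on the last one is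
    integrated one order at a time, by comparison with a monomial. *)
Lemma taylor_flat (phi : nat -> R -> R) N K :
  (forall k s, (k <= N)%N -> 0 <= s <= 1 -> is_derive s 1 (phi k) (phi k.+1 s)) ->
  (forall k, (k <= N)%N -> phi k 0 = 0) ->
  (forall s, 0 <= s <= 1 -> `|phi N.+1 s| <= K) ->
  forall s, 0 <= s <= 1 -> `|phi 0 s| <= K * s ^+ N.+1 / N.+1`!%:R.
Proof.
elim: N phi => [|N IH] phi dp p0 pK s /andP[s0 s1].
  apply: (@derive_bound (phi 0) (phi 1) (fun t => K * t ^+ 1 / 1`!%:R)
    (fun t => K * t ^+ 0 / 0`!%:R)) => //.
  - by move=> t /andP[t0 ts]; apply: dp => //; rewrite t0 (le_trans ts).
  - by move=> t _; apply: is_derive_pow.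
  - exact: p0.
  - by rewrite expr0n mulr0 mul0r.
  - move=> t /andP[t0 ts]; rewrite fact0 divr1 expr0 mulr1.
    by apply: pK; rewrite t0 (le_trans ts).
have h := IH (fun k => phi k.+1) (fun k s kN => dp k.+1 s kN) (fun k kN => p0 k.+1 kN) pK.
apply: (@derive_bound (phi 0) (phi 1) (fun t => K * t ^+ N.+2 / N.+2`!%:R)
  (fun t => K * t ^+ N.+1 / N.+1`!%:R)) => //.
- by move=> t /andP[t0 ts]; apply: dp => //; rewrite t0 (le_trans ts).
- by move=> t _; apply: is_derive_pow.
- exact: p0.
- by rewrite expr0n mulr0 mul0r.
- by move=> t /andP[t0 ts]; apply: h; rewrite t0 (le_trans ts).
Qed.

Lemma taylor_1d (phi : nat -> R -> R) N K :
  (forall k s, (k <= N)%N -> 0 <= s <= 1 -> is_derive s 1 (phi k) (phi k.+1 s)) ->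
  (forall s, 0 <= s <= 1 -> `|phi N.+1 s| <= K) ->
  `|phi 0 1 - \sum_(j < N.+1) phi j 0 / j`!%:R| <= K / N.+1`!%:R.
Proof.
move=> dp pK.
(* Taylor polynomial of [phi k], truncated at the degree left after [k] derivations, so that
   differentiating [P k] gives [P k.+1]; subtracting it reduces to the flat case. *)
pose P k : {poly R} := \poly_(j < N.+1 - k) (phi (k + j)%N 0 / j`!%:R).
have dP k : (P k)^`() = P k.+1.
  apply/polyP => j; rewrite coef_deriv !coef_poly subnS.
  rewrite ltn_predRL; case: ifP => _; last by rewrite mul0rn.
  rewrite -[LHS]mulr_natr addnS addSn factS natrM invfM -!mulrA; congr (_ * _).
  by rewrite mulrCA mulVf ?mulr1 // pnatr_eq0.
have := @taylor_flat (fun k s => phi k s - (P k).[s]) N K _ _ _ 1.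
rewrite ler01 lexx expr1n mulr1 /= => h.
have -> : \sum_(j < N.+1) phi j 0 / j`!%:R = (P 0).[1].
  rewrite horner_poly subn0; apply: eq_bigr => j _.
  by rewrite expr1n mulr1.
apply: h => //.
- move=> k s kN s01; rewrite -dP.
  exact: (is_deriveB (dp k s kN s01) (is_derive_poly (P k) s)).
- move=> k kN; rewrite horner_coef0 coef_poly subn_gt0 ltnS kN addn0 fact0 divr1.
  by rewrite subrr.
- move=> s s01; have -> : P N.+1 = 0.
    by apply/polyP => j; rewrite coef_poly subnn ltn0 coef0.
  by rewrite horner0 subr0 pK.
Qed.

Lemma is_derive_eps f s c :
  (forall eps, 0 < eps -> \forall h \near 0, `|f (s + h) - f s - h * c| <= eps * `|h|) ->
  is_derive s 1 f c.
Proof.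
move=> fe.
have lin : linear (fun h : R => h * c : R).
  by move=> k u v; rewrite mulrDl /GRing.scale /= mulrA.
pose A0 := GRing.isLinear.Build _ _ _ _ _ lin.
pose A : {linear R -> R} := HB.pack (fun h : R => h * c) A0.
have Ac : continuous A by move=> x; apply: mulrr_continuous.
have [df dE] := differentiable_eps Ac fe.
have /derivableP : derivable f s 1 by exact: diff_derivable df.
by rewrite deriveE // dE /= mul1r.
Qed.

End OneVariable.

Section Taylor.
Variables (R : realType) (V : normedModType R).
Implicit Types (F G : V -> R) (U : set V) (w : seq V) (x h v : V) (m C K : R).

Lemma dws_nseqS k h F x : dws (nseq k.+1 h) F x = 'D_h (dws (nseq k h) F) x.
Proof. by elim: k F => // k IH F; apply: IH. Qed.

Lemma mvt_line U F x h : sm U F -> (forall s : R, 0 <= s <= 1 -> U (x + s *: h)) ->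
  exists2 s : R, 0 <= s <= 1 & F (x + h) - F x = 'D_h F (x + s *: h).
Proof.
move=> sF Uxh.
have [|c c01] := @mean_value R (fun s => F (x + s *: h)) (fun s => 'D_h F (x + s *: h)) 0 1 ler01.
  by move=> s s01; apply: is_derive_line; apply: sm_diff sF _; apply: Uxh.
by rewrite scale0r scale1r addr0 subr0 mulr1 => e; exists c.
Qed.

Lemma taylor_line U F x h N (K : R) : sm U F ->
  (forall s : R, 0 <= s <= 1 -> U (x + s *: h)) ->
  (forall s : R, 0 <= s <= 1 -> `|dws (nseq N.+1 h) F (x + s *: h)| <= K) ->
  `|F (x + h) - \sum_(j < N.+1) dws (nseq j h) F x / j`!%:R| <= K / N.+1`!%:R.
Proof.
move=> sF Uxh bK.
have := @taylor_1d R (fun k s => dws (nseq k h) F (x + s *: h)) N K.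
rewrite /= scale1r scale0r addr0; apply => //.
move=> k s _ s01.
have := is_derive_line (sm_diff (sm_dws (nseq k h) sF) (Uxh s s01)).
by rewrite -dws_nseqS.
Qed.

Lemma ball_segment (x y h : V) (r : R) : ball x r y -> ball x r (y + h) ->
  forall s : R, 0 <= s <= 1 -> ball x r (y + s *: h).
Proof.
rewrite -!ball_normE /ball_ /= => yr yhr s /andP[s0 s1].
have -> : x - (y + s *: h) = (1 - s) *: (x - y) + s *: (x - (y + h)).
  rewrite scalerBl scale1r -[RHS]addrA [- _ + _]addrC -scalerBr.
  have -> : x - (y + h) - (x - y) = - h by rewrite opprB addrC addrA subrK opprD addrA subrr add0r.
  by rewrite scalerN opprD addrA.
apply: le_lt_trans (ler_normD _ _) _; rewrite !normrZ !ger0_norm ?subr_ge0 //.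
have [->|sn0] := eqVneq s 0; first by rewrite subr0 mul1r mul0r addr0.
have s0' : 0 < s by rewrite lt_neqAle eq_sym sn0.
apply: (@le_lt_trans _ _ ((1 - s) * r + s * `|x - (y + h)|)).
  by rewrite lerD2r ler_wpM2l ?subr_ge0 // ltW.
rewrite [ltRHS](_ : r = (1 - s) * r + s * r); last by ring.
by rewrite ltrD2l ltr_pM2l.
Qed.

End Taylor.

(** * Limits of smooth functions under uniform Cauchy estimates *)

Section Limit.
Variable R : realType.

Lemma cvg_approx (a : nat -> R) :
  (forall e, 0 < e -> exists b : nat -> R, cvgn b /\ forall n, `|a n - b n| <= e) ->
  cvgn a.
Proof.
move=> ab; apply/cauchy_cvgP/cauchy_exP => e e0.
have [b [/cvg_ex[/= l bl] abe]] := ab _ (divr_gt0 e0 (ltr0n R 2)).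
exists l => /=; have /cvgrPdist_lt/(_ _ (divr_gt0 e0 (ltr0n R 2))) := bl.
move=> H; rewrite /nbhs /=; apply: filterS H => n /= bn.
rewrite -ball_normE /ball_ /= -(subrK (b n) l) -addrA [e]splitr.
apply: le_lt_trans (ler_normD _ _) _; apply: ltr_leD => //.
by rewrite distrC.
Qed.

Lemma cvgn_norm_le (a : nat -> R) l B : a @ \oo --> l -> (forall n, `|a n| <= B) ->
  `|l| <= B.
Proof.
move=> al aB; have h : `|a n| @[n --> \oo] --> `|l| by apply: cvg_norm.
rewrite -(cvg_lim (@norm_hausdorff _ _) h).
by apply: limr_le; [apply/cvg_ex; exists `|l|%R|apply: nearW].
Qed.

Lemma cvgn_uniq (a : nat -> R) (l l' : R) : a @ \oo --> l -> a @ \oo --> l' -> l = l'.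
Proof. by move=> h h'; apply: (cvg_unique (@norm_hausdorff _ _) h h'). Qed.

Variable V : normedModType R.
Implicit Types (F G : V -> R) (U : set V) (w : seq V) (x h v : V) (m C K : R).

Lemma quad_bound U F x h m C K : sm U F -> bnd U F m C K -> 0 <= m -> 0 <= C -> 0 <= K ->
  (forall s : R, 0 <= s <= 1 -> U (x + s *: h)) ->
  `|F (x + h) - F x - 'D_h F x| <= C * rise m 2 * K ^+ 2 * `|h| ^+ 2.
Proof.
move=> sF bF m0 C0 K0 Uxh.
have r0 : 0 <= rise m 2 by exact: rise_ge0.
have B0 : 0 <= C * rise m 2 * K ^+ 2 * `|h| ^+ 2.
  apply: mulr_ge0; last exact: exprn_ge0.
  by apply: mulr_ge0; [apply: mulr_ge0|apply: exprn_ge0].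
have := @taylor_line R V U F x h 1 (C * rise m 2 * K ^+ 2 * `|h| ^+ 2) sF Uxh.
rewrite !big_ord_recr big_ord0 /= !add0r divr1 divr1 opprD addrA => H.
apply: le_trans (H _) _.
  move=> s s01.
  have -> : `|h| ^+ 2 = \prod_(v <- [:: h; h]) `|v| by rewrite !big_cons big_nil mulr1.
  exact: (bF 2 [:: h; h] _ isT (Uxh s s01)).
by rewrite ler_piMr // invf_le1 ?ltr0n ?ler1n // fact_gt0.
Qed.

Lemma lip_continuous (A : {linear V -> R}) (B : R) : (forall v, `|A v| <= B * `|v|) ->
  continuous A.
Proof.
move=> AB x; apply/cvgrPdist_le => e e0.
have B0 : 0 < `|B| + 1 by rewrite ltr_pwDr.
have := @cvg_id _ (nbhs x) => /cvgrPdist_le/(_ _ (divr_gt0 e0 B0)).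
apply: filterS => y xy; rewrite -linearB; apply: le_trans (AB _) _.
apply: le_trans (_ : (`|B| + 1) * `|x - y| <= _); last by rewrite mulrC -ler_pdivlMr.
by apply: ler_wpM2r => //; apply: le_trans (ler_norm _) _; rewrite lerDl.
Qed.

Lemma ball_near (x y : V) (r : R) : ball x r y -> \forall h \near (0 : V), ball x r (y + h).
Proof.
move=> xy; have /nbhs_ballP[e /= e0 He] : nbhs y (ball x r).
  by apply: open_nbhs_nbhs; split => //; exact: ball_open.
apply/nbhs_ballP; exists e => //= h hh; apply: He; move: hh.
by rewrite -ball_normE /ball_ /= sub0r opprD addrA subrr sub0r.
Qed.

Section Sequence.
Variables (x0 : V) (r : R).
Let U := ball x0 r.

(** The second order bound is uniform in [n]. Difference quotients therefore approximate derivatives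
    uniformly, which makes the derivatives converge, and the quadratic remainder survives in the
    limit, which makes the limit differentiable. *)
Lemma limit_diff (Fs : nat -> V -> R) F m C K : 0 <= m -> 0 <= C -> 0 <= K ->
  (forall n, sm U (Fs n)) -> (forall n, bnd U (Fs n) m C K) ->
  (forall y, U y -> Fs n y @[n --> \oo] --> F y) ->
  forall y, U y -> differentiable F y /\
    forall v, 'D_v (Fs n) y @[n --> \oo] --> 'D_v F y.
Proof.
move=> m0 C0 K0 sF bF cF y Uy.
pose K2 := C * rise m 2 * K ^+ 2.
have K20 : 0 <= K2.
  apply: mulr_ge0; last exact: exprn_ge0.
  by apply: mulr_ge0 => //; exact: rise_ge0.
have quad n h : U (y + h) -> `|Fs n (y + h) - Fs n y - 'D_h (Fs n) y| <= K2 * `|h| ^+ 2.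
  by move=> Uh; apply: quad_bound (bF n) _ _ _ _ => //; apply: ball_segment.
have dF n : differentiable (Fs n) y by apply: sm_diff (sF n) Uy.
have cD v : cvgn (fun n => 'D_v (Fs n) y).
  apply: cvg_approx => e e0.
  have Q0 : 0 < K2 * `|v| ^+ 2 + 1 by rewrite ltr_pwDr // mulr_ge0 // exprn_ge0.
  (* A step short enough to stay in the ball and to make the error of the difference quotient, at
     most K2 t |v|^2, smaller than [e]. *)
  have [t [t0 te Ut]] : exists t : R, [/\ 0 < t, t <= e / (K2 * `|v| ^+ 2 + 1) & U (y + t *: v)].
    have /nbhs_ballP[d /= d0 Hd] := ball_near Uy.
    exists (Num.min (d / (`|v| + 1)) (e / (K2 * `|v| ^+ 2 + 1))); split.
    - by rewrite lt_min !divr_gt0 // ltr_pwDr.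
    - by rewrite ge_min lexx orbT.
    - apply: Hd; rewrite -ball_normE /ball_ /= sub0r normrN normrZ.
      set t := Num.min _ _; have t0 : 0 < t by rewrite lt_min !divr_gt0 // ltr_pwDr.
      have td : t <= d / (`|v| + 1) by rewrite ge_min lexx.
      rewrite gtr0_norm //; apply: le_lt_trans (ler_wpM2r _ td) _ => //.
      by rewrite -mulrA gtr_pMr // mulrC ltr_pdivrMr ?ltr_pwDr // mul1r ltrDl.
  exists (fun n => t^-1 * (Fs n (y + t *: v) - Fs n y)); split.
    apply/cvg_ex; exists (t^-1 * (F (y + t *: v) - F y)).
    by apply: cvgMr; apply: cvgB; apply: cF.
  move=> n; have := quad n _ Ut; rewrite deriveZv // normrZ gtr0_norm // => H.
  rewrite distrC.
  have -> : t^-1 * (Fs n (y + t *: v) - Fs n y) - 'D_v (Fs n) y =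
      t^-1 * (Fs n (y + t *: v) - Fs n y - t * 'D_v (Fs n) y).
    by rewrite [RHS]mulrBr mulKf // gt_eqF.
  rewrite normrM gtr0_norm ?invr_gt0 // mulrC ler_pdivrMr //.
  apply: le_trans H _; rewrite [leRHS]mulrC.
  have -> : K2 * (t * `|v|) ^+ 2 = t * (t * (K2 * `|v| ^+ 2)) by ring.
  apply: ler_wpM2l; first exact: ltW.
  move: te; rewrite ler_pdivlMr //; apply: le_trans.
  by apply: ler_wpM2l; [exact: ltW|rewrite lerDl].
pose A v : R := lim ('D_v (Fs n) y @[n --> \oo]).
have AE v : 'D_v (Fs n) y @[n --> \oo] --> A v by apply: cD.

have lin : linear A.
  move=> k u v; apply: (@cvgn_uniq (fun n => 'D_(k *: u + v) (Fs n) y)); first exact: AE.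
  rewrite (_ : (fun n => _) = (fun n => k * 'D_u (Fs n) y + 'D_v (Fs n) y)).
    by apply: cvgD; [apply: cvgMr; apply: AE|apply: AE].
  by apply: funext => n; rewrite deriveDv // deriveZv.
pose A0 := GRing.isLinear.Build _ _ _ _ _ lin.
pose AL : {linear V -> R} := HB.pack A A0.
have Ac : continuous AL.
  apply: (@lip_continuous AL (C * m * K)) => v.
  apply: (cvgn_norm_le (AE v)) => n.
  by have := bF n 1%N [:: v] y isT Uy; rewrite /= big_cons big_nil !mulr1.
have [dFy dE] : is_diff y F AL.
  apply: differentiable_eps => // e e0.
  have := ball_near Uy; have := @cvg_id _ (nbhs (0 : V)) => /cvgrPdist_le.
  have K21 : 0 < K2 + 1 by rewrite ltr_pwDr.
  move=> /(_ _ (divr_gt0 e0 K21)); apply: filterS2 => h; rewrite sub0r normrN => he Uh.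
  apply: (@le_trans _ _ (K2 * `|h| ^+ 2)).
    apply: (@cvgn_norm_le (fun n => Fs n (y + h) - Fs n y - 'D_h (Fs n) y)).
      by apply: cvgB; [apply: cvgB; apply: cF|apply: AE].
    by move=> n; apply: quad.
  rewrite expr2 mulrA; apply: ler_wpM2r => //.
  apply: (@le_trans _ _ ((K2 + 1) * `|h|)); first by apply: ler_wpM2r => //; rewrite lerDl.
  by rewrite mulrC -ler_pdivlMr.
split=> // v; rewrite deriveE // dE; exact: AE.
Qed.

(** Coinduction on the class of pointwise limits of sequences with uniform estimates: [limit_diff]
    shows that it is stable under directional derivatives, whose estimates are again uniform. *)
Lemma limit_sm (Fs : nat -> V -> R) F m C K : 0 <= m -> 0 <= C -> 0 <= K ->
  (forall n, sm U (Fs n)) -> (forall n, bnd U (Fs n) m C K) ->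
  (forall y, U y -> Fs n y @[n --> \oo] --> F y) ->
  [/\ sm U F, bnd U F m C K &
    forall w y, U y -> dws w (Fs n) y @[n --> \oo] --> dws w F y].
Proof.
move=> m0 C0 K0 sF bF cF.
have oU : open U by exact: ball_open.
pose S G := exists Gs m C K, [/\ 0 <= m, 0 <= C & 0 <= K] /\
  [/\ forall n, sm U (Gs n), forall n, bnd U (Gs n) m C K &
   forall y, U y -> Gs n y @[n --> \oo] --> (G y : R)].
have SD G v : S G -> S ('D_v G).
  move=> [Gs [m' [C' [K' [[m'0 C'0 K'0] [sG bG cG]]]]]].
  exists (fun n => 'D_v (Gs n)), (m' + 1), (C' * m' * K' * `|v|), K'; split; split.
  - by rewrite addr_ge0.
  - by rewrite !mulr_ge0.
  - by [].
  - by move=> n; exact: (sm_D v (sG n)).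
  - by move=> n; exact: (bnd_D v (bG n)).
  - by move=> y Uy; have [_] := @limit_diff Gs G m' C' K' m'0 C'0 K'0 sG bG cG y Uy.
have cW w y : U y -> dws w (Fs n) y @[n --> \oo] --> dws w F y.
  move=> Uy; elim: w (Fs) F m C K m0 C0 K0 sF bF cF => [|v w IH] Gs G m' C' K' m'0 C'0 K'0 sG bG cG /=.
    exact: cG.
  apply: (IH (fun n => 'D_v (Gs n)) ('D_v G) (m' + 1) (C' * m' * K' * `|v|) K').
  - by rewrite addr_ge0.
  - by rewrite !mulr_ge0.
  - by [].
  - by move=> n; exact: (sm_D v (sG n)).
  - by move=> n; exact: (bnd_D v (bG n)).
  - by move=> z Uz; have [_] := @limit_diff Gs G m' C' K' m'0 C'0 K'0 sG bG cG z Uz.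
split; [|by move=> n w y sw Uy; apply: (cvgn_norm_le (cW w y Uy)) => k; exact: (bF k n w y sw Uy)|exact: cW].
apply: (@sm_coind _ _ U S) => [G SG|G v|]; [split| exact: SD|by exists Fs, m, C, K; split].
  move: SG => [Gs [m' [C' [K' [[m'0 C'0 K'0] [sG bG cG]]]]]] y Uy.
  by have [] := @limit_diff Gs G m' C' K' m'0 C'0 K'0 sG bG cG y Uy.
move=> y Uy u v.
have lim2 : S G -> exists2 Gs : nat -> V -> R, (forall n, sm U (Gs n)) &
    forall u v, 'D_u ('D_v (Gs n)) y @[n --> \oo] --> 'D_u ('D_v G) y.
  move=> [Gs [m' [C' [K' [[m'0 C'0 K'0] [sG bG cG]]]]]]; exists Gs; first exact: sG.
  move=> u1 v1.
  have cG' z : U z -> 'D_v1 (Gs n) z @[n --> \oo] --> 'D_v1 G z.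
    by move=> Uz; have [_] := @limit_diff Gs G m' C' K' m'0 C'0 K'0 sG bG cG z Uz.
  have m10 : 0 <= m' + 1 by rewrite addr_ge0.
  have C10 : 0 <= C' * m' * K' * `|v1| by rewrite !mulr_ge0.
  have [_] := @limit_diff (fun n => 'D_v1 (Gs n)) ('D_v1 G) (m' + 1)
    (C' * m' * K' * `|v1|) K' m10 C10 K'0 (fun n => sm_D v1 (sG n))
    (fun n => bnd_D v1 (bG n)) cG' y Uy.
  exact.
have [Gs sG cG] := lim2 SG.
apply: (cvgn_uniq (cG u v)).
rewrite (_ : (fun n => _) = (fun n => 'D_v ('D_u (Gs n)) y)); first exact: cG.
by apply: funext => n; rewrite (sm_com u v (sG n) Uy).
Qed.

End Sequence.
End Limit.

(** * Arcs inside a regular level set *)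

Section Curve.
Variables (R : realType) (V : normedModType R).
Implicit Types (F G rho : V -> R) (U : set V) (w : seq V) (q x h u v : V) (m C K r : R).

Lemma lip_bound U F x h m C K : sm U F -> bnd U F m C K ->
  (forall s : R, 0 <= s <= 1 -> U (x + s *: h)) ->
  `|F (x + h) - F x| <= C * m * K * `|h|.
Proof.
move=> sF bF Uxh; have [s s01 ->] := mvt_line sF Uxh.
have := bF 1%N [:: h] _ isT (Uxh s s01).
by rewrite /= big_cons big_nil expr1 !mulr1.
Qed.

Lemma ball_shrink (x : V) r : 0 < r -> forall P : set V, (\near x, P x) ->
  exists2 r', 0 < r' <= r & ball x r' `<=` P.
Proof.
move=> r0 P /nbhs_ballP[e /= e0 eP]; exists (Num.min r e).
  by rewrite lt_min r0 e0 ge_min lexx.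
by move=> y xy; apply: eP; apply: le_ball xy; rewrite ge_min lexx orbT.
Qed.

Lemma sm_continuous U F x : open U -> sm U F -> U x -> {for x, continuous F}.
Proof. by move=> oU sF Ux; apply: differentiable_continuous; exact: sm_diff sF Ux. Qed.

Lemma near_gt U F x a : open U -> sm U F -> U x -> a < F x -> \forall y \near x, a < F y.
Proof.
move=> oU sF Ux aF; have := sm_continuous oU sF Ux => /cvgrPdist_lt.
move=> /(_ (F x - a)); rewrite subr_gt0 aF => /(_ isT).
by apply: filterS => y; rewrite ltr_norml => /andP[_]; rewrite ltrD2l ltrN2.
Qed.

Lemma near_neq0 U F x : open U -> sm U F -> U x -> F x != 0 -> \forall y \near x, F y != 0.
Proof.
move=> oU sF Ux F0; have [h|h] : 0 < F x \/ 0 < - F x.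
    by case: (ltgtP 0 (F x)) F0 => // h _; [left|right; rewrite oppr_gt0].
  by apply: filterS (near_gt oU sF Ux h) => y; rewrite lt_neqAle eq_sym => /andP[].
apply: filterS (near_gt oU (sm_opp oU sF) Ux h) => y.
by rewrite oppr_gt0 lt_neqAle => /andP[].
Qed.

Lemma near_shift_itv (a b s : R) : a < s < b -> \forall h \near 0, a < s + h < b.
Proof.
case/andP => sa sb.
have := @cvg_id _ (nbhs (0 : R)) => /cvgrPdist_lt /(_ (Num.min (b - s) (s - a))).
rewrite lt_min !subr_gt0 sa sb => /(_ isT).
apply: filterS => h; rewrite sub0r normrN lt_min !ltr_norml.
by move=> /andP[/andP[? ?] /andP[? ?]]; apply/andP; split; lra.
Qed.

(* The level set {rho = 0} near q contains, for each small u, an arc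
   s |-> q + s u + phi(s) v, obtained from the intermediate value theorem. *)
Lemma curve_pos q r rho v m C K : 0 < r -> 0 <= m -> 0 <= C -> 0 <= K ->
  sm (ball q r) rho -> bnd (ball q r) rho m C K ->
  rho q = 0 -> 0 < 'D_v rho q ->
  exists e L, [/\ 0 < e, 0 <= L & forall u, `|u| < e -> exists phi : R -> R,
    [/\ phi 0 = 0, rho (q + u) = 0 -> phi 1 = 0 & forall s, -2 < s < 2 ->
      let y := q + s *: u + phi s *: v in
      [/\ ball q r y, rho y = 0, `|phi s| <= L * `|u|, 'D_v rho y != 0 &
       is_derive s 1 phi (- ('D_u rho y / 'D_v rho y))]]].
Proof.
move=> r0 m0 C0 K0 srho brho rhoq d0.
set U := ball q r in srho brho *; have oU : open U by exact: ball_open.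
have Uq : U q by exact: ballxx.
pose d := 'D_v rho q / 2; have dp : 0 < d by rewrite divr_gt0.
have dlt : d < 'D_v rho q by rewrite ltr_pdivrMr // ltr_pMr // ltr1n.
have [r1 /andP[r10 r1r] r1d] := ball_shrink r0 (near_gt oU (sm_D v srho) Uq dlt).
have r1U : ball q r1 `<=` U by apply: le_ball.
pose B := C * m * K; have B0 : 0 <= B by rewrite !mulr_ge0.
(* For |s| at most 2 the value of [rho] at [q + s *: u] is at most 2 B |u|, and [rho] increases at
   rate at least [d] along [v]: a correction of size L |u| reaches both signs. The range of [s]
   extends to 2 so that [0, 1] is interior. *)
pose L := 2 * B / d; have L0 : 0 <= L by rewrite !mulr_ge0 // invr_ge0 ltW.
have D0 : 0 < 2 + L * `|v| + 1 by rewrite ltr_pwDr // addr_ge0 // mulr_ge0.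
exists (r1 / (2 + L * `|v| + 1)), L; split => //; first exact: divr_gt0.
move=> u; rewrite ltr_pdivlMr // => ue.
have inb (s x : R) : `|s| <= 2 -> `|x| <= L * `|u| -> ball q r1 (q + s *: u + x *: v).
  move=> s2 xL; rewrite -ball_normE /ball_ /= -addrA opprD addrA subrr sub0r normrN.
  apply: le_lt_trans (ler_normD _ _) _; rewrite !normrZ.
  apply: le_lt_trans ue.
  have h1 : `|s| * `|u| <= 2 * `|u| by apply: ler_wpM2r.
  have h2 : `|x| * `|v| <= L * `|u| * `|v| by apply: ler_wpM2r.
  have h3 : 0 <= `|u| by [].
  lra.
have seg (s x h : R) : `|s| <= 2 -> `|x| <= L * `|u| -> `|x + h| <= L * `|u| ->
    forall t, 0 <= t <= 1 -> ball q r1 (q + s *: u + x *: v + t *: (h *: v)).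
  move=> s2 xL hL; apply: ball_segment; first exact: inb.
  by rewrite -addrA -scalerDl; apply: inb.
have incr (s x h : R) : `|s| <= 2 -> `|x| <= L * `|u| -> `|x + h| <= L * `|u| -> 0 <= h ->
    d * h <= rho (q + s *: u + (x + h) *: v) - rho (q + s *: u + x *: v).
  move=> s2 xL hL h0; rewrite scalerDl addrA.
  have [t t01 ->] := mvt_line srho (fun t t01 => r1U _ (seg s x h s2 xL hL t t01)).
  have bt := seg s x h s2 xL hL t t01.
  rewrite deriveZv; last exact: sm_diff srho (r1U _ bt).
  by rewrite mulrC; apply: ler_wpM2l => //; apply: ltW; apply: r1d.
have uniq (s x x' : R) : `|s| <= 2 -> `|x| <= L * `|u| -> `|x'| <= L * `|u| ->
    d * `|x' - x| <= `|rho (q + s *: u + x' *: v) - rho (q + s *: u + x *: v)|.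
  move=> s2; wlog: x x' / x <= x'.
    move=> W xL x'L; have [xx|/ltW xx] := leP x x'; first exact: W.
    by rewrite distrC [leRHS]distrC; apply: W.
  move=> xx xL x'L; have := incr s x (x' - x) s2 xL; rewrite [x + _]addrC subrK => /(_ x'L).
  rewrite subr_ge0 xx => /(_ isT) h; rewrite (ger0_norm (_ : 0 <= x' - x)) ?subr_ge0 //.
  exact: le_trans h (ler_norm _).
have rhos (s : R) : `|s| <= 2 -> `|rho (q + s *: u)| <= 2 * B * `|u|.
  move=> s2; have -> : rho (q + s *: u) = rho (q + s *: u) - rho q by rewrite rhoq subr0.
  apply: le_trans (lip_bound srho brho _) _.
    apply: ball_segment => //; apply: r1U.
    by have := inb s 0 s2; rewrite scale0r addr0 normr0; apply; rewrite mulr_ge0.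
  rewrite normrZ mulrA -/B [2 * _]mulrC.
  by apply: ler_wpM2r => //; apply: ler_wpM2l.
have ex (s : R) : exists x : R, `|s| <= 2 -> `|x| <= L * `|u| /\ rho (q + s *: u + x *: v) = 0.
  have [s2|_] := leP `|s| 2; last by exists 0.
  pose f (x : R) := rho (q + s *: u + x *: v).
  have M0 : 0 <= L * `|u| by rewrite mulr_ge0.
  have Lu0 : - (L * `|u|) <= L * `|u| by rewrite ge0_cp.
  have fc : {within `[- (L * `|u|), L * `|u|], continuous f}.
    have fd (x : R) : - (L * `|u|) <= x <= L * `|u| ->
        is_derive x 1 f ('D_v rho (q + s *: u + x *: v)).
      move=> xL; apply: is_derive_line; apply: sm_diff srho _; apply: r1U.
      by apply: inb => //; rewrite ler_norml.
    exact: (is_derive_within fd).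
  have f0 : f 0 = rho (q + s *: u) by rewrite /f scale0r addr0.
  have fpos : 0 <= f (L * `|u|).
    have := incr s 0 (L * `|u|) s2; rewrite normr0 add0r ger0_norm //.
    move=> /(_ M0 (lexx _) M0); rewrite -/(f _) -/(f 0) f0.
    have -> : d * (L * `|u|) = 2 * B * `|u|.
      by rewrite /L mulrA mulrCA divff ?mulr1 // gt_eqF.
    by have := rhos s s2; rewrite ler_norml => /andP[? ?]; lra.
  have fneg : f (- (L * `|u|)) <= 0.
    have := incr s (- (L * `|u|)) (L * `|u|) s2; rewrite addNr normrN ger0_norm //.
    move=> /(_ (lexx _)); rewrite normr0 => /(_ M0 M0).
    rewrite -/(f 0) -/(f (- (L * `|u|))) f0.
    have -> : d * (L * `|u|) = 2 * B * `|u|.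
      by rewrite /L mulrA mulrCA divff ?mulr1 // gt_eqF.
    by have := rhos s s2; rewrite ler_norml => /andP[? ?]; lra.
  have [|x xL fx] := IVT Lu0 fc (_ : _ <= 0 <= _).
    by rewrite ge_min fneg le_max fpos orbT.
  by exists x => _; split => //; rewrite ler_norml; move: xL; rewrite in_itv.
have [phi phiP] := choice ex.
have phi0 (s x : R) : `|s| <= 2 -> `|x| <= L * `|u| -> rho (q + s *: u + x *: v) = 0 -> phi s = x.
  move=> s2 xL rx; have [pL rp] := phiP s s2; have := uniq s x (phi s) s2 xL pL.
  rewrite rx rp subr0 normr0 pmulr_rle0 // normr_le0 subr_eq0 => /eqP //.
have M0 : 0 <= L * `|u| by rewrite mulr_ge0.
exists phi; split.
- by apply: phi0; rewrite ?normr0 // scale0r addr0 scale0r addr0.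
- by move=> h; apply: phi0; rewrite ?normr0 ?normr1 ?ler1n // scale1r scale0r addr0.
move=> s s2 y; have s2' : `|s| <= 2 by rewrite ler_norml !ltW //; case/andP: s2.
have [pL ry] := phiP s s2'; have by1 := inb s (phi s) s2' pL.
have dy := r1d _ by1; have dy0 : 0 < 'D_v rho y by apply: lt_trans dy.
split => //; [exact: r1U|by rewrite gt_eqF|].
have dfy : differentiable rho y by apply: sm_diff srho _; apply: r1U.
(* [rho] vanishes at both ends of the increment h u + eta v, and eta is of the order of h because
   [phi] is Lipschitz. The first order expansion of [rho] at [y] can then be solved for eta. *)
apply: is_derive_eps => eps eps0.
pose L1 := B * `|u| / d; have L10 : 0 <= L1 by rewrite !mulr_ge0 // invr_ge0 ltW.
have lipphi (h : R) : -2 < s + h < 2 -> `|phi (s + h) - phi s| <= L1 * `|h|.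
  move=> sh2; have sh2' : `|s + h| <= 2 by rewrite ler_norml !ltW //; case/andP: sh2.
  have [pL' ry'] := phiP (s + h) sh2'.
  have := uniq (s + h) (phi s) (phi (s + h)) sh2' pL pL'; rewrite ry' sub0r normrN.
  have -> : q + (s + h) *: u + phi s *: v = y + h *: u by rewrite /y scalerDl addrA; exact: addrAC.
  have -> : rho (y + h *: u) = rho (y + h *: u) - rho y by rewrite ry subr0.
  move=> H; rewrite /L1 mulrAC ler_pdivlMr // mulrC.
  apply: le_trans H _; apply: le_trans (lip_bound srho brho _) _.
    apply: ball_segment; first exact: r1U.
    by apply: r1U; rewrite /y addrAC -[q + _ + _]addrA -scalerDl; exact: inb.
  by rewrite normrZ -/B [X in B * X]mulrC mulrA.
pose dl := 'D_v rho y.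
pose e' := eps * dl / (`|u| + L1 * `|v| + 1).
have P0 : 0 < `|u| + L1 * `|v| + 1 by rewrite ltr_pwDr // addr_ge0 // mulr_ge0.
have e'0 : 0 < e' by rewrite divr_gt0 // mulr_gt0.
have /nbhs_ballP[dd /= dd0 Hdd] := diff_eps dfy e'0.
have N0 : 0 < dd / (`|u| + L1 * `|v| + 1) by rewrite divr_gt0.
near=> h.
have sh2 : -2 < s + h < 2.
  by near: h; apply: near_shift_itv.
have hlt : `|h| < dd / (`|u| + L1 * `|v| + 1).
  near: h; have := @cvg_id _ (nbhs (0 : R)) => /cvgrPdist_lt /(_ _ N0).
  by apply: filterS => h; rewrite sub0r normrN.
have lh := lipphi h sh2; set eta := phi (s + h) - phi s in lh.
have nk : `|h *: u + eta *: v| <= `|h| * (`|u| + L1 * `|v|).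
  apply: le_trans (ler_normD _ _) _; rewrite !normrZ mulrDr lerD2l mulrA.
  by apply: ler_wpM2r => //; rewrite mulrC.
have := Hdd (h *: u + eta *: v); rewrite -ball_normE /ball_ /= sub0r normrN => H.
have nd : `|h| * (`|u| + L1 * `|v|) < dd.
  move: hlt; rewrite ltr_pdivlMr // => hlt; apply: le_lt_trans hlt.
  by apply: ler_wpM2l => //; rewrite lerDl.
have {}H := H (le_lt_trans nk nd).
have ye : y + (h *: u + eta *: v) = q + (s + h) *: u + phi (s + h) *: v.
  rewrite /y (_ : phi (s + h) = phi s + eta); last by rewrite /eta [RHS]addrC subrK.
  rewrite (scalerDl u s h) (scalerDl v (phi s) eta) [LHS]addrACA.
  by congr (_ + _); rewrite -addrA.
have sh2' : `|s + h| <= 2 by rewrite ler_norml !ltW //; case/andP: sh2.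
have [_ ry'] := phiP (s + h) sh2'.
move: H; rewrite ye ry' ry subr0 sub0r normrN deriveDv // !deriveZv // -/dl => H.
have -> : phi (s + h) - phi s - h * - ('D_u rho y / dl) =
    (h * 'D_u rho y + eta * dl) / dl.
  by rewrite mulrDl mulfK ?gt_eqF // mulrN opprK addrC mulrA.
rewrite normrM normfV (gtr0_norm dy0) ler_pdivrMr //; apply: le_trans H _.
apply: le_trans (ler_wpM2l (ltW e'0) nk) _.
have -> : e' * (`|h| * (`|u| + L1 * `|v|)) =
    eps * `|h| * dl * ((`|u| + L1 * `|v|) / (`|u| + L1 * `|v| + 1)).
  by rewrite /e'; ring.
have Q0 : 0 <= eps * `|h| * dl by rewrite !mulr_ge0 // ltW.
by rewrite ler_piMr // ler_pdivrMr // mul1r lerDl.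
Unshelve. all: by end_near. Qed.

End Curve.

(** * Analytic functions and tangential derivatives on a level set *)

Section Flat.
Variables (R : realType) (V : normedModType R).
Implicit Types (F G rho : V -> R) (U : set V) (w : seq V) (q x h u v : V) (m C K r : R).

(** Analyticity stated as uniform Cauchy estimates on the whole ball, a form stable under sums,
    products and directional derivatives and directly usable in Taylor remainders. *)
Definition an_on q r F := sm (ball q r) F /\
  exists m C K, [/\ 0 <= m, 0 <= C, 0 <= K & bnd (ball q r) F m C K].

Lemma an_on_le q r r' F : r' <= r -> an_on q r F -> an_on q r' F.
Proof.
move=> rr [sF [m [C [K [m0 C0 K0 bF]]]]].
have s : ball q r' `<=` ball q r by apply: le_ball.
split; first exact: (sm_sub s sF).
by exists m, C, K; split => //; exact: (bnd_set s bF).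
Qed.

Lemma an_on_D q r F v : an_on q r F -> an_on q r ('D_v F).
Proof.
move=> [sF [m [C [K [m0 C0 K0 bF]]]]]; split; first exact: sm_D.
exists (m + 1), (C * m * K * `|v|), K; split; [by rewrite addr_ge0|by rewrite !mulr_ge0|by []|].
exact: (bnd_D v bF).
Qed.

Lemma an_on_ext q r F G : (forall x, ball q r x -> F x = G x) -> an_on q r F -> an_on q r G.
Proof.
move=> FG [sF [m [C [K [m0 C0 K0 bF]]]]]; have oU : open (ball q r) by exact: ball_open.
split; first exact: (sm_ext oU FG sF).
by exists m, C, K; split => // n; exact: (bndn_ext oU FG (bF n)).
Qed.

Lemma an_on_cst q r c : an_on q r (cst c).
Proof.
have oU : open (ball q r) by exact: ball_open.
split; first exact: sm_cst.
exists 0, `|c|, 0; split => // n [|v w] y _ _ /=; first by rewrite big_nil !mulr1.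
have -> : dws w ('D_v (cst c)) y = 0.
  elim: w v c => [|u w IH] v c /=; first by rewrite derive_cst.
  rewrite (_ : 'D_v (cst c) = cst 0); first exact: IH.
  by apply: funext => z; rewrite derive_cst.
by rewrite normr0 mul0r mulr0 !mul0r.
Qed.

Lemma an_on_common q r F G : an_on q r F -> an_on q r G -> exists m C K,
  [/\ 0 <= m, 0 <= C, 0 <= K, bnd (ball q r) F m C K & bnd (ball q r) G m C K].
Proof.
move=> [sF [m [C [K [m0 C0 K0 bF]]]]] [sG [m' [C' [K' [m'0 C'0 K'0 bG]]]]].
exists (m + m'), (C + C'), (K + K').
have h1 : m <= m + m' by rewrite lerDl. have h2 : C <= C + C' by rewrite lerDl.
have h3 : K <= K + K' by rewrite lerDl. have h4 : m' <= m + m' by rewrite lerDr.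
have h5 : C' <= C + C' by rewrite lerDr. have h6 : K' <= K + K' by rewrite lerDr.
split; [exact: addr_ge0|exact: addr_ge0|exact: addr_ge0| |].
  exact: (bnd_le m0 h1 C0 h2 K0 h3 bF).
exact: (bnd_le m'0 h4 C'0 h5 K'0 h6 bG).
Qed.

Lemma an_on_add q r F G : an_on q r F -> an_on q r G -> an_on q r (fun x => F x + G x).
Proof.
move=> aF aG; have [m [C [K [m0 C0 K0 bF bG]]]] := an_on_common aF aG.
have oU : open (ball q r) by exact: ball_open.
split; first exact: (sm_add oU aF.1 aG.1).
exists m, (C + C), K; split; [exact: m0|exact: addr_ge0|exact: K0|].
exact: (bnd_add oU aF.1 aG.1 bF bG).
Qed.

Lemma an_on_mul q r F G : an_on q r F -> an_on q r G -> an_on q r (fun x => F x * G x).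
Proof.
move=> aF aG; have [m [C [K [m0 C0 K0 bF bG]]]] := an_on_common aF aG.
have oU : open (ball q r) by exact: ball_open.
split; first exact: (sm_mul oU aF.1 aG.1).
exists (m + m), (C * C), K; split; [exact: addr_ge0|exact: mulr_ge0|exact: K0|].
exact: (bnd_mul oU aF.1 aG.1 bF bG).
Qed.

Lemma an_on_opp q r F : an_on q r F -> an_on q r (fun x => - F x).
Proof.
move=> aF; apply: an_on_ext (an_on_mul (an_on_cst q r (-1)) aF) => x _.
by rewrite /= mulN1r.
Qed.

Lemma an_on_sub q r F G : an_on q r F -> an_on q r G -> an_on q r (fun x => F x - G x).
Proof. by move=> aF aG; exact: (an_on_add aF (an_on_opp aG)). Qed.

Lemma curve q r rho v : 0 < r -> an_on q r rho -> rho q = 0 -> 'D_v rho q != 0 ->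
  exists e L, [/\ 0 < e, 0 <= L & forall u, `|u| < e -> exists phi : R -> R,
    [/\ phi 0 = 0, rho (q + u) = 0 -> phi 1 = 0 & forall s, -2 < s < 2 ->
      let y := q + s *: u + phi s *: v in
      [/\ ball q r y, rho y = 0, `|phi s| <= L * `|u|, 'D_v rho y != 0 &
       is_derive s 1 phi (- ('D_u rho y / 'D_v rho y))]]].
Proof.
move=> r0 [sF [m [C [K [m0 C0 K0 bF]]]]] rq; have qq : ball q r q by exact: ballxx.
rewrite neq_lt => /orP[d0|]; last exact: (curve_pos r0 m0 C0 K0 sF bF).
have d0' : 0 < 'D_(- v) rho q.
  by rewrite deriveNv ?oppr_gt0 //; exact: sm_diff sF qq.
have [e [L [e0 L0 H]]] := curve_pos r0 m0 C0 K0 sF bF rq d0'.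
exists e, L; split => // u /H[phi [p0 p1 pP]]; exists (fun s => - phi s); split.
- by rewrite p0 oppr0.
- by move/p1 ->; rewrite oppr0.
move=> s /pP; rewrite scalerN -scaleNr => -[by_ ry pL dy dp].
have dr := sm_diff sF by_; move: dy dp; rewrite !deriveNv // => dy dp.
split=> //; first by rewrite normrN.
  by rewrite -oppr_eq0.
by apply: is_derive_eq (is_deriveN dp) _; rewrite invrN mulrN opprK.
Qed.

Lemma is_derive_arc q u v (phi : R -> R) (s dphi : R) G :
  is_derive s 1 phi dphi -> differentiable G (q + s *: u + phi s *: v) ->
  is_derive s 1 (fun t => G (q + t *: u + phi t *: v))
    ('D_u G (q + s *: u + phi s *: v) + dphi * 'D_v G (q + s *: u + phi s *: v)).
Proof.
move=> dp dG; set y := q + _ + _ in dG *.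
have [dp1 dpE] := dp.
have dfp : differentiable phi s by apply/derivable1_diffP.
pose g (t : R) := q + t *: u + phi t *: v.
have dg : is_diff s g (0 + (fun h : R => h *: u) + (fun h : R => 'd phi s h *: v)).
  have i1 : is_diff s (fun t : R => t *: u) (fun h : R => h *: u) by exact: is_diff_scalel.
  have i2 : is_diff s (fun t : R => phi t *: v) (fun h : R => 'd phi s h *: v).
    by apply: DiffDef; [exact: differentiableZl|rewrite diffZl].
  exact: (is_diffD (is_diffD (is_diff_cst q s) i1) i2).
have dGg : differentiable G (g s) by [].
have [dgs dgE] := dg.
have dGc : differentiable (G \o g) s by exact: differentiable_comp.
have /derivableP : derivable (G \o g) s 1 by exact: diff_derivable.
rewrite (deriveE (1 : R) dGc) (diff_comp dgs dGg) /= dgE !fctE add0r scale1r.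
have -> : 'd phi s 1 = dphi by rewrite -deriveE.
by rewrite linearD linearZ /= -!deriveE.
Qed.

(* For v transversal to {rho = 0}, the derivation along the projection of u to
   the tangent space of the level sets of rho, parallel to v. *)
Definition tang rho v u F x := 'D_u F x - 'D_u rho x / 'D_v rho x * 'D_v F x.

Lemma sm_tang U rho v u F : open U -> sm U rho -> sm U F ->
  (forall x, U x -> 'D_v rho x != 0) -> sm U (tang rho v u F).
Proof.
move=> oU sr sF r0.
have s1 := sm_D u sF; have s2 := sm_D v sF; have s3 := sm_D u sr; have s4 := sm_D v sr.
exact: (sm_sub2 oU s1 (sm_mul oU (sm_div oU s3 s4 r0) s2)).
Qed.

Lemma tang_vanish q r rho v u F : 0 < r -> an_on q r rho -> rho q = 0 ->
  'D_v rho q != 0 -> differentiable F q ->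
  (\forall y \near q, rho y = 0 -> F y = 0) -> tang rho v u F q = 0.
Proof.
move=> r0 ar rq dv dF FM.
have [r1 /andP[r10 r1r] H1] := ball_shrink r0 FM.
have [e [L [e0 L0 H]]] := curve r10 (an_on_le r1r ar) rq dv.
pose k := e / (`|u| + 1) / 2.
have k0 : 0 < k by rewrite !divr_gt0 // ltr_pwDr.
have ke : `|k *: u| < e.
  rewrite normrZ gtr0_norm //.
  have kE : k * (`|u| + 1) = e / 2.
    by rewrite /k mulrAC divfK // gt_eqF // ltr_pwDr.
  apply: (@le_lt_trans _ _ (e / 2)); last by rewrite ltr_pdivrMr // ltr_pMr // ltr1n.
  by rewrite -kE; apply: ler_wpM2l; [exact: ltW|rewrite lerDl].
have [phi [p0 _ pP]] := H _ ke.

have := pP 0; rewrite oppr_lt0 !ltr0n => /(_ isT) [_ _ _ _].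
have y0 : q + 0 *: (k *: u) + phi 0 *: v = q by rewrite p0 !scale0r !addr0.
rewrite y0 => {}dp.
have := @is_derive_arc q (k *: u) v phi 0 _ F dp; rewrite y0 => /(_ dF) dA.
have : 'D_1 (fun t : R => F (q + t *: (k *: u) + phi t *: v)) 0 = 0.
  transitivity ('D_1 (cst 0 : R -> R) 0); last by rewrite derive_cst.
  apply: near_eq_derive.
  near=> t; have t2 : -2 < t < 2.
    near: t; have h0 : -2 < (0 : R) < 2 by apply/andP; split; lra.
    by have := near_shift_itv h0; apply: filterS => t; rewrite add0r.
  by have [b ry _ _ _] := pP t t2; apply: H1.
have [_ ->] := dA.
have dr : differentiable rho q by apply: sm_diff ar.1 _; exact: ballxx.
rewrite !deriveZv // => E; apply: (mulfI (lt0r_neq0 k0)); rewrite mulr0 /tang -E.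
by move: ('D_u F q) ('D_v F q) ('D_u rho q) ('D_v rho q)^-1 => a b c d; ring.
Unshelve. all: by end_near. Qed.

(* If all iterated tangential derivatives of F vanish at q, so does F on
   {rho = 0} near q: along the arcs above, the n-th derivative is bounded by
   n! C (B |u|)^n. *)
Lemma flat_vanish q r rho v F : 0 < r -> an_on q r rho -> an_on q r F ->
  rho q = 0 -> 'D_v rho q != 0 ->
  (forall u n, iter n (tang rho v u) F q = 0) ->
  \forall y \near q, rho y = 0 -> F y = 0.
Proof.
move=> r0 ar aF rq dv flat.
have qq : ball q r q by exact: ballxx.
pose d := `|'D_v rho q| / 2; have d0 : 0 < d by rewrite divr_gt0 // normr_gt0.
have [r1 /andP[r10 r1r] r1d] : exists2 r1, 0 < r1 <= r &
    forall y, ball q r1 y -> d <= `|'D_v rho y|.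
  have sD := sm_D v ar.1; have oU : open (ball q r) by exact: ball_open.
  have dl : d < `|'D_v rho q| by rewrite ltr_pdivrMr // ltr_pMr ?normr_gt0 // ltr1n.
  have := ball_shrink r0 (_ : \near q, d < `|'D_v rho q|).
  case; last by move=> r1 h1 h2; exists r1 => // y /h2/ltW.
  have := sm_continuous oU sD qq => /cvg_norm /cvgrPdist_lt /(_ (`|'D_v rho q| - d)).
  rewrite subr_gt0 dl => /(_ isT); apply: filterS => y.
  by rewrite ltr_norml => /andP[_]; rewrite ltrD2l ltrN2.
have oU : open (ball q r1) by exact: ball_open.
have ar1 := an_on_le r1r ar; have aF1 := an_on_le r1r aF.
set U := ball q r1 in oU r1d.
have dn0 y : U y -> 'D_v rho y != 0.
  by move/r1d; rewrite -normr_gt0; apply: lt_le_trans.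
have [sr [mr [Cr [Kr [mr0 Cr0 Kr0 br]]]]] := ar1.
have [sF [m [C [K [m0 C0 K0 bF]]]]] := aF1.
have Crv0 : 0 <= Cr * mr * Kr * `|v| by rewrite !mulr_ge0.
have mr10 : 0 <= mr + 1 by rewrite addr_ge0.
have [K' KK' bE] := bnd_inv oU (sm_D v sr) mr10 Crv0 Kr0 (bnd_D v br) d0 r1d.
have K'0 : 0 <= K' by exact: le_trans KK'.
pose K1 := K + K'; have K10 : 0 <= K1 by rewrite addr_ge0.
have K'K1 : K' <= K1 by rewrite lerDr.
have KrK1 : Kr <= K1 by exact: le_trans K'K1.
have h20 : 0 <= 2^-1 :> R by rewrite invr_ge0.
have d10 : 0 <= d^-1 by rewrite invr_ge0 ltW.
have sE := sm_inv oU (sm_D v sr) dn0.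
pose A := Cr * mr * Kr / d; have A0 : 0 <= A by rewrite !mulr_ge0.
pose mt := mr + 1 + 2^-1; have mt0 : 0 <= mt by rewrite !addr_ge0.
have btau u : bnd U (fun y => 'D_u rho y / 'D_v rho y) mt (A * `|u|) K1.
  have Cu0 : 0 <= Cr * mr * Kr * `|u| by rewrite !mulr_ge0.
  have b1 := bnd_le mr10 (lexx _) Cu0 (lexx _) Kr0 KrK1 (bnd_D u br).
  have b2 := bnd_le h20 (lexx _) d10 (lexx _) K'0 K'K1 bE.
  have := bnd_mul oU (sm_D u sr) sE b1 b2.
  by rewrite (_ : Cr * mr * Kr * `|u| / d = A * `|u|) // /A; ring.
pose a := mt + 1; pose B := 1 + A * `|v|.
have a0 : 0 <= a by rewrite addr_ge0.
have B0 : 0 <= B by rewrite addr_ge0 // mulr_ge0.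
have btang u G m1 C1 : 0 <= m1 -> 0 <= C1 -> sm U G -> bnd U G m1 C1 K1 ->
    bnd U (tang rho v u G) (m1 + a) (C1 * (m1 * (K1 * B * `|u|))) K1.
  move=> m10 C10 sG bG.
  have Q0 (z : V) : 0 <= C1 * m1 * K1 * `|z| by rewrite !mulr_ge0.
  have le1 : m1 + 1 <= m1 + a by rewrite lerD2l lerDr.
  have m110 : 0 <= m1 + 1 by rewrite addr_ge0.
  have b1 := bnd_le m110 le1 (Q0 u) (lexx _) K10 (lexx _) (bnd_D u bG).
  have b2 := bnd_mul oU (sm_mul oU (sm_D u sr) sE) (sm_D v sG) (btau u) (bnd_D v bG).
  have := bnd_sub oU (sm_D u sG) (sm_mul oU (sm_mul oU (sm_D u sr) sE) (sm_D v sG)) b1.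
  rewrite (_ : mt + (m1 + 1) = m1 + a) in b2; last by rewrite /a addrCA.
  move=> /(_ _ b2); rewrite (_ : C1 * m1 * K1 * `|u| + A * `|u| * (C1 * m1 * K1 * `|v|) =
     C1 * (m1 * (K1 * B * `|u|))) //.
  by rewrite /B; ring.
have siter u n : sm U (iter n (tang rho v u) F).
  elim: n => [|n IH]; first exact: sF.
  exact: (sm_tang u oU sr IH dn0).
pose M := m + a; have M0 : 0 <= M by rewrite addr_ge0.
(* Each tangential derivative raises the exponent by [a] and brings the factor m + n a, which is at
   most (n + 1)(m + a). The product of these factors gives n! times a geometric term, and the
   factorial is cancelled by the one in Taylor's formula. *)
have biter u n : exists2 Cn, 0 <= Cn <= C * (n`!%:R * (M * (K1 * B * `|u|)) ^+ n) &
    bnd U (iter n (tang rho v u) F) (m + n%:R * a) Cn K1.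
  elim: n => [|n [Cn /andP[Cn0 CnC] IH]].
    exists C; first by rewrite fact0 expr0 !mulr1 C0 lexx.
    rewrite mul0r addr0.
    exact: (bnd_le m0 (lexx _) C0 (lexx _) K0 (ltac:(by rewrite lerDl) : K <= K1) bF).
  have mn0 : 0 <= m + n%:R * a by rewrite addr_ge0 // mulr_ge0.
  exists (Cn * ((m + n%:R * a) * (K1 * B * `|u|))).
    apply/andP; split; first by rewrite !mulr_ge0.
    rewrite factS natrM exprS.
    have -> : C * (n.+1%:R * n`!%:R * (M * (K1 * B * `|u|) * (M * (K1 * B * `|u|)) ^+ n)) =
       C * (n`!%:R * (M * (K1 * B * `|u|)) ^+ n) * (n.+1%:R * M * (K1 * B * `|u|)) by ring.
    apply: ler_pM => //; first by rewrite !mulr_ge0.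
    apply: ler_wpM2r; first by rewrite !mulr_ge0.
    have nm0 : 0 <= n%:R * m by rewrite mulr_ge0.
    rewrite /M -natr1; move: nm0 a0; move: (n%:R : R) => nr nm0 a0.
    clear -nm0 a0; lra.
  have := btang u _ _ _ mn0 Cn0 (siter u n) IH.
  by have -> : m + n.+1%:R * a = m + n%:R * a + a by rewrite -natr1; ring.
have [e [L [e0 L0 H]]] := curve r10 ar1 rq dv.
have P0 : 0 < 2 * (M * (K1 * B)) + 1 by rewrite ltr_pwDr // !mulr_ge0.
pose e2 := Num.min e (2 * (M * (K1 * B)) + 1)^-1.
have e20 : 0 < e2 by rewrite lt_min e0 invr_gt0.
apply/nbhs_ballP; exists e2 => //= y.
rewrite -ball_normE /ball_ /= distrC lt_min => /andP[ye1 ye2] ry.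
pose u := y - q; have qu : q + u = y by rewrite /u addrC subrK.
have [phi [p0 p1 pP]] := H _ ye1.
move: p1; rewrite -/u qu => /(_ ry) p1.
have small : M * (K1 * B * `|u|) <= 2^-1.
  have q0 : 0 <= M * (K1 * B) by rewrite !mulr_ge0.
  rewrite mulrA; apply: le_trans (ler_wpM2l q0 (ltW ye2)) _.
  by rewrite ler_pdivrMr //; move: (M * (K1 * B)) q0 => X q0; clear -q0; lra.
have bound N : `|F y| <= C * 2^-1 ^+ N.+1.
  pose ph k (s : R) := iter k (tang rho v u) F (q + s *: u + phi s *: v).
  have itv (s : R) : 0 <= s <= 1 -> -2 < s < 2.
    by move=> /andP[s0 s1]; apply/andP; split; clear -s0 s1; lra.
  have h1 k (s : R) : (k <= N)%N -> 0 <= s <= 1 -> is_derive s 1 (ph k) (ph k.+1 s).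
    move=> kN /itv s2; have [b _ _ _ dp] := pP s s2.
    have dT := sm_diff (siter u k) b.
    by apply: is_derive_eq (is_derive_arc dp dT) _; rewrite /ph /tang mulNr.
  have h2 k : (k <= N)%N -> ph k 0 = 0.
    by move=> _; rewrite /ph p0 !scale0r !addr0; exact: flat.
  have h3 (s : R) : 0 <= s <= 1 -> `|ph N.+1 s| <= C * N.+1`!%:R * 2^-1 ^+ N.+1.
    move=> /itv s2; have [b _ _ _ _] := pP s s2.
    have [Cn /andP[_ CnC] bn] := biter u N.+1.
    have := bn 0 [::] _ isT b; rewrite /= big_nil !mulr1 => /le_trans; apply.
    apply: le_trans CnC _; rewrite mulrA; apply: ler_wpM2l; first by rewrite mulr_ge0.
    by apply: lerXn2r; rewrite ?nnegrE // !mulr_ge0.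
  have s1 : 0 <= (1 : R) <= 1 by rewrite ler01 lexx.
  have := taylor_flat h1 h2 h3 s1.
  rewrite expr1n mulr1 /ph /= p1 scale0r addr0 scale1r qu => /le_trans; apply.
  by rewrite mulrAC mulfK // pnatr_eq0 -lt0n fact_gt0.
apply/eqP; rewrite -normr_le0; apply/ler_addgt0Pl => eps eps0; rewrite addr0.
have : C * 2^-1 ^+ n.+1 @[n --> \oo] --> C * 0.
  apply: cvgMr; rewrite (cvg_shiftS (fun n => 2^-1 ^+ n : R)).
  have := @cvg_geometric R 1 2^-1.
  rewrite (_ : geometric 1 2^-1 = fun n => 2^-1 ^+ n); last first.
    by apply: funext => n; rewrite /= mul1r.
  by apply; rewrite ger0_norm // invf_lt1 // ltr1n.
rewrite mulr0 => /cvgrPdist_lt /(_ _ eps0) [N _ /(_ N (leqnn N))].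
rewrite /= sub0r normrN => /ltW; apply: le_trans; apply: le_trans (bound N) _.
exact: ler_norm.
Unshelve. all: by end_near. Qed.

End Flat.

Local Open Scope complex_scope.

(** * A real-valued norm on the complex numbers *)

Section CNorm.
Variable R : rcfType.
Implicit Types z : R[i].

(** The l1 norm: its values are real numbers, while the norm of [R[i]] takes values in [R[i]], and
    it is controlled componentwise. *)
Definition cn (z : R[i]) : R := `|complex.Re z| + `|complex.Im z|.

Lemma cn_ge0 z : 0 <= cn z. Proof. by rewrite addr_ge0. Qed.

Lemma cnD z z' : cn (z + z') <= cn z + cn z'.
Proof. by case: z z' => [a b] [c d]; rewrite /cn /= addrACA; apply: lerD; apply: ler_normD. Qed.

Lemma cnN z : cn (- z) = cn z.
Proof. by case: z => a b; rewrite /cn /= !normrN. Qed.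

Lemma cnM z z' : cn (z * z') <= cn z * cn z'.
Proof.
case: z z' => [a b] [c d]; rewrite /cn /=.
have h1 := ler_normB (a * c) (b * d); have h2 := ler_normD (a * d) (b * c).
apply: le_trans (lerD h1 h2) _; rewrite !normrM.
by rewrite le_eqVlt; apply/orP; left; apply/eqP; ring.
Qed.

Lemma cn_real (x : R) : cn x%:C = `|x|.
Proof. by rewrite /cn /= normr0 addr0. Qed.

Lemma cn_sum (I : Type) (s : seq I) (F : I -> R[i]) :
  cn (\sum_(i <- s) F i) <= \sum_(i <- s) cn (F i).
Proof.
elim: s => [|i s IH]; first by rewrite !big_nil /cn /= normr0 addr0.
by rewrite !big_cons; apply: le_trans (cnD _ _) _; rewrite lerD2l.
Qed.

Lemma cn_prod (I : Type) (s : seq I) (F : I -> R[i]) :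
  cn (\prod_(i <- s) F i) <= \prod_(i <- s) cn (F i).
Proof.
elim: s => [|i s IH]; first by rewrite !big_nil /cn /= normr0 normr1 addr0.
rewrite !big_cons; apply: le_trans (cnM _ _) _.
by apply: ler_wpM2l => //; exact: cn_ge0.
Qed.

Lemma Re_le_cn z : `|complex.Re z| <= cn z. Proof. by rewrite lerDl. Qed.
Lemma Im_le_cn z : `|complex.Im z| <= cn z. Proof. by rewrite lerDr. Qed.
Lemma cn0 : cn 0 = 0. Proof. by rewrite /cn /= normr0 addr0. Qed.

Lemma cn_eq0 z : cn z = 0 -> z = 0.
Proof.
case: z => a b /eqP; rewrite /cn /= paddr_eq0 // !normr_eq0.
by move=> /andP[/eqP -> /eqP ->].
Qed.

End CNorm.

(** * Polynomials as formal sums of products of linear forms *)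

Section FormalSum.
Variables (R : realType) (V : normedModType R).
Notation C := R[i].
Implicit Types (l : V -> C) (ls : seq (V -> C)) (x y v : V) (w : seq V).

Definition lform (k : R) l := (exists A B : {linear V -> R},
  [/\ continuous A, continuous B & l = fun v => A v +i* B v]) /\
  forall v, cn (l v) <= k * `|v|.

Definition isD y v (F : V -> C) (d : C) :=
  is_derive y v (fun y => complex.Re (F y)) (complex.Re d) /\
  is_derive y v (fun y => complex.Im (F y)) (complex.Im d).

Lemma isD_cst y v c : isD y v (fun=> c) 0.
Proof. by split; exact: is_derive_cst. Qed.

Lemma isD_add y v F G d e : isD y v F d -> isD y v G e ->
  isD y v (fun y => F y + G y) (d + e).
Proof.
move=> [f1 f2] [g1 g2]; split.
  have := is_deriveD f1 g1; congr is_derive; last by case: d e {f1 f2 g1 g2} => [? ?] [? ?].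
  by apply: funext => z; rewrite !fctE; case: (F z) (G z) => [? ?] [? ?].
have := is_deriveD f2 g2; congr is_derive; last by case: d e {f1 f2 g1 g2} => [? ?] [? ?].
by apply: funext => z; rewrite !fctE; case: (F z) (G z) => [? ?] [? ?].
Qed.

Lemma isD_mul y v F G d e : isD y v F d -> isD y v G e ->
  isD y v (fun y => F y * G y) (d * G y + F y * e).
Proof.
move=> [f1 f2] [g1 g2]; split.
  have := is_deriveB (is_deriveM f1 g1) (is_deriveM f2 g2); congr is_derive.
    by apply: funext => z; rewrite !fctE; case: (F z) (G z) => [? ?] [? ?].
  case: d e (F y) (G y) {f1 f2 g1 g2} => [? ?] [? ?] [? ?] [? ?].
  by rewrite /GRing.scale /=; ring.
have := is_deriveD (is_deriveM f1 g2) (is_deriveM f2 g1); congr is_derive.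
  by apply: funext => z; rewrite !fctE; case: (F z) (G z) => [? ?] [? ?].
case: d e (F y) (G y) {f1 f2 g1 g2} => [? ?] [? ?] [? ?] [? ?].
by rewrite /GRing.scale /=; ring.
Qed.

Definition csm (U : set V) (F : V -> C) :=
  sm U (fun y => complex.Re (F y)) /\ sm U (fun y => complex.Im (F y)).

Lemma csm_ext (U : set V) F G : open U -> (forall y, U y -> F y = G y) ->
  csm U F -> csm U G.
Proof.
move=> oU FG [h1 h2]; split.
  by apply: (sm_ext oU _ h1) => y Uy; rewrite FG.
by apply: (sm_ext oU _ h2) => y Uy; rewrite FG.
Qed.

Lemma csm_cst (U : set V) c : open U -> csm U (fun=> c).
Proof. by move=> oU; split; exact: (sm_cst _ oU). Qed.

Lemma csm_add (U : set V) F G : open U -> csm U F -> csm U G -> csm U (fun y => F y + G y).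
Proof.
move=> oU [f1 f2] [g1 g2]; split.
  apply: (sm_ext oU _ (sm_add oU f1 g1)) => y _.
  by case: (F y) (G y) => [? ?] [? ?].
apply: (sm_ext oU _ (sm_add oU f2 g2)) => y _.
by case: (F y) (G y) => [? ?] [? ?].
Qed.

Lemma csm_mul (U : set V) F G : open U -> csm U F -> csm U G -> csm U (fun y => F y * G y).
Proof.
move=> oU [f1 f2] [g1 g2]; split.
  apply: (sm_ext oU _ (sm_sub2 oU (sm_mul oU f1 g1) (sm_mul oU f2 g2))) => y _.
  by case: (F y) (G y) => [? ?] [? ?].
apply: (sm_ext oU _ (sm_add oU (sm_mul oU f1 g2) (sm_mul oU f2 g1))) => y _.
by case: (F y) (G y) => [? ?] [? ?].
Qed.

Lemma is_derive_linear (D : {linear V -> R}) x y v : continuous D ->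
  is_derive y v (fun y => D (y - x)) (D v).
Proof.
move=> Dc.
have dD : differentiable D y by exact: linear_differentiable.
have i1 : is_derive y v (D : V -> R) (D v).
  by have := derivableP (diff_derivable (v := v) dD); rewrite deriveE // diff_lin.
have := is_deriveB i1 (is_derive_cst (D x) y v); rewrite subr0.
by congr is_derive; apply: funext => z; rewrite !fctE linearB.
Qed.

Lemma sm_linear (U : set V) (D : {linear V -> R}) x : continuous D ->
  sm U (fun y => D (y - x)).
Proof.
move=> Dc; pose S F := F = (fun y => D (y - x)) \/ exists c : R, F = cst c.
have dc (c : R) v : 'D_v (cst c : V -> R) = cst 0 by apply: funext => y; rewrite derive_cst.
have dD v : 'D_v (fun y => D (y - x)) = cst (D v).
  by apply: funext => y; have [_ ->] := is_derive_linear x y v Dc.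
apply: (@sm_coind _ _ U S) => [F|F v|]; last by left.
  case=> [->|[c ->]]; split.
  - move=> y _; have -> : (fun y => D (y - x)) = (D : V -> R) - cst (D x).
      by apply: funext => z; rewrite !fctE linearB.
    by apply: differentiableB; [exact: linear_differentiable|exact: differentiable_cst].
  - by move=> y _ u v; rewrite !dD !derive_cst.
  - by move=> y _; exact: differentiable_cst.
  - by move=> y _ u v; rewrite !dc !derive_cst.
by case=> [->|[c ->]]; right; [exists (D v); exact: dD|exists 0; exact: dc].
Qed.

Lemma csm_lform k (U : set V) x l : lform k l -> csm U (fun y => l (y - x)).
Proof. by move=> [[A [B [Ac Bc ->]]] _]; split; exact: sm_linear. Qed.

Lemma isD_lform k x y v l : lform k l -> isD y v (fun y => l (y - x)) (l v).
Proof.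
move=> [[A [B [Ac Bc ->]]] _] /=.
by split; exact: is_derive_linear.
Qed.

Fixpoint rems (T : Type) (s : seq T) : seq (T * seq T) :=
  if s is a :: s' then (a, s') :: [seq (p.1, a :: p.2) | p <- rems s'] else [::].

Lemma isD_prod x y v ls : (forall l, List.In l ls -> exists k, lform k l) ->
  isD y v (fun y => \prod_(l <- ls) l (y - x))
    (\sum_(p <- rems ls) p.1 v * \prod_(l <- p.2) l (y - x)).
Proof.
elim: ls => [|l ls IH] lsP.
  have := isD_cst y v 1; congr isD; last by rewrite big_nil.
  by apply: funext => z; rewrite big_nil.
have [k lk] := lsP l (or_introl erefl).
have {}IH := IH (fun l h => lsP l (or_intror h)).
have := isD_mul (isD_lform x y v lk) IH; congr isD.
  by apply: funext => z; rewrite big_cons.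
rewrite /= big_cons /= big_map /=; congr (_ + _).
rewrite mulr_sumr; apply: eq_bigr => p _.
by rewrite big_cons mulrCA.
Qed.

(* A formal sum of products of linear forms, and its formal derivative. *)
Definition fsum := seq (C * seq (V -> C)).
Definition ev (s : fsum) x y : C := \sum_(p <- s) p.1 * \prod_(l <- p.2) l (y - x).
Definition fD v (s : fsum) : fsum :=
  flatten [seq [seq (p.1 * p'.1 v, p'.2) | p' <- rems p.2] | p <- s].
Definition wf k (s : fsum) := forall p, List.In p s -> forall l, List.In l p.2 -> lform k l.

Lemma isD_ev k s x y v : wf k s -> isD y v (ev s x) (ev (fD v s) x y).
Proof.
rewrite /ev /fD; elim: s => [|[c ls] s IH] sP.
  have := isD_cst y v 0; congr isD; last by rewrite big_nil.
  by apply: funext => z; rewrite big_nil.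
have {}IH := IH (fun p h => sP p (or_intror h)).
have h1 : isD y v (fun y => \prod_(l <- ls) l (y - x)) _ :=
  @isD_prod x y v ls (fun l h => ex_intro _ k (sP _ (or_introl erefl) l h)).
have := isD_add (isD_mul (isD_cst y v c) h1) IH; congr isD.
  by apply: funext => z; rewrite big_cons.
rewrite /= big_cat big_map /= mul0r add0r mulr_sumr; congr (_ + _).
by apply: eq_bigr => p _; rewrite mulrA.
Qed.

Lemma rems_size (T : Type) (s : seq T) p : List.In p (rems s) -> size p.2 = (size s).-1.
Proof.
elim: s p => //= a s IH p [<- //|/List.in_map_iff[p' [<- h]]] /=.
by rewrite (IH _ h); case: s h {IH}.
Qed.

Lemma rems_In (T : Type) (s : seq T) p a : List.In p (rems s) ->
  List.In p.1 s /\ (List.In a p.2 -> List.In a s).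
Proof.
elim: s p a => //= b s IH p a [<- /=|/List.in_map_iff[p' [<- /= h]]].
  by split; [left|right].
have [h1 h2] := IH p' a h; split; first by right.
by case=> [->|/h2]; [left|right].
Qed.

Lemma size_rems (T : Type) (s : seq T) : size (rems s) = size s.
Proof. by elim: s => //= a s IH; rewrite size_map IH. Qed.

Lemma wf_fD k v s : wf k s -> wf k (fD v s).
Proof.
move=> sP p /List.in_concat[q [/List.in_map_iff[p' [<- p's]]]].
move=> /List.in_map_iff[p2 [<- /= h]] l hl.
by apply: (sP _ p's); exact: (rems_In l h).2.
Qed.

Variables (k r : R).
Hypotheses (k0 : 0 <= k) (r0 : 0 <= r).

(** Bound for the derivatives of order [j] of a product of d linear forms of norm at most [k], where
    k |y - x| is at most [r]: a falling factorial counts the forms removed, and each removed form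
    costs [k] in place of [r]. *)
Definition wt j (p : C * seq (V -> C)) : R :=
  cn p.1 * ((size p.2) ^_ j)%:R * r ^+ (size p.2 - j) * k ^+ j.
Definition wts j (s : fsum) : R := \sum_(p <- s) wt j p.

Lemma wt_ge0 j p : 0 <= wt j p.
Proof. by rewrite !mulr_ge0 ?exprn_ge0 // cn_ge0. Qed.

Lemma sumr_In (T : Type) (s : seq T) (f g : T -> R) :
  (forall p, List.In p s -> f p <= g p) -> \sum_(p <- s) f p <= \sum_(p <- s) g p.
Proof.
elim: s => [|a s IH] h; first by rewrite !big_nil.
rewrite !big_cons; apply: lerD; first by apply: h; left.
by apply: IH => p hp; apply: h; right.
Qed.

Lemma wts_fD v j s : wf k s -> wts j (fD v s) <= wts j.+1 s * `|v|.
Proof.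
rewrite /wts /fD; elim: s => [|[c ls] s IH] sP; first by rewrite /= !big_nil mul0r.
rewrite /= big_cat big_cons mulrDl; apply: lerD; last first.
  by apply: IH => p h; apply: sP; right.
rewrite big_map /=; set d := size ls.
apply: (@le_trans _ _ (\sum_(p <- rems ls)
    cn c * (k * `|v|) * (d.-1 ^_ j)%:R * r ^+ (d.-1 - j) * k ^+ j)).
  apply: sumr_In => p hp; rewrite /wt /= (rems_size hp).
  apply: ler_wpM2r; first by rewrite exprn_ge0.
  apply: ler_wpM2r; first by rewrite exprn_ge0.
  apply: ler_wpM2r => //; apply: le_trans (cnM _ _) _.
  apply: ler_wpM2l; first exact: cn_ge0.
  have [h1 _] := rems_In (fun=> 0) hp.
  by have [_] := sP _ (or_introl erefl) _ h1; apply.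
rewrite big_const_seq count_predT size_rems iter_addr_0 -/d /wt /= -/d.
have [->|d0] := posnP d; first by rewrite mulr0n !mulr_ge0 ?exprn_ge0 ?cn_ge0.
rewrite -mulr_natl ffactnS natrM -[(d - j.+1)%N](_ : (d.-1 - j)%N = _); last first.
  by rewrite -subn1 -subnDA add1n.
by rewrite exprS le_eqVlt; apply/orP; left; apply/eqP; ring.
Qed.

Lemma cn_ev s x y : wf k s -> k * `|y - x| <= r -> cn (ev s x y) <= wts 0 s.
Proof.
move=> sP yr; apply: le_trans (cn_sum _ _) _; apply: sumr_In => p hp.
have -> : wt 0 p = cn p.1 * r ^+ size p.2 by rewrite /wt ffactn0 subn0 !mulr1.
apply: le_trans (cnM _ _) _.
apply: ler_wpM2l; first exact: cn_ge0.
apply: le_trans (cn_prod _ _) _; have := sP p hp.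
elim: (p.2) => [|l ls IH] lP; first by rewrite big_nil expr0.
rewrite big_cons /= exprS; apply: ler_pM; [exact: cn_ge0| | |].
- by apply: prodr_ge0 => i _; exact: cn_ge0.
- by have [_ h] := lP l (or_introl erefl); apply: le_trans (h _) yr.
- by apply: IH => l' h; apply: lP; right.
Qed.

Fixpoint fDs w s := if w is v :: w' then fDs w' (fD v s) else s.

Lemma dws_ev w s x : wf k s ->
  dws w (fun y => complex.Re (ev s x y)) = (fun y => complex.Re (ev (fDs w s) x y)) /\
  dws w (fun y => complex.Im (ev s x y)) = (fun y => complex.Im (ev (fDs w s) x y)).
Proof.
elim: w s => //= v w IH s sP; have [h1 h2] := IH _ (wf_fD (v := v) sP).
rewrite -h1 -h2; split; congr dws; apply: funext => y;
  by have [[_ e1] [_ e2]] := @isD_ev k s x y v sP.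
Qed.

Lemma wf_fDs w s : wf k s -> wf k (fDs w s).
Proof. by elim: w s => //= v w IH s sP; exact: (IH _ (wf_fD sP)). Qed.

Lemma wts_fDs w s : wf k s -> wts 0 (fDs w s) <= wts (size w) s * \prod_(v <- w) `|v|.
Proof.
move=> sP; rewrite -[X in wts X s]addn0; move: 0%N => j.
elim: w s j sP => [|v w IH] s j sP; first by rewrite /= big_nil mulr1.
rewrite /= big_cons; apply: le_trans (IH _ _ (wf_fD (v := v) sP)) _.
rewrite mulrA; apply: ler_wpM2r; first exact: prod_norm_ge0.
exact: wts_fD.
Qed.

Lemma csm_ev s x : wf k s -> csm setT (ev s x).
Proof.
have oT : open (setT : set V) by exact: openT.
rewrite /ev; elim: s => [|[c ls] s IH] sP.
  by apply: (csm_ext oT _ (csm_cst 0 oT)) => y _; rewrite big_nil.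
have {}IH := IH (fun p h => sP p (or_intror h)).
have hp : csm setT (fun y => \prod_(l <- ls) l (y - x)).
  have := sP _ (or_introl erefl) => /= {IH}.
  elim: ls {sP} => [|l ls IH] lP.
    by apply: (csm_ext oT _ (csm_cst 1 oT)) => y _; rewrite big_nil.
  have {}IH := IH (fun l' h => lP l' (or_intror h)).
  have := csm_mul oT (csm_lform setT x (lP l (or_introl erefl))) IH.
  by apply: (csm_ext oT) => y _; rewrite big_cons.
apply: (csm_ext oT _ (csm_add oT (csm_mul oT (csm_cst c oT) hp) IH)) => y _.
by rewrite big_cons.
Qed.

End FormalSum.

(** * From unconditionally convergent power series to Cauchy estimates *)

Section Bridge.
Variables (R : realType) (V : normedModType R).
Notation C := R[i].
Variables (n : nat) (L : 'I_n.+1 -> V -> C) (k : R).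
Hypotheses (k0 : 0 < k) (HL : forall i, lform k (L i)).
Local Notation midx := {ffun 'I_n.+1 -> nat}.
Variables (c : midx -> C) (F : V -> C) (x hs : V) (s e : R).
Hypotheses (s0 : 0 < s) (e0 : 0 < e) (hsL : forall i, L i hs = s%:C) (hse : `|hs| < e).

Let mono (a : midx) (h : V) : C := \prod_(i < n.+1) L i h ^+ a i.

Hypothesis Hsum : forall h, `|h| < e -> forall d, 0 < d -> exists A0 : seq midx,
  forall A, uniq A -> {subset A0 <= A} ->
  cn (F (x + h) - \sum_(a <- A) c a * mono a h) <= d.

Let deg (a : midx) := (\sum_(i < n.+1) a i)%N.
Let lst (a : midx) : seq (V -> C) := flatten [seq nseq (a i) (L i) | i <- enum 'I_n.+1].

Lemma lst_prod a h : \prod_(l <- lst a) l h = mono a h.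
Proof.
rewrite /lst /mono big_flatten big_map big_enum /=; apply: eq_bigr => i _.
by rewrite big_nseq -Monoid.iteropE /=; elim: (a i) => //= m ->; rewrite exprS.
Qed.

Lemma lst_size a : size (lst a) = deg a.
Proof.
rewrite size_flatten /shape -map_comp sumnE big_map big_enum /=.
by apply: eq_bigr => i _; rewrite /= size_nseq.
Qed.

Lemma lst_lform a l : List.In l (lst a) -> lform k l.
Proof.
move=> /List.in_concat[q [/List.in_map_iff[i [<- _]]]].
by elim: (a i) => //= m IH [<-|/IH].
Qed.

(** At [hs] every form takes the value [s]. Adding one multi-index to a sufficiently large finite
    set changes the sum by a single term, which is thus at most 1/2 + 1/2; the finitely many
    multi-indices of that set are bounded by their sum. *)
Lemma coef_bound : exists2 B, 0 <= B & forall a, cn (c a) * s ^+ deg a <= B.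
Proof.
have [A0 HA0] := Hsum hse (divr_gt0 ltr01 (ltr0n R 2)).
have A0u : uniq (undup A0) by exact: undup_uniq.
have sub0 : {subset A0 <= undup A0} by move=> a; rewrite mem_undup.
have cnc a : cn (c a * mono a hs) = cn (c a) * s ^+ deg a.
  have -> : mono a hs = (s ^+ deg a)%:C.
    rewrite /mono /deg -prodrXr rmorph_prod; apply: eq_bigr => i _.
    by rewrite hsL rmorphXn.
  have sd : 0 <= s ^+ deg a by rewrite exprn_ge0 // ltW.
  case: (c a) => u v; rewrite /cn /= !mulr0 subr0 add0r !normrM (ger0_norm sd).
  by rewrite mulrDl.
exists (1 + \sum_(a <- undup A0) cn (c a) * s ^+ deg a).
  rewrite addr_ge0 // big_seq; apply: sumr_ge0 => a _.
  by rewrite mulr_ge0 ?cn_ge0 // exprn_ge0 // ltW.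
move=> a; have P0 b : 0 <= cn (c b) * s ^+ deg b.
  by rewrite mulr_ge0 ?cn_ge0 // exprn_ge0 // ltW.
have [aA|aA] := boolP (a \in undup A0).
  rewrite (big_rem a) //= addrCA lerDl addr_ge0 //.
  by apply: sumr_ge0.
have h1 := HA0 _ A0u sub0.
have h2 : cn (F (x + hs) - \sum_(b <- a :: undup A0) c b * mono b hs) <= 1 / 2.
  apply: HA0; first by rewrite /= aA.
  by move=> b /sub0 h; rewrite inE h orbT.
rewrite -cnc -[c a * _]opprK cnN.
have -> : - (c a * mono a hs) =
   (F (x + hs) - \sum_(b <- a :: undup A0) c b * mono b hs)
   + - (F (x + hs) - \sum_(b <- undup A0) c b * mono b hs).
  by rewrite big_cons; ring.
apply: le_trans (cnD _ _) _; rewrite cnN; apply: le_trans (lerD h2 h1) _.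
have -> : 1 / 2 + 1 / 2 = 1 :> R by lra.
by rewrite lerDl sumr_ge0.
Qed.

Let fN N (a : {ffun 'I_n.+1 -> 'I_N.+1}) : midx := [ffun i => nat_of_ord (a i)].
Let fsN N : fsum V := [seq (c (fN a), lst (fN a)) | a <- enum {ffun 'I_n.+1 -> 'I_N.+1}].

Lemma fsN_wf N : wf k (fsN N).
Proof. by move=> p /List.in_map_iff[a [<- _]] l; exact: lst_lform. Qed.

Lemma binom_le d j : ('C(d, j) <= 2 ^ d)%N.
Proof.
elim: d j => [|d IH] [|j] //; first by rewrite bin0 expn_gt0.
by rewrite binS expnS mul2n -addnn leq_add.
Qed.

(** One factor 2 pays for bounding the binomial coefficient by 2^d; the other leaves the factor
    2^(-d), so that the sum over all multi-indices is at most 2^(n+1). *)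
Let r : R := s / 4.

Lemma r_gt0 : 0 < r. Proof. by rewrite divr_gt0. Qed.

Lemma wts_bound : exists2 B, 0 <= B & forall N j, wts k r j (fsN N) <= B * rise 1 j * (k / r) ^+ j.
Proof.
have [B B0 cB] := coef_bound; exists (B * 2 ^+ n.+1); first by rewrite mulr_ge0 ?exprn_ge0.
move=> N j.
have r0 := r_gt0.
have risej : rise 1 j = j`!%:R :> R.
  have gen m : rise (m.+1%:R : R) j * m`!%:R = (m + j)`!%:R.
    elim: j m => [|j IH] m; first by rewrite addn0 mul1r.
    by rewrite /= natr1 addnS -addSn -(IH m.+1) factS natrM; ring.
  by have := gen 0%N; rewrite fact0 mulr1 add0n.
have kr0 : 0 <= k / r by rewrite divr_ge0 // ltW.
have term a : wt k r j (c a, lst a) <= B * rise 1 j * (k / r) ^+ j * 2^-1 ^+ deg a.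
  rewrite /wt /= lst_size; set d := deg a.
  have [dj|jd] := ltnP d j.
    rewrite ffact_small // !(mulr0, mul0r) !mulr_ge0 ?exprn_ge0 //.
    - by apply: rise_ge0.
    - by rewrite invr_ge0.
  have e1 : r ^+ (d - j) * k ^+ j = r ^+ d * (k / r) ^+ j.
    have -> : r ^+ d = r ^+ (d - j) * r ^+ j by rewrite -exprD subnK.
    have rn : r ^+ j != 0 by rewrite expf_neq0 // gt_eqF.
    rewrite (expr_div_n k r j); move: rn; move: (r ^+ (d - j)) (r ^+ j) (k ^+ j) => a1 b1 c1 rn.
    by field.
  rewrite -mulrA e1.
  have e2 : (d ^_ j)%:R <= 2 ^+ d * rise 1 j :> R.
    by rewrite risej -bin_ffact natrM ler_wpM2r // -natrX ler_nat binom_le.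
  have rj : 0 <= rise 1 j :> R by exact: rise_ge0.
  have krj : 0 <= (k / r) ^+ j by rewrite exprn_ge0.
  apply: (@le_trans _ _ (cn (c a) * (2 ^+ d * rise 1 j * (r ^+ d * (k / r) ^+ j)))).
    rewrite -[leLHS]mulrA; apply: ler_wpM2l; first exact: cn_ge0.
    apply: ler_wpM2r => //; apply: mulr_ge0 => //.
    by apply: exprn_ge0; apply: ltW.
  have -> : cn (c a) * (2 ^+ d * rise 1 j * (r ^+ d * (k / r) ^+ j)) =
     cn (c a) * (2 * r) ^+ d * (rise 1 j * (k / r) ^+ j) by rewrite (exprMn_comm d (mulrC 2 r)); ring.
  have -> : B * rise 1 j * (k / r) ^+ j * 2^-1 ^+ d =
     B * 2^-1 ^+ d * (rise 1 j * (k / r) ^+ j) by ring.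
  apply: ler_wpM2r; first by rewrite mulr_ge0.
  have -> : 2 * r = s * 2^-1 by rewrite /r; lra.
  rewrite exprMn mulrA; apply: ler_wpM2r; first by rewrite exprn_ge0 // invr_ge0.
  exact: cB.
rewrite /wts big_map big_enum /=.
apply: le_trans (ler_sum _ (fun a _ => term (fN a))) _.
rewrite -mulr_sumr.
have -> : B * 2 ^+ n.+1 * rise 1 j * (k / r) ^+ j = B * rise 1 j * (k / r) ^+ j * 2 ^+ n.+1 by ring.
apply: ler_wpM2l; first by rewrite !mulr_ge0 ?exprn_ge0 // rise_ge0.
have -> : \sum_(a : {ffun 'I_n.+1 -> 'I_N.+1}) 2^-1 ^+ deg (fN a) =
    \prod_(i < n.+1) \sum_(j < N.+1) 2^-1 ^+ j :> R.
  rewrite (bigA_distr_bigA (fun (i : 'I_n.+1) (j : 'I_N.+1) => 2^-1 ^+ j : R)) /=.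
  apply: eq_bigr => a _.
  by rewrite /deg -prodrXr; apply: eq_bigr => i _; rewrite ffunE.
rewrite prodr_const card_ord; apply: lerXn2r; rewrite ?nnegrE //.
  by apply: sumr_ge0 => i _; rewrite exprn_ge0 // invr_ge0.
elim: N => [|N IH]; first by rewrite big_ord_recl big_ord0 expr0 addr0 ler1n.
rewrite big_ord_recl expr0 /=.
have -> : \sum_(i < N.+1) 2^-1 ^+ bump 0 i = 2^-1 * \sum_(i < N.+1) 2^-1 ^+ i :> R.
  by rewrite mulr_sumr; apply: eq_bigr => i _; rewrite /bump /= add1n exprS.
by move: IH; move: (\sum_(i < _) _) => S h; lra.
Qed.

Lemma fsN_cvg h : `|h| < e ->
  (complex.Re (ev (fsN N) x (x + h)) @[N --> \oo] --> complex.Re (F (x + h))) /\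
  (complex.Im (ev (fsN N) x (x + h)) @[N --> \oo] --> complex.Im (F (x + h))).
Proof.
move=> he.
have evE N : ev (fsN N) x (x + h) =
    \sum_(a <- [seq fN a | a <- enum {ffun 'I_n.+1 -> 'I_N.+1}]) c a * mono a h.
  rewrite /ev !big_map; apply: eq_bigr => a _ /=.
  by rewrite -lst_prod; congr (_ * _); apply: eq_bigr => l _; rewrite addrC addKr.
have cl d : 0 < d -> \forall N \near \oo, cn (F (x + h) - ev (fsN N) x (x + h)) <= d.
  move=> d0; have [A0 HA0] := Hsum he d0.
  exists (\sum_(a <- A0) deg a)%N => // N /= degN; rewrite evE; apply: HA0.
    rewrite map_inj_in_uniq ?enum_uniq // => a b _ _ /ffunP ab; apply/ffunP => i.
    by apply: val_inj; have := ab i; rewrite !ffunE.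
  move=> a aA0; have aN i : (a i < N.+1)%N.
    rewrite ltnS; apply: leq_trans degN; rewrite (big_rem a) //=.
    by apply: leq_trans (leq_addr _ _); rewrite /deg (bigD1 i) //= leq_addr.
  apply/mapP; exists [ffun i => Ordinal (aN i)]; first by rewrite mem_enum.
  by apply/ffunP => i; rewrite !ffunE.
split; apply/cvgrPdist_le => d /cl; apply: filterS => N; apply: le_trans.
  have -> : forall a b : C, complex.Re a - complex.Re b = complex.Re (a - b).
    by case=> [? ?] [? ?].
  exact: Re_le_cn.
have -> : forall a b : C, complex.Im a - complex.Im b = complex.Im (a - b).
  by case=> [? ?] [? ?].
exact: Im_le_cn.
Qed.

(** Serves the real and the holomorphic case alike, the coordinates being given as complex-valued
    real-linear forms. The series is the limit of its truncations to exponents at most N, which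
    satisfy uniform estimates; the Cauchy-Riemann equations hold for each truncation and pass to the
    limit. *)
Theorem series_an : exists2 d, 0 < d &
  [/\ an_on x d (fun y => complex.Re (F y)), an_on x d (fun y => complex.Im (F y)) &
   forall u v, (forall i, L i u = 'i * L i v) -> forall y, ball x d y ->
     'D_u (fun y => complex.Re (F y)) y = - 'D_v (fun y => complex.Im (F y)) y /\
     'D_u (fun y => complex.Im (F y)) y = 'D_v (fun y => complex.Re (F y)) y].
Proof.
have r0 := r_gt0; pose d := Num.min e (r / k).
have d0 : 0 < d by rewrite lt_min e0 divr_gt0.
have [B B0 HB] := wts_bound; exists d; first exact: d0.
have bd y : ball x d y -> `|y - x| < e /\ k * `|y - x| <= r.
  rewrite -ball_normE /ball_ /= distrC lt_min => /andP[h1 h2]; split => //.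
  by rewrite mulrC -ler_pdivlMr // ltW.
have oT : open (setT : set V) by exact: openT.
have kr0 : 0 <= k / r by rewrite divr_ge0 // ltW.
have bnds N w y : ball x d y ->
   cn (ev (fDs w (fsN N)) x y) <= B * rise 1 (size w) * (k / r) ^+ size w * \prod_(v <- w) `|v|.
  have wfN : wf k (fDs w (fsN N)) by apply: wf_fDs; exact: fsN_wf.
  move=> /bd[_ h]; apply: le_trans (cn_ev wfN h) _.
  apply: le_trans (wts_fDs (ltW k0) (ltW r0) w (@fsN_wf N)) _.
  by apply: ler_wpM2r; [exact: prod_norm_ge0|exact: HB].
have smU N : sm (ball x d) (fun y => complex.Re (ev (fsN N) x y)) /\
    sm (ball x d) (fun y => complex.Im (ev (fsN N) x y)).
  by have [h1 h2] := csm_ev x (@fsN_wf N); split; [exact: sm_sub h1|exact: sm_sub h2].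
have bRe N : bnd (ball x d) (fun y => complex.Re (ev (fsN N) x y)) 1 B (k / r).
  move=> m w y _ Uy; have [-> _] := dws_ev w x (@fsN_wf N).
  exact: le_trans (Re_le_cn _) (bnds N w y Uy).
have bIm N : bnd (ball x d) (fun y => complex.Im (ev (fsN N) x y)) 1 B (k / r).
  move=> m w y _ Uy; have [_ ->] := dws_ev w x (@fsN_wf N).
  exact: le_trans (Im_le_cn _) (bnds N w y Uy).
have cv y : ball x d y ->
  (complex.Re (ev (fsN N) x y) @[N --> \oo] --> complex.Re (F y)) /\
  (complex.Im (ev (fsN N) x y) @[N --> \oo] --> complex.Im (F y)).
  by move=> /bd[h _]; have := fsN_cvg h; rewrite addrC subrK.
have [sR bR cR] := limit_sm ler01 B0 kr0 (fun N => (smU N).1) bRe (fun y Uy => (cv y Uy).1).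
have [sI bI cI] := limit_sm ler01 B0 kr0 (fun N => (smU N).2) bIm (fun y Uy => (cv y Uy).2).
split; [split; first exact: sR|split; first exact: sI|].
- by exists 1, B, (k / r); split; [exact: ler01|exact: B0|exact: kr0|assumption].
- by exists 1, B, (k / r); split; [exact: ler01|exact: B0|exact: kr0|assumption].
move=> u v uv y Uy.
have key N : ev (fD u (fsN N)) x y = 'i * ev (fD v (fsN N)) x y.
  rewrite /ev /fD !big_flatten /= !big_map mulr_sumr; apply: eq_bigr => a _.
  rewrite !big_map mulr_sumr.
  have H p : List.In p (rems (lst (fN a))) -> p.1 u = 'i * p.1 v.
    move=> hp; have [h1 _] := rems_In (fun=> 0) hp.
    have : forall l, List.In l (lst (fN a)) -> l u = 'i * l v.
      move=> l /List.in_concat[q [/List.in_map_iff[i [<- _]]]].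
      by elim: (fN a i) => //= m IH [<-|/IH].
    exact.
  elim: (rems _) H => [|p q IH] H; first by rewrite !big_nil.
  rewrite !big_cons IH; last by move=> p' h; apply: H; right.
  by rewrite (H p (or_introl erefl)) /=; congr (_ + _); ring.
have e1 z : forall N, 'D_z (fun y => complex.Re (ev (fsN N) x y)) y = complex.Re (ev (fD z (fsN N)) x y).
  by move=> N; have [h _] := dws_ev [:: z] x (@fsN_wf N); rewrite -[LHS]/(dws [:: z] _ y) h.
have e2 z : forall N, 'D_z (fun y => complex.Im (ev (fsN N) x y)) y = complex.Im (ev (fD z (fsN N)) x y).
  by move=> N; have [_ h] := dws_ev [:: z] x (@fsN_wf N); rewrite -[LHS]/(dws [:: z] _ y) h.
split.
  apply: (cvgn_uniq (cR [:: u] y Uy)).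
  have -> : (fun N => dws [:: u] (fun y => complex.Re (ev (fsN N) x y)) y) =
      - (fun N => dws [:: v] (fun y => complex.Im (ev (fsN N) x y)) y).
    apply: funext => N; rewrite /= fctE e1 e2 key.
    by case: (ev _ _ _) => a b /=; ring.
  exact: cvgN (cI [:: v] y Uy).
apply: (cvgn_uniq (cI [:: u] y Uy)).
have -> : (fun N => dws [:: u] (fun y => complex.Im (ev (fsN N) x y)) y) =
    (fun N => dws [:: v] (fun y => complex.Re (ev (fsN N) x y)) y).
  apply: funext => N; rewrite /= e1 e2 key.
  by case: (ev _ _ _) => a b /=; ring.
exact: cR [:: v] y Uy.
Qed.

End Bridge.

(** * Passage between complex and real coordinates *)

Section RealCoordinates.
Variable R : realType.
Local Notation C := R[i].
Local Notation C2 := 'rV[C]_2.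
Local Notation R4 := 'rV[R]_4.
Implicit Types (z : C2) (x y u v : R4).

Definition unr (x : R4) : C2 :=
  \row_j ((x : 'rV_(2 + 2)) ord0 (lshift 2 j) +i* (x : 'rV_(2 + 2)) ord0 (rshift 2 j)).

Lemma realify_l z (j : 'I_2) : realify z ord0 (lshift 2 j : 'I_(2 + 2)) = complex.Re (z ord0 j).
Proof.
have := row_mxEl (map_mx (@complex.Re R) z) (map_mx (@complex.Im R) z) ord0 j; rewrite [RHS]mxE.
exact.
Qed.

Lemma realify_r z (j : 'I_2) : realify z ord0 (rshift 2 j : 'I_(2 + 2)) = complex.Im (z ord0 j).
Proof.
have := row_mxEr (map_mx (@complex.Re R) z) (map_mx (@complex.Im R) z) ord0 j; rewrite [RHS]mxE.
exact.
Qed.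

Lemma realifyK z : unr (realify z) = z.
Proof.
by apply/rowP => j; rewrite mxE realify_l realify_r; case: (z ord0 j).
Qed.

Lemma unrK x : realify (unr x) = x.
Proof.
apply/rowP => j; case: (@split_ordP 2 2 j) => i ->.
  by rewrite realify_l mxE.
by rewrite realify_r mxE.
Qed.

Lemma unr0 : unr 0 = 0. Proof. by apply/rowP => j; rewrite !mxE. Qed.
Lemma unrD x y : unr (x + y) = unr x + unr y.
Proof. by apply/rowP => j; rewrite !mxE. Qed.
Lemma unrZ (k : R) x : unr (k *: x) = k%:C *: unr x.
Proof. by apply/rowP => j; rewrite !mxE; apply/eqP; rewrite eq_complex /= !mul0r subr0 addr0 !eqxx. Qed.
Lemma unrN x : unr (- x) = - unr x.
Proof. by apply/rowP => j; rewrite !mxE. Qed.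

Lemma realifyD z z' : realify (z + z') = realify z + realify z'.
Proof. by rewrite -[LHS]unrK -[RHS]unrK unrD !realifyK. Qed.
Lemma realifyZ (k : R) z : realify (k%:C *: z) = k *: realify z.
Proof. by rewrite -[RHS]unrK unrZ !realifyK. Qed.
Lemma realify0 : realify (0 : C2) = 0. Proof. by rewrite -unr0 unrK. Qed.
Lemma realifyN z : realify (- z) = - realify z.
Proof. by rewrite -[RHS]unrK unrN !realifyK. Qed.
Lemma realify_inj : injective (@realify R).
Proof. by move=> z z' /(congr1 unr); rewrite !realifyK. Qed.

Lemma normC_le_cn (w : C) : `|w| <= (cn w)%:C.
Proof.
case: w => a b; rewrite normc_def /= lecR /cn /=.
rewrite -[leRHS]ger0_norm ?addr_ge0 // -sqrtr_sqr ler_wsqrtr //.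
rewrite -(real_normK (num_real a)) -(real_normK (num_real b)).
have := mulr_ge0 (normr_ge0 a) (normr_ge0 b).
by move: (`|a|) (`|b|) => c d cd; lra.
Qed.

Lemma coord_le_norm n (x : 'rV[R]_n.+1) i : `|x ord0 i| <= `|x|.
Proof.
rewrite [leRHS]/Num.norm /= mx_normrE.
exact: (le_bigmax _ (fun p : 'I_1 * 'I_n.+1 => `|x p.1 p.2|) (ord0, i)).
Qed.

Lemma norm_lt n (x : 'rV[R]_n.+1) e : 0 < e -> (forall i, `|x ord0 i| < e) -> `|x| < e.
Proof.
move=> e0 H; rewrite [ltLHS]/Num.norm /= mx_normrE; apply: bigmax_lt => // -[i j] _ /=.
by rewrite (ord1 i).
Qed.

Lemma ltC_real (e : C) : 0 < e -> exists2 e' : R, 0 < e' & e = e'%:C.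
Proof.
case: e => a b; rewrite ltcE /= => /andP[/eqP b0 a0].
by exists a => //; rewrite b0.
Qed.

Lemma near_unr (P : set C2) x : (\forall z \near unr x, P z) -> \near x, P (unr x).
Proof.
move=> /nbhs_ballP[d /= d0 H]; have [e e0 dE] := ltC_real d0; rewrite {d0}dE in H; apply/nbhs_ballP; exists (e / 2) => /=.
  exact: divr_gt0.
move=> y [_ xy]; apply: H; split; first by rewrite ltcR.
move=> i j; rewrite /ball /= !mxE; apply: le_lt_trans (normC_le_cn _) _.
rewrite ltcR /cn /= [e]splitr; apply: ltrD.
  by have := xy ord0 (lshift 2 j); rewrite /ball /=.
by have := xy ord0 (rshift 2 j); rewrite /ball /=.
Qed.

Lemma near_realify (P : set R4) z : (\forall y \near realify z, P y) -> \near z, P (realify z).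
Proof.
move=> /nbhs_ballP[e /= e0 H]; apply/nbhs_ballP; exists e%:C => /=; first by rewrite ltcR.
move=> z' [_ zz']; apply: H; split => // i j; rewrite (ord1 i).
rewrite /ball /=; case: (@split_ordP 2 2 j) => k ->; rewrite ?realify_l ?realify_r.
all: have := zz' ord0 k; rewrite /ball /= => h; rewrite -ltcR; apply: le_lt_trans h.
all: rewrite normc_def lecR -sqrtr_sqr ler_wsqrtr //.
  by case: (z _ _) (z' _ _) => [? ?] [? ?] /=; rewrite lerDl sqr_ge0.
by case: (z _ _) (z' _ _) => [? ?] [? ?] /=; rewrite lerDr sqr_ge0.
Qed.

Lemma near_unrP (P : set C2) z : (\near z, P z) <-> \forall y \near realify z, P (unr y).
Proof.
split=> [h|/near_realify]; first by apply: near_unr; rewrite realifyK.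
by apply: filterS => z'; rewrite realifyK.
Qed.

Lemma lform_re n (i : 'I_n.+1) : lform 1 (fun v : 'rV[R]_n.+1 => (v ord0 i)%:C).
Proof.
split; last by move=> v; rewrite cn_real mul1r; exact: coord_le_norm.
have lin : linear (fun v : 'rV[R]_n.+1 => v ord0 i : R) by move=> k u v; rewrite !mxE.
pose A0 := GRing.isLinear.Build _ _ _ _ _ lin.
pose A : {linear 'rV[R]_n.+1 -> R} := HB.pack (fun v : 'rV[R]_n.+1 => v ord0 i : R) A0.
have lin' : linear (fun v : 'rV[R]_n.+1 => 0 : R) by move=> k u v; rewrite scaler0 addr0.
pose B0 := GRing.isLinear.Build _ _ _ _ _ lin'.
pose B : {linear 'rV[R]_n.+1 -> R} := HB.pack (fun v : 'rV[R]_n.+1 => 0 : R) B0.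
exists A, B; split => //; first exact: coord_continuous.
exact: cst_continuous.
Qed.

Lemma lform_unr (i : 'I_2) : lform 2 (fun v : R4 => unr v ord0 i).
Proof.
split; last first.
  move=> v; rewrite mxE /cn /= mulr_natl mulr2n; apply: lerD; exact: coord_le_norm.
have lin (j : 'I_4) : linear (fun v : 'rV[R]_4 => v ord0 j : R) by move=> k u v; rewrite !mxE.
pose A0 j := GRing.isLinear.Build _ _ _ _ _ (lin j).
pose A j : {linear R4 -> R} := HB.pack (fun v : R4 => v ord0 j : R) (A0 j).
exists (A (lshift 2 i)), (A (rshift 2 i)); split; [exact: coord_continuous..|].
by apply: funext => v; rewrite mxE.
Qed.

Lemma fset_sum (I : choiceType) (W : zmodType) (s : seq I) (f : I -> W) : uniq s ->
  \sum_(a <- [fset a in s]%fset) f a = \sum_(a <- s) f a.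
Proof.
move=> us; apply: perm_big; apply: uniq_perm; [by rewrite fset_uniq|exact: us|].
by move=> a; rewrite !inE.
Qed.

Lemma totally_cvg (I : choiceType) (K : numFieldType) (f : I -> K) (l : K) :
  (fun A : {fset I} => \sum_(a <- A) f a) @ summability.totally --> l ->
  forall d, 0 < d -> exists A0 : seq I, forall A, uniq A -> {subset A0 <= A} ->
    `|l - \sum_(a <- A) f a| <= d.
Proof.
have FF := @summability.totally_filter I.
move=> /cvgrPdist_le fl d /fl[A0 _ HA0]; exists A0 => A uA sA.
rewrite -fset_sum //; apply: HA0 => /=; apply/fsubsetP => a aA0.
by rewrite !inE; apply: sA.
Qed.

Lemma analytic_real n (F : 'rV[R]_n.+1 -> R) (x : 'rV[R]_n.+1) : analytic_at F x ->
  exists2 d, 0 < d & an_on x d F.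
Proof.
move=> [c /nbhs_ballP[e /= e0 He]].
pose hs : 'rV[R]_n.+1 := const_mx (e / 2).
have hse : `|hs| < e.
  apply: norm_lt => // i; rewrite mxE gtr0_norm ?divr_gt0 //.
  by rewrite ltr_pdivrMr // ltr_pMr // ltr1n.
have [|||d d0 [aF _ _]] := @series_an R 'rV[R]_n.+1 n (fun i (v : 'rV[R]_n.+1) => (v ord0 i)%:C) 1 ltr01
  (fun i => lform_re i) (fun a => (c a)%:C) (fun y : 'rV[R]_n.+1 => (F y)%:C) x hs (e / 2) e (divr_gt0 e0 (ltr0n _ 2)) e0.
- by move=> i; rewrite mxE.
- by [].
- move=> h he dd dd0; have hb : ball 0 e h by rewrite -ball_normE /ball_ /= sub0r normrN.
  have [A0 HA0] := totally_cvg (He h hb) dd0; exists A0 => A uA sA.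
  have := HA0 A uA sA; rewrite -cn_real rmorphB rmorph_sum /=.
  congr (cn (_ - _) <= _); apply: eq_bigr => a _.
  rewrite rmorphM rmorph_prod; congr (_ * _); apply: eq_bigr => i _.
  by rewrite rmorphXn.
by exists d.
Qed.

Lemma realify_i v (i : 'I_2) : unr (realify ('i *: unr v)) ord0 i = 'i * unr v ord0 i.
Proof. by rewrite realifyK mxE. Qed.

(* The complex structure of R^4 = C^2. *)
Definition Jm v : R4 := realify ('i *: unr v).

Lemma analytic_holo (f : C2 -> C) x : analytic_at f (unr x) ->
  exists2 d, 0 < d & [/\ an_on x d (fun y => complex.Re (f (unr y))),
    an_on x d (fun y => complex.Im (f (unr y))) &
    forall v y, ball x d y ->
     'D_(Jm v) (fun y => complex.Re (f (unr y))) y = - 'D_v (fun y => complex.Im (f (unr y))) y /\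
     'D_(Jm v) (fun y => complex.Im (f (unr y))) y = 'D_v (fun y => complex.Re (f (unr y))) y].
Proof.
move=> [c hc]; have : \forall h \near (0 : R4),
    (fun A : {fset {ffun 'I_2 -> nat}} => \sum_(a <- A) c a * monomial (unr h) a)
      @ summability.totally --> f (unr x + unr h).
  by move: hc; rewrite -unr0 => /near_unr.
move=> /nbhs_ballP[e /= e0 He].
pose hs : R4 := realify (const_mx (e / 2)%:C).
have hse : `|hs| < e.
  apply: norm_lt => // i; rewrite /hs.
  have e2 : `|e / 2| < e by rewrite gtr0_norm ?divr_gt0 // ltr_pdivrMr // ltr_pMr // ltr1n.
  by case: (@split_ordP 2 2 i) => k ->; rewrite ?realify_l ?realify_r !mxE /= ?normr0.
have [|||d d0 [a1 a2 H]] := @series_an R R4 1 (fun i v => unr v ord0 i) 2 (ltr0n _ 2)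
  lform_unr c (fun y => f (unr y)) x hs (e / 2) e (divr_gt0 e0 (ltr0n _ 2)) e0.
- by move=> i; rewrite realifyK mxE.
- by [].
- move=> h he dd dd0; have hb : ball 0 e h by rewrite -ball_normE /ball_ /= sub0r normrN.
  have dd2 : 0 < (dd / 2)%:C by rewrite ltcR divr_gt0.
  have [A0 HA0] := totally_cvg (He h hb) dd2; exists A0 => A uA sA.
  have := HA0 A uA sA; rewrite unrD normc_def lecR /monomial.
  move: (_ - _) => -[a b] /= h1; rewrite /cn /= [dd]splitr; apply: lerD; apply: le_trans h1.
    by rewrite -sqrtr_sqr ler_wsqrtr // lerDl sqr_ge0.
  by rewrite -sqrtr_sqr ler_wsqrtr // lerDr sqr_ge0.
exists d; first exact: d0.
by split; [exact: a1|exact: a2|move=> v y Uy; apply: H => // i; exact: realify_i].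
Qed.

End RealCoordinates.

(** * Complex first order operators and Wirtinger derivatives *)

Section ComplexCalculus.
Variable R : realType.
Local Notation C := R[i].
Local Notation C2 := 'rV[C]_2.
Local Notation R4 := 'rV[R]_4.
Implicit Types (x y u v : R4) (e : C2) (U : set R4) (F G : R4 -> C).

Lemma eqC (a b : C) : complex.Re a = complex.Re b -> complex.Im a = complex.Im b -> a = b.
Proof. by case: a b => [? ?] [? ?] /= -> ->. Qed.

Lemma isD_val x v F d : isD x v F d -> Rderive v F x = d.
Proof. by move=> [[_ h1] [_ h2]]; apply: eqC. Qed.

Lemma isD_csm U F x v : csm U F -> U x -> isD x v F (Rderive v F x).
Proof.
move=> [s1 s2] Ux; split; apply: derivableP.
  exact: sm_derivable v s1 Ux.
exact: sm_derivable v s2 Ux.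
Qed.

Lemma csm_Rderive U F v : csm U F -> csm U (Rderive v F).
Proof. by move=> [s1 s2]; split; [exact: sm_D v s1|exact: sm_D v s2]. Qed.

Lemma Rderive_open U F G x v : open U -> U x -> (forall y, U y -> F y = G y) ->
  Rderive v F x = Rderive v G x.
Proof.
move=> oU Ux FG; apply: eqC; apply: (derive_open v oU Ux) => y Uy /=; by rewrite FG.
Qed.

Lemma csm_opp U F : open U -> csm U F -> csm U (fun x => - F x).
Proof.
move=> oU sF; apply: (csm_ext oU _ (csm_mul oU (csm_cst (-1) oU) sF)) => y _.
by rewrite mulN1r.
Qed.

Lemma csm_sub U F G : open U -> csm U F -> csm U G -> csm U (fun x => F x - G x).
Proof. by move=> oU sF sG; exact: (csm_add oU sF (csm_opp oU sG)). Qed.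

Lemma csm_conj U F : open U -> csm U F -> csm U (fun x => (F x)^*).
Proof.
move=> oU [s1 s2]; split.
  by apply: (sm_ext oU _ s1) => y _; case: (F y).
by apply: (sm_ext oU _ (sm_opp oU s2)) => y _; case: (F y).
Qed.

Lemma csm_real U (f : R4 -> R) : open U -> sm U f -> csm U (fun x => (f x)%:C).
Proof. by move=> oU s; split; [exact: s|exact: sm_cst 0 oU]. Qed.

Lemma csm_restr U U' F : U' `<=` U -> csm U F -> csm U' F.
Proof. by move=> UU [s1 s2]; split; exact: sm_sub UU _. Qed.

(* All first order operators below have this shape. *)
Definition cd (a b : C) u v F x := a * Rderive u F x + b * Rderive v F x.

Lemma csm_cd U a b u v F : open U -> csm U F -> csm U (cd a b u v F).
Proof.
move=> oU sF; have s1 := csm_Rderive u sF; have s2 := csm_Rderive v sF.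
exact: (csm_add oU (csm_mul oU (csm_cst a oU) s1) (csm_mul oU (csm_cst b oU) s2)).
Qed.

Lemma cd_open U a b u v F G x : open U -> U x -> (forall y, U y -> F y = G y) ->
  cd a b u v F x = cd a b u v G x.
Proof. by move=> oU Ux FG; rewrite /cd !(Rderive_open _ oU Ux FG). Qed.

Lemma cd_cst a b u v (c : C) x : cd a b u v (fun=> c) x = 0.
Proof. by rewrite /cd !(isD_val (isD_cst x _ c)) !mulr0 addr0. Qed.

Lemma cdD U a b u v F G x : csm U F -> csm U G -> U x ->
  cd a b u v (fun y => F y + G y) x = cd a b u v F x + cd a b u v G x.
Proof.
move=> sF sG Ux; rewrite /cd.
rewrite (isD_val (isD_add (isD_csm u sF Ux) (isD_csm u sG Ux))).
rewrite (isD_val (isD_add (isD_csm v sF Ux) (isD_csm v sG Ux))).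
by rewrite !mulrDr addrACA.
Qed.

Lemma cdM U a b u v F G x : csm U F -> csm U G -> U x ->
  cd a b u v (fun y => F y * G y) x = cd a b u v F x * G x + F x * cd a b u v G x.
Proof.
move=> sF sG Ux; rewrite /cd.
rewrite (isD_val (isD_mul (isD_csm u sF Ux) (isD_csm u sG Ux))).
rewrite (isD_val (isD_mul (isD_csm v sF Ux) (isD_csm v sG Ux))).
by move: (Rderive u F x) (Rderive v F x) (Rderive u G x) (Rderive v G x) => p q r s; ring.
Qed.

Lemma cdZ U a b u v (c : C) F x : csm U F -> U x -> open U ->
  cd a b u v (fun y => c * F y) x = c * cd a b u v F x.
Proof.
by move=> sF Ux oU; rewrite (cdM _ _ _ _ (csm_cst c oU) sF Ux) cd_cst mul0r add0r.
Qed.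

Lemma cdZr U a b u v (c : C) F x : csm U F -> U x -> open U ->
  cd a b u v (fun y => F y * c) x = cd a b u v F x * c.
Proof.
by move=> sF Ux oU; rewrite (cdM _ _ _ _ sF (csm_cst c oU) Ux) cd_cst mulr0 addr0.
Qed.

Lemma cdN U a b u v F x : csm U F -> U x -> open U ->
  cd a b u v (fun y => - F y) x = - cd a b u v F x.
Proof.
move=> sF Ux oU; rewrite -mulN1r -(cdZ a b u v (-1) sF Ux oU).
by apply: (cd_open _ _ _ _ oU Ux) => y _; rewrite mulN1r.
Qed.

Lemma cdB U a b u v F G x : csm U F -> csm U G -> U x -> open U ->
  cd a b u v (fun y => F y - G y) x = cd a b u v F x - cd a b u v G x.
Proof.
move=> sF sG Ux oU.
by rewrite (cdD a b u v sF (csm_opp oU sG) Ux) (cdN _ _ _ _ sG Ux oU).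
Qed.

Lemma Rderive_com U F x u v : csm U F -> U x ->
  Rderive u (Rderive v F) x = Rderive v (Rderive u F) x.
Proof. by move=> [s1 s2] Ux; apply: eqC; [exact: sm_com s1 Ux|exact: sm_com s2 Ux]. Qed.

Lemma RderiveE_cd u F x : Rderive u F x = cd 1 0 u u F x.
Proof. by rewrite /cd mul1r mul0r addr0. Qed.

Lemma cd_com U a b u v a' b' u' v' F x : open U -> csm U F -> U x ->
  cd a b u v (cd a' b' u' v' F) x = cd a' b' u' v' (cd a b u v F) x.
Proof.
move=> oU sF Ux.
have key w c d p q : Rderive w (cd c d p q F) x =
    c * Rderive w (Rderive p F) x + d * Rderive w (Rderive q F) x.
  have sp := csm_Rderive p sF; have sq := csm_Rderive q sF.
  rewrite RderiveE_cd (cdD 1 0 w w (csm_mul oU (csm_cst c oU) sp) (csm_mul oU (csm_cst d oU) sq) Ux).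
  by rewrite (cdZ _ _ _ _ c sp Ux oU) (cdZ _ _ _ _ d sq Ux oU) -!RderiveE_cd.
rewrite [LHS]/cd [RHS]/cd !key (Rderive_com u u' sF Ux) (Rderive_com v u' sF Ux).
rewrite (Rderive_com u v' sF Ux) (Rderive_com v v' sF Ux).
move: (Rderive u' (Rderive u F) x) (Rderive u' (Rderive v F) x).
by move: (Rderive v' (Rderive u F) x) (Rderive v' (Rderive v F) x) => p q r s; ring.
Qed.

End ComplexCalculus.

(** The (1,0) derivative along an arbitrary complex vector, complex-linear in that vector, so that
    coordinate derivatives and derivatives along fields are treated together. Locking keeps
    rewriting from unfolding it; [dzb] is antilinear. *)
HB.lock Definition dz (R : realType) (e : 'rV[R[i]]_2) (F : 'rV[R]_4 -> R[i]) (x : 'rV[R]_4) :=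
  cd (1 / 2) (- 'i / 2) (realify e) (realify ('i *: e)) F x.
HB.lock Definition dzb (R : realType) (e : 'rV[R[i]]_2) (F : 'rV[R]_4 -> R[i]) (x : 'rV[R]_4) :=
  cd (1 / 2) ('i / 2) (realify e) (realify ('i *: e)) F x.

Section Wirtinger.
Variable R : realType.
Local Notation C := R[i].
Local Notation C2 := 'rV[C]_2.
Local Notation R4 := 'rV[R]_4.
Implicit Types (x y u v : R4) (e : C2) (U : set R4) (F G : R4 -> C).


Lemma csm_dz U F e : open U -> csm U F -> csm U (dz e F).
Proof. rewrite ?dz.unlock ?dzb.unlock; exact: csm_cd. Qed.
Lemma dz_open U F G e x : open U -> U x -> (forall y, U y -> F y = G y) ->
  dz e F x = dz e G x.
Proof. rewrite ?dz.unlock ?dzb.unlock; exact: cd_open. Qed.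
Lemma dz_cst e c x : dz e (fun=> c) x = 0.
Proof. rewrite ?dz.unlock ?dzb.unlock; exact: cd_cst. Qed.
Lemma dz_add U F G e x : csm U F -> csm U G -> U x ->
  dz e (fun y => F y + G y) x = dz e F x + dz e G x.
Proof. rewrite ?dz.unlock ?dzb.unlock; exact: cdD. Qed.
Lemma dz_mul U F G e x : csm U F -> csm U G -> U x ->
  dz e (fun y => F y * G y) x = dz e F x * G x + F x * dz e G x.
Proof. rewrite ?dz.unlock ?dzb.unlock; exact: cdM. Qed.
Lemma dz_scal U F (c : C) e x : csm U F -> U x -> open U ->
  dz e (fun y => c * F y) x = c * dz e F x.
Proof. rewrite ?dz.unlock ?dzb.unlock; exact: cdZ. Qed.
Lemma dz_scalr U F (c : C) e x : csm U F -> U x -> open U ->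
  dz e (fun y => F y * c) x = dz e F x * c.
Proof. rewrite ?dz.unlock ?dzb.unlock; exact: cdZr. Qed.
Lemma dz_opp U F e x : csm U F -> U x -> open U ->
  dz e (fun y => - F y) x = - dz e F x.
Proof. rewrite ?dz.unlock ?dzb.unlock; exact: cdN. Qed.
Lemma dz_sub U F G e x : csm U F -> csm U G -> U x -> open U ->
  dz e (fun y => F y - G y) x = dz e F x - dz e G x.
Proof. rewrite ?dz.unlock ?dzb.unlock; exact: cdB. Qed.

Lemma csm_dzb U F e : open U -> csm U F -> csm U (dzb e F).
Proof. rewrite ?dz.unlock ?dzb.unlock; exact: csm_cd. Qed.
Lemma dzb_open U F G e x : open U -> U x -> (forall y, U y -> F y = G y) ->
  dzb e F x = dzb e G x.
Proof. rewrite ?dz.unlock ?dzb.unlock; exact: cd_open. Qed.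
Lemma dzb_cst e c x : dzb e (fun=> c) x = 0.
Proof. rewrite ?dz.unlock ?dzb.unlock; exact: cd_cst. Qed.
Lemma dzb_add U F G e x : csm U F -> csm U G -> U x ->
  dzb e (fun y => F y + G y) x = dzb e F x + dzb e G x.
Proof. rewrite ?dz.unlock ?dzb.unlock; exact: cdD. Qed.
Lemma dzb_mul U F G e x : csm U F -> csm U G -> U x ->
  dzb e (fun y => F y * G y) x = dzb e F x * G x + F x * dzb e G x.
Proof. rewrite ?dz.unlock ?dzb.unlock; exact: cdM. Qed.
Lemma dzb_scal U F (c : C) e x : csm U F -> U x -> open U ->
  dzb e (fun y => c * F y) x = c * dzb e F x.
Proof. rewrite ?dz.unlock ?dzb.unlock; exact: cdZ. Qed.
Lemma dzb_scalr U F (c : C) e x : csm U F -> U x -> open U ->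
  dzb e (fun y => F y * c) x = dzb e F x * c.
Proof. rewrite ?dz.unlock ?dzb.unlock; exact: cdZr. Qed.
Lemma dzb_opp U F e x : csm U F -> U x -> open U ->
  dzb e (fun y => - F y) x = - dzb e F x.
Proof. rewrite ?dz.unlock ?dzb.unlock; exact: cdN. Qed.
Lemma dzb_sub U F G e x : csm U F -> csm U G -> U x -> open U ->
  dzb e (fun y => F y - G y) x = dzb e F x - dzb e G x.
Proof. rewrite ?dz.unlock ?dzb.unlock; exact: cdB. Qed.

Lemma dz_dz_com U F e e' x : open U -> csm U F -> U x ->
  dz e (dz e' F) x = dz e' (dz e F) x.
Proof. rewrite ?dz.unlock ?dzb.unlock; exact: cd_com. Qed.

Lemma dz_dzb_com U F e e' x : open U -> csm U F -> U x ->
  dz e (dzb e' F) x = dzb e' (dz e F) x.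
Proof. rewrite ?dz.unlock ?dzb.unlock; exact: cd_com. Qed.

Lemma dzb_dzb_com U F e e' x : open U -> csm U F -> U x ->
  dzb e (dzb e' F) x = dzb e' (dzb e F) x.
Proof. rewrite ?dz.unlock ?dzb.unlock; exact: cd_com. Qed.

Lemma sqi : 'i * 'i = -1 :> C. Proof. by rewrite -expr2 sqr_i. Qed.

Lemma Rderive_lin U F x u v (k l : R) : csm U F -> U x ->
  Rderive (k *: u + l *: v) F x = k%:C * Rderive u F x + l%:C * Rderive v F x.
Proof.
move=> [s1 s2] Ux; have d1 := sm_diff s1 Ux; have d2 := sm_diff s2 Ux.
have h f : differentiable f x -> 'D_(k *: u + l *: v) f x = k * 'D_u f x + l * 'D_v f x.
  by move=> df; rewrite (deriveDv _ _ df) !(deriveZv _ _ df).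
apply: eqC; rewrite [LHS](h _ _) //=.
  by move: ('D_u _ x) ('D_v _ x) => p q; ring.
by move: ('D_u _ x) ('D_v _ x) => p q; ring.
Qed.

Lemma realify_lin (a : C) e : realify (a *: e) =
  complex.Re a *: realify e + complex.Im a *: realify ('i *: e).
Proof.
rewrite -(realifyZ _ e) -(realifyZ _ ('i *: e)) -realifyD scalerA -scalerDl.
congr (realify (_ *: _)).
by apply: eqC; case: a => a b /=; ring.
Qed.

Lemma dzZ U F x (a : C) e : csm U F -> U x -> dz (a *: e) F x = a * dz e F x.
Proof.
move=> sF Ux; rewrite dz.unlock /cd scalerA (realify_lin a e) (realify_lin ('i * a) e) !(Rderive_lin _ _ _ _ sF Ux).
move: (Rderive _ F x) (Rderive _ F x) => [p q] [r s]; case: a => a b.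
by apply: eqC; rewrite /=; field.
Qed.

Lemma dzbZ U F x (a : C) e : csm U F -> U x -> dzb (a *: e) F x = a^* * dzb e F x.
Proof.
move=> sF Ux; rewrite dzb.unlock /cd scalerA (realify_lin a e) (realify_lin ('i * a) e) !(Rderive_lin _ _ _ _ sF Ux).
move: (Rderive _ F x) (Rderive _ F x) => [p q] [r s]; case: a => a b.
by apply: eqC; rewrite /=; field.
Qed.

Lemma RderiveDv U F x u v : csm U F -> U x ->
  Rderive (u + v) F x = Rderive u F x + Rderive v F x.
Proof. by move=> sF Ux; have := Rderive_lin u v 1 1 sF Ux; rewrite !scale1r !mul1r. Qed.

Lemma dzD U F x e e' : csm U F -> U x -> dz (e + e') F x = dz e F x + dz e' F x.
Proof.
move=> sF Ux; rewrite dz.unlock /cd scalerDr !realifyD !(RderiveDv _ _ sF Ux) !mulrDr.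
exact: addrACA.
Qed.

Lemma dzbD U F x e e' : csm U F -> U x -> dzb (e + e') F x = dzb e F x + dzb e' F x.
Proof.
move=> sF Ux; rewrite dzb.unlock /cd scalerDr !realifyD !(RderiveDv _ _ sF Ux) !mulrDr.
exact: addrACA.
Qed.

Lemma Rderive_dz F x e : Rderive (realify e) F x = dz e F x + dzb e F x.
Proof.
rewrite dz.unlock dzb.unlock /cd; move: (Rderive _ F x) (Rderive _ F x) => p q.
by field.
Qed.

Lemma dz_conj F x e : differentiable (fun y => complex.Im (F y)) x ->
  dz e (fun y => (F y)^*) x = (dzb e F x)^*.
Proof.
move=> dF; have h u : Rderive u (fun y => (F y)^*) x = (Rderive u F x)^*.
  apply: eqC => /=; first by congr ('D_u _ x); apply: funext => y; case: (F y).
  rewrite -deriveN; last exact: diff_derivable dF.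
  by congr ('D_u _ x); apply: funext => y; rewrite fctE; case: (F y).
rewrite dz.unlock dzb.unlock /cd !h; move: (Rderive _ F x) (Rderive _ F x) => [p q] [r s].
by apply: eqC; rewrite /=; field.
Qed.

Lemma dzb_real (f : R4 -> R) x e : dzb e (fun y => (f y)%:C) x = (dz e (fun y => (f y)%:C) x)^*.
Proof.
have h u : Rderive u (fun y => (f y)%:C) x = ('D_u f x)%:C.
  by apply: eqC => //=; rewrite derive_cst.
rewrite dz.unlock dzb.unlock /cd !h; move: ('D__ f x) ('D__ f x) => p q.
by apply: eqC; rewrite /=; field.
Qed.

Lemma Re_dz_real (f : R4 -> R) x e :
  dz e (fun y => (f y)%:C) x = ('D_(realify e) f x / 2) +i* (- 'D_(Jm (realify e)) f x / 2).
Proof.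
have h u : Rderive u (fun y => (f y)%:C) x = ('D_u f x)%:C.
  by apply: eqC => //=; rewrite derive_cst.
rewrite dz.unlock /cd !h /Jm realifyK; move: ('D__ f x) ('D__ f x) => p q.
by apply: eqC; rewrite /=; field.
Qed.

(* e_j and e_k below are the standard basis vectors. *)
Lemma ddz_dz j F x : ddz j F x = dz (delta_mx ord0 j) F x.
Proof.
rewrite /ddz dz.unlock /cd /ddx /ddy; move: (Rderive _ F x) (Rderive _ F x) => p q.
by field.
Qed.
Lemma ddzbar_dzb j F x : ddzbar j F x = dzb (delta_mx ord0 j) F x.
Proof.
rewrite /ddzbar dzb.unlock /cd /ddx /ddy; move: (Rderive _ F x) (Rderive _ F x) => p q.
by field.
Qed.

Lemma row2E (c : C2) : c = c ord0 ord0 *: delta_mx ord0 ord0 +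
  c ord0 (lift ord0 ord0) *: delta_mx ord0 (lift ord0 ord0).
Proof. by have := row_sum_delta c; rewrite big_ord_recl big_ord1. Qed.

Local Notation d0 := (delta_mx ord0 ord0 : C2).
Local Notation d1 := (delta_mx ord0 (lift ord0 ord0) : C2).

Lemma dz_coord U F x (c : C2) : csm U F -> U x ->
  dz c F x = dz d0 F x * c ord0 ord0 + dz d1 F x * c ord0 (lift ord0 ord0).
Proof.
move=> sF Ux; have := dzD (c ord0 ord0 *: d0) (c ord0 (lift ord0 ord0) *: d1) sF Ux.
rewrite -row2E => ->.
rewrite (dzZ (c ord0 ord0) _ sF Ux) (dzZ (c ord0 (lift ord0 ord0)) _ sF Ux).
ring.
Qed.

Lemma dzb_coord U F x (c : C2) : csm U F -> U x ->
  dzb c F x = dzb d0 F x * (c ord0 ord0)^* + dzb d1 F x * (c ord0 (lift ord0 ord0))^*.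
Proof.
move=> sF Ux; have := dzbD (c ord0 ord0 *: d0) (c ord0 (lift ord0 ord0) *: d1) sF Ux.
rewrite -row2E => ->.
rewrite (dzbZ (c ord0 ord0) _ sF Ux) (dzbZ (c ord0 (lift ord0 ord0)) _ sF Ux).
ring.
Qed.

Lemma sum_ddz U F x (c : C2) : csm U F -> U x ->
  \sum_(j < 2) ddz j F x * c ord0 j = dz c F x.
Proof. by move=> sF Ux; rewrite big_ord_recl big_ord1 !ddz_dz (dz_coord c sF Ux). Qed.

Lemma levi_dz U (rho : R4 -> R) (p v : C2) : open U -> sm U rho -> U (realify p) ->
  levi_form rho p v = dz v (dzb v (fun y => (rho y)%:C)) (realify p).
Proof.
move=> oU sr Ux; have sP := csm_real oU sr; rewrite /levi_form.
have E j k : ddz j (ddzbar k (fun x => (rho x)%:C)) (realify p) =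
    dz (delta_mx ord0 j) (dzb (delta_mx ord0 k) (fun x => (rho x)%:C)) (realify p).
  by rewrite ddz_dz; congr dz; apply: funext => y; rewrite ddzbar_dzb.
under eq_bigr do under eq_bigr do rewrite E.
clear E; set P := fun y => (rho y)%:C in sP *.
have sb c : csm U (dzb c P) by exact: csm_dzb.
have Ev y : U y -> dzb v P y = dzb d0 P y * (v ord0 ord0)^* + dzb d1 P y * (v ord0 (lift ord0 ord0))^*.
  by move=> Uy; exact: dzb_coord sP Uy.
have sc c (a : C) := csm_mul oU (sb c) (csm_cst a oU).
have E1 := dz_scalr (v ord0 ord0)^* v (sb d0) Ux oU.
have E2 := dz_scalr (v ord0 (lift ord0 ord0))^* v (sb d1) Ux oU.
rewrite (etrans (dz_open v oU Ux Ev) (etrans (dz_add v (sc d0 _) (sc d1 _) Ux) (congr2 +%R E1 E2))).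
rewrite (dz_coord v (sb d0) Ux) (dz_coord v (sb d1) Ux).
rewrite !big_ord_recl !big_ord0 !addr0.
ring.
Qed.

(** The Levi form is a quarter of the Laplacian of [rho] along the complex line of [v]; in this form
    it can be compared with real second order expansions. *)
Lemma levi_real U (rho : R4 -> R) (p v : C2) : open U -> sm U rho -> U (realify p) ->
  let u := realify v in
  levi_form rho p v = (('D_u ('D_u rho) (realify p) +
    'D_(Jm u) ('D_(Jm u) rho) (realify p)) / 4)%:C.
Proof.
move=> oU sr Ux u; rewrite (levi_dz v oU sr Ux).
have h w f y : Rderive w (fun y => (f y)%:C) y = ('D_w f y)%:C.
  by apply: eqC => //=; rewrite derive_cst.
have sw w := csm_real oU (sm_D w sr).
have uJ : realify ('i *: v) = Jm u by rewrite /Jm /u realifyK.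
have E y : dzb v (fun y => (rho y)%:C) y =
    1 / 2 * ('D_u rho y)%:C + 'i / 2 * ('D_(Jm u) rho y)%:C.
  by rewrite dzb.unlock /cd !h uJ.
have sc1 := csm_mul oU (csm_cst (1 / 2) oU) (sw u).
have sc2 := csm_mul oU (csm_cst ('i / 2) oU) (sw (Jm u)).
have E1 := dz_scal (1 / 2) v (sw u) Ux oU.
have E2 := dz_scal ('i / 2) v (sw (Jm u)) Ux oU.
rewrite (etrans (dz_open v oU Ux (fun y _ => E y)) (etrans (dz_add v sc1 sc2 Ux) (congr2 +%R E1 E2))).
have D w : dz v (fun y => ('D_w rho y)%:C) (realify p) =
   1 / 2 * ('D_u ('D_w rho) (realify p))%:C + - 'i / 2 * ('D_(Jm u) ('D_w rho) (realify p))%:C.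
  by rewrite dz.unlock /cd !h -/u uJ.
rewrite (D u) (D (Jm u)) (sm_com u (Jm u) sr Ux).
move: ('D_u ('D_u rho) _) ('D_(Jm u) ('D_u rho) _) ('D_(Jm u) ('D_(Jm u) rho) _) => p1 q1 r1.
by apply: eqC; rewrite /=; field.
Qed.

Lemma tangent_real U (rho : R4 -> R) (p v : C2) : open U -> sm U rho -> U (realify p) ->
  complex_tangent rho p v <->
  'D_(realify v) rho (realify p) = 0 /\ 'D_(Jm (realify v)) rho (realify p) = 0.
Proof.
move=> oU sr Ux; rewrite /complex_tangent (sum_ddz v (csm_real oU sr) Ux) Re_dz_real.
split=> [[/eqP h1 /eqP h2]|[-> ->]]; last by rewrite oppr0 !mul0r.
by move: h1 h2; rewrite !mulf_eq0 !invr_eq0 oppr_eq0 pnatr_eq0 !orbF => /eqP -> /eqP ->.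
Qed.

End Wirtinger.

(** * The Levi determinant of a defining function *)

Section LeviDeterminant.
Variable R : realType.
Local Notation C := R[i].
Local Notation C2 := 'rV[C]_2.
Local Notation R4 := 'rV[R]_4.
Implicit Types (x y q u v n : R4) (r : R) (e : C2) (U : set R4) (F G : R4 -> C) (rho : R4 -> R).
Local Notation d0 := (delta_mx ord0 ord0 : C2).
Local Notation d1 := (delta_mx ord0 (lift ord0 ord0) : C2).

Lemma an_on_at q r y (f : R4 -> R) : an_on q r f -> ball q r y ->
  exists2 r', 0 < r' & ball y r' `<=` ball q r /\ an_on y r' f.
Proof.
move=> [sf [m [c [k [m0 c0 k0 bf]]]]] qy.
have [e e0 He] : exists2 e : R, 0 < e & ball y e `<=` ball q r.
  have /nbhs_ballP[e /= e0 He] : nbhs y (ball q r).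
    by apply: open_nbhs_nbhs; split => //; exact: ball_open.
  by exists e.
exists e; first exact: e0.
split; first exact: He.
split; first exact: (sm_sub He sf).
by exists m, c, k; split; [exact: m0|exact: c0|exact: k0|exact: (bnd_set He bf)].
Qed.

Lemma near_ball q r y : ball q r y -> \forall z \near y, ball q r z.
Proof. by move=> qy; apply: open_nbhs_nbhs; split => //; exact: ball_open. Qed.

Lemma tang_vanish_near q r rho v u (f : R4 -> R) : 0 < r -> an_on q r rho -> rho q = 0 ->
  'D_v rho q != 0 -> sm (ball q r) f -> (\forall y \near q, rho y = 0 -> f y = 0) ->
  \forall y \near q, rho y = 0 -> tang rho v u f y = 0.
Proof.
move=> r0 ar rq dv sf fM; have qq : ball q r q by exact: ballxx.
have oU : open (ball q r) by exact: ball_open.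
have nv := near_neq0 oU (sm_D v ar.1) qq dv.
near=> y => ry; have by_ : ball q r y by near: y; exact: near_ball.
have [r' r'0 [_ ar']] := an_on_at ar by_.
apply: (tang_vanish u r'0 ar' ry).
- by near: y.
- exact: sm_diff sf by_.
- by near: y; exact: (near_join fM).
Unshelve. all: by end_near. Qed.

(* Replacing rho by another defining function multiplies its Hessian in the
   directions tangent to {rho = 0} by a function. *)
Lemma hess_change q r rho rho' n v : 0 < r -> an_on q r rho -> an_on q r rho' ->
  rho q = 0 -> 'D_n rho q != 0 -> (\forall y \near q, rho y = 0 -> rho' y = 0) ->
  'D_v rho q = 0 -> 'D_v rho' q = 0 /\
  'D_v ('D_v rho') q = 'D_n rho' q / 'D_n rho q * 'D_v ('D_v rho) q.
Proof.
move=> r0 ar ar' rq dn rr dv; have qq : ball q r q by exact: ballxx.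
have oU : open (ball q r) by exact: ball_open.
have t0 := tang_vanish v r0 ar rq dn (sm_diff ar'.1 qq) rr.
have e0 : 'D_v rho' q = 0 by move: t0; rewrite /tang dv mul0r mul0r subr0.
split => //.
have nv := near_neq0 oU (sm_D n ar.1) qq dn.
have [r1 /andP[r10 r1r] H1] := ball_shrink r0 nv.
have ar1 := an_on_le r1r ar; have ar'1 := an_on_le r1r ar'.
have oU1 : open (ball q r1) by exact: ball_open.
have qq1 : ball q r1 q by exact: ballxx.
have sT := sm_tang v oU1 ar1.1 ar'1.1 H1.
have tn := tang_vanish_near v r10 ar1 rq dn ar'1.1 rr.
have := tang_vanish v r10 ar1 rq dn (sm_diff sT qq1) tn.
rewrite {1}/tang dv !mul0r subr0 => T0.
have s1 := sm_D v ar1.1; have s2 := sm_D v ar'1.1.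
have s3 := sm_D n ar1.1; have s4 := sm_D n ar'1.1.
have sc := sm_div oU1 s4 s3 H1.
have E y : ball q r1 y -> tang rho n v rho' y = 'D_v rho' y - 'D_v rho y * ('D_n rho' y / 'D_n rho y).
  by move=> _; rewrite /tang; move: ('D_v rho y) ('D_n rho y)^-1 => a b; ring.
move: T0; rewrite (derive_open v oU1 qq1 E).
rewrite (deriveB (sm_derivable v s2 qq1) (sm_derivable v (sm_mul oU1 s1 sc) qq1)).
rewrite (deriveM (sm_derivable v s1 qq1) (sm_derivable v sc qq1)).
rewrite dv /GRing.scale /= mul0r add0r => /eqP; rewrite subr_eq0 => /eqP ->.
by [].
Qed.

Definition can_on q r F := an_on q r (fun y => complex.Re (F y)) /\
  an_on q r (fun y => complex.Im (F y)).

Lemma can_csm q r F : can_on q r F -> csm (ball q r) F.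
Proof. by move=> [[h1 _] [h2 _]]. Qed.

Lemma can_ext q r F G : (forall y, ball q r y -> F y = G y) -> can_on q r F -> can_on q r G.
Proof.
move=> FG [h1 h2]; split.
  by apply: (an_on_ext _ h1) => y Uy; rewrite FG.
by apply: (an_on_ext _ h2) => y Uy; rewrite FG.
Qed.

Lemma can_cst q r c : can_on q r (fun=> c).
Proof. by split; exact: an_on_cst. Qed.

Lemma can_add q r F G : can_on q r F -> can_on q r G -> can_on q r (fun y => F y + G y).
Proof.
move=> [f1 f2] [g1 g2]; split.
  by apply: (an_on_ext _ (an_on_add f1 g1)) => y _; case: (F y) (G y) => [? ?] [? ?].
by apply: (an_on_ext _ (an_on_add f2 g2)) => y _; case: (F y) (G y) => [? ?] [? ?].
Qed.

Lemma can_mul q r F G : can_on q r F -> can_on q r G -> can_on q r (fun y => F y * G y).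
Proof.
move=> [f1 f2] [g1 g2]; split.
  apply: (an_on_ext _ (an_on_sub (an_on_mul f1 g1) (an_on_mul f2 g2))) => y _.
  by case: (F y) (G y) => [? ?] [? ?].
apply: (an_on_ext _ (an_on_add (an_on_mul f1 g2) (an_on_mul f2 g1))) => y _.
by case: (F y) (G y) => [? ?] [? ?].
Qed.

Lemma can_opp q r F : can_on q r F -> can_on q r (fun y => - F y).
Proof.
move=> aF; apply: can_ext (can_mul (can_cst q r (-1)) aF) => y _.
by rewrite mulN1r.
Qed.

Lemma can_sub q r F G : can_on q r F -> can_on q r G -> can_on q r (fun y => F y - G y).
Proof. by move=> aF aG; exact: (can_add aF (can_opp aG)). Qed.

Lemma can_real q r (f : R4 -> R) : an_on q r f -> can_on q r (fun y => (f y)%:C).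
Proof. by move=> af; split; [exact: af|exact: an_on_cst]. Qed.

Lemma can_Rderive q r F v : can_on q r F -> can_on q r (Rderive v F).
Proof. by move=> [h1 h2]; split; [exact: (an_on_D v h1)|exact: (an_on_D v h2)]. Qed.

Lemma can_dz q r F e : can_on q r F -> can_on q r (dz e F).
Proof.
move=> aF; rewrite dz.unlock.
exact: (can_add (can_mul (can_cst _ _ _) (can_Rderive _ aF)) (can_mul (can_cst _ _ _) (can_Rderive _ aF))).
Qed.

Lemma can_dzb q r F e : can_on q r F -> can_on q r (dzb e F).
Proof.
move=> aF; rewrite dzb.unlock.
exact: (can_add (can_mul (can_cst _ _ _) (can_Rderive _ aF)) (can_mul (can_cst _ _ _) (can_Rderive _ aF))).
Qed.

Lemma can_le q r r' F : r' <= r -> can_on q r F -> can_on q r' F.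
Proof. by move=> rr [h1 h2]; split; exact: (an_on_le rr). Qed.

(* If G vanishes on {rho = 0}, then dG is a multiple of d rho there. *)
Lemma vanish_dz q r rho n G : 0 < r -> an_on q r rho -> rho q = 0 -> 'D_n rho q != 0 ->
  csm (ball q r) G -> (\forall y \near q, rho y = 0 -> G y = 0) ->
  let c := Rderive n G q / ('D_n rho q)%:C in
  forall e, dz e G q = c * dz e (fun y => (rho y)%:C) q /\
            dzb e G q = c * dzb e (fun y => (rho y)%:C) q.
Proof.
move=> r0 ar rq dn [sG1 sG2] GM c e; have qq : ball q r q by exact: ballxx.
have h1 u : 'D_u (fun y => complex.Re (G y)) q =
    'D_u rho q / 'D_n rho q * 'D_n (fun y => complex.Re (G y)) q.
  apply/eqP; rewrite -subr_eq0; apply/eqP.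
  apply: (tang_vanish u r0 ar rq dn (sm_diff sG1 qq)).
  by apply: filterS GM => y h /h ->.
have h2 u : 'D_u (fun y => complex.Im (G y)) q =
    'D_u rho q / 'D_n rho q * 'D_n (fun y => complex.Im (G y)) q.
  apply/eqP; rewrite -subr_eq0; apply/eqP.
  apply: (tang_vanish u r0 ar rq dn (sm_diff sG2 qq)).
  by apply: filterS GM => y h /h ->.
have h u : Rderive u G q = c * ('D_u rho q)%:C.
  rewrite /c -fmorphV.
  apply/eqP; rewrite eq_complex; apply/andP; split; apply/eqP; rewrite /Rderive /=; [rewrite h1|rewrite h2]; move: ('D_n rho q)^-1 ('D_n _ q) ('D_n _ q) => t k l; ring.
have hr u : Rderive u (fun y => (rho y)%:C) q = ('D_u rho q)%:C.
  by apply/eqP; rewrite eq_complex /= derive_cst !eqxx.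
have hc a b u v : cd a b u v G q = c * cd a b u v (fun y => (rho y)%:C) q.
  rewrite /cd (h u) (h v) (hr u) (hr v); move: ('D_u rho q)%:C ('D_v rho q)%:C => k l.
  by clear; move: c => c'; ring.
by rewrite dz.unlock dzb.unlock; split; exact: hc.
Qed.

Section Determinant.
Variable rho : R4 -> R.
Let P y : C := (rho y)%:C.

Definition Jdet y : C :=
  dz d0 (dzb d0 P) y * dz d1 P y * dzb d1 P y - dz d0 (dzb d1 P) y * dz d1 P y * dzb d0 P y
  - dz d1 (dzb d0 P) y * dz d0 P y * dzb d1 P y + dz d1 (dzb d1 P) y * dz d0 P y * dzb d0 P y.

Lemma can_Jdet q r : an_on q r rho -> can_on q r Jdet.
Proof.
move=> ar; have aP := can_real ar.
have a e := can_dz e aP; have b e := can_dzb e aP.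
have h e e' := can_dz e (b e').
exact: (can_add (can_sub (can_sub (can_mul (can_mul (h d0 d0) (a d1)) (b d1))
  (can_mul (can_mul (h d0 d1) (a d1)) (b d0))) (can_mul (can_mul (h d1 d0) (a d0)) (b d1)))
  (can_mul (can_mul (h d1 d1) (a d0)) (b d0))).
Qed.

(** Annihilated by the (1,0) differential of [rho]; where that differential is nonzero, it spans the
    complex tangent line. *)
Definition Zvec y : C2 := dz d1 P y *: d0 - dz d0 P y *: d1.

Lemma Zvec0 y : Zvec y ord0 ord0 = dz d1 P y.
Proof. by rewrite !mxE !eqxx /= mulr1 mulr0 subr0. Qed.
Lemma Zvec1 y : Zvec y ord0 (lift ord0 ord0) = - dz d0 P y.
Proof. by rewrite !mxE !eqxx /= mulr1 mulr0 sub0r. Qed.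

Lemma Jdet_levi U y : open U -> sm U rho -> U y -> levi_form rho (unr y) (Zvec y) = Jdet y.
Proof.
move=> oU sr Uy; have Ux : U (realify (unr y)) by rewrite unrK.
rewrite (levi_dz (Zvec y) oU sr Ux) unrK; have sP := csm_real oU sr.
have sb e : csm U (dzb e P) by exact: csm_dzb.
have Ev z : U z -> dzb (Zvec y) P z = dzb d0 P z * (Zvec y ord0 ord0)^*
    + dzb d1 P z * (Zvec y ord0 (lift ord0 ord0))^*.
  by move=> Uz; exact: dzb_coord sP Uz.
have sc e (a : C) := csm_mul oU (sb e) (csm_cst a oU).
have E1 := dz_scalr (Zvec y ord0 ord0)^* (Zvec y) (sb d0) Uy oU.
have E2 := dz_scalr (Zvec y ord0 (lift ord0 ord0))^* (Zvec y) (sb d1) Uy oU.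
rewrite (etrans (dz_open (Zvec y) oU Uy Ev) (etrans (dz_add (Zvec y) (sc d0 _) (sc d1 _) Uy) (congr2 +%R E1 E2))).
rewrite (dz_coord (Zvec y) (sb d0) Uy) (dz_coord (Zvec y) (sb d1) Uy) Zvec0 Zvec1.
have cj e : (dz e P y)^* = dzb e P y by rewrite dzb_real.
by rewrite rmorphN /= !cj /Jdet; ring.
Qed.

Lemma Jdet_real U y : open U -> sm U rho -> U y -> complex.Im (Jdet y) = 0.
Proof.
move=> oU sr Uy; rewrite -(Jdet_levi oU sr Uy).
have Ux : U (realify (unr y)) by rewrite unrK.
by rewrite (levi_real _ oU sr Ux).
Qed.

Lemma dz_neq0 U y n : open U -> sm U rho -> U y -> 'D_n rho y != 0 ->
  dz d0 P y != 0 \/ dz d1 P y != 0.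
Proof.
move=> oU sr Uy dn; have sP := csm_real oU sr.
have [h0|] := eqVneq (dz d0 P y) 0; last by left.
have [h1|] := eqVneq (dz d1 P y) 0; last by right.
have hn : Rderive n P y = ('D_n rho y)%:C by apply/eqP; rewrite eq_complex /= derive_cst !eqxx.
move: dn; have := Rderive_dz P y (unr n); rewrite unrK hn dzb_real (dz_coord _ sP Uy) h0 h1.
by rewrite !mul0r addr0 conjc0 addr0 => -[->]; rewrite eqxx.
Qed.

(** In two variables the complex tangent space of M is the line of [Zvec], so the single number
    [Jdet] decides whether the Levi form vanishes. *)
Lemma levi_Jdet U y n (v : C2) : open U -> sm U rho -> U y -> 'D_n rho y != 0 ->
  complex_tangent rho (unr y) v ->
  exists k : C, v = k *: Zvec y /\ levi_form rho (unr y) v = k * k^* * Jdet y.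
Proof.
move=> oU sr Uy dn; have Ux : U (realify (unr y)) by rewrite unrK.
have sP := csm_real oU sr.
rewrite /complex_tangent (sum_ddz v sP Ux) unrK (dz_coord v sP Uy) => tv.
have [k vk] : exists k, v = k *: Zvec y.
  have c1 (i : 'I_1) : i = ord0 by exact: ord1.
  have [h|h] := dz_neq0 oU sr Uy dn.
    exists (- v ord0 (lift ord0 ord0) / dz d0 P y); apply/rowP => j.
    rewrite mxE; case: (unliftP ord0 j) => [i ->|->].
      by rewrite (c1 i) Zvec1 mulrN -mulNr -mulNr opprK divfK.
    rewrite Zvec0; apply: (mulfI h); move: tv => /eqP; rewrite addr_eq0 => /eqP ->.
    by move: h; move: (dz d0 P y) (dz d1 P y) (v _ _) => a b c h; field.
  exists (v ord0 ord0 / dz d1 P y); apply/rowP => j.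
  rewrite mxE; case: (unliftP ord0 j) => [i ->|->]; last by rewrite Zvec0 divfK.
  rewrite (c1 i) Zvec1; apply: (mulfI h); move: tv => /eqP; rewrite addrC addr_eq0 => /eqP ->.
  by move: h; move: (dz d0 P y) (dz d1 P y) (v _ _) => a b c h; field.
exists k; split => //; rewrite vk (levi_dz _ oU sr Ux) unrK.
have sb e : csm U (dzb e P) by exact: csm_dzb.
have E z : U z -> dzb (k *: Zvec y) P z = k^* * dzb (Zvec y) P z.
  by move=> Uz; exact: dzbZ sP Uz.
rewrite (etrans (dz_open (k *: Zvec y) oU Uy E) (dz_scal k^* (k *: Zvec y) (sb (Zvec y)) Uy oU)).
rewrite (dzZ k (Zvec y) (sb (Zvec y)) Uy).
rewrite -(Jdet_levi oU sr Uy) (levi_dz (Zvec y) oU sr Ux) unrK.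
by rewrite mulrCA mulrA.
Qed.

End Determinant.
End LeviDeterminant.

(** * The ring of smooth functions on a ball *)

Section ConcreteRing.
Variable R : realType.
Local Notation C := R[i].
Local Notation C2 := 'rV[C]_2.
Local Notation R4 := 'rV[R]_4.

(* The functions smooth on a ball, made total by the value at the center, form
   a ring on which the differential operators act. *)
Record cfun (q : R4) (r : R) := Cfun {
  cf :> R4 -> C;
  cf_csm : csm (ball q r) cf;
  cf_out : forall y, ~ ball q r y -> cf y = cf q }.

Variables (q : R4) (r : R).
Local Notation A := (cfun q r).
Implicit Types (f g : A) (F G : R4 -> C) (y : R4).

Lemma cfP f g : f q = g q -> (forall y, ball q r y -> f y = g y) -> f = g.
Proof.
case: f g => [f cf fo] [g cg go] /= fg h; have E : f = g.
  apply: funext => y; have [/h //|ny] := pselect (ball q r y).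
  by rewrite fo // go.
by subst g; congr Cfun; exact: Prop_irrelevance.
Qed.

Definition ext F y : C := if `[< ball q r y >] then F y else F q.

Lemma extE F y : ball q r y -> ext F y = F y.
Proof. by move=> h; rewrite /ext asboolT. Qed.
Lemma ext_q F : ext F q = F q.
Proof. by rewrite /ext if_same. Qed.

Lemma ext_csm F : csm (ball q r) F -> csm (ball q r) (ext F).
Proof.
move=> cF; have oU : open (ball q r) by exact: ball_open.
by apply: (csm_ext oU _ cF) => y Uy; rewrite extE.
Qed.

Lemma ext_out F y : ~ ball q r y -> ext F y = ext F q.
Proof. by move=> h; rewrite ext_q /ext asboolF. Qed.

Definition mkc F (cF : csm (ball q r) F) : A := Cfun (ext_csm cF) (@ext_out F).

Let oU : open (ball q r). Proof. exact: ball_open. Qed.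

Definition ccst (c : C) : A := mkc (csm_cst c oU).
Definition cadd f g : A := mkc (csm_add oU (cf_csm f) (cf_csm g)).
Definition cmul f g : A := mkc (csm_mul oU (cf_csm f) (cf_csm g)).
Definition copp f : A := mkc (csm_opp oU (cf_csm f)).

Lemma cfval F (cF : csm (ball q r) F) y : ball q r y \/ y = q -> mkc cF y = F y.
Proof. by move=> [h|->]; rewrite /= ?ext_q // extE. Qed.

Lemma cfP' f g : (forall y, ball q r y \/ y = q -> f y = g y) -> f = g.
Proof. by move=> h; apply: cfP => [|y Uy]; apply: h; [right|left]. Qed.

HB.instance Definition _ := gen_eqMixin A.
HB.instance Definition _ := gen_choiceMixin A.

Lemma caddA : associative cadd.
Proof. by move=> f g h; apply: cfP' => y hy; rewrite !cfval // addrA. Qed.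
Lemma caddC : commutative cadd.
Proof. by move=> f g; apply: cfP' => y hy; rewrite !cfval // addrC. Qed.
Lemma cadd0 : left_id (ccst 0) cadd.
Proof. by move=> f; apply: cfP' => y hy; rewrite !cfval // add0r. Qed.
Lemma caddN : left_inverse (ccst 0) copp cadd.
Proof. by move=> f; apply: cfP' => y hy; rewrite !cfval // addNr. Qed.
Lemma cmulA : associative cmul.
Proof. by move=> f g h; apply: cfP' => y hy; rewrite !cfval // mulrA. Qed.
Lemma cmulC : commutative cmul.
Proof. by move=> f g; apply: cfP' => y hy; rewrite !cfval // mulrC. Qed.
Lemma cmul1 : left_id (ccst 1) cmul.
Proof. by move=> f; apply: cfP' => y hy; rewrite !cfval // mul1r. Qed.
Lemma cmulD : left_distributive cmul cadd.
Proof. by move=> f g h; apply: cfP' => y hy; rewrite !cfval // mulrDl. Qed.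
(** The value at the center is recorded even when the ball is empty, so the ring is nontrivial
    before any sign condition on the radius. *)
Lemma c1_neq0 : ccst 1 != ccst 0.
Proof.
apply/eqP => /(congr1 (fun f : A => f q)); rewrite !cfval; [|by right..].
by move/eqP; rewrite oner_eq0.
Qed.

HB.instance Definition _ := GRing.isZmodule.Build A caddA caddC cadd0 caddN.
HB.instance Definition _ := GRing.Zmodule_isComNzRing.Build A cmulA cmulC cmul1 cmulD c1_neq0.

Lemma cfD f g y : ball q r y -> (f + g) y = f y + g y.
Proof. by move=> h; rewrite [LHS]cfval //; left. Qed.
Lemma cfM f g y : ball q r y -> (f * g) y = f y * g y.
Proof. by move=> h; rewrite [LHS]cfval //; left. Qed.
Lemma cfN f y : ball q r y -> (- f) y = - f y.
Proof. by move=> h; rewrite [LHS]cfval //; left. Qed.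
Lemma cfB f g y : ball q r y -> (f - g) y = f y - g y.
Proof. by move=> h; rewrite cfD // cfN. Qed.
Lemma cf_0 y : ball q r y -> (0 : A) y = 0.
Proof. by move=> h; rewrite [LHS]cfval //; left. Qed.
Lemma cf_1 y : ball q r y -> (1 : A) y = 1.
Proof. by move=> h; rewrite [LHS]cfval //; left. Qed.
Lemma cf_cst c y : ball q r y -> ccst c y = c.
Proof. by move=> h; rewrite [LHS]cfval //; left. Qed.

Definition dj (j : bool) : C2 := delta_mx ord0 (if j then lift ord0 ord0 else ord0).
Definition d_ (s : bool) : C2 -> (R4 -> C) -> R4 -> C := if s then @dzb R else @dz R.

Lemma csm_d_ s e F : csm (ball q r) F -> csm (ball q r) (d_ s e F).
Proof. by case: s => cF; [exact: csm_dzb|exact: csm_dz]. Qed.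

Definition pdc s j f : A := mkc (csm_d_ s (dj j) (cf_csm f)).

Lemma pdcE s j f y : ball q r y -> pdc s j f y = d_ s (dj j) f y.
Proof. by move=> h; rewrite cfval //; left. Qed.

Lemma d_open_ s e F G y : ball q r y -> (forall y, ball q r y -> F y = G y) ->
  d_ s e F y = d_ s e G y.
Proof. by case: s => Uy FG; [exact: dzb_open oU Uy FG|exact: dz_open oU Uy FG]. Qed.

Hypothesis r0 : 0 < r.
Let qq : ball q r q. Proof. exact: ballxx. Qed.

Lemma cfPU f g : (forall y, ball q r y -> f y = g y) -> f = g.
Proof. by move=> h; apply: cfP => //; exact: h. Qed.

Lemma pdc_der s j : derivation (pdc s j).
Proof.
split=> f g; apply: cfPU => y Uy.
  rewrite cfD // !pdcE // (@d_open_ s _ _ (fun y => f y + g y) _ Uy); last by move=> z; exact: cfD.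
  by case: s; [exact: dzb_add (cf_csm f) (cf_csm g) Uy|exact: dz_add (cf_csm f) (cf_csm g) Uy].
rewrite cfD // !cfM // !pdcE // (@d_open_ s _ _ (fun y => f y * g y) _ Uy); last by move=> z; exact: cfM.
by case: s; [exact: dzb_mul (cf_csm f) (cf_csm g) Uy|exact: dz_mul (cf_csm f) (cf_csm g) Uy].
Qed.

Lemma pdc_com s j s' j' f : pdc s j (pdc s' j' f) = pdc s' j' (pdc s j f).
Proof.
apply: cfPU => y Uy; rewrite !pdcE //.
rewrite (@d_open_ s _ _ (d_ s' (dj j') f) _ Uy); last by move=> z; exact: pdcE.
rewrite (@d_open_ s' _ _ (d_ s (dj j) f) _ Uy); last by move=> z; exact: pdcE.
have cf := cf_csm f; case: s; case: s' => /=.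
- exact: dzb_dzb_com oU cf Uy.
- exact: esym (dz_dzb_com _ _ oU cf Uy).
- exact: dz_dzb_com oU cf Uy.
- exact: dz_dz_com oU cf Uy.
Qed.

Definition ccj f : A := mkc (csm_conj oU (cf_csm f)).

Lemma ccjE f y : ball q r y -> ccj f y = conjc (f y).
Proof. by move=> h; rewrite cfval //; left. Qed.

Lemma ccjD f g : ccj (f + g) = ccj f + ccj g.
Proof. by apply: cfPU => y Uy; rewrite cfD // !ccjE // cfD // rmorphD. Qed.
Lemma ccjM f g : ccj (f * g) = ccj f * ccj g.
Proof. by apply: cfPU => y Uy; rewrite cfM // !ccjE // cfM // rmorphM. Qed.

Lemma ccj_pdc s j f : ccj (pdc s j f) = pdc (~~ s) j (ccj f).
Proof.
apply: cfPU => y Uy; rewrite ccjE // !pdcE //.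
rewrite (@d_open_ (~~ s) _ _ (fun y => conjc (f y)) _ Uy); last by move=> z; exact: ccjE.
have df : differentiable (fun y => complex.Im (f y)) y by exact: sm_diff (cf_csm f).2 Uy.
case: s => /=; first by rewrite (dz_conj _ df).
have df' : differentiable (fun y => complex.Im (conjc (f y))) y.
  by exact: sm_diff (csm_conj oU (cf_csm f)).2 Uy.
have := dz_conj (dj j) df'.
have -> : (fun y => conjc (conjc (f y))) = f by apply: funext => z; rewrite conjcK.
by move=> ->; rewrite conjcK.
Qed.

End ConcreteRing.

(** * The identity theorem on a ball *)

Section Identity.
Variables (R : realType) (V : normedModType R).
Implicit Types (x y q : V) (r : R) (F : V -> R).

Lemma rise1 k : rise (1 : R) k = k`!%:R.
Proof.
suff H n : rise (n%:R + 1 : R) k * n`!%:R = (n + k)`!%:R.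
  by have := H 0%N; rewrite add0r mulr1.
elim: k n => [|k IH] n /=; first by rewrite mul1r addn0.
rewrite addnS -addSn -IH factS natrM -[n.+1%:R]natr1.
by move: (rise _ _) => a; ring.
Qed.

(** The Cauchy estimates are uniform on the ball, so the distance at which the Taylor remainder of a
    flat function is seen to tend to zero does not depend on the point [x]. *)
Lemma flat_step q r F : an_on q r F -> exists2 d, 0 < d &
  forall x, ball q r x -> (forall w, dws w F x = 0) ->
  forall y, ball q r y -> `|y - x| < d -> F y = 0.
Proof.
move=> [sF [m [c [K [m0 c0 K0 bF]]]]].
have m1 : 1 <= m + 1 by rewrite lerDr.
have mm : m <= (m + 1) * 1 by rewrite mulr1 lerDl.
have p0 : 0 <= (m + 1) * K by rewrite mulr_ge0 // addr_ge0.
exists (2 * ((m + 1) * K) + 1)^-1; first by rewrite invr_gt0 ltr_pwDr // mulr_ge0.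
move=> x qx flat y qy xy; pose h := y - x.
have xh : x + h = y by rewrite /h addrC subrK.
have seg (s : R) : 0 <= s <= 1 -> ball q r (x + s *: h).
  by apply: ball_segment => //; rewrite xh.
have small : (m + 1) * K * `|h| <= 2^-1.
  apply: le_trans (ler_wpM2l p0 (ltW xy)) _.
  by rewrite ler_pdivrMr //; move: ((m + 1) * K) p0 => X q0; clear -q0; lra.
have bound n : `|F y| <= c * 2^-1 ^+ n.+1.
  have H (s : R) : 0 <= s <= 1 -> `|dws (nseq n.+1 h) F (x + s *: h)| <= c * n.+1`!%:R * 2^-1 ^+ n.+1.
    move=> s01; have := bF n.+1 (nseq n.+1 h) _ _ (seg s s01); rewrite size_nseq leqnn => /(_ isT).
    move/le_trans; apply.
    have -> : \prod_(v <- nseq n.+1 h) `|v| = `|h| ^+ n.+1 by rewrite big_nseq iter_mulr_1.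
    have rs := rise_scale n.+1 m0 (ler01 : 0 <= 1 :> R) m1 mm; rewrite rise1 in rs.
    have q0 : 0 <= K ^+ n.+1 * `|h| ^+ n.+1 by rewrite mulr_ge0 // exprn_ge0.
    have E1 := ler_wpM2r q0 rs.
    have E2 : (m + 1) ^+ n.+1 * n.+1`!%:R * (K ^+ n.+1 * `|h| ^+ n.+1) =
        n.+1`!%:R * ((m + 1) * K * `|h|) ^+ n.+1.
      by rewrite !exprMn; move: (_ ^+ _) (_ ^+ _) (_ ^+ _) n.+1`!%:R => t u v z; ring.
    have E3 : ((m + 1) * K * `|h|) ^+ n.+1 <= 2^-1 ^+ n.+1 :> R.
      by apply: lerXn2r; rewrite ?nnegrE ?invr_ge0 // mulr_ge0.
    rewrite E2 in E1.
    have E4 := ler_wpM2l c0 (le_trans E1 (ler_wpM2l (ler0n _ _) E3)).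
    move: E4; move: (rise m n.+1) n.+1`!%:R => u v; rewrite !mulrA; exact.
  have := taylor_line sF seg H.
  rewrite xh big1 ?subr0; last by move=> i _; rewrite flat mul0r.
  by move/le_trans; apply; rewrite mulrAC mulfK // pnatr_eq0 -lt0n fact_gt0.
apply/eqP; rewrite -normr_le0; apply/ler_addgt0Pl => eps eps0; rewrite addr0.
have : c * 2^-1 ^+ n.+1 @[n --> \oo] --> c * 0.
  apply: cvgMr; rewrite (cvg_shiftS (fun n => 2^-1 ^+ n : R)).
  have := @cvg_geometric R 1 2^-1.
  rewrite (_ : geometric 1 2^-1 = fun n => 2^-1 ^+ n); last first.
    by apply: funext => n; rewrite /= mul1r.
  have h2 : (2^-1 : R) < 1 by rewrite invf_lt1 // ltr1n.
  by apply; rewrite ger0_norm ?invr_ge0 //; exact: h2.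
rewrite mulr0 => /cvgrPdist_lt /(_ _ eps0) [N _ /(_ N (leqnn N))].
rewrite /= sub0r normrN => /ltW; apply: le_trans; apply: le_trans (bound N) _.
exact: ler_norm.
Unshelve. all: by end_near. Qed.

Lemma flat_ball q r F x : an_on q r F -> ball q r x -> (forall w, dws w F x = 0) ->
  forall y, ball q r y -> F y = 0.
Proof.
move=> aF qx flat y qy; have [d d0 H] := flat_step aF.
(* Enough equal steps along the segment for each to be shorter than [d]; flatness is carried from
   one subdivision point to the next. *)
pose N := Num.bound (`|y - x| / d); pose h := N.+1%:R^-1 *: (y - x).
have N0 : 0 < N.+1%:R :> R by [].
have hd : `|h| < d.
  rewrite normrZ gtr0_norm ?invr_gt0 // mulrC ltr_pdivrMr // mulrC -ltr_pdivrMr //.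
  apply: lt_le_trans (archi_boundP _) _; first by rewrite divr_ge0 // ltW.
  by rewrite ler_nat.
have sg k : (k <= N.+1)%N -> ball q r (x + k%:R *: h).
  move=> kN; rewrite /h scalerA; apply: ball_segment => //; first by rewrite addrC subrK.
  by rewrite divr_ge0 //= ler_pdivrMr // mul1r ler_nat.
have fl k : (k <= N.+1)%N -> forall w, dws w F (x + k%:R *: h) = 0.
  elim: k => [_ w|k IH kN w]; first by rewrite scale0r addr0.
  pose U := ball q r `&` ball (x + k%:R *: h) d.
  have oU : open U by apply: openI; exact: ball_open.
  have F0 z : U z -> F z = cst 0 z.
    move=> [qz]; rewrite -ball_normE /ball_ /= distrC => zd.
    by apply: H zd => //; [exact/sg/ltnW|exact/IH/ltnW].
  rewrite (dws_open w oU F0).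
    by elim: w => [//|v w IHw]; rewrite /= (_ : 'D_v (cst 0) = cst 0) //; apply: funext => z; rewrite derive_cst.
  split; first exact: sg.
  rewrite -ball_normE /ball_ /= distrC (_ : _ - _ = h); first exact: hd.
  by apply/eqP; rewrite subr_eq -natr1 scalerDl scale1r addrA addrC.
have := fl N.+1 (leqnn _) [::]; rewrite /= /h scalerA divff ?gt_eqF // scale1r.
by rewrite addrC subrK.
Qed.

End Identity.

(** * The graded model at a Levi nondegenerate point *)

Section Model.
Variable R : realType.
Local Notation C := R[i].
Local Notation C2 := 'rV[C]_2.
Local Notation R4 := 'rV[R]_4.
Variables (p : R4) (r : R) (rho : R4 -> R) (n : R4).
Hypotheses (r0 : 0 < r) (ar : an_on p r rho)
  (dn : forall y, ball p r y -> 'D_n rho y != 0).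
Local Notation U := (ball p r).
Local Notation A := (cfun p r).
Let oU : open U. Proof. exact: ball_open. Qed.
Let pp : U p. Proof. exact: ballxx. Qed.
Let sr : sm U rho := ar.1.
Implicit Types (f g : A) (y : R4).

Definition Pc : A := mkc (csm_real oU sr).
Local Notation pd := (@pdc R p r).
Local Notation Z := (Zf pd Pc).
Local Notation T := (Tf pd Pc).
Local Notation Pf := (fun y => (rho y)%:C).

Let pdD := @pdc_der R p r r0.
Let pdC := @pdc_com R p r r0.

Lemma PcE y : U y -> Pc y = Pf y.
Proof. by move=> Uy; rewrite cfval //; left. Qed.

Lemma pdP s j y : U y -> pd s j Pc y = d_ s (dj R j) Pf y.
Proof. by move=> Uy; rewrite pdcE //; exact: (@d_open_ R p r s _ _ _ y Uy PcE). Qed.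

Lemma pdpdP s j s' j' y : U y -> pd s j (pd s' j' Pc) y = d_ s (dj R j) (d_ s' (dj R j') Pf) y.
Proof. by move=> Uy; rewrite pdcE //; exact: (@d_open_ R p r s _ _ _ y Uy (pdP s' j')). Qed.

Definition Nc f := forall y, U y -> rho y = 0 -> f y = 0.

Lemma Nc_D f g : Nc f -> Nc g -> Nc (f + g).
Proof. by move=> Nf Ng y Uy ry; rewrite cfD // Nf // Ng // addr0. Qed.
Lemma Nc_M f g : Nc g -> Nc (f * g).
Proof. by move=> Ng y Uy ry; rewrite cfM // Ng // mulr0. Qed.

Lemma Nc_pd f y : Nc f -> U y -> rho y = 0 ->
  forall s j, pd s j f y = Rderive n f y / ('D_n rho y)%:C * pd s j Pc y.
Proof.
move=> Nf Uy ry s j; have [r' r'0 [sub ar']] := an_on_at ar Uy.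
have cf' := csm_restr sub (cf_csm f).
have NM : \forall z \near y, rho z = 0 -> f z = 0.
  have yy : ball y r' y by exact: ballxx.
  by apply: filterS (near_ball yy) => z zy rz; exact: (Nf z (sub z zy) rz).
have [E1 E2] := vanish_dz r'0 ar' ry (dn Uy) cf' NM (dj R j).
by rewrite pdP // pdcE //; case: s; [exact: E2|exact: E1].
Qed.

Lemma Nc_Z s f : Nc f -> Nc (Z s f).
Proof.
move=> Nf y Uy ry; rewrite /Zf cfB // !cfM // !(Nc_pd Nf Uy ry).
by move: (pd _ _ _ y) (pd _ _ _ y) (_ / _) => u v w; ring.
Qed.

Lemma JfJdet y : U y -> Jf pd Pc y = Jdet rho y.
Proof.
move=> Uy; rewrite /Jf cfB // !cfM // /Zf !cfB // !cfM // !pdP // !pdpdP //=.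
rewrite /Jdet /dj /=.
rewrite -!(dz_dzb_com _ _ oU (csm_real oU sr) Uy).
move: (dz _ _ y) (dz _ _ y) (dzb _ _ y) (dzb _ _ y) => a b c d.
move: (dz _ _ y) (dz _ _ y) (dz _ _ y) (dz _ _ y) => e f g h; ring.
Qed.

Hypothesis Jn0 : forall y, U y -> Jdet rho y != 0.

Lemma JRe y : U y -> Jdet rho y = (complex.Re (Jdet rho y))%:C.
Proof.
move=> Uy; apply/eqP; rewrite eq_complex /= eqxx /=; apply/eqP.
exact: Jdet_real oU sr Uy.
Qed.

Lemma ReJ_neq0 y : U y -> complex.Re (Jdet rho y) != 0.
Proof. by move=> Uy; have := Jn0 Uy; rewrite {1}(JRe Uy) fmorph_eq0. Qed.

Lemma sm_ReJ : sm U (fun y => complex.Re (Jdet rho y)).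
Proof. exact: (can_csm (can_Jdet ar)).1. Qed.

Definition Jic : A := mkc (csm_real oU (sm_inv oU sm_ReJ ReJ_neq0)).

Lemma JicE : Jf pd Pc * Jic = 1.
Proof.
apply: cfPU => // y Uy; rewrite cfM // JfJdet // cf_1 // cfval; last by left.
by rewrite {1}(JRe Uy) -rmorphM divff ?ReJ_neq0.
Qed.

Lemma ccjP : ccj Pc = Pc.
Proof. by apply: cfPU => // y Uy; rewrite ccjE // PcE // conjc_real. Qed.

Variables (V : vectType R) (f : V -> bool -> A).
Implicit Types x z : V.
Hypotheses (fL : forall (k : R) x z j, f (k *: x + z) j = ccst p r k%:C * f x j + f z j)
  (fh : forall x k j, pd true k (f x j) = 0)
  (ft : forall x y, U y -> rho y = 0 -> complex.Re
    (f x false y * dz (dj R false) Pf y + f x true y * dz (dj R true) Pf y) = 0)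
  (fa : forall x j, can_on p r (f x j))
  (finj : forall x, (forall j y, U y -> f x j y = 0) -> x = 0)
  (rp : rho p = 0).

Let h x : A := hf pd Pc (f x).
Let ev (u : A) : C := u p.

Lemma h_tan x : Nc (h x + ccj (h x)).
Proof.
move=> y Uy ry; rewrite cfD // ccjE // /h /hf cfD // !cfM // !pdP //=.
have := ft x Uy ry; move: (_ + _) => [u v] /= ->.
by apply/eqP; rewrite eq_complex /= addr0 subrr eqxx.
Qed.

Let half := ccst p r (2%:R^-1).
Let third := ccst p r (3%:R^-1).

Lemma halfE : half *+ 2 = 1.
Proof.
apply: cfPU => // y Uy; rewrite mulr2n cfD // cf_1 // !cf_cst //.
by field.
Qed.
Lemma thirdE : third *+ 3 = 1.
Proof.
apply: cfPU => // y Uy; rewrite -[3%N]/(2.+1)%N mulrS mulr2n !cfD // cf_1 // !cf_cst //.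
by field.
Qed.

Let evD u v : ev (u + v) = ev u + ev v. Proof. exact: cfD. Qed.
Let evM u v : ev (u * v) = ev u * ev v. Proof. exact: cfM. Qed.
Let Zd s := Zf_der pdD Pc s.
Let TE u : T u = Z false (Z true u) - Z true (Z false u). Proof. by []. Qed.

Lemma h_facts x : symbol_facts Z T ev (h x).
Proof.
apply: (@symbol_factsP R A Z T ev Nc Zd TE evD evM Nc_D Nc_M Nc_Z _ half third (h x) halfE thirdE _ _ (@ccj R p r)).
- by move=> u Nu; exact: Nu pp rp.
- move=> s; exact: (sp_ZZ pdD JicE Nc_D Nc_M Nc_Z (@ccjD R p r r0) (@ccjM R p r r0) (@ccj_pdc R p r r0) ccjP (fh x) (h_tan x) s).
- move=> s u; exact: (sp_TZ pdD pdC JicE Nc s u).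
- by move=> u v; exact: (cjB (@ccjD R p r r0)).
- by move=> s u; exact: (cjZ (@ccjD R p r r0) (@ccjM R p r r0) (@ccj_pdc R p r r0) ccjP).
- by move=> u; exact: ccjE.
- exact: h_tan.
Qed.

Definition h0 x : R := complex.Im (h x p).
Definition sa x : C := Z false (h x) p.
Definition sc x : C := Z false (Z true (h x)) p.
Definition sb x : C := T (Z false (h x)) p.
Definition k4 x : R := complex.Im (T (T (h x)) p).

Lemma pd_cst s j c : pd s j (ccst p r c) = 0.
Proof.
apply: cfPU => // y Uy; rewrite pdcE // cf_0 //.
rewrite (@d_open_ R p r s _ _ (fun=> c) _ Uy); last by move=> z; exact: cf_cst.
by case: s; [exact: dzb_cst|exact: dz_cst].
Qed.

Lemma Z_lin s c u v : Z s (ccst p r c * u + v) = ccst p r c * Z s u + Z s v.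
Proof.
rewrite (derD _ _ (Zd s)) (derM _ _ (Zd s)) (_ : Z s (ccst p r c) = 0) ?mul0r ?add0r //.
by rewrite /Zf !pd_cst !mulr0 subr0.
Qed.
Lemma T_lin c u v : T (ccst p r c * u + v) = ccst p r c * T u + T v.
Proof. by rewrite !TE !Z_lin; move: (Z _ _) (Z _ _) (Z _ _) (Z _ _) => ? ? ? ?; ring. Qed.
Lemma h_lin k x z : h (k *: x + z) = ccst p r k%:C * h x + h z.
Proof. by rewrite /h /hf !fL; ring. Qed.
Lemma ev_lin c u v : (ccst p r c * u + v) p = c * u p + v p.
Proof. by rewrite cfD // cfM // cf_cst. Qed.
Lemma Im_lin (k : R) (u v : C) : complex.Im (k%:C * u + v) = k * complex.Im u + complex.Im v.
Proof. by case: u v => [? ?] [? ?] /=; ring. Qed.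

Lemma h0L (k : R) x z : h0 (k *: x + z) = k * h0 x + h0 z.
Proof. by rewrite /h0 h_lin ev_lin Im_lin. Qed.
Lemma saL (k : R) x z : sa (k *: x + z) = k%:C * sa x + sa z.
Proof. by rewrite /sa h_lin Z_lin ev_lin. Qed.
Lemma scL (k : R) x z : sc (k *: x + z) = k%:C * sc x + sc z.
Proof. by rewrite /sc h_lin !Z_lin ev_lin. Qed.
Lemma sbL (k : R) x z : sb (k *: x + z) = k%:C * sb x + sb z.
Proof. by rewrite /sb h_lin Z_lin T_lin ev_lin. Qed.
Lemma k4L (k : R) x z : k4 (k *: x + z) = k * k4 x + k4 z.
Proof. by rewrite /k4 h_lin !T_lin ev_lin Im_lin. Qed.

Lemma imagE (w : C) : w = - Num.conj w -> w = 'i * (complex.Im w)%:C.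
Proof.
case: w => u v /eqP; rewrite eq_complex /= => /andP[/eqP E _].
have u0 : u = 0.
  by apply/eqP; have := subrr u; rewrite {2}E opprK -mulr2n => /eqP; rewrite mulrn_eq0.
by apply/eqP; rewrite eq_complex /= u0; apply/andP; split; apply/eqP; ring.
Qed.

(** [symbol_facts] raises the order by one for each symbol that vanishes. The values of [h] and of
    [T (T h)] are imaginary, so their imaginary parts suffice. *)
Lemma FkE k x : Fk h0 k4 sa sc sb k x <-> ord Z ev k (h x).
Proof.
have [[f0 f1] [[f2 f3] [[f4 f5] [[g1 g2] [[g3 g4] [[g5 gk] _]]]]]] := h_facts x.
have i0 (w : C) : w = - Num.conj w -> complex.Im w = 0 -> w = 0.
  by move=> h1 h2; rewrite (imagE h1) h2 mulr0.
split=> [[F0 F1 F2 F3 F4]|o].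
  case: k F0 F1 F2 F3 F4 => [//|k] F0 F1 F2 F3 F4.
  have o1 : ord Z ev 1 (h x) by exact/g1/(i0 _ f0)/F0.
  case: k F0 F1 F2 F3 F4 => [//|k] F0 F1 F2 F3 F4.
  have o2 := g2 o1 (F1 isT).
  case: k F0 F1 F2 F3 F4 => [//|k] F0 F1 F2 F3 F4.
  have o3 := g3 o2 (F2 isT).
  case: k F0 F1 F2 F3 F4 => [//|k] F0 F1 F2 F3 F4.
  have o4 := g4 o3 (F3 isT).
  case: k F0 F1 F2 F3 F4 => [//|k] F0 F1 F2 F3 F4.
  by apply/gk/(g5 o4)/(i0 _ f4)/F4.
have le j : (j <= k)%N -> ord Z ev j (h x) by move=> jk; exact: ord_le jk o.
split => kj.
- by have := ord_ev (le 1 kj); rewrite /ev /h0 => ->.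
- exact: (ord_ev (ord_Z false (le 2 kj))).
- exact: (ord_ev (ord_Z false (ord_Z true (le 3 kj)))).
- exact: (ord_ev (ord_T Zd TE evD evM (ord_Z false (le 4 kj)))).
- by have := ord_ev (ord_T Zd TE evD evM (ord_T Zd TE evD evM (le 5 kj))); rewrite /ev /k4 => ->.
Qed.

Definition flat (u : A) := forall k, ord Z ev k u.

Lemma flat_Z s u : flat u -> flat (Z s u).
Proof. by move=> fu k; apply: ord_Z. Qed.
Lemma flat_M a u : flat u -> flat (a * u).
Proof. by move=> fu k; apply: (ord_Ml Zd evD evM). Qed.
Lemma flat_D u v : flat u -> flat v -> flat (u + v).
Proof. by move=> fu fv k; apply: (ord_D Zd evD). Qed.
Lemma flat_N u : flat u -> flat (- u).
Proof. by move=> fu; rewrite -mulN1r; exact: flat_M. Qed.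
Lemma flat_B u v : flat u -> flat v -> flat (u - v).
Proof. by move=> fu fv; apply: flat_D => //; exact: flat_N. Qed.
Lemma flat_T u : flat u -> flat (T u).
Proof. by move=> fu; rewrite TE; apply: flat_B; do 2! apply: flat_Z. Qed.

(** For a holomorphic function [T u] and [Z false u] involve only its two complex derivatives, and
    Cramer's rule recovers these. Vanishing to infinite order along M therefore becomes vanishing in
    all directions. *)
Lemma flat_pd u : (forall k, pd true k u = 0) -> flat u -> forall j, flat (pd false j u).
Proof.
move=> uh fu j; have TS : T u = sf pd Pc false * pd false false u + sf pd Pc true * pd false true u.
  by rewrite (TfE pdD pdC) !uh !mulr0 !addr0.
have fZ := flat_Z false fu; have fT := flat_T fu.
have Etrue : Jf pd Pc * pd false true u =
    pd false true Pc * T u + Z true (pd false true Pc) * Z false u.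
  rewrite TS /sf /Jf /(Zf pd Pc false u).
  by move: (Zf _ _ _ _) (Zf _ _ _ _) => ? ?; ring.
have Efalse : Jf pd Pc * pd false false u =
    pd false false Pc * T u + Z true (pd false false Pc) * Z false u.
  rewrite TS /sf /Jf /(Zf pd Pc false u).
  by move: (Zf _ _ _ _) (Zf _ _ _ _) => ? ?; ring.
by case: j; [rewrite (mulJi JicE Etrue)|rewrite (mulJi JicE Efalse)];
  apply: flat_M; apply: flat_D; exact: flat_M.
Qed.

Lemma flat_dws w u : (forall k, pd true k u = 0) -> flat u ->
  dws w (fun y => complex.Re (u y)) p = 0 /\ dws w (fun y => complex.Im (u y)) p = 0.
Proof.
elim: w u => [|v w IH] u uh fu; first by have /ord_ev := fu 1%N; rewrite /ev /= => ->.
pose e := unr v.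
(* The real derivative along [v] of a holomorphic function is this complex combination of its
   partial derivatives; it is again holomorphic and flat, which feeds the induction on the word. *)
pose u' : A := ccst p r (e ord0 ord0) * pd false false u + ccst p r (e ord0 (lift ord0 ord0)) * pd false true u.
have u'h k : pd true k u' = 0.
  rewrite /u' (derD _ _ (pdD _ _)) !(derM _ _ (pdD _ _)) !pd_cst !(pdC true k false _ u) uh.
  by rewrite !(der0 (pdD _ _)); ring.
have fu' : flat u' by apply: flat_D; apply/flat_M/flat_pd.
have E y : U y -> Rderive v u y = u' y.
  move=> Uy; rewrite -(unrK v) (Rderive_dz u y (unr v)).
  rewrite (dz_coord (unr v) (cf_csm u) Uy) (dzb_coord (unr v) (cf_csm u) Uy).
  have z k : dzb (dj R k) u y = 0 by have := congr1 (fun g : A => g y) (uh k); rewrite pdcE // cf_0.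
  rewrite [dzb _ u y](z false) [dzb _ u y](z true) !mul0r !addr0.
  by rewrite /u' cfD // !cfM // !cf_cst // !pdcE //= mulrC [X in _ + X]mulrC.
have [h1 h2] := IH u' u'h fu'.
rewrite /= (dws_open (G := fun y => complex.Re (u' y)) w oU _ pp); last by move=> y Uy; rewrite -E.
by rewrite (dws_open (F := 'D_v _) (G := fun y => complex.Im (u' y)) w oU _ pp) // => y Uy; rewrite -E.
Qed.

(** Order five forces all orders, the coefficients inherit flatness from [h] through Cramer's rule,
    and the identity theorem makes them zero on the ball. *)
Lemma model_inj x : Fk h0 k4 sa sc sb 5 x -> x = 0.
Proof.
move=> /FkE o; have fl : flat (h x).
  by have [_ [_ [_ [_ [_ [[_ gk] _]]]]]] := h_facts x; exact: gk.
have fj j : flat (f x j).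
  case: j.
    by rewrite (f1E pdD JicE (fh x)); apply: flat_M; apply: flat_B; apply: flat_M => //; exact: flat_Z.
  by rewrite (f0E pdD JicE (fh x)); apply: flat_M; apply: flat_B; apply: flat_M => //; exact: flat_Z.
apply: finj => j y Uy; have dw w := flat_dws w (fun k => fh x k j) (fj j).
have [a1 a2] := fa x j.
apply/eqP; rewrite eq_complex.
rewrite (flat_ball a1 pp (fun w => (dw w).1) Uy) (flat_ball a2 pp (fun w => (dw w).2) Uy).
by rewrite !eqxx.
Qed.

Lemma model_dim : (\dim (fullv : {vspace V}) <= 8)%N.
Proof. exact: (dim_le8 h0L k4L saL scL sbL model_inj). Qed.

Variable bk : V -> V -> V.
Hypothesis bkE : forall x z j, f (bk x z) j = br pd (f x) (f z) j.
Let jc : C := Jic p.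

Lemma model_table x z : bracket_table Z T ev (h x) (h z) (h (bk x z)) Jic.
Proof.
apply: (bracket_tableP Zd TE evD evM (q := Jic * Jic * Qf pd Pc)).
have -> : h (bk x z) = hf pd Pc (br pd (f x) (f z)) by rewrite /h /hf !bkE.
exact: (hf_brE pdD pdC JicE (fh x) (fh z)).
Qed.

Let jc0 : jc != 0.
Proof.
apply/eqP => j0; have := congr1 (fun g : A => g p) JicE; rewrite cfM // cf_1 // -/jc j0 mulr0 => /eqP.
by rewrite eq_sym oner_eq0.
Qed.

Let bkF k k' x z : Fk h0 k4 sa sc sb k x -> Fk h0 k4 sa sc sb k' z ->
  Fk h0 k4 sa sc sb (k + k' - 2) (bk x z).
Proof. by move=> /FkE ox /FkE oz; apply/FkE; exact: (model_table x z).1. Qed.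

Let im0 x : h x p = 'i * (h0 x)%:C.
Proof. by have [[f0 _] _] := h_facts x; exact: imagE f0. Qed.
Let im4 x : T (T (h x)) p = 'i * (k4 x)%:C.
Proof. by have [_ [_ [[f4 _] _]]] := h_facts x; exact: imagE f4. Qed.
Let za x : Z true (h x) p = - Num.conj (sa x).
Proof. by have [[_ f1] _] := h_facts x; exact: (f1 true). Qed.
Let zc x : Z true (Z false (h x)) p = - Num.conj (sc x).
Proof. by have [_ [[f2 _] _]] := h_facts x; exact: (f2 true false). Qed.
Let zb x : T (Z true (h x)) p = Num.conj (sb x).
Proof. by have [_ [[_ f3] _]] := h_facts x; exact: (f3 true). Qed.

Let b11 x z : Fk h0 k4 sa sc sb 1 x -> Fk h0 k4 sa sc sb 1 z ->
  'i * (h0 (bk x z))%:C = jc * (sa x * Num.conj (sa z) - Num.conj (sa x) * sa z).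
Proof.
move=> /FkE ox /FkE oz; have [_ [t _]] := model_table x z.
by rewrite -im0 [LHS](t ox oz) /ev !za -/(sa x) -/(sa z) -/jc; ring.
Qed.
Let b12 x z : Fk h0 k4 sa sc sb 1 x -> Fk h0 k4 sa sc sb 2 z ->
  sa (bk x z) = jc * (sa x * Num.conj (sc z)).
Proof.
move=> /FkE ox /FkE oz; have [_ [_ [t _]]] := model_table x z.
have [_ [_ [[_ g] _]]] := h_facts z.
by rewrite [LHS](t ox oz (g false oz)) /ev zc -/(sa x) -/jc; ring.
Qed.
Let b03 x z : Fk h0 k4 sa sc sb 3 z -> sa (bk x z) = jc * ('i * (h0 x)%:C * sb z).
Proof.
move=> /FkE oz; have [_ [_ [_ [t _]]]] := model_table x z.
have [_ [_ [_ [_ [_ [_ [_ [g _]]]]]]]] := h_facts z.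
by rewrite [LHS](t oz) (g false oz) /ev im0 -/(sb z) -/jc -!mulrA.
Qed.
Let b13 x z : Fk h0 k4 sa sc sb 1 x -> Fk h0 k4 sa sc sb 3 z ->
  sc (bk x z) = jc * (sa x * Num.conj (sb z) - Num.conj (sa x) * sb z *+ 2).
Proof.
move=> /FkE ox /FkE oz; have [_ [_ [_ [_ [t _]]]]] := model_table x z.
have [_ [_ [_ [_ [_ [_ [[g1 g2] [g3 _]]]]]]]] := h_facts z.
have F u1 u2 u3 u4 u5 c' : u1 = - Num.conj (sa x) -> u2 = sb z -> u3 = sb z -> u5 = Num.conj (sb z) ->
    u4 = u5 -> c' = jc * (u1 * (u2 + u3) + sa x * u4) ->
    c' = jc * (sa x * Num.conj (sb z) - Num.conj (sa x) * sb z *+ 2).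
  move=> -> -> -> -> -> ->.
  by move: (Num.conj (sa x)) (Num.conj (sb z)) (sa x) (sb z) (jc) => u v w t' j; ring.
exact: (F _ _ _ _ _ _ (za x) (g2 oz) (g3 false oz) (zb z) (g3 true oz) (t ox oz (g1 false true oz))).
Qed.
Let b23 x z : Fk h0 k4 sa sc sb 2 x -> Fk h0 k4 sa sc sb 3 z -> sb (bk x z) = jc * (sc x * sb z).
Proof.
move=> /FkE ox /FkE oz; have [_ [_ [_ [_ [_ [t _]]]]]] := model_table x z.
have [_ [_ [[_ g] _]]] := h_facts x.
have [_ [_ [_ [_ [_ [_ [_ [g3 _]]]]]]]] := h_facts z.
have F u v c' : u = v -> c' = jc * (sc x * sb z + T (h x) p * (u - v)) -> c' = jc * (sc x * sb z).
  by move=> -> ->; rewrite subrr mulr0 addr0.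
exact: (F _ _ _ (g3 false oz) (t ox oz (g false ox))).
Qed.
Let b33 x z : Fk h0 k4 sa sc sb 3 x -> Fk h0 k4 sa sc sb 3 z ->
  'i * (k4 (bk x z))%:C = jc * (Num.conj (sb x) * sb z - sb x * Num.conj (sb z)) *+ 2.
Proof.
move=> /FkE ox /FkE oz; have [_ [_ [_ [_ [_ [_ [t _]]]]]]] := model_table x z.
have F u1 u2 c' d' : u1 = Num.conj (sb x) -> u2 = Num.conj (sb z) -> d' = c' ->
    d' = jc * (u1 * sb z - u2 * sb x) *+ 2 ->
    c' = jc * (Num.conj (sb x) * sb z - sb x * Num.conj (sb z)) *+ 2.
  move=> -> -> -> ->.
  by move: (Num.conj (sb x)) (Num.conj (sb z)) (sb x) (sb z) (jc) => u v w t' j; ring.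
exact: (F _ _ _ _ (zb x) (zb z) (im4 _) (t ox oz)).
Qed.
Let b14 x z : Fk h0 k4 sa sc sb 1 x -> Fk h0 k4 sa sc sb 4 z ->
  sb (bk x z) = jc * (sa x * ('i * (k4 z)%:C / 2)).
Proof.
move=> /FkE ox /FkE oz; have [_ [_ [_ [_ [_ [_ [_ t]]]]]]] := model_table x z.
have [_ [_ [_ [_ [_ [_ [_ [_ [g1 g2]]]]]]]]] := h_facts z.
have F u v c' : v = u / 2 -> u = 'i * (k4 z)%:C -> c' = jc * sa x * (u - v) ->
    c' = jc * (sa x * ('i * (k4 z)%:C / 2)).
  by move=> -> -> ->; rewrite -mulrA {1}['i * _]splitr addrK.
exact: (F _ _ _ (g1 oz) (im4 z) (t ox oz (g2 oz))).
Qed.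

Lemma model_subalg (W : {vspace V}) : (forall x z, x \in W -> z \in W -> bk x z \in W) ->
  (6 <= \dim W)%N -> \dim W = 8.
Proof.
apply: (@subalg_dim R V bk h0 k4 sa sc sb jc).
- exact h0L.
- exact k4L.
- exact saL.
- exact scL.
- exact sbL.
- exact model_inj.
- exact jc0.
- exact bkF.
- exact b11.
- move=> x y Fx Fy; move: (b12 Fx Fy); move: (sa (bk x y)) (sa x) (Num.conj (sc y)) (jc) => u v w t; exact.
- move=> x y Fy; move: (b03 x Fy); move: (sa (bk x y)) (h0 x) (sb y) (jc) => u v w t; exact.
- move=> x y Fx Fy; move: (b13 Fx Fy); move: (sc (bk x y)) (Num.conj (sa x)) (Num.conj (sb y)) (sa x) (sb y) (jc) => u v w t a b; exact.
- move=> x y Fx Fy; move: (b23 Fx Fy); move: (sb (bk x y)) (sc x) (sb y) (jc) => u v w t; exact.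
- move=> x y Fx Fy; move: (b33 Fx Fy); move: (k4 (bk x y)) (Num.conj (sb x)) (Num.conj (sb y)) (sb x) (sb y) (jc) => u v w t a b; exact.
- move=> x y Fx Fy; move: (b14 Fx Fy); move: (sb (bk x y)) (sa x) (k4 y) (jc) => u v w t; exact.
Qed.

Lemma model_perfect (S : {vspace V}) : \dim (fullv : {vspace V}) = 8 ->
  (forall x z, bk x z \in S) -> S = fullv.
Proof.
apply: (@full_perfect R V bk h0 k4 sa sc sb jc).
- exact h0L.
- exact k4L.
- exact saL.
- exact scL.
- exact sbL.
- exact model_inj.
- exact jc0.
- exact bkF.
- exact b11.
- move=> x y Fy; move: (b03 x Fy); move: (sa (bk x y)) (h0 x) (sb y) (jc) => u v w t; exact.
- move=> x y Fx Fy; move: (b13 Fx Fy); move: (sc (bk x y)) (Num.conj (sa x)) (Num.conj (sb y)) (sa x) (sb y) (jc) => u v w t a b; exact.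
- move=> x y Fx Fy; move: (b23 Fx Fy); move: (sb (bk x y)) (sc x) (sb y) (jc) => u v w t; exact.
- move=> x y Fx Fy; move: (b33 Fx Fy); move: (k4 (bk x y)) (Num.conj (sb x)) (Num.conj (sb y)) (sb x) (sb y) (jc) => u v w t a b; exact.
Qed.

End Model.

(** * Functions semi-invariant under a frame of tangent fields *)

Section Frame.
Variable R : realType.
Local Notation R4 := 'rV[R]_4.
Implicit Types (y u : R4) (F G : R4 -> R) (U : set R4).

Lemma sm_det k U (B : R4 -> 'M[R]_k) : open U -> (forall i j, sm U (fun y => B y i j)) ->
  sm U (fun y => \det (B y)).
Proof.
move=> oU sB; rewrite /determinant.
apply: (sm_sum _ _ oU) => s; apply: (sm_mul oU (sm_cst _ oU)).
by apply: (sm_prod _ oU) => i; exact: sB.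
Qed.

Lemma sm_inv_row k U (B : R4 -> 'M[R]_k.+1) (u : 'rV[R]_k.+1) i : open U ->
  (forall i j, sm U (fun y => B y i j)) -> (forall y, U y -> \det (B y) != 0) ->
  sm U (fun y => (u *m invmx (B y)) ord0 i).
Proof.
move=> oU sB dB.
have sA j : sm U (fun y => \adj (B y) j i).
  have sM : sm U (fun y => \det (row' i (col' j (B y)))).
    apply: (sm_det oU) => a b.
    by apply: (sm_ext oU _ (sB (lift i a) (lift j b))) => y _; rewrite !mxE.
  by apply: (sm_ext oU _ (sm_mul oU (sm_cst ((-1) ^+ (i + j)) oU) sM)) => y _; rewrite !mxE.
have sI j : sm U (fun y => u ord0 j * ((\det (B y))^-1 * \adj (B y) j i)).
  exact: (sm_mul oU (sm_cst (u ord0 j) oU) (sm_mul oU (sm_inv oU (sm_det oU sB) dB) (sA j))).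
apply: (sm_ext oU _ (sm_sum (index_enum _) xpredT oU sI)) => y Uy.
rewrite [RHS]mxE; apply: eq_bigr => j _.
by rewrite /invmx unitmxE unitfE dB // [in RHS]mxE.
Qed.

Lemma derive_comb F y (I : finType) (t : I -> R) (w : I -> R4) : differentiable F y ->
  'D_(\sum_i t i *: w i) F y = \sum_i t i * 'D_(w i) F y.
Proof.
move=> dF; rewrite deriveE // linear_sum; apply: eq_bigr => i _.
by rewrite linearZ deriveE.
Qed.

(** The last vector of the frame is the transversal [n], the others are tangent along the
    hypersurface. Every tangential derivative of [F] is there a multiple of [F], hence so is every
    iterated one; all vanish at [q] and [flat_vanish] applies. *)
Lemma frame_flat q r rho n F (v : 'I_4 -> R4 -> R4) (kap : 'I_4 -> R4 -> R) :
  0 < r -> an_on q r rho -> an_on q r F ->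
  (forall y, ball q r y -> 'D_n rho y != 0) ->
  (forall i j, sm (ball q r) (fun y => v i y ord0 j)) ->
  (forall i, i != ord_max -> sm (ball q r) (kap i)) ->
  (forall i, i != ord_max -> forall y, ball q r y -> rho y = 0 ->
    'D_(v i y) rho y = 0 /\ 'D_(v i y) F y = kap i y * F y) ->
  (forall y, v ord_max y = n) -> \det (\matrix_i v i q) != 0 ->
  rho q = 0 -> F q = 0 -> \forall y \near q, rho y = 0 -> F y = 0.
Proof.
move=> r0 ar aF dn sv sk H vn dq rq Fq.
pose B y := \matrix_i v i y : 'M[R]_4.
have oU : open (ball q r) by exact: ball_open.
have qq : ball q r q by exact: ballxx.
have sB i j : sm (ball q r) (fun y => B y i j).
  by apply: (sm_ext oU _ (sv i j)) => y _; rewrite !mxE.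
have [r1 /andP[r10 r1r] dB] := ball_shrink r0 (near_neq0 oU (sm_det oU sB) qq dq).
have oU1 : open (ball q r1) by exact: ball_open.
have qq1 : ball q r1 q by exact: ballxx.
have ar1 := an_on_le r1r ar; have aF1 := an_on_le r1r aF.
have sub : ball q r1 `<=` ball q r by exact: le_ball.
have dn1 y : ball q r1 y -> 'D_n rho y != 0 by move=> h; exact/dn/sub.
have sr := ar1.1; have sF := aF1.1.
pose t u y i := (u *m invmx (B y)) ord0 i.
have st u i : sm (ball q r1) (fun y => t u y i).
  by apply: (sm_inv_row u i oU1 _ dB) => a b; exact: sm_sub sub (sB a b).
have uE u y : ball q r1 y -> u = \sum_i t u y i *: v i y.
  move=> Uy; rewrite -[LHS]mulmx1 -(mulVmx (_ : B y \in unitmx)); last by rewrite unitmxE unitfE; exact: dB.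
  rewrite mulmxA mulmx_sum_row; apply: eq_bigr => i _; congr (_ *: _).
  by rewrite rowK.
pose cu u y := \sum_(i | i != ord_max) t u y i * kap i y.
have scu u : sm (ball q r1) (cu u).
  rewrite /cu.
  have sc i : sm (ball q r1) (fun y => if i != ord_max then t u y i * kap i y else 0).
    case: (i != ord_max) (sk i) => hi; last exact: (sm_cst 0 oU1).
    exact: (sm_mul oU1 (st u i) (sm_sub sub (hi isT))).
  apply: (sm_ext oU1 _ (sm_sum (index_enum _) xpredT oU1 sc)) => y _.
  by rewrite [RHS]big_mkcond.
have tF u y : ball q r1 y -> rho y = 0 -> tang rho n u F y = cu u y * F y.
  move=> Uy ry; have Uy' := sub _ Uy.
  have E1 := derive_comb (t u y) (fun i => v i y) (sm_diff sF Uy).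
  have E2 := derive_comb (t u y) (fun i => v i y) (sm_diff sr Uy).
  rewrite -(uE u y Uy) in E1 E2.
  have E2' : 'D_u rho y = t u y ord_max * 'D_n rho y.
    rewrite E2 (bigD1 ord_max) //= vn big1 ?addr0 // => i hi.
    by rewrite (H i hi y Uy' ry).1 mulr0.
  rewrite /tang E2' mulfK ?dn1 // E1 (bigD1 ord_max) //= vn addrC addrK.
  rewrite /cu mulr_suml; apply: eq_bigr => i hi.
  by rewrite (H i hi y Uy' ry).2 mulrA.
have stang u G : sm (ball q r1) G -> sm (ball q r1) (tang rho n u G).
  by move=> sG; exact: (sm_tang u oU1 sr sG dn1).
have key u k : sm (ball q r1) (iter k (tang rho n u) F) /\ exists c, sm (ball q r1) c /\
    forall y, ball q r1 y -> rho y = 0 -> iter k (tang rho n u) F y = c y * F y.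
  elim: k => [|k [sG [c [sc cE]]]].
    by split; [exact: sF|exists (cst 1); split; [exact: (sm_cst 1 oU1)|move=> y _ _; rewrite mul1r]].
  split; first exact: stang.
  (* The product rule gives the new multiplier. Equality of the iterate with [c] times [F] holds
     only on the level set, so its tangential derivative is taken by [tang_vanish] applied to the
     difference. *)
  exists (fun y => tang rho n u c y + c y * cu u y); split.
    exact: (sm_add oU1 (stang u c sc) (sm_mul oU1 sc (scu u))).
  move=> y Uy ry; set G := iter k (tang rho n u) F in sG cE *.
  have [r' r'0 [sub' ar']] := an_on_at ar1 Uy.
  have sH := sm_sub2 oU1 sG (sm_mul oU1 sc sF).
  have HM : \forall z \near y, rho z = 0 -> G z - c z * F z = 0.
    by apply: filterS (near_ball Uy) => z Uz rz; rewrite cE // subrr.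
  have := tang_vanish u r'0 ar' ry (dn1 y Uy) (sm_diff sH Uy) HM.
  rewrite iterS -/G {1}/tang.
  rewrite !(deriveB (sm_derivable _ sG Uy) (sm_derivable _ (sm_mul oU1 sc sF) Uy)).
  rewrite !(deriveM (sm_derivable _ sc Uy) (sm_derivable _ sF Uy)).
  rewrite /GRing.scale /= => E; have := tF u y Uy ry; rewrite /tang => E'.
  move: E E'; move: ('D_u rho y / 'D_n rho y) ('D_u G y) ('D_n G y) ('D_u F y) ('D_n F y) ('D_u c y) ('D_n c y).
  move: (F y) (c y) (cu u y) => F0 c0 cu0 w1 w2 w3 w4 w5 w6 w7 E E'.
  have -> : w2 - w1 * w3 = (w2 - (c0 * w4 + F0 * w6) - w1 * (w3 - (c0 * w5 + F0 * w7)))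
     + c0 * (w4 - w1 * w5) + F0 * (w6 - w1 * w7) by ring.
  by rewrite E E'; ring.
apply: (flat_vanish r10 ar1 aF1 rq (dn q qq)) => u k.
by have [_ [c [_ cE]]] := key u k; rewrite cE // Fq mulr0.
Qed.

End Frame.

(** * Rank of the fields where the Levi determinant vanishes *)

Section Isotropy.
Variable R : realType.
Local Notation C := R[i].
Local Notation C2 := 'rV[C]_2.
Local Notation R4 := 'rV[R]_4.
Variables (q : R4) (r : R) (rho : R4 -> R) (n : R4).
Hypotheses (r0 : 0 < r) (ar : an_on q r rho) (dn : forall y, ball q r y -> 'D_n rho y != 0).
Local Notation U := (ball q r).
Local Notation A := (cfun q r).
Let oU : open U. Proof. exact: ball_open. Qed.
Let qq : U q. Proof. exact: ballxx. Qed.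
Let sr : sm U rho := ar.1.
Local Notation pd := (@pdc R q r).
Local Notation P := (Pc ar).
Local Notation Pf := (fun y => (rho y)%:C).
Implicit Types (u : A) (y : R4) (g : bool -> A).
Let pdD := @pdc_der R q r r0.
Let pdC := @pdc_com R q r r0.

(** The multiplier is the ratio of the derivatives of [u] and [rho] along [n]; it is a smooth
    function on the whole ball because the denominator has no zero there. *)
Lemma Nc_pdc u : Nc rho u -> exists c, forall s j, Nc rho (pd s j u - c * pd s j P).
Proof.
move=> Nu.
exists (mkc (csm_mul oU (csm_Rderive n (cf_csm u)) (csm_real oU (sm_inv oU (sm_D n sr) dn)))).
move=> s j y Uy ry; rewrite cfB // cfM // cfval; last by left.
by rewrite (Nc_pd ar dn Nu Uy ry) fmorphV subrr.
Qed.

Definition cjf g j : A := ccj (g j).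

Lemma cjf_hol g : (forall k j, pd true k (g j) = 0) -> forall k j, pd false k (cjf g j) = 0.
Proof.
move=> gh k j; rewrite -[false]/(~~ true) -(ccj_pdc r0) gh.
by apply: cfPU => // y Uy; rewrite ccjE // cf_0 // conjc0.
Qed.

Definition vecf g y : R4 := realify (g false y *: dj R false + g true y *: dj R true).

Lemma vecf0 g y : (g false y *: dj R false + g true y *: dj R true) ord0 ord0 = g false y.
Proof. by rewrite !mxE !eqxx /= mulr1 mulr0 addr0. Qed.
Lemma vecf1 g y : (g false y *: dj R false + g true y *: dj R true) ord0 (lift ord0 ord0) = g true y.
Proof. by rewrite !mxE !eqxx /= mulr1 mulr0 add0r. Qed.

Lemma XfE g u y : U y -> Xf pd g (cjf g) u y = Rderive (vecf g y) u y.
Proof.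
move=> Uy; rewrite (Rderive_dz u y) (dz_coord _ (cf_csm u) Uy) (dzb_coord _ (cf_csm u) Uy).
rewrite vecf0 vecf1 /Xf /cjf !(cfD, cfM, ccjE, pdcE) //=.
have e (w : C) : conjc w = Num.conj w by [].
rewrite /dj !e; move: (dz _ u y) (dz _ u y) (dzb _ u y) (dzb _ u y) => a b c d.
by move: (Num.conj (g false y)) (Num.conj (g true y)) (g false y) (g true y) => ? ? ? ?; ring.
Qed.

Definition tangent g := forall y, U y -> rho y = 0 -> complex.Re
    (g false y * dz (dj R false) Pf y + g true y * dz (dj R true) Pf y) = 0.

Lemma tangent_N g : tangent g ->
  Nc rho (hf pd P g + (cjf g false * pd true false P + cjf g true * pd true true P)).
Proof.
move=> gt y Uy ry; rewrite /hf /cjf !(cfD, cfM, ccjE, pdP) //= !dzb_real.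
have := gt y Uy ry; move: (g false y) (g true y) (dz _ _ y) (dz _ _ y) => [a a'] [b b'] [d d'] [c c'] /= E.
apply/eqP; rewrite eq_complex /=; apply/andP; split; apply/eqP; last by ring.
transitivity (2 * (a * c - a' * c' + (b * d - b' * d'))); first by ring.
by rewrite E mulr0.
Qed.

Lemma vecf_rho g : tangent g -> forall y, U y -> rho y = 0 -> 'D_(vecf g y) rho y = 0.
Proof.
move=> gt y Uy ry; have := tangent_N gt Uy ry.
have E := XfE g P Uy; rewrite /Xf in E; rewrite /hf [X in X = 0 -> _]E.
move=> /(congr1 (@complex.Re R)) /= <-.
have h z : U z -> rho z = complex.Re (P z) by move=> Uz; rewrite PcE.
exact: (derive_open _ oU Uy h).
Qed.

Lemma vecf_J g : (forall k j, pd true k (g j) = 0) -> tangent g -> exists k : R4 -> R, sm U k /\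
  forall y, U y -> rho y = 0 -> 'D_(vecf g y) (fun z => complex.Re (Jdet rho z)) y =
    k y * complex.Re (Jdet rho y).
Proof.
move=> gh gt.
have [k Nk] := Xf_J pdD pdC (@Nc_D R q r rho) (@Nc_M R q r rho) Nc_pdc gh (cjf_hol gh) (tangent_N gt).
exists (fun y => complex.Re (k y)); split; first exact: (cf_csm k).1.
move=> y Uy ry; have := Nk y Uy ry; rewrite cfB // cfM // XfE // JfJdet //.
have -> : Rderive (vecf g y) (Jf pd P) y = Rderive (vecf g y) (Jdet rho) y.
  by apply: (Rderive_open _ oU Uy) => z Uz; exact: JfJdet.
move/eqP; rewrite subr_eq0 => /eqP /(congr1 (@complex.Re R)) E.
rewrite [LHS]E; move: (Jdet_real oU sr Uy).
by case: (k y) (Jdet rho y) => [a b] [c d] /= ->; ring.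
Qed.

(** With [n], three fields of independent values at [q] form a frame near [q], and by relative
    invariance each of them multiplies the Levi determinant by a function along M. A zero at [q]
    then spreads. *)
Lemma span_flat (g : 'I_3 -> bool -> A) : (forall i k j, pd true k (g i j) = 0) ->
  (forall i, tangent (g i)) ->
  \det (\matrix_(i < 4) (if unlift ord_max i is Some i' then vecf (g i') q else n)) != 0 ->
  rho q = 0 -> Jdet rho q = 0 -> \forall y \near q, rho y = 0 -> Jdet rho y = 0.
Proof.
move=> gh gt dq rq Jq.
have /choice[k kP] : forall i, exists k : R4 -> R, sm U k /\
  forall y, U y -> rho y = 0 -> 'D_(vecf (g i) y) (fun z => complex.Re (Jdet rho z)) y =
    k y * complex.Re (Jdet rho y) by move=> i; exact: vecf_J.
pose v (i : 'I_4) y := if unlift ord_max i is Some i' then vecf (g i') y else n.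
pose kap (i : 'I_4) := if unlift ord_max i is Some i' then k i' else cst 0.
have sg i j : sm U (fun y => vecf (g i) y ord0 j).
  have cz s : csm U (fun y => (g i false y *: dj R false + g i true y *: dj R true) ord0 s).
    have c1 := csm_mul oU (cf_csm (g i false)) (csm_cst (dj R false ord0 s) oU).
    have c2 := csm_mul oU (cf_csm (g i true)) (csm_cst (dj R true ord0 s) oU).
    by apply: (csm_ext oU _ (csm_add oU c1 c2)) => y _; rewrite !mxE.
  have := splitK (j : 'I_(2 + 2)); case: (fintype.split (j : 'I_(2 + 2))) => s /= <-.
    by apply: (sm_ext oU _ (cz s).1) => y _; rewrite [RHS]realify_l.
  by apply: (sm_ext oU _ (cz s).2) => y _; rewrite [RHS]realify_r.
have aJ := (can_Jdet ar).1.
have JI y : U y -> complex.Re (Jdet rho y) = 0 -> Jdet rho y = 0.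
  by move=> Uy h; apply/eqP; rewrite eq_complex h (Jdet_real oU sr Uy) !eqxx.
have sv i j : sm U (fun y => v i y ord0 j).
  by rewrite /v; case: (unlift ord_max i) => [i'|]; [exact: sg|exact: (sm_cst _ oU)].
have sk i : i != ord_max -> sm U (kap i).
  by rewrite /kap; case: unliftP => [i' _ _|->]; [exact: (proj1 (kP i'))|by rewrite eqxx].
have H i : i != ord_max -> forall y, U y -> rho y = 0 -> 'D_(v i y) rho y = 0 /\ 'D_(v i y) (fun z => complex.Re (Jdet rho z)) y = kap i y * complex.Re (Jdet rho y).
  rewrite /v /kap; case: unliftP => [i' _ _ y Uy ry|->]; last by rewrite eqxx.
  by split; [exact: vecf_rho|exact: (kP i').2].
have vn y : v ord_max y = n by rewrite /v unlift_none.
have Jq' : complex.Re (Jdet rho q) = 0 by rewrite Jq.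
have := frame_flat r0 ar aJ dn sv sk H vn dq rq Jq'.
move=> fl; have nU : \forall y \near q, U y by exact: near_ball qq.
by apply: filterS2 nU fl => y Uy h /h; exact: JI.
Qed.

End Isotropy.

(** * Local Levi flatness propagates over a connected hypersurface *)

Section Connectivity.
Variable R : realType.
Local Notation C := R[i].
Local Notation C2 := 'rV[C]_2.
Local Notation R4 := 'rV[R]_4.
Implicit Types (M : set C2) (p : C2) (y u v n : R4) (rho : R4 -> R) (r : R).

Lemma local_equationP M p rho : local_equation M p rho -> exists r n,
  [/\ 0 < r, an_on (realify p) r rho,
     forall y, ball (realify p) r y -> 'D_n rho y != 0 &
     forall y, ball (realify p) r y -> (M (unr y) <-> rho y = 0)].
Proof.
move=> [an [n dn] MP].
have [r r0 ar] := analytic_real (nbhs_singleton an).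
have pp : ball (realify p) r (realify p) by exact: ballxx.
have oU : open (ball (realify p) r) by exact: ball_open.
have nD := near_neq0 oU (sm_D n ar.1) pp dn.
have nM : \forall y \near realify p, M (unr y) <-> rho y = 0.
  by apply: filterS (iffLR (near_unrP _ p) MP) => y; rewrite unrK.
have nB : \forall y \near realify p, 'D_n rho y != 0 /\ (M (unr y) <-> rho y = 0).
  by apply: filterS2 nD nM => y h1 h2.
have [r1 /andP[r10 r1r] sub] := ball_shrink r0 nB.
exists r1, n; split.
- exact: r10.
- exact: an_on_le r1r ar.
- by move=> y /sub [].
- by move=> y /sub [].
Qed.

Lemma local_equation0 M p rho : M p -> local_equation M p rho -> rho (realify p) = 0.
Proof. by move=> Mp [_ _ h]; exact/(nbhs_singleton h). Qed.

Lemma local_equation_near M p rho : local_equation M p rho ->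
  \forall z \near p, M z -> local_equation M z rho.
Proof.
move=> le; have [an _ MP] := le; have [r [n [r0 ar dn rM]]] := local_equationP le.
have an' : \forall z \near p, \forall x \near realify z, analytic_at rho x.
  exact: (@near_realify R (fun y => \forall x \near y, analytic_at rho x) p (near_join an)).
have MP' : \forall z \near p, \forall z' \near z, M z' <-> rho (realify z') = 0.
  exact: near_join MP.
have pp : ball (realify p) r (realify p) by exact: ballxx.
have nb : \forall z \near p, ball (realify p) r (realify z).
  exact: (@near_realify R (ball (realify p) r) p (near_ball pp)).
near=> z => Mz; split.
- by near: z.
- by exists n; apply: dn; near: z.
- by near: z.
Unshelve. all: by end_near. Qed.

Definition Jflat rho p := \forall y \near realify p, rho y = 0 -> Jdet rho y = 0.

Lemma Jflat_near rho p : Jflat rho p -> \forall z \near p, Jflat rho z.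
Proof.
move=> /near_join h.
exact: (@near_realify R (fun x => \forall y \near x, rho y = 0 -> Jdet rho y = 0) p h).
Qed.

(** Two equations of M have the same tangent directions, and by [hess_change] their second
    derivatives along [v] and along ['i *: v] are proportional with one factor. Their Levi forms on
    the complex tangent line then vanish together. *)
Lemma Jdet_change M p rho rho' : M p -> local_equation M p rho -> local_equation M p rho' ->
  Jdet rho' (realify p) = 0 -> Jdet rho (realify p) = 0.
Proof.
move=> Mp le le' J'.
have [r [n [r0 ar dn rM]]] := local_equationP le.
have [r' [n' [r'0 ar' dn' rM']]] := local_equationP le'.
pose s := Num.min r r'; have s0 : 0 < s by rewrite lt_min r0.
have sr : s <= r by rewrite ge_min lexx. have sr' : s <= r' by rewrite ge_min lexx orbT.
have as1 := an_on_le sr ar; have as2 := an_on_le sr' ar'.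
set q := realify p in ar ar' dn dn' rM rM' as1 as2 J' *.
have qq : ball q s q by exact: ballxx.
have oU : open (ball q s) by exact: ball_open.
have sub1 : ball q s `<=` ball q r by exact: le_ball.
have sub2 : ball q s `<=` ball q r' by exact: le_ball.
have rq : rho q = 0 by exact: local_equation0 le. have rq' : rho' q = 0 by exact: local_equation0 le'.
have dq := dn q (sub1 q qq); have dq' := dn' q (sub2 q qq).
have v12 : \forall y \near q, rho y = 0 -> rho' y = 0.
  by apply: filterS (near_ball qq) => y h /(rM y (sub1 y h)) /(rM' y (sub2 y h)).
have v21 : \forall y \near q, rho' y = 0 -> rho y = 0.
  by apply: filterS (near_ball qq) => y h /(rM' y (sub2 y h)) /(rM y (sub1 y h)).
pose v := Zvec rho q; pose u := realify v.
have tv : complex_tangent rho p v.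
  have sP := csm_real oU as1.1; rewrite /complex_tangent (sum_ddz v sP qq) -/q.
  by rewrite (dz_coord v sP qq) Zvec0 Zvec1 mulrN mulrC subrr.
have [t1 t2] := iffLR (tangent_real v oU as1.1 qq) tv.
have [e1 _] := hess_change s0 as1 as2 rq dq v12 t1.
have [e2 _] := hess_change s0 as1 as2 rq dq v12 t2.
have tv' : complex_tangent rho' p v by exact/(tangent_real v oU as2.1 qq).
have [_ f1] := hess_change s0 as2 as1 rq' dq' v21 e1.
have [_ f2] := hess_change s0 as2 as1 rq' dq' v21 e2.
have up : unr q = p by exact: realifyK.
have l' : levi_form rho' p v = 0.
  have := levi_Jdet (v := v) oU as2.1 qq dq'; rewrite up => /(_ tv') [k [_ ->]].
  by rewrite J' mulr0.
have := levi_real v oU as2.1 qq; rewrite l' /= -/q -/u => /esym /eqP.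
rewrite fmorph_eq0 => /eqP h0.
rewrite -(Jdet_levi oU as1.1 qq) up (levi_real v oU as1.1 qq) /= -/q -/u f1 f2.
by rewrite -mulrDr -mulrA h0 mulr0.
Qed.

Lemma Jflat_change M p rho rho' : M p -> local_equation M p rho -> local_equation M p rho' ->
  Jflat rho' p -> Jflat rho p.
Proof.
move=> Mp le le' jf.
have [r [n [r0 ar dn rM]]] := local_equationP le.
have n1 := iffLR (near_unrP _ p) (local_equation_near le).
have n2 := iffLR (near_unrP _ p) (local_equation_near le').
have nb : \forall y \near realify p, ball (realify p) r y.
  have pp : ball (realify p) r (realify p) by exact: ballxx.
  exact: near_ball pp.
have n3 : \forall y \near realify p, rho' y = 0 -> Jdet rho' y = 0 by exact: jf.
near=> y => ry.
have by_ : ball (realify p) r y by near: y.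
have My : M (unr y) by exact/(rM y by_).
have l1 : local_equation M (unr y) rho by move: My; near: y.
have l2 : local_equation M (unr y) rho' by move: My; near: y.
rewrite -(unrK y); apply: (Jdet_change My l1 l2); rewrite unrK.
have ry' : rho' y = 0 by have := local_equation0 My l2; rewrite unrK.
by move: ry'; near: y.
Unshelve. all: by end_near. Qed.

(** By [flat_vanish], some iterated tangential derivative of the Levi determinant is nonzero at [p],
    hence near [p]; at a point where the determinant vanished on M nearby, all of them would be
    zero. *)
Lemma not_Jflat_near M p rho : M p -> local_equation M p rho -> ~ Jflat rho p ->
  \forall z \near p, M z -> ~ Jflat rho z.
Proof.
move=> Mp le nj.
have [r [n [r0 ar dn rM]]] := local_equationP le.
set q := realify p in ar dn rM.
have qq : ball q r q by exact: ballxx.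
have oU : open (ball q r) by exact: ball_open.
pose F y := complex.Re (Jdet rho y).
have aF : an_on q r F by exact: (can_Jdet ar).1.
have JE y : ball q r y -> F y = 0 -> Jdet rho y = 0.
  by move=> Uy h; apply/eqP; rewrite eq_complex -/(F y) h (Jdet_real oU ar.1 Uy) !eqxx.
have rq : rho q = 0 by exact: local_equation0 le.
have [u [k ne]] : exists u k, iter k (tang rho n u) F q != 0.
  apply: contrapT => h; apply: nj.
  have fl := flat_vanish r0 ar aF rq (dn q qq).
  have {}fl : \forall y \near q, rho y = 0 -> F y = 0.
    apply: fl => u k; apply/eqP; apply: contrapT => /negP ne; apply: h.
    by exists u, k.
  by apply: filterS2 (near_ball qq) fl => y Uy h' /h'; exact: JE.
have sT j : sm (ball q r) (iter j (tang rho n u) F).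
  by elim: j => [|j IH]; [exact: aF.1|exact: (sm_tang u oU ar.1 IH dn)].
have nn : \forall z \near p, iter k (tang rho n u) F (realify z) != 0.
  exact: (@near_realify R (fun y => iter k (tang rho n u) F y != 0) p (near_neq0 oU (sT k) qq ne)).
have nb : \forall z \near p, ball q r (realify z).
  exact: (@near_realify R (ball q r) p (near_ball qq)).
near=> z => Mz jz.
have bz : ball q r (realify z) by near: z.
have rz : rho (realify z) = 0 by apply/(rM _ bz); rewrite realifyK.
have : iter k (tang rho n u) F (realify z) != 0 by near: z.
have [r' r'0 [sub ar']] := an_on_at ar bz.
suff : \forall y \near realify z, rho y = 0 -> iter k (tang rho n u) F y = 0.
  by move=> /nbhs_singleton /(_ rz) ->; rewrite eqxx.
elim: (k) => [|j IH].
  by apply: filterS (jz : \forall y \near realify z, _) => y h /h; rewrite /= /F => ->.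
exact: (tang_vanish_near u r'0 ar' rz (dn _ bz) (sm_sub sub (sT j)) IH).
Unshelve. all: by end_near. Qed.

(** The points near which the Levi determinant vanishes on M, for some local equation, form a
    relatively open set, and so do the other points of M; connectedness makes the first set all of
    M. *)
Lemma Jflat_levi_flat M p rho : hypersurface M -> M p -> local_equation M p rho ->
  Jflat rho p -> levi_flat M.
Proof.
move=> [cM hM] Mp le jf.
pose Q z := M z /\ exists rho', local_equation M z rho' /\ Jflat rho' z.
have Qn z : Q z -> \forall z' \near z, M z' -> Q z'.
  move=> [Mz [rho' [le' jf']]].
  apply: filterS2 (local_equation_near le') (Jflat_near jf') => z' h1 h2 Mz'.
  split; first exact: Mz'.
  exists rho'; split; [exact: (h1 Mz')|exact: h2].
have nQn z : M z -> ~ Q z -> \forall z' \near z, M z' -> ~ Q z'.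
  move=> Mz nQ; have [rho' le'] := hM z Mz.
  have nj : ~ Jflat rho' z.
    move=> jz; apply: nQ; split; first exact: Mz.
    by exists rho'; split; [exact: le'|exact: jz].
  apply: filterS2 (local_equation_near le') (not_Jflat_near Mz le' nj) => z' h1 h2 Mz' [_ [rho2 [le2 jf2]]].
  exact: (h2 Mz' (Jflat_change Mz' (h1 Mz') le2 jf2)).
have QM : [set z | Q z] = M.
  apply: cM.
  - exists p; split; first exact: Mp.
    by exists rho; split; [exact: le|exact: jf].
  - exists (interior [set z | M z -> Q z]); first exact: open_interior.
    apply/seteqP; split => z /=.
      by move=> Qz; split; first exact: (proj1 Qz); exact: Qn.
    by move=> [Mz /nbhs_singleton h]; exact: h.
  - exists (~` (interior [set z | M z -> ~ Q z])); first by apply: open_closedC; exact: open_interior.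
    apply/seteqP; split => z /=.
      move=> Qz; split; first exact: (proj1 Qz).
      by move=> /nbhs_singleton h; exact: (h (proj1 Qz) Qz).
    by move=> [Mz h]; apply: contrapT => nQ; apply: h; exact: nQn.
move=> z rho1 v Mz le1 tv.
have [_ [rho2 [le2 jf2]]] : Q z by have : [set z | Q z] z by rewrite QM.
have J1 := nbhs_singleton (Jflat_change Mz le1 le2 jf2) (local_equation0 Mz le1).
have [r [n [r0 ar dn rM]]] := local_equationP le1.
have qq : ball (realify z) r (realify z) by exact: ballxx.
have oU : open (ball (realify z) r) by exact: ball_open.
have := levi_Jdet (v := v) oU ar.1 qq (dn _ qq); rewrite realifyK => /(_ tv) [k [_ ->]].
by rewrite J1 mulr0.
Qed.

End Connectivity.

Lemma arith1 (R : realType) (x1 x2 x3 x4 x5 x6 k1 k2 k3 : R) :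
  `|x5 - (x6 + (x4 + (x1 + x2 + x3)) / 2)| <= k3 -> `|x1| <= k2 -> `|x2| <= k2 -> `|x3| <= k2 ->
  k3 <= k1 -> 0 <= k2 -> `|x5 - x6 - x4 / 2| <= k1 + k2 * 2.
Proof.
rewrite !ler_norml => /andP[? ?] /andP[? ?] /andP[? ?] /andP[? ?] ? ?.
by apply/andP; split; lra.
Qed.

Lemma arith2 (R : realType) (x1 x2 x3 x4 y1 y2 k : R) : `|x1 - x3 - y1| <= k -> `|x2 - x4 - y2| <= k ->
  `|x1 + x2 - (x3 + x4) - (y1 + y2)| <= k * 2.
Proof. by rewrite !ler_norml => /andP[? ?] /andP[? ?]; apply/andP; split; lra. Qed.

(** * Second order expansions along two directions at once *)

Section SecondOrder.
Variables (R : realType) (V : normedModType R).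
Implicit Types (q u v h : V) (r : R) (F : V -> R).

Lemma bnd2 q r F : 0 < r -> an_on q r F -> exists2 B, 0 <= B &
  forall u v, `|'D_u F q| <= B * `|u| /\ `|'D_u ('D_v F) q| <= B * (`|u| * `|v|).
Proof.
move=> r0 [sF [m [c [K [m0 c0 K0 bF]]]]].
have qq : ball q r q by exact: ballxx.
have r1 : 0 <= c * rise m 1 * K ^+ 1 by apply: mulr_ge0; [apply: mulr_ge0 => //; exact: rise_ge0|exact: exprn_ge0].
have r2 : 0 <= c * rise m 2 * K ^+ 2 by apply: mulr_ge0; [apply: mulr_ge0 => //; exact: rise_ge0|exact: exprn_ge0].
exists (c * rise m 1 * K ^+ 1 + c * rise m 2 * K ^+ 2); first exact: addr_ge0.
move=> u v; split.
  have := bF 1%N [:: u] q isT qq; rewrite big_seq1 => /le_trans; apply.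
  by apply: ler_wpM2r => //; rewrite lerDl.
have := bF 2%N [:: v; u] q isT qq; rewrite big_cons big_seq1 (mulrC (Num.norm v)) => /le_trans; apply.
by apply: ler_wpM2r; [exact: mulr_ge0|rewrite lerDr].
Qed.

Lemma taylor3 q r F : 0 < r -> an_on q r F -> exists2 B, 0 <= B &
  forall h, `|h| < r -> `|F (q + h) - (F q + 'D_h F q + 'D_h ('D_h F) q / 2)| <= B * `|h| ^+ 3.
Proof.
move=> r0 [sF [m [c [K [m0 c0 K0 bF]]]]].
have qq : ball q r q by exact: ballxx.
have r3 : 0 <= c * rise m 3 * K ^+ 3 by apply: mulr_ge0; [apply: mulr_ge0 => //; exact: rise_ge0|exact: exprn_ge0].
exists (c * rise m 3 * K ^+ 3 / 3`!%:R); first exact: divr_ge0.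
move=> h hr.
have seg (s : R) : 0 <= s <= 1 -> ball q r (q + s *: h).
  apply: ball_segment => //; rewrite -ball_normE /ball_ /= opprD addrA subrr sub0r normrN.
  exact: hr.
have H (s : R) : 0 <= s <= 1 -> `|dws (nseq 3 h) F (q + s *: h)| <= c * rise m 3 * K ^+ 3 * `|h| ^+ 3.
  move=> s01; have := bF 3 (nseq 3 h) _ isT (seg s s01).
  by rewrite big_nseq iter_mulr_1.
have := taylor_line sF seg H; rewrite !big_ord_recr big_ord0 /= add0r.
rewrite fact0 divr1 (_ : 1`! = 1)%N // divr1 (_ : 2`! = 2)%N //.
by move/le_trans; apply; rewrite mulrAC.
Qed.

(** The perturbations are of size t^2, so up to t^3 they enter only through the first derivative.
    The sum over both directions produces the combination of second derivatives that becomes a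
    Laplacian when [u'] is [u] multiplied by ['i]. *)
Lemma two_points q r F u u' (c : R) : 0 < r -> an_on q r F -> F q = 0 ->
  'D_u F q = 0 -> 'D_u' F q = 0 -> 0 <= c ->
  exists B d, [/\ 0 <= B, 0 < d & forall t e e', 0 < t < d -> `|e| <= c * t ^+ 2 -> `|e'| <= c * t ^+ 2 ->
    `|F (q + (t *: u + e)) + F (q + (t *: u' + e')) - 'D_(e + e') F q
      - t ^+ 2 * ('D_u ('D_u F) q + 'D_u' ('D_u' F) q) / 2| <= B * t ^+ 3].
Proof.
move=> r0 aF F0 du du' c0.
have [B1 B10 b1] := bnd2 r0 aF; have [B2 B20 b2] := taylor3 r0 aF.
have oU : open (ball q r) by exact: ball_open.
have qq : ball q r q by exact: ballxx.
pose L := `|u| + `|u'| + c; have L0 : 0 <= L by rewrite !addr_ge0.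
have one w e t : `|w| + c <= L -> 'D_w F q = 0 -> 0 < t < Num.min 1 (r / (L + 1)) -> `|e| <= c * t ^+ 2 ->
   `|F (q + (t *: w + e)) - 'D_e F q - t ^+ 2 * 'D_w ('D_w F) q / 2| <= (B2 * L ^+ 3 + B1 * L ^+ 2 * 2) * t ^+ 3.
  move=> wL dw /andP[t0]; rewrite lt_min => /andP[t1 tr] ec.
  have w0 : 0 <= `|w| by [].
  have ec' : `|e| <= c * t.
    by apply: le_trans ec _; rewrite ler_wpM2l // expr2 ler_piMl // ltW.
  have hL : `|t *: w + e| <= L * t.
    apply: le_trans (ler_normD _ _) _; rewrite normrZ gtr0_norm // mulrC.
    by apply: le_trans (lerD (lexx _) ec') _; rewrite -mulrDl ler_wpM2r // ltW.
  have hr : `|t *: w + e| < r.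
    apply: le_lt_trans hL _; move: tr; rewrite ltr_pdivlMr ?ltr_pwDr // => tr.
    by apply: le_lt_trans tr; rewrite mulrC ler_wpM2l ?lerDl // ltW.
  have := b2 _ hr; set h := t *: w + e in hL hr *.
  have dF := sm_diff aF.1 qq.
  have -> : 'D_h F q = 'D_e F q by rewrite /h deriveDv // deriveZv // dw mulr0 add0r.
  have E : 'D_h ('D_h F) q = t ^+ 2 * 'D_w ('D_w F) q + (t * 'D_w ('D_e F) q + t * 'D_e ('D_w F) q + 'D_e ('D_e F) q).
    have Eh y : ball q r y -> 'D_h F y = t * 'D_w F y + 'D_e F y.
      by move=> Uy; have d := sm_diff aF.1 Uy; rewrite /h deriveDv // deriveZv.
    have sw := sm_mul oU (sm_cst t oU) (sm_D w aF.1); have se := sm_D e aF.1.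
    have dd v : 'D_v ('D_h F) q = t * 'D_v ('D_w F) q + 'D_v ('D_e F) q.
      rewrite (derive_open v oU qq Eh) (deriveD (sm_derivable v sw qq) (sm_derivable v se qq)).
      have h1 : derivable (fun _ : V => t) q v by exact: derivable_cst.
      rewrite (deriveM h1 (sm_derivable v (sm_D w aF.1) qq)) derive_cst scaler0 addr0.
      by [].
    have dh := sm_diff (sm_D h aF.1) qq.
    rewrite {1}/h (deriveDv (t *: w) e dh) (deriveZv t w dh) (dd w) (dd e).
    move: ('D_w ('D_w F) q) ('D_w ('D_e F) q) ('D_e ('D_w F) q) ('D_e ('D_e F) q) => x1 x2 x3 x4.
    by rewrite mulrDr mulrA -expr2 -!addrA.
  rewrite E F0 add0r => H3.
  have C3 : `|h| ^+ 3 <= L ^+ 3 * t ^+ 3.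
    by rewrite -exprMn; apply: lerXn2r; rewrite ?nnegrE // mulr_ge0 // ltW.
  have cL : c <= L by rewrite lerDr addr_ge0.
  have wL' : `|w| <= L by apply: le_trans wL; rewrite lerDl.
  have tt : 0 <= t by exact: ltW.
  have eL : `|e| <= L * t ^+ 2 by apply: le_trans ec _; rewrite ler_wpM2r ?exprn_ge0.
  have m1 : `|e| * `|w| <= L ^+ 2 * t ^+ 2.
    by rewrite [L ^+ 2]expr2 mulrAC; apply: ler_pM.
  have n1 : `|t * 'D_w ('D_e F) q| <= B1 * (L ^+ 2 * t ^+ 2) * t.
    rewrite normrM gtr0_norm // mulrC ler_wpM2r //; apply: le_trans (b1 w e).2 _.
    by rewrite ler_wpM2l // mulrC.
  have n2 : `|t * 'D_e ('D_w F) q| <= B1 * (L ^+ 2 * t ^+ 2) * t.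
    rewrite normrM gtr0_norm // mulrC ler_wpM2r //; apply: le_trans (b1 e w).2 _.
    by rewrite ler_wpM2l.
  have eL' : `|e| <= L * t.
    by apply: le_trans ec' _; rewrite ler_wpM2r.
  have n3 : `|'D_e ('D_e F) q| <= B1 * (L ^+ 2 * t ^+ 2) * t.
    apply: le_trans (b1 e e).2 _; rewrite -mulrA ler_wpM2l //.
    have -> : L ^+ 2 * t ^+ 2 * t = (L * t ^+ 2) * (L * t) by ring.
    exact: ler_pM.
  have H4 : B2 * `|h| ^+ 3 <= B2 * (L ^+ 3 * t ^+ 3) by rewrite ler_wpM2l.
  have Q0 : 0 <= B1 * (L ^+ 2 * t ^+ 2) * t by rewrite !mulr_ge0 // exprn_ge0.
  have -> : (B2 * L ^+ 3 + B1 * L ^+ 2 * 2) * t ^+ 3 = B2 * (L ^+ 3 * t ^+ 3) + B1 * (L ^+ 2 * t ^+ 2) * t * 2 by ring.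
  exact: (arith1 H3 n1 n2 n3 H4 Q0).
have uL : `|u| + c <= L by rewrite lerD2r lerDl.
have uL' : `|u'| + c <= L by rewrite lerD2r lerDr.
exists ((B2 * L ^+ 3 + B1 * L ^+ 2 * 2) * 2), (Num.min 1 (r / (L + 1))); split.
- by rewrite mulr_ge0 // addr_ge0 // !mulr_ge0 // exprn_ge0.
- by rewrite lt_min ltr01 divr_gt0 // ltr_pwDr.
move=> t e e' td ec ec'.
have E1 := one u e t uL du td ec; have E2 := one u' e' t uL' du' td ec'.
rewrite (deriveDv _ _ (sm_diff aF.1 qq)).
rewrite (_ : _ * 2 * t ^+ 3 = (B2 * L ^+ 3 + B1 * L ^+ 2 * 2) * t ^+ 3 * 2); last by ring.
rewrite mulrDr mulrDl; exact: (arith2 E1 E2).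
Qed.

End SecondOrder.

Lemma arith3 (R : realType) (x K W : R) : 0 < W -> 0 <= K -> 4 * (K + 1) * W <= `|x| ->
  x ^+ 2 <= 2 * (K * W) ^+ 2 -> False.
Proof.
move=> W0 K0 h1; rewrite -real_normK ?num_real // => h2.
have p0 : 0 <= 4 * (K + 1) * W by rewrite !mulr_ge0 ?addr_ge0 // ltW.
have h3 : (4 * (K + 1) * W) ^+ 2 <= `|x| ^+ 2 by apply: lerXn2r; rewrite ?nnegrE.
have := le_trans h3 h2; have -> : (4 * (K + 1) * W) ^+ 2 = 2 * (K * W) ^+ 2 + (14 * K ^+ 2 + 32 * K + 16) * W ^+ 2 by ring.
rewrite -subr_ge0 (_ : _ - _ = - ((14 * K ^+ 2 + 32 * K + 16) * W ^+ 2)); last by ring.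
rewrite oppr_ge0 leNgt mulr_gt0 ?exprn_gt0 // ltr_wpDl // addr_ge0 ?mulr_ge0 // exprn_ge0 //.
Qed.

Lemma lip_cont (R : realType) (V W : normedModType R) (f : V -> W) (L : R) : 0 <= L ->
  (forall a b, `|f a - f b| <= L * `|a - b|) -> forall a, {for a, continuous f}.
Proof.
move=> L0 fL a; apply/cvgrPdist_lt => eps eps0; apply/nbhs_ballP; exists (eps / (L + 1)) => /=.
  by rewrite divr_gt0 // ltr_pwDr.
move=> b; rewrite -ball_normE /ball_ /= => ab.
apply: le_lt_trans (fL _ _) _; move: ab; rewrite ltr_pdivlMr ?ltr_pwDr // => ab.
by apply: le_lt_trans ab; rewrite mulrC ler_wpM2l // lerDl.
Qed.

(** * Zeros of a holomorphic function near a regular zero *)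

Section Zeros.
Variable R : realType.
Local Notation C := R[i].
Local Notation C2 := 'rV[C]_2.
Local Notation R4 := 'rV[R]_4.
Implicit Types (q w e y : R4) (a : 'rV[R]_2).

(** The squared modulus GR^2 + GI^2 is minimised over a small box of corrections. The minimum lies
    in the interior, and at a critical point the Cauchy-Riemann equations with nonzero derivative
    force both components to vanish. The correction is quadratic in [w] because [w] is tangent to
    the zero set. *)
Lemma zero_near q r (GR GI : R4 -> R) (n1 n2 : R4) : 0 < r -> an_on q r GR -> an_on q r GI ->
  GR q = 0 -> GI q = 0 -> 'D_n1 GR q = 1 -> 'D_n1 GI q = 0 ->
  (forall y, ball q r y -> 'D_n2 GR y = - 'D_n1 GI y /\ 'D_n2 GI y = 'D_n1 GR y) ->
  exists c d, [/\ 0 <= c, 0 < d & forall w, `|w| < d -> 'D_w GR q = 0 -> 'D_w GI q = 0 ->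
    exists x1 x2 : R, let e := x1 *: n1 + x2 *: n2 in
    [/\ `|e| <= c * `|w| ^+ 2, GR (q + (w + e)) = 0 & GI (q + (w + e)) = 0]].
Proof.
move=> r0 aR aI GR0 GI0 d1R d1I CR.
have qq : ball q r q by exact: ballxx.
have oU : open (ball q r) by exact: ball_open.
have [d2R d2I] := CR q qq; rewrite d1R d1I oppr0 in d2R d2I.
have [sR [mR [cR [KR [mR0 cR0 KR0 bR]]]]] := aR.
have [sI [mI [cI [KI [mI0 cI0 KI0 bI]]]]] := aI.
pose K := cR * rise mR 2 * KR ^+ 2 + cI * rise mI 2 * KI ^+ 2.
have k1 : 0 <= cR * rise mR 2 * KR ^+ 2.
  by apply: mulr_ge0; [apply: mulr_ge0 => //; exact: rise_ge0|exact: exprn_ge0].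
have k2 : 0 <= cI * rise mI 2 * KI ^+ 2.
  by apply: mulr_ge0; [apply: mulr_ge0 => //; exact: rise_ge0|exact: exprn_ge0].
have K0 : 0 <= K by exact: addr_ge0.
have seg (h : R4) : `|h| < r -> forall s : R, 0 <= s <= 1 -> ball q r (q + s *: h).
  by move=> hr; apply: ball_segment => //; rewrite -ball_normE /ball_ /= opprD addrA subrr sub0r normrN.
have QR h : `|h| < r -> `|GR (q + h) - 'D_h GR q| <= K * `|h| ^+ 2.
  move=> hr; have := quad_bound sR bR mR0 cR0 KR0 (seg h hr); rewrite GR0 subr0 => /le_trans; apply.
  by rewrite ler_wpM2r ?exprn_ge0 // lerDl.
have QI h : `|h| < r -> `|GI (q + h) - 'D_h GI q| <= K * `|h| ^+ 2.
  move=> hr; have := quad_bound sI bI mI0 cI0 KI0 (seg h hr); rewrite GI0 subr0 => /le_trans; apply.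
  by rewrite ler_wpM2r ?exprn_ge0 // lerDr.
have d1n : 'D_n1 GR q != 0 by rewrite d1R oner_eq0.
have [r1 /andP[r10 r1r] H1] := ball_shrink r0 (near_neq0 oU (sm_D n1 sR) qq d1n).
pose L := `|n1| + `|n2|; have L0 : 0 <= L by rewrite addr_ge0.
pose K' := K + 1; have K'0 : 0 < K' by rewrite ltr_pwDr.
have p0 : 0 <= 8 * K' * L by rewrite !mulr_ge0 // ltW.
exists (L * (8 * K')), (Num.min (r1 / 2) (8 * K' * L + 1)^-1); split.
- by rewrite !mulr_ge0 // ltW.
- by rewrite lt_min divr_gt0 //= invr_gt0 ltr_pwDr.
move=> w; rewrite lt_min => /andP[wr1 wL] dwR dwI.
have [w0|w0] := eqVneq w 0.
  by exists 0, 0; rewrite /= w0 !scale0r !addr0 normr0 GR0 GI0 expr0n /= mulr0.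
have wp : 0 < `|w| by rewrite normr_gt0.
(* On the boundary of this box GR or GI has modulus at least 4 (K + 1) |w|^2, while at its center
   both are at most K |w|^2; the minimum cannot be on the boundary. *)
pose s := 8 * K' * `|w| ^+ 2; have s0 : 0 < s by rewrite !mulr_gt0 // exprn_gt0.
have Ls : L * s <= `|w|.
  have -> : L * s = (8 * K' * L * `|w|) * `|w| by rewrite /s; ring.
  rewrite ger_pMl //; apply: le_trans (ler_wpM2l p0 (ltW wL)) _.
  by rewrite ler_pdivrMr ?ltr_pwDr // mul1r lerDl.
pose eta a : R4 := a ord0 ord0 *: n1 + a ord0 ord_max *: n2.
have etaD a b : eta a - eta b = eta (a - b).
  by rewrite /eta !mxE opprD addrACA -!scalerBl.
have etaL a : `|eta a| <= L * `|a|.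
  apply: le_trans (ler_normD _ _) _; rewrite !normrZ mulrDl; apply: lerD;
    by rewrite mulrC ler_wpM2l // coord_le_norm.
pose pt a := q + (w + eta a).
have hb a : `|a| <= s -> `|w + eta a| <= 2 * `|w|.
  move=> as_; apply: le_trans (ler_normD _ _) _; rewrite mulr2n mulrDl mul1r lerD2l.
  by apply: le_trans (etaL a) _; apply: le_trans (ler_wpM2l L0 as_) Ls.
have hr1 a : `|a| <= s -> `|w + eta a| < r1.
  by move=> /hb h; apply: le_lt_trans h _; rewrite mulrC -ltr_pdivlMr.
have ptU a : `|a| <= s -> ball q r1 (pt a).
  by move=> /hr1 h; rewrite -ball_normE /ball_ /= /pt opprD addrA subrr sub0r normrN.
have sub : ball q r1 `<=` ball q r by exact: le_ball.
have dR := sm_diff sR qq; have dI := sm_diff sI qq.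
have DR a : 'D_(w + eta a) GR q = a ord0 ord0.
  by rewrite /eta !deriveDv // !deriveZv // dwR d1R d2R mulr1 mulr0 addr0 add0r.
have DI a : 'D_(w + eta a) GI q = a ord0 ord_max.
  by rewrite /eta !deriveDv // !deriveZv // dwI d1I d2I mulr1 mulr0 !add0r.
pose F y := GR y * GR y + GI y * GI y.
have sF : sm (ball q r) F by exact: (sm_add oU (sm_mul oU sR sR) (sm_mul oU sI sI)).
have cpt a : {for a, continuous pt}.
  apply: (@lip_cont R _ _ pt L L0) => a' b.
  rewrite /pt opprD addrACA subrr add0r opprD addrACA subrr add0r etaD.
  exact: etaL.
have [a aK amin] : exists2 a, a \in closed_ball (0 : 'rV[R]_2) s & forall b, b \in closed_ball (0 : 'rV[R]_2) s -> F (pt a) <= F (pt b).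
  apply: (@EVT_min_rV R 2 (F \o pt)).
  - by exists 0; rewrite closed_ballE // /closed_ball_ /= subrr normr0 ltW.
  - apply: bounded_closed_compact; last exact: closed_ball_closed.
    exists s; split; first exact: num_real.
    move=> M sM b; rewrite closed_ballE // /closed_ball_ /= sub0r normrN => bs.
    exact: le_trans bs (ltW sM).
  - apply: continuous_in_subspaceT => b; rewrite inE closed_ballE // /closed_ball_ /= sub0r normrN => bs.
    apply: continuous_comp; first exact: cpt.
    exact: (sm_continuous oU sF (sub _ (ptU b bs))).
move: aK; rewrite inE closed_ballE // /closed_ball_ /= sub0r normrN => as_.
have {}amin b : `|b| <= s -> F (pt a) <= F (pt b).
  by move=> bs; apply: amin; rewrite inE closed_ballE // /closed_ball_ /= sub0r normrN.
have W0 : 0 < `|w| ^+ 2 by rewrite exprn_gt0.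
have F0 : F (pt 0) <= 2 * (K * `|w| ^+ 2) ^+ 2.
  have e0 : eta 0 = 0 by rewrite /eta !mxE !scale0r addr0.
  have wr : `|w| < r.
    apply: lt_le_trans r1r; apply: lt_le_trans wr1 _.
    by rewrite ler_pdivrMr // ler_peMr ?ler1n // ltW.
  have hR : `|GR (pt 0)| <= K * `|w| ^+ 2 by have := QR w wr; rewrite dwR subr0 /pt e0 addr0.
  have hI : `|GI (pt 0)| <= K * `|w| ^+ 2 by have := QI w wr; rewrite dwI subr0 /pt e0 addr0.
  have sq (x : R) : `|x| <= K * `|w| ^+ 2 -> x * x <= (K * `|w| ^+ 2) ^+ 2.
    by move=> h; rewrite -expr2 -real_normK ?num_real //; apply: lerXn2r; rewrite ?nnegrE // mulr_ge0 // ltW.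
  by rewrite /F mulr2n mulrDl mul1r; apply: lerD; exact: sq.
have h4 : K * `|w + eta a| ^+ 2 <= 4 * K * `|w| ^+ 2.
  have -> : 4 * K * `|w| ^+ 2 = K * (2 * `|w|) ^+ 2 by ring.
  by rewrite ler_wpM2l //; apply: lerXn2r; rewrite ?nnegrE ?hb // mulr_ge0.
have har : `|w + eta a| < r by apply: lt_le_trans (hr1 a as_) r1r.
have big (x y : R) : `|x - y| <= K * `|w + eta a| ^+ 2 -> s <= `|y| -> 4 * (K + 1) * `|w| ^+ 2 <= `|x|.
  move=> h5 h6; have h7 := ler_normD (y - x) x; rewrite subrK distrC in h7.
  move: h5 h6 h7 h4; rewrite /s /K'.
  move: (`|y|) (`|x|) (`|x - y|) (K * `|w + eta a| ^+ 2) => t1 t2 t3 t4.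
  have kw : 0 <= K * `|w| ^+ 2 by rewrite mulr_ge0 // ltW.
  rewrite (_ : 4 * (K + 1) * `|w| ^+ 2 = 4 * (K * `|w| ^+ 2) + 4 * `|w| ^+ 2); last by ring.
  rewrite (_ : 8 * (K + 1) * `|w| ^+ 2 = 8 * (K * `|w| ^+ 2) + 8 * `|w| ^+ 2); last by ring.
  rewrite -[4 * K * _]mulrA; move: W0 kw; move: (K * `|w| ^+ 2) (`|w| ^+ 2) => t5 t6.
  by clear; lra.
have al : `|a| < s.
  apply: norm_lt => // i; rewrite ltNge; apply/negP => sa.
  have fa := le_trans (amin 0 _) F0; rewrite normr0 in fa; have {}fa := fa (ltW s0).
  have hGR : GR (pt a) ^+ 2 <= F (pt a) by rewrite /F expr2 lerDl -expr2 sqr_ge0.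
  have hGI : GI (pt a) ^+ 2 <= F (pt a) by rewrite /F expr2 lerDr -expr2 sqr_ge0.
  have [i0|i1] : i = ord0 \/ i = ord_max.
    by case: i sa => [[|[|//]] hi] _; [left|right]; exact: val_inj.
    have := QR _ har; rewrite DR => h5; rewrite i0 in sa.
    exact: (arith3 W0 K0 (big _ _ h5 sa) (le_trans hGR fa)).
  have := QI _ har; rewrite DI => h5; rewrite i1 in sa.
  exact: (arith3 W0 K0 (big _ _ h5 sa) (le_trans hGI fa)).
have crit (dl : 'rV[R]_2) (nn : R4) : (forall t : R, pt (a + t *: dl) = pt a + t *: nn) ->
    (forall j, `|dl ord0 j| <= 1) -> GR (pt a) * 'D_nn GR (pt a) + GI (pt a) * 'D_nn GI (pt a) = 0.
  move=> pE dl1; pose ep := s - `|a|; have ep0 : 0 < ep by rewrite subr_gt0.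
  have in_s (t : R) : t \in `]- ep, ep[ -> `|a + t *: dl| <= s.
    rewrite in_itv /= => te; have te' : `|t| < ep by rewrite ltr_norml.
    apply/ltW/norm_lt => // j; rewrite !mxE; apply: le_lt_trans (ler_normD _ _) _.
    rewrite normrM; have h1 := coord_le_norm a j.
    have h2 : `|t| * `|dl ord0 j| <= `|t| by rewrite ler_piMr.
    apply: le_lt_trans (lerD h1 h2) _; by rewrite -ltrBrDl.
  have dF (t : R) : t \in `]- ep, ep[ -> is_derive t 1 (fun t : R => F (pt a + t *: nn)) ('D_nn F (pt a + t *: nn)).
    move=> te; apply: is_derive_line; rewrite -pE; apply: (sm_diff sF); exact/sub/ptU/in_s.
  have z0 : (0 : R) \in `]- ep, ep[ by rewrite in_itv /= oppr_lt0 ep0.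
  have mn (t : R) : t \in `]- ep, ep[ -> F (pt a + 0 *: nn) <= F (pt a + t *: nn).
    by move=> te; rewrite -!pE scale0r addr0; apply: amin; exact: in_s.
  have := derive1_at_min (_ : - ep <= ep) (fun t te => @ex_derive _ _ _ _ _ _ _ (dF t te)) z0 mn.
  have epp : - ep <= ep by rewrite ge0_cp // ltW.
  move=> /(_ epp) [_ e1]; have [_ e2] := dF 0 z0; rewrite e2 scale0r addr0 in e1.
  have Ua := sub _ (ptU a as_).
  have sRR := sm_mul oU sR sR; have sII := sm_mul oU sI sI.
  move: e1; rewrite (deriveD (sm_derivable nn sRR Ua) (sm_derivable nn sII Ua)).
  rewrite (deriveM (sm_derivable nn sR Ua) (sm_derivable nn sR Ua)).
  rewrite (deriveM (sm_derivable nn sI Ua) (sm_derivable nn sI Ua)) /GRing.scale /=.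
  move: (GR (pt a) * _) (GI (pt a) * _) => x y E; clear -E; lra.
exists (a ord0 ord0), (a ord0 ord_max) => /=; rewrite -/(eta a).
have h1 : GR (pt a) * 'D_n1 GR (pt a) + GI (pt a) * 'D_n1 GI (pt a) = 0.
  apply: (crit (delta_mx ord0 ord0)) => [t|j].
    rewrite /pt /eta !mxE !eqxx /= mulr1 mulr0 addr0 scalerDl -!addrA.
    by do 3 congr (_ + _); rewrite addrC.
  by rewrite mxE; case: (_ && _); rewrite ?normr1 ?normr0.
have h2 : GR (pt a) * 'D_n2 GR (pt a) + GI (pt a) * 'D_n2 GI (pt a) = 0.
  apply: (crit (delta_mx ord0 ord_max)) => [t|j].
    by rewrite /pt /eta !mxE !eqxx /= mulr1 mulr0 addr0 scalerDl -!addrA.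
  by rewrite mxE; case: (_ && _); rewrite ?normr1 ?normr0.
have Ua1 := ptU a as_; have [c1 c2] := CR _ (sub _ Ua1); rewrite c1 c2 in h2.
have p0' := H1 _ Ua1; rewrite /= in p0'.
(* Determinant of the two critical equations [h1] and [h2] as a linear system in the values of GR
   and GI, after the substitution by the Cauchy-Riemann equations. *)
have sq0 : 'D_n1 GR (pt a) ^+ 2 + 'D_n1 GI (pt a) ^+ 2 != 0.
  by rewrite paddr_eq0 ?sqr_ge0 // sqrf_eq0 (negPf p0').
split.
- apply: le_trans (etaL a) _; rewrite -mulrA ler_wpM2l //.
- apply: (mulfI sq0); rewrite mulr0; move: h1 h2.
  rewrite -/(pt a); move: (GR (pt a)) (GI (pt a)) ('D_n1 GR (pt a)) ('D_n1 GI (pt a)) => x y u v E1 E2.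
  have -> : (u ^+ 2 + v ^+ 2) * x = u * (x * u + y * v) - v * (x * - v + y * u) by ring.
  by rewrite E1 E2 !mulr0 subr0.
- apply: (mulfI sq0); rewrite mulr0; move: h1 h2.
  rewrite -/(pt a); move: (GR (pt a)) (GI (pt a)) ('D_n1 GR (pt a)) ('D_n1 GI (pt a)) => x y u v E1 E2.
  have -> : (u ^+ 2 + v ^+ 2) * y = v * (x * u + y * v) + u * (x * - v + y * u) by ring.
  by rewrite E1 E2 !mulr0 addr0.
Qed.

End Zeros.

Lemma arith4 (R : realType) (x1 x2 x3 x4 x5 x6 y1 y2 y3 y4 y5 y6 : R) : y1 <= y3 -> y2 <= y4 ->
  `|x1| <= y6 -> `|x2| <= y5 -> `|x5 - (x6 + x1 / 2)| <= y2 -> `|x3 - (x4 + x2 / 2)| <= y1 ->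
  `|x3 - x4| + `|x5 - x6| <= y3 + y4 + y5 + y6.
Proof.
move=> h1 h2; rewrite !ler_norml => /andP[a1 a2] /andP[b1 b2] /andP[c1 c2] /andP[d1 d2].
have e1 : `|x3 - x4| <= y3 + y5 by rewrite ler_norml; apply/andP; split; lra.
have e2 : `|x5 - x6| <= y4 + y6 by rewrite ler_norml; apply/andP; split; lra.
lra.
Qed.

Lemma arith5 (R : realType) (x y1 y2 k1 k2 k3 : R) : `|y2| <= k1 -> `|x + y1 + y2 / 2| <= k2 ->
  `|y1| <= k3 -> `|x| <= k1 + k2 + k3.
Proof.
rewrite !ler_norml => /andP[a1 a2] /andP[b1 b2] /andP[c1 c2]; apply/andP; split; lra.
Qed.

Lemma arith6 (R : realType) (x y z k1 k2 k3 : R) : `|- (x + y) - z / 2| <= k1 -> `|x| <= k2 ->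
  `|y| <= k3 -> `|z| <= (k1 + k2 + k3) * 2.
Proof.
rewrite !ler_norml => /andP[a1 a2] /andP[b1 b2] /andP[c1 c2]; apply/andP; split; lra.
Qed.

(** * The Levi determinant vanishes at a nonminimal point *)

Section Nonminimal.
Variable R : realType.
Local Notation C := R[i].
Local Notation C2 := 'rV[C]_2.
Local Notation R4 := 'rV[R]_4.
Implicit Types (q w e y u v : R4) (F : R4 -> R) (r : R) (g : C2 -> C).

Lemma holo_dzb r q (G : R4 -> C) : (forall v y, ball q r y ->
     'D_(Jm v) (fun y => complex.Re (G y)) y = - 'D_v (fun y => complex.Im (G y)) y /\
     'D_(Jm v) (fun y => complex.Im (G y)) y = 'D_v (fun y => complex.Re (G y)) y) ->
  forall c y, ball q r y -> dzb c G y = 0.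
Proof.
move=> H c y Uy; have [h1 h2] := H (realify c) y Uy.
rewrite dzb.unlock /cd /Rderive; move: h1 h2; rewrite /Jm realifyK => -> ->.
move: ('D__ _ y) ('D__ _ y) => s t.
by apply/eqP; rewrite eq_complex /=; apply/andP; split; apply/eqP; field.
Qed.

Lemma small0 (S K d : R) : 0 < d -> 0 <= K -> (forall t, 0 < t < d -> `|S| * t <= K * t ^+ 2) -> S = 0.
Proof.
move=> d0 K0 H; apply/eqP; rewrite -normr_eq0; apply/negPn/negP => S0.
have Sp : 0 < `|S| by rewrite lt_neqAle eq_sym S0 normr_ge0.
pose t := Num.min (d / 2) (`|S| / (K + 1) / 2).
have K1 : 0 < K + 1 by rewrite ltr_pwDr.
have t0 : 0 < t by rewrite lt_min !divr_gt0.
have td : t < d.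
  by rewrite gt_min ltr_pdivrMr // ltr_pMr // ltr1n.
have := H t; rewrite t0 td => /(_ isT); rewrite expr2 mulrA ler_pM2r //; apply/negP; rewrite -ltNge.
have tS : t <= `|S| / (K + 1) / 2 by rewrite ge_min lexx orbT.
have h1 : K * t <= (K + 1) * t by rewrite ler_wpM2r ?lerDl // ltW.
apply: le_lt_trans h1 _; rewrite mulrC -ltr_pdivlMr //; apply: le_lt_trans tS _.
by rewrite ltr_pdivrMr // ltr_pMr ?ltr1n // divr_gt0.
Qed.

(** Links the complex directional derivative used for holomorphic equations with the real ones: when
    all real first derivatives vanish, the increment of [g] is quadratic and the complex difference
    quotients tend to zero. *)
Lemma holo_deriv0 r q g : 0 < r -> an_on q r (fun y => complex.Re (g (unr y))) ->
  an_on q r (fun y => complex.Im (g (unr y))) ->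
  (forall u, 'D_u (fun y => complex.Re (g (unr y))) q = 0 /\ 'D_u (fun y => complex.Im (g (unr y))) q = 0) ->
  forall v : C2, 'D_v g (unr q) = 0.
Proof.
move=> r0 aR aI z v.
have [B1 B10 b1] := taylor3 r0 aR; have [B2 B20 b2] := taylor3 r0 aI.
have [B3 B30 b3] := bnd2 r0 aR; have [B4 B40 b4] := bnd2 r0 aI.
pose K := (B1 + B2) * r + B3 + B4; have K0 : 0 <= K by rewrite !addr_ge0 // mulr_ge0 ?addr_ge0 // ltW.
have gK h : `|h| < r -> cn (g (unr (q + h)) - g (unr q)) <= K * `|h| ^+ 2.
  move=> hr; have := b1 h hr; have := b2 h hr; rewrite (z h).1 (z h).2 !addr0.
  have := (b3 h h).2; have := (b4 h h).2; rewrite -expr2.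
  have hh : `|h| ^+ 3 <= r * `|h| ^+ 2 by rewrite exprS ler_wpM2r ?exprn_ge0 // ltW.
  have h1 := ler_wpM2l B10 hh; have h2 := ler_wpM2l B20 hh; rewrite /cn.
  have -> : complex.Re (g (unr (q + h)) - g (unr q)) = complex.Re (g (unr (q + h))) - complex.Re (g (unr q)).
    by case: (g _) (g _) => [? ?] [? ?].
  have -> : complex.Im (g (unr (q + h)) - g (unr q)) = complex.Im (g (unr (q + h))) - complex.Im (g (unr q)).
    by case: (g _) (g _) => [? ?] [? ?].
  have -> : K * `|h| ^+ 2 = B1 * (r * `|h| ^+ 2) + B2 * (r * `|h| ^+ 2) + B3 * `|h| ^+ 2 + B4 * `|h| ^+ 2.
    by rewrite /K; ring.
  move=> t4 t3 t2 t1; exact: (arith4 h1 h2 t4 t3 t2 t1).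
pose L := `|realify v| + `|realify ('i *: v)|; have L0 : 0 <= L by rewrite addr_ge0.
have etaL (h : C) : `|realify (h *: v)| <= L * cn h.
  rewrite realify_lin; apply: le_trans (ler_normD _ _) _; rewrite !normrZ /cn /L mulrDl mulrDr mulrDr.
  have := normr_ge0 (realify v); have := normr_ge0 (realify ('i *: v)).
  have := normr_ge0 (complex.Re h); have := normr_ge0 (complex.Im h).
  move: (Num.norm (realify v)) (Num.norm (realify _)) (Num.norm (complex.Re h)) (Num.norm (complex.Im h)).
  by move=> t1 t2 t3 t4 p4 p3 p2 p1; nra.
apply: cvg_lim => //; apply/cvgrPdist_le => eps /ltC_real[e e0 ->].
have cnh (h : C) : (cn h)%:C <= 2 * `|h|.
  rewrite /cn rmorphD; case: h => a b /=.
  have hA : `|a|%:C <= `|a +i* b|.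
    by rewrite normc_def lecR /= -sqrtr_sqr ler_wsqrtr // lerDl sqr_ge0.
  have hB : `|b|%:C <= `|a +i* b|.
    by rewrite normc_def lecR /= -sqrtr_sqr ler_wsqrtr // lerDr sqr_ge0.
  by rewrite mulr2n mulrDl mul1r; exact: lerD.
pose dd := Num.min (r / (L + 1)) (e / (2 * K * L ^+ 2 + 1)) / 2.
have q0 : 0 <= 2 * K * L ^+ 2 by rewrite !mulr_ge0 // exprn_ge0.
have dd0 : 0 < dd by rewrite divr_gt0 // lt_min !divr_gt0 // ltr_pwDr.
have ddC : (0 : C) < dd%:C by rewrite ltcR.
apply/nbhs_ballP; exists dd%:C => //= h; rewrite -ball_normE /ball_ /= sub0r normrN => hd h0.
rewrite sub0r normrN normrZ normfV ler_pdivrMl ?normr_gt0 //.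
apply: le_trans (normC_le_cn _) _.
have cnd : cn h < 2 * dd.
  have h2 : 2 * `|h| < (2 * dd)%:C by rewrite rmorphM rmorph_nat ltr_pM2l.
  by have := le_lt_trans (cnh h) h2; rewrite ltcR.
have c0 : 0 <= cn h by rewrite addr_ge0.
have [d1 d2] : 2 * dd <= r / (L + 1) /\ 2 * dd <= e / (2 * K * L ^+ 2 + 1).
  by rewrite /dd mulrC divfK ?pnatr_eq0 //; split; rewrite ge_min lexx ?orbT.
have hr : `|realify (h *: v)| < r.
  apply: le_lt_trans (etaL h) _; have := lt_le_trans cnd d1; rewrite ltr_pdivlMr ?ltr_pwDr // => d1'.
  by apply: le_lt_trans d1'; rewrite mulrC ler_wpM2l // lerDl.
have := gK _ hr; rewrite unrD realifyK [unr q + _]addrC => gk.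
have gk2 : cn (g (h *: v + unr q) - g (unr q)) * 2 <= e * cn h.
  have s1 : `|realify (h *: v)| ^+ 2 <= (L * cn h) ^+ 2.
    by apply: lerXn2r; rewrite ?nnegrE // mulr_ge0.
  have s2 : K * `|realify (h *: v)| ^+ 2 <= K * (L * cn h) ^+ 2 by rewrite ler_wpM2l.
  have s3 := le_trans gk s2.
  have s4 : cn h * (2 * K * L ^+ 2) <= e.
    apply: le_trans (_ : cn h * (2 * K * L ^+ 2 + 1) <= e); first by rewrite ler_wpM2l // lerDl.
    by rewrite -ler_pdivlMr ?ltr_pwDr //; exact: ltW (lt_le_trans cnd d2).
  apply: (le_trans (ler_wpM2r (ler0n R 2) s3)).
  have -> : K * (L * cn h) ^+ 2 * 2 = (cn h * (2 * K * L ^+ 2)) * cn h by ring.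
  by rewrite ler_wpM2r.
have gk3 : cn (g (h *: v + unr q) - g (unr q)) <= e * cn h / 2 by rewrite ler_pdivlMr.
apply: le_trans (_ : (e * cn h / 2)%:C <= _); first by rewrite lecR.
have -> : (e * cn h / 2)%:C = e%:C * ((cn h)%:C / 2) by rewrite -mulrA !rmorphM /= fmorphV rmorph_nat.
rewrite [leRHS]mulrC; apply: ler_wpM2l; first by rewrite lecR ltW.
by rewrite ler_pdivrMr // mulrC; exact: cnh.
Qed.

Lemma Jm_realify (c : C2) : Jm (realify c) = realify ('i *: c).
Proof. by rewrite /Jm realifyK. Qed.

(** The complex curve X lies in M, so [rho] vanishes at points of X close to [q + t *: u] and
    [q + t *: u'], where [u] spans the tangent line of X and [u'] is its image by ['i]. The
    holomorphic equation of X is harmonic, which makes the two corrections cancel to third order;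
    the Laplacian of [rho] along that line is then zero. *)
Lemma nonminimal_Jdet (M : set C2) rho : nonminimal_at0 M -> M 0 -> local_equation M 0 rho ->
  Jdet rho (realify 0) = 0.
Proof.
move=> [X [[_ hX] X0 XM]] M0 le; have [g [an [v dv] Xg]] := hX 0 X0.
have [r1 [n [r10 ar1 dn rM]]] := local_equationP le.
pose q : R4 := realify 0; have uq : unr q = 0 by exact: realifyK.
have ag : analytic_at g (unr q) by rewrite uq; exact: nbhs_singleton an.
have [r2 r20 [aR2 aI2 H2]] := analytic_holo ag.
have nXM : \forall y \near q, g (unr y) = 0 -> rho y = 0.
  have n1 : \forall y \near q, X (unr y) <-> g (unr y) = 0 by exact: (iffLR (near_unrP _ 0) Xg).
  have n2 : \forall y \near q, X (unr y) -> M (unr y) by exact: (iffLR (near_unrP _ 0) XM).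
  have qq1 : ball q r1 q by exact: ballxx.
  have n3 := near_ball qq1; near=> y => gy.
  have Uy : ball q r1 y by near: y.
  apply/(rM y Uy); have Xy : X (unr y) by move: gy; near: y; apply: filterS n1 => y [].
  by move: Xy; near: y.
pose r3 := Num.min r1 r2; have r30 : 0 < r3 by rewrite lt_min r10.
have [r /andP[r0 rr3] HXM] := ball_shrink r30 nXM.
have rr1 : r <= r1 by apply: le_trans rr3 _; rewrite ge_min lexx.
have rr2 : r <= r2 by apply: le_trans rr3 _; rewrite ge_min lexx orbT.
have ar := an_on_le rr1 ar1; have aR := an_on_le rr2 aR2; have aI := an_on_le rr2 aI2.
have sub2 : ball q r `<=` ball q r2 by exact: le_ball.
have H w y (Uy : ball q r y) := H2 w y (sub2 y Uy).
have qq : ball q r q by exact: ballxx.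
have oU : open (ball q r) by exact: ball_open.
set GR := (fun y => complex.Re (g (unr y))) in aR aI H aR2 aI2 H2.
set GI := (fun y => complex.Im (g (unr y))) in aI H aI2 H2.
pose G y := g (unr y); have cG : csm (ball q r) G by split; [exact: aR.1|exact: aI.1].
have hol := holo_dzb (G := G) H.
have g0 : g 0 = 0 by exact/(nbhs_singleton Xg).
have GR0 : GR q = 0 by rewrite /GR uq g0. have GI0 : GI q = 0 by rewrite /GI uq g0.
have RG c : Rderive (realify c) G q = dz c G q by rewrite Rderive_dz hol // addr0.
have DG c : 'D_(realify c) GR q = complex.Re (dz c G q) /\ 'D_(realify c) GI q = complex.Im (dz c G q).
  by rewrite -RG.
pose g1 := dz (delta_mx ord0 ord0) G q; pose g2 := dz (delta_mx ord0 (lift ord0 ord0)) G q.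
have dzG c : dz c G q = g1 * c ord0 ord0 + g2 * c ord0 (lift ord0 ord0) by exact: dz_coord cG qq.
have g12 : g1 != 0 \/ g2 != 0.
  have [z1|] := eqVneq g1 0; last by left.
  have [z2|] := eqVneq g2 0; last by right.
  have zz u : 'D_u GR q = 0 /\ 'D_u GI q = 0.
    by rewrite -(unrK u) (DG (unr u)).1 (DG (unr u)).2 dzG z1 z2 !mul0r addr0.
  by have := holo_deriv0 r0 aR aI zz v; rewrite uq => dv0; rewrite dv0 eqxx in dv.
have [nn dnn] : exists nn, dz nn G q = 1.
  have [h|h] := g12.
    exists (g1^-1 *: delta_mx ord0 ord0); rewrite dzG !mxE !eqxx /= mulr1 !mulr0 addr0.
    by rewrite mulfV.
  exists (g2^-1 *: delta_mx ord0 (lift ord0 ord0)); rewrite dzG !mxE !eqxx /= mulr1 !mulr0 add0r.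
  by rewrite mulfV.
(* Spans the kernel of the differential of [g] at the origin, the complex tangent line of X. *)
pose e : C2 := g2 *: delta_mx ord0 ord0 - g1 *: delta_mx ord0 (lift ord0 ord0).
have e0E : e ord0 ord0 = g2 by rewrite !mxE !eqxx /= mulr1 mulr0 subr0.
have e1E : e ord0 (lift ord0 ord0) = - g1 by rewrite !mxE !eqxx /= mulr1 mulr0 sub0r.
have dze : dz e G q = 0 by rewrite dzG e0E e1E mulrN mulrC subrr.
pose u := realify e; pose u' := Jm u; pose n1 := realify nn; pose n2 := Jm n1.
have d1R : 'D_n1 GR q = 1 by rewrite (DG nn).1 dnn.
have d1I : 'D_n1 GI q = 0 by rewrite (DG nn).2 dnn.
have [d2R d2I] := H n1 q qq; rewrite -/n2 d1R d1I oppr0 in d2R d2I.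
have duR : 'D_u GR q = 0 by rewrite (DG e).1 dze.
have duI : 'D_u GI q = 0 by rewrite (DG e).2 dze.
have [du'R du'I] := H u q qq; rewrite -/u' duR duI oppr0 in du'R du'I.
have [c [d [c0 d0 Hz]]] := zero_near r0 aR aI GR0 GI0 d1R d1I (fun y Uy => H n1 y Uy).
pose L := `|u| + `|u'|; have L0 : 0 <= L by rewrite addr_ge0.
pose c' := c * L ^+ 2; have c'0 : 0 <= c' by rewrite mulr_ge0 // exprn_ge0.
have zero w t : `|w| <= L -> 'D_w GR q = 0 -> 'D_w GI q = 0 -> 0 < t < d / (L + 1) ->
    exists x1 x2 : R, let e := x1 *: n1 + x2 *: n2 in
    [/\ `|e| <= c' * t ^+ 2, GR (q + (t *: w + e)) = 0 & GI (q + (t *: w + e)) = 0].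
  move=> wL wR wI /andP[t0 td].
  have tw : `|t *: w| <= L * t by rewrite normrZ gtr0_norm // mulrC ler_wpM2r // ltW.
  have twd : `|t *: w| < d.
    apply: le_lt_trans tw _; move: td; rewrite ltr_pdivlMr ?ltr_pwDr // => td.
    by apply: le_lt_trans td; rewrite mulrC ler_wpM2l ?lerDl // ltW.
  have [||x1 [x2 [ec e1 e2]]] := Hz (t *: w) twd.
  - by rewrite deriveZv ?wR ?mulr0 //; exact: sm_diff aR.1 qq.
  - by rewrite deriveZv ?wI ?mulr0 //; exact: sm_diff aI.1 qq.
  exists x1, x2; split => //; apply: le_trans ec _; rewrite /c' -mulrA ler_wpM2l // -exprMn.
  by apply: lerXn2r; rewrite ?nnegrE // mulr_ge0 // ltW.
have uL : `|u| <= L by rewrite lerDl. have uL' : `|u'| <= L by rewrite lerDr.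
pose d1 := Num.min 1 (Num.min (d / (L + 1)) (r / (L + c' + 1))).
have d10 : 0 < d1 by rewrite !lt_min ltr01 !divr_gt0 // ltr_pwDr // addr_ge0.
have inU w t (ee : R4) : `|w| <= L -> 0 < t < d1 -> `|ee| <= c' * t ^+ 2 ->
    `|t *: w + ee| <= (L + c') * t /\ ball q r (q + (t *: w + ee)).
  move=> wL /andP[t0]; rewrite !lt_min => /andP[t1 /andP[_ tr]] ec.
  have h1 : `|t *: w + ee| <= (L + c') * t.
    apply: le_trans (ler_normD _ _) _; rewrite normrZ gtr0_norm // mulrDl; apply: lerD.
      by rewrite mulrC ler_wpM2r // ltW.
    by apply: le_trans ec _; rewrite ler_wpM2l // expr2 ler_piMl // ltW.
  split => //; rewrite -ball_normE /ball_ /= opprD addrA subrr sub0r normrN.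
  apply: le_lt_trans h1 _; move: tr; rewrite ltr_pdivlMr ?ltr_pwDr ?addr_ge0 // => tr.
  by apply: le_lt_trans tr; rewrite mulrC ler_wpM2l ?lerDl // ltW.
have zr y : ball q r y -> GR y = 0 -> GI y = 0 -> rho y = 0.
  move=> Uy h1 h2; apply: HXM => //; rewrite -[LHS]/(G y).
  by apply/eqP; rewrite eq_complex -/(GR y) -/(GI y) h1 h2 !eqxx.
have rq : rho q = 0 by exact: zr.
have tdL t : 0 < t < d1 -> 0 < t < d / (L + 1).
  by move=> /andP[->]; rewrite !lt_min => /andP[_ /andP[-> _]].
have dr := sm_diff ar.1 qq.
have [B1 B10 b1] := bnd2 r0 ar; have [B2 B20 b2] := taylor3 r0 ar.
(* First order: points of X at distance of order t^2 from [q + t *: w] lie on M, so the derivative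
   of [rho] along [w] is zero. *)
have first w : `|w| <= L -> 'D_w GR q = 0 -> 'D_w GI q = 0 -> 'D_w rho q = 0.
  move=> wL wR wI.
  have Lc : 0 <= L + c' by rewrite addr_ge0.
  apply: (@small0 _ (B1 * (L + c') ^+ 2 + B2 * (L + c') ^+ 3 + B1 * c') d1 d10).
    by rewrite !addr_ge0 // mulr_ge0 // exprn_ge0.
  move=> t td; have [x1 [x2]] := zero w t wL wR wI (tdL t td).
  set ee := (_ + _ : R4) => -[ec e1 e2]; have [hL hU] := inU w t ee wL td ec.
  have ry := zr _ hU e1 e2.
  have hr : `|t *: w + ee| < r.
    by move: hU; rewrite -ball_normE /ball_ /= opprD addrA subrr sub0r normrN.
  have := b2 _ hr; rewrite ry rq !add0r normrN.
  set h := t *: w + ee in hL hr hU *.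
  have -> : 'D_h rho q = t * 'D_w rho q + 'D_ee rho q by rewrite /h (deriveDv _ _ dr) (deriveZv _ _ dr).
  have /andP[t0 t1] := td; have t1' : t <= 1 by move: t1; rewrite lt_min => /andP[/ltW].
  move=> E3; have E2 := (b1 ee ee).1; have E1 := (b1 h h).2.
  have F1 : B1 * (`|h| * `|h|) <= B1 * (L + c') ^+ 2 * t ^+ 2.
    by rewrite -mulrA ler_wpM2l // -exprMn expr2; apply: ler_pM.
  have F2 : B2 * `|h| ^+ 3 <= B2 * (L + c') ^+ 3 * t ^+ 2.
    rewrite -mulrA ler_wpM2l //; apply: le_trans (_ : ((L + c') * t) ^+ 3 <= _).
      by apply: lerXn2r; rewrite ?nnegrE // mulr_ge0 // ltW.
    rewrite exprMn; apply: ler_wpM2l; first exact: exprn_ge0.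
    by rewrite exprS; apply: ler_piMl => //; exact/exprn_ge0/ltW.
  have F3 : B1 * `|ee| <= B1 * c' * t ^+ 2 by rewrite -mulrA ler_wpM2l.
  have fin := arith5 (le_trans E1 F1) (le_trans E3 F2) (le_trans E2 F3).
  rewrite normrM (gtr0_norm t0) in fin; rewrite mulrC; apply: (le_trans fin).
  by rewrite !mulrDl.
have du := first u uL duR duI; have du' := first u' uL' du'R du'I.
have [KR [dR [KR0 dR0 tR]]] := two_points r0 aR GR0 duR du'R c'0.
have [KI [dI [KI0 dI0 tI]]] := two_points r0 aI GI0 duI du'I c'0.
have [Kr [dr' [Kr0 dr0 tr]]] := two_points r0 ar rq du du' c'0.
(* Real and imaginary parts of [g] are harmonic along the complex line. In [two_points] for GR and
   GI everything but the corrections disappears, so the coordinates x1 + x3 and x2 + x4 of their sum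
   are of size t^3. *)
have hR : 'D_u ('D_u GR) q + 'D_u' ('D_u' GR) q = 0.
  have E1 := derive_open u' oU qq (fun y Uy => (H u y Uy).1).
  have E2 := derive_open u oU qq (fun y Uy => (H u y Uy).2).
  have E3 := deriveN (sm_derivable u' (sm_D u aI.1) qq).
  have E4 := sm_com u' u aI.1 qq.
  by rewrite (etrans E1 (etrans E3 (congr1 -%R (etrans E4 E2)))) subrr.
have hI : 'D_u ('D_u GI) q + 'D_u' ('D_u' GI) q = 0.
  have E1 := derive_open u' oU qq (fun y Uy => (H u y Uy).2).
  have E2 := derive_open u oU qq (fun y Uy => (H u y Uy).1).
  have E3 := deriveN (sm_derivable u (sm_D u aI.1) qq).
  by rewrite (etrans E1 (etrans (sm_com u' u aR.1 qq) (etrans E2 E3))) subrr.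
have S0 : 'D_u ('D_u rho) q + 'D_u' ('D_u' rho) q = 0.
  pose K := (Kr + KR * (B1 * `|n1|) + KI * (B1 * `|n2|)) * 2.
  have K0 : 0 <= K.
    apply: mulr_ge0; last exact: ler0n.
    have N1 := mulr_ge0 KR0 (mulr_ge0 B10 (normr_ge0 n1)).
    have N2 := mulr_ge0 KI0 (mulr_ge0 B10 (normr_ge0 n2)).
    exact: (addr_ge0 (addr_ge0 Kr0 N1) N2).
  pose d2 := Num.min d1 (Num.min dR (Num.min dI dr')).
  have d20 : 0 < d2.
    rewrite /d2 lt_min; apply/andP; split; first exact: d10.
    rewrite lt_min; apply/andP; split; first exact: dR0.
    by rewrite lt_min; apply/andP; split; [exact: dI0|exact: dr0].
  apply: (small0 d20 K0) => t /andP[t0]; rewrite /d2 lt_min => /andP[t1].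
  rewrite lt_min => /andP[tR1]; rewrite lt_min => /andP[tI1 tr1].
  have td : 0 < t < d1 by apply/andP; split; [exact: t0|exact: t1].
  have [x1 [x2 /= [ec eR eI]]] := zero u t uL duR duI (tdL t td).
  have [x3 [x4 /= [ec' eR' eI']]] := zero u' t uL' du'R du'I (tdL t td).
  have T1 : 0 < t < dR by apply/andP; split; [exact: t0|exact: tR1].
  have T2 : 0 < t < dI by apply/andP; split; [exact: t0|exact: tI1].
  have T3 : 0 < t < dr' by apply/andP; split; [exact: t0|exact: tr1].
  have Q1 := tR t _ _ T1 ec ec'; have Q2 := tI t _ _ T2 ec ec'; have Q3 := tr t _ _ T3 ec ec'.
  rewrite eR eR' hR mulr0 mul0r subr0 !add0r normrN in Q1.
  rewrite eI eI' hI mulr0 mul0r subr0 !add0r normrN in Q2.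
  rewrite (zr _ (inU u t _ uL td ec).2 eR eI) (zr _ (inU u' t _ uL' td ec').2 eR' eI') !add0r in Q3.
  have EE F (dF : differentiable F q) : 'D_(x1 *: n1 + x2 *: n2 + (x3 *: n1 + x4 *: n2)) F q =
      (x1 + x3) * 'D_n1 F q + (x2 + x4) * 'D_n2 F q.
    by rewrite !(deriveDv _ _ dF) !(deriveZv _ _ dF); ring.
  rewrite (EE _ (sm_diff aR.1 qq)) d1R d2R mulr1 mulr0 addr0 in Q1.
  rewrite (EE _ (sm_diff aI.1 qq)) d1I d2I mulr1 mulr0 add0r in Q2.
  rewrite (EE _ dr) in Q3.
  have P1 : `|(x1 + x3) * 'D_n1 rho q| <= KR * t ^+ 3 * (B1 * `|n1|).
    by rewrite normrM; exact: (ler_pM (normr_ge0 _) (normr_ge0 _) Q1 (b1 n1 n1).1).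
  have P2 : `|(x2 + x4) * 'D_n2 rho q| <= KI * t ^+ 3 * (B1 * `|n2|).
    by rewrite normrM; exact: (ler_pM (normr_ge0 _) (normr_ge0 _) Q2 (b1 n2 n2).1).
  set S := 'D_u ('D_u rho) q + _ in Q3 *.
  have fin := arith6 Q3 P1 P2.
  rewrite normrM (ger0_norm (exprn_ge0 2 (ltW t0))) in fin.
  have EQ : (Kr * t ^+ 3 + KR * t ^+ 3 * (B1 * `|n1|) + KI * t ^+ 3 * (B1 * `|n2|)) * 2 = K * t ^+ 2 * t.
    by rewrite /K; ring.
  have EQ2 : t ^+ 2 * `|S| = `|S| * t * t by rewrite expr2 mulrC mulrA.
  rewrite EQ EQ2 in fin; rewrite -(ler_pM2r t0); exact: fin.
have tv : complex_tangent rho 0 e by apply/(tangent_real e oU ar.1 qq).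
have lv : levi_form rho 0 e = 0.
  by rewrite (levi_real e oU ar.1 qq) /= -/q -/u -/u' S0 mul0r.
(* The Levi form on [e] is the squared modulus of [k] times [Jdet], and [k] is nonzero because [e]
   is. *)
have := levi_Jdet (v := e) oU ar.1 qq (dn q _); rewrite uq => /(_ _ tv) [|k [ek]].
  by exact: ballxx.
rewrite lv => /esym/eqP; rewrite !mulf_eq0 conjc_eq0 orbb => /orP[/eqP k0|/eqP //].
have e0 : e = 0 by rewrite ek k0 scale0r.
move: g12; rewrite -[g2]e0E -[g1]opprK -e1E e0 !mxE oppr0 eqxx => -[] //.
Unshelve. all: by end_near. Qed.

End Nonminimal.

(** * Linear independence of germs and maximal families *)

Section Germs.
Variable R : realType.
Local Notation C := R[i].
Local Notation C2 := 'rV[C]_2.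
Local Notation R4 := 'rV[R]_4.
Local Notation T := (bool -> R4 -> C).
Local Notation q := (realify (0 : C2)).
Implicit Types (F X : T) (y : R4) (r : R).

Definition lc n (a : 'I_n -> R) (b : 'I_n -> T) : T := fun j y => \sum_(i < n) (a i)%:C * b i j y.
Definition germ0 F := \forall y \near q, forall j, F j y = 0.
Definition indep n (b : 'I_n -> T) := forall a, germ0 (lc a b) -> forall i, a i = 0.
Definition extend n (b : 'I_n -> T) X (i : 'I_n.+1) := if unlift ord_max i is Some i' then b i' else X.

Lemma extend_lift n (b : 'I_n -> T) X i : extend b X (widen_ord (leqnSn n) i) = b i.
Proof.
have -> : widen_ord (leqnSn n) i = lift ord_max i by apply: val_inj; rewrite /= /bump leqNgt ltn_ord.
by rewrite /extend liftK.
Qed.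

Lemma dep_extend n (b : 'I_n -> T) X : indep b -> ~ indep (extend b X) ->
  exists c : 'I_n -> R, \forall y \near q, forall j, X j y = lc c b j y.
Proof.
move=> ib nib.
have [a [za [i0 ai0]]] : exists a, germ0 (lc a (extend b X)) /\ exists i, a i <> 0.
  apply: contrapT => h; apply: nib => a za i; apply: contrapT => ai.
  by apply: h; exists a; split; [exact: za|exists i].
pose a' i := a (widen_ord (leqnSn n) i).
have E j y : lc a (extend b X) j y = lc a' b j y + (a ord_max)%:C * X j y.
  rewrite /lc big_ord_recr /=; congr (_ + _); last by rewrite /extend unlift_none.
  by apply: eq_bigr => i _; rewrite extend_lift.
have am : a ord_max != 0.
  apply/eqP => am; apply: ai0; have z' : germ0 (lc a' b).
    by apply: filterS za => y h j; have := h j; rewrite E am mul0r addr0.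
  have := ib a' z'; case: (unliftP ord_max i0) => [i' ->|->] // h.
  rewrite -(h i') /a'; congr a; apply: val_inj; by rewrite /= /bump leqNgt ltn_ord.
exists (fun i => - (a ord_max)^-1 * a' i); apply: filterS za => y h j.
have := h j; rewrite E => /eqP; rewrite addrC addr_eq0 => /eqP E2.
have am' : (a ord_max)%:C != 0 :> C by rewrite fmorph_eq0.
apply: (mulfI am'); rewrite E2 /lc mulr_sumr -sumrN; apply: eq_bigr => i _.
rewrite rmorphM rmorphN fmorphV !mulrA mulrN mulfV // !mulN1r mulNr; by [].
Qed.

(** A bound on the length of independent families gives one of maximal length, which must generate.
    The initial family serves only to bound that length from below. *)
Lemma max_family (D : T -> Prop) N : (forall n (b : 'I_n -> T), (forall i, D (b i)) -> indep b -> (n <= N)%N) ->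
  forall n0 (b0 : 'I_n0 -> T), (forall i, D (b0 i)) -> indep b0 ->
  exists n (b : 'I_n -> T), [/\ (n0 <= n <= N)%N, forall i, D (b i), indep b &
    forall X, D X -> exists c : 'I_n -> R, \forall y \near q, forall j, X j y = lc c b j y].
Proof.
move=> bN n0 b0 D0 i0.
pose Q n := `[< (n0 <= n)%N /\ exists b : 'I_n -> T, (forall i, D (b i)) /\ indep b >].
have Q0 : exists n, Q n by exists n0; apply/asboolP; split => //; exists b0.
have QN n : Q n -> (n <= N)%N by move/asboolP => [_ [b [Db ib]]]; exact: bN Db ib.
have [n /asboolP[n0n [b [Db ib]]] nmax] := ex_maxnP Q0 QN.
exists n, b; split.
- by rewrite n0n; exact: bN Db ib.
- exact: Db.
- exact: ib.
move=> X DX; apply: dep_extend => // ie.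
suff : (n.+1 <= n)%N by rewrite ltnn.
apply: nmax; apply/asboolP; split; first exact: leqW.
exists (extend b X); split => // i; rewrite /extend; case: unlift => [i'|]; [exact: Db|exact: DX].
Qed.

End Germs.

Lemma sum2 (K : nmodType) (F : 'I_2 -> K) : \sum_(j < 2) F j = F ord0 + F (lift ord0 ord0).
Proof. by rewrite !big_ord_recl big_ord0 addr0. Qed.

Lemma rowDZ (K : nzRingType) m (c : K) (u v : 'rV[K]_m) j :
  (c *: u + v) ord0 j = c * u ord0 j + v ord0 j.
Proof. by rewrite !mxE. Qed.

(** * Commutators of two by two matrices fixing a line *)

Section TwoByTwo.
Variable K : fieldType.
Implicit Types (a : bool -> K) (A B : bool -> bool -> K).

Definition cm A B k j := A k false * B false j + A k true * B true j
  - (B k false * A false j + B k true * A true j).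

(** The eigenvalues are scalars and cancel in the commutator; applied with [a] the conormal vector
    of M at the origin. *)
Lemma cm_kill a A B c d : (forall k, A k false * a false + A k true * a true = c * a k) ->
  (forall k, B k false * a false + B k true * a true = d * a k) ->
  forall k, cm A B k false * a false + cm A B k true * a true = 0.
Proof.
move=> hA hB k.
have -> : cm A B k false * a false + cm A B k true * a true =
    A k false * (B false false * a false + B false true * a true)
    + A k true * (B true false * a false + B true true * a true)
    - (B k false * (A false false * a false + A false true * a true)
    + B k true * (A true false * a false + A true true * a true)) by rewrite /cm; ring.
rewrite !hA !hB.
have -> : A k false * (d * a false) + A k true * (d * a true)
    - (B k false * (c * a false) + B k true * (c * a true)) =
    d * (A k false * a false + A k true * a true) - c * (B k false * a false + B k true * a true) by ring.
by rewrite hA hB; ring.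
Qed.

Lemma cm_tr A B : cm A B false false + cm A B true true = 0.
Proof. by rewrite /cm; ring. Qed.

(* The traceless matrices annihilating a fixed nonzero vector form a line. *)
Lemma nil2 a A B : a false != 0 \/ a true != 0 ->
  (forall k, A k false * a false + A k true * a true = 0) -> A false false + A true true = 0 ->
  (forall k, B k false * a false + B k true * a true = 0) -> B false false + B true true = 0 ->
  forall k j, cm A B k j = 0.
Proof.
move=> a0 hA tA hB tB.
have solve (u v w t : K) : u != 0 -> w * u + v * t = 0 -> w = - (v * (t / u)).
  move=> u0 h; apply: (mulIf u0); rewrite mulNr mulrA divfK //.
  by apply/eqP; rewrite -subr_eq0 opprK; apply/eqP.
case: a0 => a0.
- pose t := a true / a false.
  have h D : (forall k, D k false * a false + D k true * a true = 0) -> D false false + D true true = 0 ->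
      [/\ D false false = - (D false true * t), D true true = D false true * t &
          D true false = - (D false true * t * t)].
    move=> h0 tr; have e k : D k false = - (D k true * t) by exact: solve.
    have e1 : D true true = D false true * t.
      by move: tr; rewrite (e false) => /eqP; rewrite addrC subr_eq0 => /eqP.
    by split; [exact: e|exact: e1|rewrite e e1].
  have [a1 a2 a3] := h A hA tA; have [b1 b2 b3] := h B hB tB.
  by case; case; rewrite /cm ?a1 ?a2 ?a3 ?b1 ?b2 ?b3; ring.
pose t := a false / a true.
have h D : (forall k, D k false * a false + D k true * a true = 0) -> D false false + D true true = 0 ->
    [/\ D true true = - (D true false * t), D false false = D true false * t &
        D false true = - (D true false * t * t)].
  move=> h0 tr; have e k : D k true = - (D k false * t) by apply: solve => //; rewrite addrC.
  have e1 : D false false = D true false * t.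
    by move: tr; rewrite (e true) => /eqP; rewrite subr_eq0 => /eqP.
  by split; [exact: e|exact: e1|rewrite e e1].
have [a1 a2 a3] := h A hA tA; have [b1 b2 b3] := h B hB tB.
by case; case; rewrite /cm ?a1 ?a2 ?a3 ?b1 ?b2 ?b3; ring.
Qed.

End TwoByTwo.

(** * Brackets of tangent fields are tangent *)

Section BracketTangency.
Variables (A : comNzRingType) (pd : bool -> bool -> A -> A).
Hypothesis pdD : forall s j, derivation (pd s j).
Hypothesis pdC : forall s j s' j' x, pd s j (pd s' j' x) = pd s' j' (pd s j x).
Variables (P : A) (f cf g cg : bool -> A).
Hypotheses (fh : forall k j, pd true k (f j) = 0) (cfh : forall k j, pd false k (cf j) = 0)
  (gh : forall k j, pd true k (g j) = 0) (cgh : forall k j, pd false k (cg j) = 0).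

(** The derivative of [P] along the real field with (1,0) part [u] and conjugate part [v]; tangency
    says that it vanishes on M. In [tt2_br] it turns the bracket into a commutator of derivations
    applied to [P]. *)
Definition tt2 (u v : bool -> A) := hf pd P u + (v false * pd true false P + v true * pd true true P).
Definition bc j := cf false * pd true false (cg j) + cf true * pd true true (cg j)
  - (cg false * pd true false (cf j) + cg true * pd true true (cf j)).

Lemma tt2_br : tt2 (br pd f g) bc = Xf pd f cf (tt2 g cg) - Xf pd g cg (tt2 f cf).
Proof.
rewrite /tt2 /Xf /hf /br /bc /Lf !(derD _ _ (pdD _ _)) !(derM _ _ (pdD _ _)) !fh !cfh !gh !cgh.
rewrite (pdC false true false false P) (pdC true false false false P) (pdC true false false true P).
rewrite (pdC true true false false P) (pdC true true false true P) (pdC true true true false P).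
by ring.
Qed.

End BracketTangency.

(** * The algebra of fields at the origin and the contradiction *)

Section Final.
Variable R : realType.
Local Notation C := R[i].
Local Notation C2 := 'rV[C]_2.
Local Notation R4 := 'rV[R]_4.
Local Notation T := (bool -> R4 -> C).
Local Notation q := (realify (0 : C2)).
Implicit Types (F X : T) (y : R4) (r : R).
Variables (M : set C2) (rho : R4 -> R) (r0 : R) (nn : R4).
Hypotheses (r00 : 0 < r0) (ar0 : an_on q r0 rho)
  (dn0 : forall y, ball q r0 y -> 'D_nn rho y != 0)
  (rM : forall y, ball q r0 y -> (M (unr y) <-> rho y = 0))
  (rq : rho q = 0) (Jq : Jdet rho q = 0) (nJ : ~ Jflat rho 0).
Local Notation Pf := (fun y => (rho y)%:C).

Definition fld r F := [/\ forall j, can_on q r (F j),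
  forall j c y, ball q r y -> dzb c (F j) y = 0 &
  forall y, ball q r y -> rho y = 0 ->
    complex.Re (F false y * dz (dj R false) Pf y + F true y * dz (dj R true) Pf y) = 0].
Definition Kf F := exists2 r, 0 < r <= r0 & fld r F.

Lemma fld_le r r' F : r' <= r -> fld r F -> fld r' F.
Proof.
move=> rr [h1 h2 h3]; have sub : ball q r' `<=` ball q r by exact: le_ball.
split; [by move=> j; exact: can_le rr (h1 j)|by move=> j c y /sub; exact: h2|by move=> y /sub; exact: h3].
Qed.

Definition brT F X : T := fun j y =>
  F false y * dz (dj R false) (X j) y + F true y * dz (dj R true) (X j) y
  - (X false y * dz (dj R false) (F j) y + X true y * dz (dj R true) (F j) y).

Lemma fld_common n (b : 'I_n -> T) : (forall i, Kf (b i)) ->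
  exists2 r, 0 < r <= r0 & forall i, fld r (b i).
Proof.
elim: n b => [|n IH] b Kb; first by exists r0; [rewrite r00 lexx|case].
have [r /andP[rp rr] h] := IH (fun i => b (lift ord0 i)) (fun i => Kb _).
have [r' /andP[r'p r'r] h'] := Kb ord0.
exists (Num.min r r'); first by rewrite lt_min rp r'p /= ge_min rr.
move=> i; case: (unliftP ord0 i) => [i' ->|->].
  by apply: fld_le (h i'); rewrite ge_min lexx.
by apply: fld_le h'; rewrite ge_min lexx orbT.
Qed.

Section Family.
Variables (n : nat) (b : 'I_n -> T) (r : R).
Hypotheses (rr : 0 < r <= r0) (bF : forall i, fld r (b i)) (ib : indep b).
Local Notation V := 'rV[R]_n.
Let rp : 0 < r. Proof. by case/andP: rr. Qed.
Let ar : an_on q r rho. Proof. by case/andP: rr => _ h; exact: an_on_le h ar0. Qed.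
Let sub0 : ball q r `<=` ball q r0. Proof. by case/andP: rr => _ h; exact: le_ball. Qed.
Let oU : open (ball q r). Proof. exact: ball_open. Qed.
Let qq : ball q r q. Proof. exact: ballxx. Qed.

Definition fx (x : V) : T := lc (fun i => x ord0 i) b.

Lemma can_sum (I : Type) (s : seq I) (G : I -> R4 -> C) : (forall i, can_on q r (G i)) ->
  can_on q r (fun y => \sum_(i <- s) G i y).
Proof.
move=> cG; elim: s => [|i s IH].
  by apply: can_ext (can_cst q r 0) => y _; rewrite big_nil.
by apply: can_ext (can_add (cG i) IH) => y _; rewrite big_cons.
Qed.

Lemma can_fx x j : can_on q r (fx x j).
Proof.
apply: can_sum => i; have [h _ _] := bF i.
exact: (can_mul (can_cst q r _) (h j)).
Qed.

Lemma fx_lin (k : R) x z j y : fx (k *: x + z) j y = k%:C * fx x j y + fx z j y.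
Proof.
rewrite /fx /lc mulr_sumr -big_split /=; apply: eq_bigr => i _.
by rewrite !mxE rmorphD rmorphM /=; ring.
Qed.

Lemma fx_row (x : V) : x = \sum_i x ord0 i *: (delta_mx ord0 i : V).
Proof.
apply/rowP => j; rewrite summxE (bigD1 j) //= !mxE !eqxx mulr1 big1 ?addr0 // => k kj.
by rewrite !mxE eqxx /= eq_sym (negPf kj) mulr0.
Qed.

Lemma fx_ind (Q : V -> Prop) : Q 0 -> (forall k x z, Q x -> Q z -> Q (k *: x + z)) ->
  (forall i, Q (delta_mx ord0 i : V)) -> forall x, Q x.
Proof.
move=> Q0 QL Qd x; rewrite (fx_row x); elim/big_rec: _ => [//|i z _ Qz]; exact: QL.
Qed.

Lemma fx_delta i j y : fx (delta_mx ord0 i : V) j y = b i j y.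
Proof.
rewrite /fx /lc (bigD1 i) //= mxE !eqxx mul1r big1 ?addr0 // => k ki.
by rewrite mxE eqxx /= (negPf ki) mul0r.
Qed.

Lemma fx0 j y : fx 0 j y = 0.
Proof. by rewrite /fx /lc big1 // => i _; rewrite mxE mul0r. Qed.

Lemma fx_csm x j : csm (ball q r) (fx x j). Proof. exact: can_csm (can_fx x j). Qed.

Lemma fx_fld x : fld r (fx x).
Proof.
move: x; apply: fx_ind => [|k x z [x1 x2 x3] [z1 z2 z3]|i].
- split; first by move=> j; exact: can_fx.
    move=> j c y Uy; rewrite (dzb_open c oU Uy (G := fun=> 0)); first exact: dzb_cst.
    by move=> z _; exact: fx0.
  by move=> y _ _; rewrite !fx0 !mul0r addr0.
- split; first by move=> j; exact: can_fx.
    move=> j c y Uy; rewrite (dzb_open c oU Uy (fun y _ => fx_lin k x z j y)).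
    rewrite (dzb_add c (csm_mul oU (csm_cst k%:C oU) (fx_csm x j)) (fx_csm z j) Uy).
    by rewrite (dzb_scal k%:C c (fx_csm x j) Uy oU) (x2 j c y Uy) (z2 j c y Uy) mulr0 addr0.
  move=> y Uy ry; rewrite !fx_lin.
  have E (u1 u2 u3 u4 v1 v2 : C) : complex.Re ((k%:C * u1 + u2) * v1 + (k%:C * u3 + u4) * v2) =
      k * complex.Re (u1 * v1 + u3 * v2) + complex.Re (u2 * v1 + u4 * v2).
    by case: u1 u2 u3 u4 v1 v2 => [? ?] [? ?] [? ?] [? ?] [? ?] [? ?] /=; ring.
  by rewrite E (x3 y Uy ry) (z3 y Uy ry) mulr0 addr0.
have [h1 h2 h3] := bF i; split; first by move=> j; exact: can_fx.
  move=> j c y Uy; rewrite (dzb_open c oU Uy (fun y _ => fx_delta i j y)); exact: h2.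
by move=> y Uy ry; rewrite !fx_delta; exact: h3.
Qed.

Lemma fx_zero x p : ball q r p -> (forall j w, dws w (fun y => complex.Re (fx x j y)) p = 0 /\
    dws w (fun y => complex.Im (fx x j y)) p = 0) -> x = 0.
Proof.
move=> Up z; have Z j y : ball q r y -> fx x j y = 0.
  move=> Uy; have [a1 a2] := can_fx x j; apply/eqP; rewrite eq_complex.
  rewrite (flat_ball a1 Up (fun w => (z j w).1) Uy) (flat_ball a2 Up (fun w => (z j w).2) Uy).
  by rewrite !eqxx.
apply/rowP => i; rewrite mxE; apply: ib.
by apply: filterS (near_ball qq) => y Uy j; exact: Z.
Qed.

(** Restriction to a ball inside the common domain: the same family is studied around a Levi
    nondegenerate point and around the origin. *)
Definition rst p s (sb : ball p s `<=` ball q r) x j : cfun p s := mkc (csm_restr sb (fx_csm x j)).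

Lemma rstE p s (sb : ball p s `<=` ball q r) x j y : ball p s y -> rst sb x j y = fx x j y.
Proof. by move=> Uy; rewrite cfval //; left. Qed.

Lemma rst_d p s (sb : ball p s `<=` ball q r) x t c j y : ball p s y ->
  d_ t c (rst sb x j) y = d_ t c (fx x j) y.
Proof. by move=> Uy; apply: (@d_open_ R p s t _ _ _ y Uy) => z Uz; exact: rstE. Qed.

Lemma rst_lin p s (s0 : 0 < s) (sb : ball p s `<=` ball q r) (k : R) x z j :
  rst sb (k *: x + z) j = ccst p s k%:C * rst sb x j + rst sb z j.
Proof.
by apply: (cfPU s0) => y Uy; rewrite cfD // cfM // cf_cst // !rstE // fx_lin.
Qed.

Lemma rst_hol p s (s0 : 0 < s) (sb : ball p s `<=` ball q r) x k j : pdc true k (rst sb x j) = 0.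
Proof.
apply: (cfPU s0) => y Uy; rewrite pdcE // cf_0 // rst_d //=.
by have [_ h _] := fx_fld x; apply: h; exact: sb.
Qed.

Lemma rst_tan p s (sb : ball p s `<=` ball q r) x y : ball p s y -> rho y = 0 -> complex.Re
  (rst sb x false y * dz (dj R false) Pf y + rst sb x true y * dz (dj R true) Pf y) = 0.
Proof. by move=> Uy ry; rewrite !rstE //; have [_ _ h] := fx_fld x; exact: h (sb y Uy) ry. Qed.

Lemma rst_can p s (sb : ball p s `<=` ball q r) x j : can_on p s (rst sb x j).
Proof.
have [[s1 [m1 [c1 [k1 [p1 p2 p3 B1]]]]] [s2 [m2 [c2 [k2 [p4 p5 p6 B2]]]]]] := can_fx x j.
apply: (@can_ext R p s (fx x j)); first by move=> y Uy; rewrite rstE.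
split.
  by split; [exact: (sm_sub sb s1)|exists m1, c1, k1; split; [exact: p1|exact: p2|exact: p3|exact: (bnd_set sb B1)]].
by split; [exact: (sm_sub sb s2)|exists m2, c2, k2; split; [exact: p4|exact: p5|exact: p6|exact: (bnd_set sb B2)]].
Qed.

(** A combination that is zero on the small ball is flat at its center, hence zero on the whole
    domain by the identity theorem, and independence of the germs at the origin applies. *)
Lemma rst_inj p s (s0 : 0 < s) (sb : ball p s `<=` ball q r) x :
  (forall j y, ball p s y -> rst sb x j y = 0) -> x = 0.
Proof.
move=> z; have pp : ball p s p by exact: ballxx.
have oP : open (ball p s) by exact: ball_open.
have z0 (G : R4 -> R) : (forall y, ball p s y -> G y = cst 0 y) -> forall w, dws w G p = 0.
  move=> G0 w; rewrite (dws_open w oP G0 pp).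
  by elim: w => [//|v w IHw]; rewrite /= (_ : 'D_v (cst 0) = cst 0) //; apply: funext => y; rewrite derive_cst.
apply: (fx_zero (sb p pp)) => j w.
by split; apply: z0 => y Uy; have := z j y Uy; rewrite rstE // => ->.
Qed.

Lemma good_point : exists p s, [/\ 0 < s, ball p s `<=` ball q r, rho p = 0 &
  forall y, ball p s y -> Jdet rho y != 0].
Proof.
have [p [Up rp0 Jp]] : exists p, [/\ ball q r p, rho p = 0 & Jdet rho p <> 0].
  apply: contrapT => h; apply: nJ; apply: filterS (near_ball qq) => y Uy ry.
  by apply: contrapT => Jy; apply: h; exists y.
have aJ := (can_Jdet ar).1; have sr := ar.1.
have Jp' : complex.Re (Jdet rho p) != 0.
  by apply/eqP => h; apply: Jp; apply/eqP; rewrite eq_complex h (Jdet_real oU sr Up) !eqxx.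
have [s s0 [sb _]] := an_on_at ar Up.
have [s' /andP[s'0 s's] H] := ball_shrink s0 (near_neq0 oU aJ.1 Up Jp').
exists p, s'; split.
- exact: s'0.
- by apply: subset_trans sb; exact: le_ball.
- exact: rp0.
- by move=> y /H; apply: contraNneq => ->.
Qed.

Lemma an_rho p s (sb : ball p s `<=` ball q r) : an_on p s rho.
Proof.
have [s1 [m1 [c1 [k1 [p1 p2 p3 B1]]]]] := ar.
by split; [exact: (sm_sub sb s1)|exists m1, c1, k1; split; [exact: p1|exact: p2|exact: p3|exact: (bnd_set sb B1)]].
Qed.

Lemma dimV : \dim (fullv : {vspace V}) = n. Proof. by rewrite dimvf /dim /= mul1n. Qed.

Lemma family_le8 : (n <= 8)%N.
Proof.
have [p [s [s0 sb rp0 Jn0]]] := good_point.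
have dnp y (Uy : ball p s y) : 'D_nn rho y != 0 by apply: dn0; apply: sub0; exact: sb.
have H := @model_dim R p s rho nn s0 (an_rho sb) dnp Jn0 V (rst sb).
move: H => /(_ (rst_lin s0 sb)) H.
move: H => /(_ (rst_hol s0 sb)) H.
move: H => /(_ (rst_tan sb)) H.
move: H => /(_ (rst_can sb)) H.
move: H => /(_ (fun x h => rst_inj (x := x) s0 h)) H.
move: H => /(_ rp0) H.
by move: H; rewrite dimV.
Qed.

Variable cc : 'I_n -> 'I_n -> V.
Hypothesis ccE : forall i i' j y, ball q r y -> fx (cc i i') j y = brT (b i) (b i') j y.
Definition bk (x z : V) : V := \sum_i x ord0 i *: \sum_i' z ord0 i' *: cc i i'.

Lemma bk_linr x (k : R) z z' : bk x (k *: z + z') = k *: bk x z + bk x z'.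
Proof.
rewrite /bk scaler_sumr -big_split /=; apply: eq_bigr => i _.
rewrite scalerA mulrC -scalerA -scalerDr; congr (_ *: _).
rewrite scaler_sumr -big_split /=; apply: eq_bigr => i' _.
by rewrite !mxE scalerDl scalerA.
Qed.
Lemma bk_linl z (k : R) x x' : bk (k *: x + x') z = k *: bk x z + bk x' z.
Proof.
rewrite /bk scaler_sumr -big_split /=; apply: eq_bigr => i _.
by rewrite !mxE scalerDl scalerA.
Qed.
Lemma bk0r x : bk x 0 = 0.
Proof. by rewrite /bk big1 // => i _; rewrite big1 ?scaler0 // => i' _; rewrite mxE scale0r. Qed.
Lemma bk0l z : bk 0 z = 0.
Proof. by rewrite /bk big1 // => i _; rewrite mxE scale0r. Qed.
Lemma bk_delta i i' : bk (delta_mx ord0 i : V) (delta_mx ord0 i' : V) = cc i i'.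
Proof.
rewrite /bk (bigD1 i) //= mxE !eqxx scale1r (bigD1 i') //= mxE !eqxx scale1r.
rewrite !big1 ?addr0 // => k ki; rewrite mxE eqxx /= (negPf ki) ?scale0r //.
Qed.

Lemma dz_fx_lin c (k : R) x z j y : ball q r y ->
  dz c (fx (k *: x + z) j) y = k%:C * dz c (fx x j) y + dz c (fx z j) y.
Proof.
move=> Uy; rewrite (dz_open c oU Uy (fun y _ => fx_lin k x z j y)).
rewrite (dz_add c (csm_mul oU (csm_cst k%:C oU) (fx_csm x j)) (fx_csm z j) Uy).
by rewrite (dz_scal k%:C c (fx_csm x j) Uy oU).
Qed.
Lemma dz_fx0 c j y : ball q r y -> dz c (fx 0 j) y = 0.
Proof. by move=> Uy; rewrite (dz_open c oU Uy (fun y _ => fx0 j y)) dz_cst. Qed.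

Lemma fx_bk x z j y : ball q r y -> fx (bk x z) j y = brT (fx x) (fx z) j y.
Proof.
move=> Uy; move: x z; apply: fx_ind => [z|k x x' IH IH' z|i].
- by rewrite bk0l fx0 /brT !fx0 !dz_fx0 // !mul0r !mulr0 !addr0 subr0.
- rewrite bk_linl fx_lin IH IH' /brT !fx_lin !dz_fx_lin //.
  move: (fx x _ y) (fx x _ y) (fx x' _ y) (fx x' _ y) (fx z _ y) (fx z _ y).
  by move: (dz _ _ y) (dz _ _ y) (dz _ _ y) (dz _ _ y) (dz _ _ y) (dz _ _ y) => *; ring.
apply: fx_ind => [|k z z' IH IH'|i'].
- by rewrite bk0r fx0 /brT !fx0 !dz_fx0 // !mul0r !mulr0 !addr0 subr0.
- rewrite bk_linr fx_lin IH IH' /brT !fx_lin !dz_fx_lin //.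
  move: (fx z _ y) (fx z _ y) (fx z' _ y) (fx z' _ y) (fx _ _ y) (fx _ _ y).
  by move: (dz _ _ y) (dz _ _ y) (dz _ _ y) (dz _ _ y) (dz _ _ y) (dz _ _ y) => *; ring.
rewrite bk_delta ccE // /brT !fx_delta.
have E k c l : dz c (fx (delta_mx ord0 k : V) l) y = dz c (b k l) y.
  exact: dz_open oU Uy (fun y _ => fx_delta k l y).
by rewrite !E.
Qed.

Lemma rst_br p s (s0 : 0 < s) (sb : ball p s `<=` ball q r) x z j :
  rst sb (bk x z) j = br (@pdc R p s) (rst sb x) (rst sb z) j.
Proof.
apply: (cfPU s0) => y Uy; rewrite rstE // fx_bk; last exact: sb.
rewrite /br /Lf cfB // !cfD // !cfM // !pdcE // !rstE //.
by rewrite !(rst_d sb _ false) //.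
Qed.

Lemma subalg8 (W : {vspace V}) : (forall x z, x \in W -> z \in W -> bk x z \in W) ->
  (6 <= \dim W)%N -> \dim W = 8.
Proof.
have [p [s [s0 sb rp0 Jn0]]] := good_point.
have dnp y (Uy : ball p s y) : 'D_nn rho y != 0 by apply: dn0; apply: sub0; exact: sb.
have H := @model_subalg R p s rho nn s0 (an_rho sb) dnp Jn0 V (rst sb).
move: H => /(_ (rst_lin s0 sb)) H.
move: H => /(_ (rst_hol s0 sb)) H.
move: H => /(_ (rst_tan sb)) H.
move: H => /(_ (rst_can sb)) H.
move: H => /(_ (fun x h => rst_inj (x := x) s0 h)) H.
move: H => /(_ rp0) H.
exact: (H bk (rst_br s0 sb) W).
Qed.

(** Perfectness turned into an induction principle: a linear condition needs to be checked on
    brackets only. *)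
Lemma perfect_ind (Q : V -> Prop) : n = 8 -> Q 0 -> (forall k x z, Q x -> Q z -> Q (k *: x + z)) ->
  (forall x z, Q (bk x z)) -> forall x, Q x.
Proof.
move=> n8 Q0 QL Qb x.
have [p [s [s0 sb rp0 Jn0]]] := good_point.
(* The brackets of basis vectors already span the derived algebra, by bilinearity. *)
pose S := (\sum_i \sum_i' <[cc i i']>)%VS.
have bS (y z : V) : bk y z \in S.
  have s1 i i' : cc i i' \in S.
    have s2 : (<[cc i i']> <= S)%VS by apply: (sumv_sup i) => //; apply: (sumv_sup i').
    exact: (subvP s2 _ (memv_line _)).
  by apply: memv_suml => i _; apply: memvZ; apply: memv_suml => i' _; exact: memvZ.
have d8 : \dim (fullv : {vspace V}) = 8 by rewrite dimV n8.
have dnp y (Uy : ball p s y) : 'D_nn rho y != 0 by apply: dn0; apply: sub0; exact: sb.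
have H := @model_perfect R p s rho nn s0 (an_rho sb) dnp Jn0 V (rst sb).
move: H => /(_ (rst_lin s0 sb)) H.
move: H => /(_ (rst_hol s0 sb)) H.
move: H => /(_ (rst_tan sb)) H.
move: H => /(_ (rst_can sb)) H.
move: H => /(_ (fun x h => rst_inj (x := x) s0 h)) H.
move: H => /(_ rp0) H.
have SV := H bk (rst_br s0 sb) S d8 bS.
have : x \in S by rewrite SV memvf.
have QD (y z : V) : Q y -> Q z -> Q (y + z) by move=> Qy Qz; rewrite -[y]scale1r; exact: QL.
case/memv_sumP => vs hv ->; elim/big_ind: _ => [//|//|i _].
case/memv_sumP: (hv i isT) => us hu ->; elim/big_ind: _ => [//|//|i' _].
have /vlineP[k ->] := hu i' isT.
by rewrite -[_ *: _]addr0; apply: QL => //; rewrite -bk_delta; exact: Qb.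
Qed.

Definition gq (x : V) j : cfun q r := rst (fun (y : R4) (Uy : ball q r y) => Uy) x j.
Let dnr y : ball q r y -> 'D_nn rho y != 0. Proof. by move=> Uy; apply: dn0; exact: sub0. Qed.
Let dq s j := pdc_der q rp s j.
Local Notation a := (fun k => dz (dj R k) Pf q).

Lemma gqE x j y : ball q r y -> gq x j y = fx x j y. Proof. exact: rstE. Qed.
Lemma gq_lin (k : R) x z j : gq (k *: x + z) j = ccst q r k%:C * gq x j + gq z j.
Proof. exact: rst_lin. Qed.
Lemma gq_hol x k j : pdc true k (gq x j) = 0. Proof. exact: rst_hol. Qed.
Lemma gq_tan x : tangent rho (gq x). Proof. by move=> y; exact: rst_tan. Qed.
Lemma gq_br x z j : gq (bk x z) j = br (@pdc R q r) (gq x) (gq z) j.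
Proof. exact: rst_br. Qed.

Definition Am (x : V) k j : C := dz (dj R k) (fx x j) q.

Lemma AmE x k j : pdc false k (gq x j) q = Am x k j.
Proof. by rewrite pdcE // rst_d. Qed.

Lemma Am_lin (c : R) x z k j : Am (c *: x + z) k j = c%:C * Am x k j + Am z k j.
Proof. exact: dz_fx_lin. Qed.

Definition phi (x : V) : R4 := vecf (gq x) q.

Lemma phi_lin : linear phi.
Proof.
move=> c x z; rewrite /phi /vecf.
have -> : gq (c *: x + z) false q *: dj R false + gq (c *: x + z) true q *: dj R true =
    c%:C *: (gq x false q *: dj R false + gq x true q *: dj R true)
    + (gq z false q *: dj R false + gq z true q *: dj R true).
  by rewrite !gq_lin !cfD // !cfM // !cf_cst // !scalerDl scalerDr !scalerA addrACA.
move: (_ *: dj R false + _) (_ *: dj R false + _) => u w.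
apply/rowP => j; rewrite rowDZ; case: (@split_ordP 2 2 j) => i ->.
  by rewrite !realify_l rowDZ; case: (u ord0 i) (w ord0 i) => [? ?] [? ?] /=; ring.
by rewrite !realify_r rowDZ; case: (u ord0 i) (w ord0 i) => [? ?] [? ?] /=; ring.
Qed.

Lemma unr_zero : unr (0 : R4) = 0.
Proof. by apply/rowP => j; rewrite !mxE. Qed.

Lemma phi_eq0 x : phi x = 0 <-> forall j, fx x j q = 0.
Proof.
split=> [h j|h].
  have zz : gq x false q *: dj R false + gq x true q *: dj R true = 0.
    have u0 : unr (phi x) = 0 by rewrite h unr_zero.
    by move: u0; rewrite /phi /vecf realifyK.
  rewrite -(gqE x j qq); case: j.
    by rewrite -(vecf1 (gq x) q) zz mxE.
  by rewrite -(vecf0 (gq x) q) zz mxE.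
by rewrite /phi /vecf !gqE // !h !scale0r addr0 -(unrK 0) unr_zero.
Qed.

(** Three independent values at the origin would complete [nn] to a frame, and the zero of the Levi
    determinant there would spread over M by [span_flat], against [nJ]. *)
Lemma rank2 (S : 'Hom(V, R4)) : (forall x, S x = phi x) -> (\dim (limg S) <= 2)%N.
Proof.
move=> SE; rewrite leqNgt; apply/negP => d3; apply: nJ.
have sY : size (take 3 (vbasis (limg S))) == 3 by rewrite size_takel // size_tuple.
pose Y := Tuple sY.
have fY : free Y.
  have := basis_free (vbasisP (limg S)); rewrite -{1}(cat_take_drop 3 (vbasis (limg S))).
  exact: catl_free.
have Yx (i : 'I_3) : exists x, Y`_i = phi x.
  have : Y`_i \in limg S.
    by apply: vbasis_mem; apply: (@mem_take 3); apply: mem_nth; rewrite (eqP sY).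
  by case/memv_imgP => x _ ->; exists x; exact: SE.
have [xs xsE] := choice Yx.
pose B : 'M[R]_4 := \matrix_(i < 4) (if unlift ord_max i is Some i' then vecf (gq (xs i')) q else nn).
have wl (i : 'I_3) : widen_ord (leqnSn 3) i = lift ord_max i.
  by apply: val_inj; rewrite /= /bump leqNgt ltn_ord.
have B1 (i : 'I_3) : row (lift ord_max i) B = Y`_i by rewrite rowK liftK xsE.
have B2 : row ord_max B = nn by rewrite rowK unlift_none.
(* Applying the differential of [rho] to a linear relation between the rows kills the tangent ones,
   so the coefficient of [nn] is zero; independence of the three values does the rest. *)
have dt : \det B != 0.
  apply/negP => /det0P[v v0]; rewrite mulmx_sum_row => vB.
  have dr : differentiable rho q := sm_diff ar.1 qq.
  have := derive_comb (fun i => v ord0 i) (fun i => row i B) dr; rewrite vB.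
  rewrite deriveE // linear0 big_ord_recr /= big1 ?add0r => [|i _]; last first.
    by rewrite wl B1 xsE (vecf_rho ar (@gq_tan (xs i)) qq rq) mulr0.
  rewrite B2 => /esym/eqP; rewrite mulf_eq0 (negPf (dnr qq)) orbF => /eqP vm.
  move: vB; rewrite big_ord_recr /= vm scale0r addr0 => vB.
  have vl : forall i : 'I_3, v ord0 (lift ord_max i) = 0.
    move: fY => /freeP/(_ (fun i => v ord0 (lift ord_max i))) h; apply: h.
    rewrite -[RHS]vB; apply: eq_bigr => i _.
    by rewrite wl B1.
  move/eqP: v0; apply; apply/rowP => j; rewrite mxE.
  by case: (unliftP ord_max j) => [i ->|->].
exact: (span_flat rp ar dnr (g := fun i => gq (xs i)) (fun i => @gq_hol (xs i)) (fun i => @gq_tan (xs i)) dt rq Jq).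
Qed.

Lemma all_isotropic : (6 <= n)%N -> n = 8 /\ forall x j, fx x j q = 0.
Proof.
move=> n6; have n8 : n = 8.
  by rewrite -dimV; apply: subalg8 => [x z _ _|]; [exact: memvf|rewrite dimV].
split; first exact: n8.
have [S SE] := hom_ex phi_lin.
pose W := lker S.
have WE x : x \in W <-> forall j, fx x j q = 0.
  rewrite memv_ker SE; split=> [/eqP/phi_eq0 //|h]; exact/eqP/phi_eq0.
have W8 : \dim W = 8.
  apply: subalg8 => [x z /WE hx /WE hz|].
    by apply/WE => j; rewrite fx_bk // /brT !hx !hz !mul0r !addr0 subrr.
  have := limg_ker_dim S fullv; rewrite capfv dimV -/W => dE.
  have [dl dd] : (\dim (limg S) <= 2)%N /\ (\dim W + \dim (limg S))%N = 8.
    exact: conj (rank2 SE) (etrans dE n8).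
  by move: dl dd; move: (\dim W) (\dim (limg S)) => u v; lia.
have WV : W = fullv by apply/eqP; rewrite eqEdim subvf /= dimV W8 n8.
by move=> x; apply/WE; rewrite WV memvf.
Qed.

(** Differentiating the tangency relation at the origin, where the field vanishes, leaves only the
    linear part of the field applied to the conormal vector, and [Nc_pdc] says that the result is a
    multiple of that vector. *)
Lemma Am_rel x : (forall j, fx x j q = 0) ->
  exists c, forall k, Am x k false * a false + Am x k true * a true = c * a k.
Proof.
move=> x0; have g0 j : gq x j q = 0 by rewrite gqE.
have [c Hc] := Nc_pdc ar dnr (tangent_N ar (@gq_tan x)).
exists (c q) => k; have := Hc false k q qq rq.
rewrite cfB // cfM // => /eqP; rewrite subr_eq0 => /eqP.
rewrite /hf !(derD _ _ (dq _ _)) !(derM _ _ (dq _ _)) !(cjf_hol rp (@gq_hol x)).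
rewrite !cfD // !cfM // cf_0 // /cjf !ccjE // !g0 conjc0 !mul0r !addr0 !AmE.
by rewrite !(pdP ar _ _ qq).
Qed.

Lemma Am_bk x z : (forall j, fx x j q = 0) -> (forall j, fx z j q = 0) ->
  forall k j, Am (bk x z) k j = cm (Am x) (Am z) k j.
Proof.
move=> x0 z0 k j.
have gx i : gq x i q = 0 by rewrite gqE.
have gz i : gq z i q = 0 by rewrite gqE.
rewrite -AmE gq_br /br /Lf (derB _ _ (dq _ _)) !(derD _ _ (dq _ _)) !(derM _ _ (dq _ _)).
by rewrite cfB // !cfD // !cfM // !gx !gz !mul0r !addr0 !AmE.
Qed.

(** Here [ord] is taken with the two holomorphic partial derivatives, so it is the usual order of
    vanishing of a holomorphic function and needs no nondegeneracy of M. *)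
Lemma hol_flat_dws w (u : cfun q r) : (forall k, pdc true k u = 0) ->
  (forall k, ord (@pdc R q r false) (fun v => v q) k u) ->
  dws w (fun y => complex.Re (u y)) q = 0 /\ dws w (fun y => complex.Im (u y)) q = 0.
Proof.
have evD (f g : cfun q r) : (f + g) q = f q + g q by exact: cfD.
have evM (f g : cfun q r) : (f * g) q = f q * g q by exact: cfM.
have dp := dq false.
elim: w u => [|v w IH] u uh fu; first by have /= [-> _ _] := fu 1%N.
pose e := unr v.
pose u' : cfun q r := ccst q r (e ord0 ord0) * pdc false false u
  + ccst q r (e ord0 (lift ord0 ord0)) * pdc false true u.
have u'h k : pdc true k u' = 0.
  rewrite /u' (derD _ _ (dq _ _)) !(derM _ _ (dq _ _)) !(pd_cst q rp).
  by rewrite !(@pdc_com R q r rp true k false _ u) uh !(der0 (dq _ _)); ring.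
have fu' k : ord (@pdc R q r false) (fun v => v q) k u'.
  by apply: (ord_D dp evD); apply: (ord_Ml dp evD evM); apply: ord_Z.
have E y : ball q r y -> Rderive v u y = u' y.
  move=> Uy; rewrite -(unrK v) (Rderive_dz u y (unr v)).
  rewrite (dz_coord (unr v) (cf_csm u) Uy) (dzb_coord (unr v) (cf_csm u) Uy).
  have z k : dzb (dj R k) u y = 0 by have := congr1 (fun g : cfun q r => g y) (uh k); rewrite pdcE // cf_0.
  rewrite [dzb _ u y](z false) [dzb _ u y](z true) !mul0r !addr0.
  by rewrite /u' cfD // !cfM // !cf_cst // !pdcE //= mulrC [X in _ + X]mulrC.
have [h1 h2] := IH u' u'h fu'.
rewrite /= (dws_open (G := fun y => complex.Re (u' y)) w oU _ qq); last by move=> y Uy; rewrite -E.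
by rewrite (dws_open (F := 'D_v _) (G := fun y => complex.Im (u' y)) w oU _ qq) // => y Uy; rewrite -E.
Qed.

(* The isotropy representation has perfect image and preserves the conormal line, so it
   vanishes; then the bracket strictly raises the order of vanishing. *)
Lemma no_family : (6 <= n)%N -> False.
Proof.
move=> n6; have [n8 z0] := all_isotropic n6.
(* First use of perfectness: a commutator of linear parts annihilates the conormal vector, their
   common eigenvector, and has trace zero; so every linear part does. *)
have q1 : forall x, (forall k, Am x k false * a false + Am x k true * a true = 0) /\
    Am x false false + Am x true true = 0.
  apply: (perfect_ind n8).
  - by rewrite /Am; split=> [k|]; rewrite !dz_fx0 // ?mul0r addr0.
  - move=> k x z [x1 x2] [z1 z2]; split=> [l|].
      rewrite !Am_lin.
      transitivity (k%:C * (Am x l false * a false + Am x l true * a true)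
        + (Am z l false * a false + Am z l true * a true)).
        by move: (Am _ _ _) (Am _ _ _) (Am _ _ _) (Am _ _ _) (dz _ _ _) (dz _ _ _) => *; ring.
      by rewrite x1 z1 mulr0 addr0.
    by rewrite !Am_lin addrACA -mulrDr x2 z2 mulr0 addr0.
  move=> x z; have [c hc] := Am_rel (z0 x); have [d hd] := Am_rel (z0 z).
  split=> [k|]; rewrite !(Am_bk (z0 x) (z0 z)); last exact: cm_tr.
  exact: (@cm_kill _ a (Am x) (Am z) c d hc hd).
have a0 : a false != 0 \/ a true != 0 by exact: (dz_neq0 oU ar.1 qq (dnr qq)).
(* Second use: matrices with these two properties lie on one line, hence commute, and linear parts,
   being sums of commutators, vanish. *)
have A0 : forall x k j, Am x k j = 0.
  apply: (perfect_ind n8).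
  - by move=> k j; rewrite /Am dz_fx0.
  - by move=> k x z hx hz l j; rewrite Am_lin hx hz mulr0 addr0.
  move=> x z k j; rewrite (Am_bk (z0 x) (z0 z)).
  exact: (@nil2 _ a (Am x) (Am z) a0 (q1 x).1 (q1 x).2 (q1 z).1 (q1 z).2).
have evD (f g : cfun q r) : (f + g) q = f q + g q by exact: cfD.
have evM (f g : cfun q r) : (f * g) q = f q * g q by exact: cfM.
have dp := dq false.
have o0 k : ord (@pdc R q r false) (fun v => v q) k 0.
  by elim: k => [//|k IHk] /=; rewrite !(der0 (dq _ _)); split => //; exact: cf_0.
have gq0 j : gq 0 j = 0.
  by apply: (cfPU rp) => y Uy; rewrite gqE // fx0 cf_0.
have om m : forall x j, ord (@pdc R q r false) (fun v => v q) m.+2 (gq x j).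
  elim: m => [|m IH].
    move=> x j; have e0 : gq x j q = 0 by rewrite gqE.
    by split; [exact: e0|split => //; rewrite AmE A0|split => //; rewrite AmE A0].
  apply: (perfect_ind n8).
  - by move=> j; rewrite gq0; exact: o0.
  - move=> k x z hx hz j; rewrite gq_lin; apply: (ord_D dp evD) (hz j).
    exact: (ord_Ml dp evD evM _ (hx j)).
  move=> x z j; rewrite gq_br /br /Lf -[- _]mulN1r.
  have o x1 x2 s j1 : ord (@pdc R q r false) (fun v => v q) m.+3 (gq x1 s * pdc false s (gq x2 j1)).
    (* In a bracket one factor of order m + 2 is kept and the other loses one order by
       differentiation; starting at order two, the total exceeds m + 2. *)
    have le : (m.+3 <= m.+2 + m.+1)%N by lia.
    exact: (ord_le le (ord_M dp evD evM (IH x1 s) (ord_Z s (IH x2 j1)))).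
  apply: (ord_D dp evD); last apply: (ord_Ml dp evD evM).
    by apply: (ord_D dp evD); exact: o.
  by apply: (ord_D dp evD); exact: o.
have n0 : (0 < n)%N by rewrite n8.
pose x : V := delta_mx ord0 (Ordinal n0).
have x0 : x = 0.
  apply: (fx_zero qq) => j w.
  have fo k : ord (@pdc R q r false) (fun v => v q) k (gq x j).
    have le : (k <= k.+2)%N by lia.
    exact: (ord_le le (om k x j)).
  have [h1 h2] := hol_flat_dws w (fun k => gq_hol x k j) fo.
  split.
    by rewrite (dws_open (G := fun y => complex.Re (gq x j y)) w oU _ qq) // => y Uy; rewrite gqE.
  by rewrite (dws_open (G := fun y => complex.Im (gq x j y)) w oU _ qq) // => y Uy; rewrite gqE.
have := congr1 (fun m : V => m ord0 (Ordinal n0)) x0; rewrite !mxE !eqxx => /eqP.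
by rewrite oner_eq0.
Qed.

End Family.

Lemma fld_br r F X : 0 < r <= r0 -> fld r F -> fld r X -> fld r (brT F X).
Proof.
move=> /andP[rp rr] [F1 F2 F3] [X1 X2 X3].
have ar : an_on q r rho by exact: an_on_le rr ar0.
have oU : open (ball q r) by exact: ball_open.
have sub : ball q r `<=` ball q r0 by exact: le_ball.
have dnr y : ball q r y -> 'D_nn rho y != 0 by move=> /sub; exact: dn0.
pose f j : cfun q r := mkc (can_csm (F1 j)); pose g j : cfun q r := mkc (can_csm (X1 j)).
have fE j y : ball q r y -> f j y = F j y by move=> Uy; rewrite cfval //; left.
have gE j y : ball q r y -> g j y = X j y by move=> Uy; rewrite cfval //; left.
have fd t c j y : ball q r y -> d_ t c (f j) y = d_ t c (F j) y.
  by move=> Uy; apply: (@d_open_ R q r t _ _ _ y Uy) => z Uz; exact: fE.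
have gd t c j y : ball q r y -> d_ t c (g j) y = d_ t c (X j) y.
  by move=> Uy; apply: (@d_open_ R q r t _ _ _ y Uy) => z Uz; exact: gE.
have fh k j : pdc true k (f j) = 0.
  by apply: (cfPU rp) => y Uy; rewrite pdcE // cf_0 // fd //=; exact: F2.
have gh k j : pdc true k (g j) = 0.
  by apply: (cfPU rp) => y Uy; rewrite pdcE // cf_0 // gd //=; exact: X2.
have dq := pdc_der q rp; have dC := @pdc_com R q r rp.
have bE j y : ball q r y -> br (@pdc R q r) f g j y = brT F X j y.
  move=> Uy; rewrite /br /Lf cfB // !cfD // !cfM // !pdcE // !fE // !gE //.
  by rewrite !fd // !gd.
have bh := br_hol dq dC fh gh.
have ft : tangent rho f by move=> y Uy ry; rewrite !fE //; exact: F3.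
have gt : tangent rho g by move=> y Uy ry; rewrite !gE //; exact: X3.
split.
- move=> j; have cF k := can_dz (dj R k) (F1 j); have cX k := can_dz (dj R k) (X1 j).
  exact: (can_sub (can_add (can_mul (F1 _) (cX _)) (can_mul (F1 _) (cX _)))
     (can_add (can_mul (X1 _) (cF _)) (can_mul (X1 _) (cF _)))).
- move=> j c y Uy.
  rewrite -(dzb_open c oU Uy (bE j)) (dzb_coord c (cf_csm (br (@pdc R q r) f g j)) Uy).
  have z k : dzb (dj R k) (br (@pdc R q r) f g j) y = 0.
    by have := congr1 (fun u : cfun q r => u y) (bh k j); rewrite pdcE // cf_0.
  by rewrite [dzb _ _ y](z false) [dzb _ _ y](z true) !mul0r addr0.
move=> y Uy ry.
(* [tt2] of a tangent field vanishes on M, so its differential there is a multiple of that of [P],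
   which the other tangent field annihilates. *)
have NX u v : tangent rho u -> tangent rho v ->
    (Xf (@pdc R q r) u (cjf u) (tt2 (@pdc R q r) (Pc ar) v (cjf v))) y = 0.
  move=> ut vt; have [c Hc] := Nc_pdc ar dnr (tangent_N ar vt).
  have e s j : pdc s j (tt2 (@pdc R q r) (Pc ar) v (cjf v)) y = c y * pdc s j (Pc ar) y.
    have := Hc s j y Uy ry; rewrite cfB // cfM // => /eqP; rewrite subr_eq0 => /eqP.
    exact.
  have := tangent_N ar ut Uy ry; rewrite /hf !cfD // !cfM // => h.
  rewrite !e.
  transitivity (c y * (u false y * pdc false false (Pc ar) y + u true y * pdc false true (Pc ar) y
    + (cjf u false y * pdc true false (Pc ar) y + cjf u true y * pdc true true (Pc ar) y))).
    by ring.
  by rewrite h mulr0.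
have cb j : cjf (br (@pdc R q r) f g) j = bc (@pdc R q r) (cjf f) (cjf g) j.
  have cp l u : pdc true l (ccj u) = ccj (pdc false l u) :> cfun q r by rewrite (ccj_pdc rp).
  apply: (cfPU rp) => z Uz; rewrite /bc /cjf !cp /br /Lf.
  by rewrite ccjE // !cfB // !cfD // !cfM // !ccjE // rmorphB !rmorphD !rmorphM.
have TB : tt2 (@pdc R q r) (Pc ar) (br (@pdc R q r) f g) (bc (@pdc R q r) (cjf f) (cjf g)) y = 0.
  rewrite (tt2_br dq dC (Pc ar) fh (cjf_hol rp fh) gh (cjf_hol rp gh)) (cfB _ _ Uy).
  by rewrite (NX f g ft gt) (NX g f gt ft) subrr.
have TT u : tt2 (@pdc R q r) (Pc ar) u (cjf u) y = 0 -> complex.Re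
    (u false y * dz (dj R false) Pf y + u true y * dz (dj R true) Pf y) = 0.
  rewrite /tt2 /hf /cjf !(cfD, cfM, ccjE, pdP) //= !dzb_real.
  have half0 (t : R) : t + t = 0 -> t = 0 by move=> h; lra.
  move: (u false y) (u true y) (dz _ _ y) (dz _ _ y) => [a a'] [b b'] [d d'] [c c'].
  by move=> /(congr1 (@complex.Re R)) /= h; apply: half0; rewrite -[RHS]h; ring.
rewrite -(bE false y Uy) -(bE true y Uy); apply: TT.
by move: TB; rewrite /tt2 -!cb.
Qed.

Lemma Kf_br F X : Kf F -> Kf X -> Kf (brT F X).
Proof.
move=> [r1 /andP[r1p r1r] f1] [r2 /andP[r2p r2r] f2].
exists (Num.min r1 r2); first by rewrite lt_min r1p r2p /= ge_min r1r.
apply: fld_br; first by rewrite lt_min r1p r2p /= ge_min r1r.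
  by apply: fld_le f1; rewrite ge_min lexx.
by apply: fld_le f2; rewrite ge_min lexx orbT.
Qed.

Lemma near_all n (Q : 'I_n -> R4 -> Prop) : (forall i, \forall y \near q, Q i y) ->
  \forall y \near q, forall i, Q i y.
Proof.
elim: n Q => [|n IH] Q h; first by apply: filterS (near_ball (ballxx q r00)) => y _ [].
apply: filterS2 (h ord0) (IH (fun i => Q (lift ord0 i)) (fun i => h _)) => y h0 h1 i.
by case: (unliftP ord0 i) => [i' ->|->].
Qed.

(** The bound 8 holds for every independent family, closed under brackets or not. It yields a
    maximal family of length at least that of [b], and maximality expresses its brackets in itself;
    the relations, finite in number, hold on one common ball. *)
Lemma Kf_bound n (b : 'I_n -> T) : (forall i, Kf (b i)) -> indep b -> (n <= 5)%N.
Proof.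
move=> Kb ib; rewrite leqNgt; apply/negP => n6.
have B8 n' (b' : 'I_n' -> T) : (forall i, Kf (b' i)) -> indep b' -> (n' <= 8)%N.
  by move=> Kb' ib'; have [r rr bF] := fld_common Kb'; exact: (family_le8 rr bF ib').
have [m [b' [/andP[nm _] Kb' ib' mx]]] := max_family B8 Kb ib.
have ex i : exists c : 'I_m -> 'I_m -> R, forall i', \forall y \near q, forall j,
    brT (b' i) (b' i') j y = lc (c i') b' j y.
  have h i' : exists c : 'I_m -> R, \forall y \near q, forall j,
      brT (b' i) (b' i') j y = lc c b' j y by exact: mx (Kf_br (Kb' i) (Kb' i')).
  by have [c hc] := choice h; exists c.
have [c cE] := choice ex.
have nc : \forall y \near q, forall i i' j, brT (b' i) (b' i') j y = lc (c i i') b' j y.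
  by apply: near_all => i; apply: near_all => i'; exact: cE.
have [e /= e0 He] := iffLR (nbhs_ballP _ _) nc.
have [r /andP[rp rr] bF] := fld_common Kb'.
have mr : 0 < Num.min e r <= r0 by rewrite lt_min e0 rp /= ge_min rr orbT.
have sb : ball q (Num.min e r) `<=` ball q e by apply: le_ball; rewrite ge_min lexx.
have bF' i : fld (Num.min e r) (b' i) by apply: fld_le (bF i); rewrite ge_min lexx orbT.
apply: (no_family mr bF' ib' (cc := fun i i' => \row_k c i i' k)).
  move=> i i' j y /sb Uy; rewrite (He y Uy i i' j) /fx /lc.
  by apply: eq_bigr => k _; rewrite mxE.
exact: leq_trans n6 nm.
Qed.

Definition coords (L : C2 -> C2) : T := fun j y => L (unr y) ord0 (if j then lift ord0 ord0 else ord0).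

Lemma hol0_Kf L : local_equation M 0 rho -> hol0 M L -> Kf (coords L).
Proof.
move=> le [aL tL].
have an (k : 'I_2) : analytic_at (fun w => L w ord0 k) (unr q).
  by rewrite realifyK; exact: nbhs_singleton (aL k).
have [d1 d10 [aR1 aI1 H1]] := analytic_holo (an ord0).
have [d2 d20 [aR2 aI2 H2]] := analytic_holo (an (lift ord0 ord0)).
have n1 := iffLR (near_unrP _ 0) tL.
have n2 := iffLR (near_unrP _ 0) (local_equation_near le).
have [e /= e0 He] := iffLR (nbhs_ballP _ _) (filterI n1 n2).
pose r := Num.min (Num.min d1 d2) (Num.min e r0).
have rp : 0 < r by rewrite !lt_min d10 d20 e0 r00.
have r1 : r <= d1 by rewrite !ge_min lexx.
have r2 : r <= d2 by rewrite !ge_min lexx !orbT.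
have re : r <= e by rewrite !ge_min lexx !orbT.
have rr : r <= r0 by rewrite !ge_min lexx !orbT.
exists r; first by rewrite rp rr.
split.
- by case; [apply: (can_le r2); split|apply: (can_le r1); split].
- by case=> c y Uy; [apply: (holo_dzb H2)|apply: (holo_dzb H1)]; apply: le_ball Uy.
move=> y Uy ry.
have My : M (unr y) by apply/rM => //; exact: le_ball rr _ Uy.
have [t1 t2] := He y (le_ball re Uy).
have T0 : complex.Re (\sum_(j < 2) L (unr y) ord0 j * ddz j Pf (realify (unr y))) = 0.
  exact: t1 My rho (t2 My).
have sE : \sum_(j < 2) L (unr y) ord0 j * ddz j Pf (realify (unr y)) =
    coords L false y * dz (dj R false) Pf y + coords L true y * dz (dj R true) Pf y.
  have eqd k : ddz k Pf (realify (unr y)) = dz (delta_mx ord0 k) Pf y by rewrite unrK ddz_dz.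
  have key (G : 'I_2 -> C) : (forall k, ddz k Pf (realify (unr y)) = G k) ->
      \sum_(j < 2) L (unr y) ord0 j * ddz j Pf (realify (unr y)) = \sum_(j < 2) L (unr y) ord0 j * G j.
    by move=> h; apply: eq_bigr => j _; rewrite h.
  by rewrite (key _ eqd) sum2 /coords /dj.
by rewrite -sE.
Qed.

End Final.

Lemma hol0_indep_bound (R : realType) (M : set 'rV[R[i]]_2) n (b : 'I_n -> bool -> 'rV[R]_4 -> R[i]) :
  hypersurface M -> M 0 -> nonminimal_at0 M -> ~ levi_flat M ->
  (forall i, exists2 L, hol0 M L & b i = @coords R L) -> indep b -> (n <= 5)%N.
Proof.
move=> hM hM0 hnonmin hnonflat Db ib.
have [rho le] := hM.2 0 hM0.
have [r0 [nn [r00 ar dn rM]]] := local_equationP le.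
have rq := local_equation0 hM0 le.
have Jq := nonminimal_Jdet hnonmin hM0 le.
have nJ : ~ Jflat rho 0 by move=> jf; exact: hnonflat (Jflat_levi_flat hM hM0 le jf).
eapply Kf_bound; try eassumption.
move=> i; have [L hL ->] := Db i.
by eapply hol0_Kf; eassumption.
Qed.

Theorem theorem1 (R : realType) (M : set 'rV[R[i]]_2) (hM : hypersurface M)
    (hM0 : M 0) (hnonmin : nonminimal_at0 M) (hnonflat : ~ levi_flat M) :
  exists n : nat, dim_hol0 M n /\ (n <= 5)%N.
Proof.
pose D F := exists2 L, hol0 M L & F = @coords R L.
have B5 n (b : 'I_n -> bool -> 'rV[R]_4 -> R[i]) : (forall i, D (b i)) -> indep b -> (n <= 5)%N.
  by move=> Db ib; exact: (hol0_indep_bound hM hM0 hnonmin hnonflat Db ib).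
pose b0 (i : 'I_0) : bool -> 'rV[R]_4 -> R[i] := fun _ _ => 0.
have D0 i : D (b0 i) by case: i.
have i0 : indep b0 by move=> a _ [].
(* The bound 5 on independent families gives existence of a basis as well: a maximal family, grown
   from the empty one, generates. *)
have [n [b [/andP[_ n5] Db ib mx]]] := max_family B5 D0 i0.
have Db' i : exists L, hol0 M L /\ b i = coords L by have [L h1 h2] := Db i; exists L.
have [L hL] := choice Db'.
have lcE a j y : lc a b j y = real_comb a L (unr y) ord0 (if j then lift ord0 ord0 else ord0).
  rewrite /lc /real_comb summxE; apply: eq_bigr => i _.
  by rewrite (hL i).2 /coords [RHS]mxE.
exists n; split; last exact: n5.
exists L; split.
- by move=> i; exact: (hL i).1.
- move=> a ha; apply: ib; have := iffLR (near_unrP _ 0) ha.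
  by apply: filterS => y h j; rewrite lcE h mxE.
move=> L' hL'.
have [c hc] := mx (coords L') (ex_intro2 _ _ L' hL' erefl).
exists c; have := near_realify hc; apply: filterS => z h; apply/rowP => k.
have e j : L' z ord0 (if j then lift ord0 ord0 else ord0) =
    real_comb c L z ord0 (if j then lift ord0 ord0 else ord0).
  by have := h j; rewrite lcE /coords realifyK.
by case: (unliftP ord0 k) => [k' ->|->]; [rewrite (ord1 k'); exact: (e true)|exact: (e false)].
Qed.
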